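(* Let $(M,g)$ be a smooth compact Riemannian manifold of dimension $n\ge 2$ with smooth boundary $\partial M$, and impose either the Dirichlet boundary condition $u|_{\partial M}=0$ or the Neumann boundary condition $\partial_n u|_{\partial M}=0$. There are constants $C=C(M,g)$ and $\lambda_0=\lambda_0(M,g)>0$, depending only on $(M,g)$, such that for every $\lambda\ge\lambda_0$ for which $\lambda^2$ is an eigenvalue of $-\Delta$ with the chosen boundary condition, the multiplicity of this eigenvalue (the dimension of the space of functions $u$ with $(\Delta+\lambda^2)u=0$ on $M$ satisfying the boundary condition) is at most $C\lambda^{n-1}$.
   Context: $\Delta$ denotes the Laplace-Beltrami operator of $(M,g)$ acting on functions, with the sign convention that $-\Delta$ is nonnegative. $\partial_n$ denotes the outward normal derivative at $\partial M$. *)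

(* Defs.v *)
From mathcomp Require Import all_boot all_order all_algebra.
From mathcomp Require Import all_classical all_reals all_analysis.

Set Implicit Arguments.
Unset Strict Implicit.
Unset Printing Implicit Defensive.

Import Order.TTheory GRing.Theory Num.Theory.
Import numFieldNormedType.Exports.
Local Open Scope classical_set_scope.
Local Open Scope ring_scope.

Section HalfSpace.
Variables (R : realType) (n : nat).
Implicit Types (x v : 'rV[R]_n) (f : 'rV[R]_n -> R) (V W : set 'rV[R]_n).

Definition basis_vec (i : 'I_n) : 'rV[R]_n := delta_mx 0 i.

(* The coordinate of index 0; the sum has exactly one term when n >= 1. *)
Definition height x : R := \sum_(i < n | i == 0 :> nat) x 0 i.

Definition half_space : set 'rV[R]_n := [set x | 0 <= height x].

Definition iter_partial (s : seq 'I_n) f : 'rV[R]_n -> R :=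
  foldr (fun i (g : 'rV[R]_n -> R) x => 'D_(basis_vec i) g x) f s.

(* C^oo on an open set W. *)
Definition smooth_open W f : Prop :=
  forall (s : seq 'I_n) x, W x ->
    {for x, continuous (iter_partial s f)} /\
    forall i, derivable (iter_partial s f) x (basis_vec i).

(* C^oo on a subset V of the half-space that need not be open in R^n:
   f extends, near each point of V, to a C^oo function on an open set. *)
Definition smooth_on V f : Prop :=
  forall x, V x -> exists W (F : 'rV[R]_n -> R),
    [/\ open W, W x, smooth_open W F & forall y, V y -> W y -> F y = f y].

(* Partial derivative of a function on the half-space: two-sided, except
   one-sided when i = 0 and x lies on the bounding hyperplane; there it is the
   partial derivative of any differentiable extension of f. *)
Definition hpartial (i : 'I_n) f x : R :=
  lim ((fun h : R => h^-1 * (f (x + h *: basis_vec i) - f x)) @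
       within [set h : R | half_space (x + h *: basis_vec i)] (0 : R)^').

End HalfSpace.

(* Compact smooth n-manifold with (possibly empty) boundary, given by a smooth
   atlas of charts valued in the closed half-space.  Second countability
   follows from compactness.  chart_at selects one chart around each point. *)
Record compact_manifold (R : realType) (n : nat) := CompactManifold {
  carrier :> topologicalType;
  carrier_hausdorff : hausdorff_space carrier;
  carrier_compact : compact [set: carrier];
  chart : Type;
  dom : chart -> set carrier;
  img : chart -> set 'rV[R]_n;
  coord : chart -> carrier -> 'rV[R]_n;
  param : chart -> 'rV[R]_n -> carrier;
  dom_open : forall a, open (dom a);
  img_open : forall a, exists2 W, open W & img a = W `&` @half_space R n;
  coord_img : forall a p, dom a p -> img a (coord a p);
  param_dom : forall a x, img a x -> dom a (param a x);
  coordK : forall a p, dom a p -> param a (coord a p) = p;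
  paramK : forall a x, img a x -> coord a (param a x) = x;
  coord_continuous : forall a, {within dom a, continuous (coord a)};
  param_continuous : forall a, {within img a, continuous (param a)};
  transition_smooth : forall a b (j : 'I_n),
    smooth_on (coord a @` (dom a `&` dom b))
      (fun x => coord b (param a x) 0 j);
  chart_at : carrier -> chart;
  chart_at_dom : forall p, dom (chart_at p) p
}.

Arguments chart {R n} _.
Arguments dom {R n} _ _ _.
Arguments img {R n} _ _ _.
Arguments coord {R n} _ _ _.
Arguments param {R n} _ _ _.
Arguments chart_at {R n} _ _.

(* Row i of the matrix is the i-th partial derivative of the change of
   coordinates from chart a to chart b. *)
Definition transition_jacobian (R : realType) (n : nat)
    (M : compact_manifold R n) (a b : chart M) (x : 'rV[R]_n) : 'M[R]_n :=
  \matrix_(i, j) hpartial i (fun y => coord M b (param M a y) 0 j) x.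

Definition bilin (R : realType) (n : nat) (G : 'M[R]_n) (v w : 'rV[R]_n) : R :=
  (v *m G *m w^T) 0 0.

(* The matrices (g_ij) of the metric in the charts; metric_transition says that
   they are the components of a single covariant 2-tensor. *)
Record riemannian_metric (R : realType) (n : nat) (M : compact_manifold R n) :=
  RiemannianMetric {
  metric :> chart M -> 'rV[R]_n -> 'M[R]_n;
  metric_smooth : forall a i j, smooth_on (img M a) (fun x => metric a x i j);
  metric_sym : forall a x, img M a x -> (metric a x)^T = metric a x;
  metric_posdef : forall a x, img M a x ->
    forall v : 'rV[R]_n, v != 0 -> 0 < bilin (metric a x) v v;
  metric_transition : forall a b p, dom M a p -> dom M b p ->
    let J := transition_jacobian a b (coord M a p) in
    metric a (coord M a p) = J *m metric b (coord M b p) *m J^T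
}.

Section LaplaceBeltrami.
Variables (R : realType) (n : nat) (M : compact_manifold R n).
Variable g : riemannian_metric M.
Implicit Types (u : M -> R) (p : M) (a : chart M) (f : 'rV[R]_n -> R).

Definition smooth_fun u : Prop :=
  forall a, smooth_on (img M a) (fun x => u (param M a x)).

Definition density a (x : 'rV[R]_n) : R := Num.sqrt (\det (g a x)).

(* i-th component of the gradient, g^{ij} d_j f. *)
Definition local_grad a f (x : 'rV[R]_n) (i : 'I_n) : R :=
  \sum_(j < n) invmx (g a x) i j * hpartial j f x.

(* |g|^{-1/2} d_i (|g|^{1/2} g^{ij} d_j f) *)
Definition local_laplacian a f (x : 'rV[R]_n) : R :=
  (density a x)^-1 *
  \sum_(i < n) hpartial i (fun y => density a y * local_grad a f y i) x.

(* On smooth u the value does not depend on the chart chosen around p. *)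
Definition laplace_beltrami u p : R :=
  let a := chart_at M p in
  local_laplacian a (fun x => u (param M a x)) (coord M a p).

Definition boundary : set M :=
  [set p | exists2 a, dom M a p & height (coord M a p) = 0].

(* Tangent vectors at p are given by their components in chart_at p. *)
Definition outward_unit_normal p (nu : 'rV[R]_n) : Prop :=
  let G := g (chart_at M p) (coord M (chart_at M p) p) in
  [/\ height nu < 0,
      forall w : 'rV[R]_n, height w = 0 -> bilin G nu w = 0
    & bilin G nu nu = 1].

Definition dir_derivative u p (v : 'rV[R]_n) : R :=
  let a := chart_at M p in
  \sum_(i < n) v 0 i * hpartial i (fun x => u (param M a x)) (coord M a p).

Inductive boundary_condition := Dirichlet | Neumann.

Definition satisfies_bc (bc : boundary_condition) u : Prop :=
  match bc with
  | Dirichlet => forall p, boundary p -> u p = 0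
  | Neumann => forall p nu, boundary p -> outward_unit_normal p nu ->
                 dir_derivative u p nu = 0
  end.

Definition laplace_eigenspace (bc : boundary_condition) (mu : R) : set (M -> R) :=
  [set u | [/\ smooth_fun u,
               forall p, laplace_beltrami u p + mu * u p = 0
             & satisfies_bc bc u]].

Definition is_laplace_eigenvalue (bc : boundary_condition) (mu : R) : Prop :=
  exists2 u, laplace_eigenspace bc mu u & exists p, u p != 0.

End LaplaceBeltrami.

(* The linear space E of real functions on T has a basis with d elements. *)
Definition has_dimension (R : realType) (T : Type) (E : set (T -> R)) (d : nat)
    : Prop :=
  exists b : 'I_d -> T -> R,
    [/\ forall i, E (b i),
        forall c : 'I_d -> R, (forall p, \sum_(i < d) c i * b i p = 0) ->
          forall i, c i = 0
      & forall u, E u -> exists c : 'I_d -> R,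
          forall p, u p = \sum_(i < d) c i * b i p].

(* Main.v *)
(* The proof is by contradiction and uses neither heat kernels nor a Weyl law.
   Let V be a space of eigenfunctions for lambda^2.  Cover M by finitely many
   coordinate cubes; a cube that meets the boundary is completed to a full one by
   reflecting the function, oddly (Dirichlet) or evenly (Neumann), along the
   conormal direction, which keeps the coefficients Lipschitz.  Sample the
   functions, cut off near the faces, on a periodic lattice of fine mesh in each
   cube.  The lattice gradient obeys an elliptic equation with a bounded residual.
   For each direction t, let P be the convolution, in the other directions, with a
   nonnegative trigonometric kernel of degree N ~ lambda.  Requiring all Fourier
   coefficients of P to vanish on q0 slices x_t = const imposes O(lambda^(n-1))
   linear conditions.  On functions satisfying them, a Rellich identity with a
   sawtooth weight of height 1/q0 bounds the energy in the direction t by a small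
   multiple of the total energy.  Summing over t and over the cubes, the energy on
   the inner cubes is at most epsilon times the energy on the full cubes, plus an
   error which vanishes with the mesh.  As the inner cubes still cover M, the energy
   on the full cubes is at most C times that on the inner cubes, so it tends to 0
   relative to the number of lattice points.  If dim V exceeded the number of
   conditions, a normalised nonzero u in V would satisfy them for every mesh,
   whereas linear independence bounds its energy from below. *)

Require Import Defs.
From HB Require Import structures.
From mathcomp Require Import all_boot all_order all_algebra fingroup perm.
From mathcomp Require Import all_classical all_reals all_analysis.
From mathcomp Require Import ring lra zify.

Set Implicit Arguments.
Unset Strict Implicit.
Unset Printing Implicit Defensive.

Import Order.TTheory GRing.Theory Num.Theory.
Import numFieldNormedType.Exports.
Local Open Scope classical_set_scope.
Local Open Scope ring_scope.

(** All estimates are finite sums on a periodic lattice: summation by parts is exact there, and no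
    integrals, traces or Sobolev spaces occur. The price is errors with the mesh as a factor. Why
    vanishing slices help: testing the equation with q d_t v, where q has slope 1, gives 2 <a_tj d_j
    v, d_t v> = <a dv, dv> - lam^2 |v|^2 up to small terms, many with a factor sup |q|; testing with
    v makes the right side small. A function q of slope 1 and small height must jump, which is
    harmless only where v and its neighbours vanish. Asking this of u itself would cost as many
    conditions as a slice has lattice points. The average v = P u needs only (2(2N+1))^(n-1)
    coefficients per slice; P blurs at scale 1/N and second derivatives of u cost a factor lam, so N
    ~ lam keeps u - v small in energy. The order of choices matters: the number of slices depends on
    the geometry alone, then come lam and the functions, the mesh last. So errors may depend on lam
    and on bounds for u, but the constants in front of energies may not. The combination of
    eigenfunctions changes with the mesh; only its normalisation is kept. *)

Local Notation coord := Defs.coord.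

(** * Discrete elliptic estimates on a periodic lattice *)

Section FiniteL2.
Variables (R : rcfType) (T : finType).
Implicit Types f g : T -> R.

Definition ip f g : R := \sum_x f x * g x.
Definition nrm f : R := Num.sqrt (ip f f).

Lemma ip_ge0 f : 0 <= ip f f.
Proof. by apply: sumr_ge0 => x _; rewrite -expr2 sqr_ge0. Qed.

Lemma nrm_ge0 f : 0 <= nrm f. Proof. exact: sqrtr_ge0. Qed.

Lemma nrm_sqr f : nrm f ^+ 2 = ip f f.
Proof. by rewrite sqr_sqrtr // ip_ge0. Qed.

Lemma ipC f g : ip f g = ip g f.
Proof. by apply: eq_bigr => x _; rewrite mulrC. Qed.

Lemma ipDl f1 f2 g : ip (fun x => f1 x + f2 x) g = ip f1 g + ip f2 g.
Proof. by rewrite /ip -big_split; apply: eq_bigr => x _; rewrite mulrDl. Qed.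

Lemma ipDr f1 f2 g : ip g (fun x => f1 x + f2 x) = ip g f1 + ip g f2.
Proof. by rewrite ipC ipDl !(ipC g). Qed.

Lemma ipBl f1 f2 g : ip (fun x => f1 x - f2 x) g = ip f1 g - ip f2 g.
Proof. by rewrite /ip -sumrB; apply: eq_bigr => x _; rewrite mulrBl. Qed.

Lemma ipBr f1 f2 g : ip g (fun x => f1 x - f2 x) = ip g f1 - ip g f2.
Proof. by rewrite ipC ipBl !(ipC g). Qed.

Lemma ipZl c f g : ip (fun x => c * f x) g = c * ip f g.
Proof. by rewrite /ip mulr_sumr; apply: eq_bigr => x _; rewrite mulrA. Qed.

Lemma ipZr c f g : ip f (fun x => c * g x) = c * ip f g.
Proof. by rewrite ipC ipZl ipC. Qed.

Lemma ip_suml (I : finType) (F : I -> T -> R) g :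
  ip (fun x => \sum_i F i x) g = \sum_i ip (F i) g.
Proof.
rewrite /ip exchange_big /=; apply: eq_bigr => x _.
by rewrite mulr_suml.
Qed.

(** Cauchy-Schwarz, from the nonnegative square norm of [ip g g * f - ip f g * g]; one factor
    [ip g g] is cancelled, so its vanishing is a separate case. *)
Lemma ip_le f g : `|ip f g| <= nrm f * nrm g.
Proof.
rewrite -(@ler_pXn2r _ 2) ?nnegrE ?mulr_ge0 ?nrm_ge0 ?normr_ge0 //.
rewrite exprMn !nrm_sqr -normrX ger0_norm ?sqr_ge0 //.
have [g0|gn0] := eqVneq (ip g g) 0.
  have gz x : g x = 0.
    have sq y : true -> 0 <= g y * g y by rewrite -expr2 sqr_ge0.
    have := psumr_eq0P sq g0 (i := x) isT.
    by move=> /eqP; rewrite mulf_eq0 orbb => /eqP.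
  by rewrite /ip [\sum_x f x * g x]big1 ?expr0n /= ?mulr_ge0 ?ip_ge0 // => x _;
     rewrite gz mulr0.
have gp : 0 < ip g g by rewrite lt_def gn0 ip_ge0.
have := ip_ge0 (fun x => ip g g * f x - ip f g * g x).
rewrite ipBl !ipBr !ipZl !ipZr (ipC g f) => H.
have {}H : 0 <= ip g g * (ip f f * ip g g - ip f g ^+ 2).
  by apply: le_trans H _; rewrite le_eqVlt; apply/orP; left; apply/eqP; ring.
by move: H; rewrite pmulr_rge0 // subr_ge0.
Qed.

Lemma nrm_le f g : (forall x, `|f x| <= `|g x|) -> nrm f <= nrm g.
Proof.
move=> H; rewrite ler_wsqrtr // ler_sum // => x _.
by rewrite -!expr2 -[f x ^+ 2]ger0_norm ?sqr_ge0 // -[g x ^+ 2]ger0_norm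
   ?sqr_ge0 // !normrX ler_pXn2r // ?nnegrE.
Qed.

Lemma nrmZ c f : nrm (fun x => c * f x) = `|c| * nrm f.
Proof. by rewrite /nrm ipZl ipZr mulrA -expr2 sqrtrM ?sqr_ge0 // sqrtr_sqr. Qed.

Lemma nrmN f : nrm (fun x => - f x) = nrm f.
Proof.
rewrite -[RHS]mul1r -[1]normr1 -normrN -nrmZ; congr nrm.
by apply/funext => x; rewrite mulN1r.
Qed.

Lemma nrmD f g : nrm (fun x => f x + g x) <= nrm f + nrm g.
Proof.
rewrite -(@ler_pXn2r _ 2) ?nnegrE ?addr_ge0 ?nrm_ge0 //.
rewrite sqrrD !nrm_sqr ipDl !ipDr (ipC g f).
have := le_trans (ler_norm _) (ip_le f g).
by move=> H; lra.
Qed.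

Lemma nrmB f g : nrm (fun x => f x - g x) <= nrm f + nrm g.
Proof. by rewrite -(nrmN g) nrmD. Qed.

Lemma nrm0 : nrm (fun _ => 0) = 0.
Proof. by rewrite /nrm /ip big1 ?sqrtr0 // => x _; rewrite mul0r. Qed.

Lemma nrm_sum (I : Type) (r : seq I) (F : I -> T -> R) :
  nrm (fun x => \sum_(i <- r) F i x) <= \sum_(i <- r) nrm (F i).
Proof.
elim: r => [|i r IH].
  by under eq_fun do rewrite big_nil; rewrite nrm0 big_nil.
under eq_fun do rewrite big_cons.
by rewrite big_cons; apply: le_trans (nrmD _ _) _; rewrite lerD2l.
Qed.

Lemma nrmM c a f : (forall x, `|a x| <= c) -> nrm (fun x => a x * f x) <= c * nrm f.
Proof.
move=> H.
have [x0 _|T0] := pickP (fun _ : T => true); last first.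
  by rewrite /nrm /ip !big_pred0 // sqrtr0 mulr0.
have c0 : 0 <= c := le_trans (normr_ge0 _) (H x0).
rewrite -(ger0_norm c0) -nrmZ; apply: nrm_le => x.
by rewrite !normrM ler_wpM2r // (ger0_norm c0).
Qed.

Lemma ip_le_bound f g A B : nrm f <= A -> nrm g <= B -> `|ip f g| <= A * B.
Proof.
by move=> fA gB; apply: le_trans (ip_le f g) _; apply: ler_pM => //; exact: nrm_ge0.
Qed.

End FiniteL2.

Section SumBounds.
Variables (R : realDomainType) (n : nat).

Lemma norm_sum_le (F : 'I_n -> R) c :
  (forall i, `|F i| <= c) -> `|\sum_i F i| <= n%:R * c.
Proof.
move=> H; apply: le_trans (ler_norm_sum _ _ _) _.
apply: le_trans (ler_sum _ (fun i _ => H i)) _.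
by rewrite sumr_const card_ord mulr_natl.
Qed.

Lemma norm_sum2_le (F : 'I_n -> 'I_n -> R) c :
  (forall i j, `|F i j| <= c) -> `|\sum_i \sum_j F i j| <= n%:R ^+ 2 * c.
Proof.
by move=> H; rewrite expr2 -mulrA; apply: norm_sum_le => i; apply: norm_sum_le.
Qed.

End SumBounds.

(** * Difference operators and regularity of lattice solutions *)

Section Differences.
Variables (R : rcfType) (G : finZmodType) (n : nat).
Variables (e : 'I_n -> G) (h : R) (h0 : 0 < h).
Implicit Types (f g : G -> R) (i j k t : 'I_n).

Definition fdiff i f x : R := (f (x + e i) - f x) / h.
(** With this sign [bdiff] is the exact adjoint of [fdiff] ([ip_fdiff]), so it approximates minus
    the derivative and summation by parts carries no sign. *)
Definition bdiff i f x : R := (f (x - e i) - f x) / h.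
Local Notation D := fdiff.
Local Notation Ds := bdiff.

Lemma ip_shift (s : G) f g :
  ip (fun x => f (x + s)) g = ip f (fun x => g (x - s)).
Proof.
rewrite /ip [RHS](reindex_inj (addIr s)) /=.
by apply: eq_bigr => x _; rewrite addrK.
Qed.

Lemma nrm_shift (s : G) f : nrm (fun x => f (x + s)) = nrm f.
Proof.
rewrite /nrm (ip_shift s f); congr Num.sqrt; apply: eq_bigr => x _ /=.
by rewrite addrNK.
Qed.

Lemma ip_fdiff i f g : ip (D i f) g = ip f (Ds i g).
Proof.
transitivity (h^-1 * (ip (fun x => f (x + e i)) g - ip f g)).
  by rewrite -ipBl -ipZl; apply: eq_bigr => x _; rewrite /fdiff; ring.
rewrite ip_shift -ipBr -ipZr; apply: eq_bigr => x _.
by rewrite /bdiff; ring.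
Qed.

Lemma fdiffC i j f : D i (D j f) = D j (D i f).
Proof. by apply/funext => x; rewrite /fdiff (addrAC x (e i)); ring. Qed.

Lemma fdiff_bdiffC i j f : D i (Ds j f) = Ds j (D i f).
Proof. by apply/funext => x; rewrite /fdiff /bdiff (addrAC x (e i)); ring. Qed.

Lemma nrm_bdiff i f : nrm (Ds i f) = nrm (D i f).
Proof.
rewrite -(nrm_shift (e i)) -nrmN; congr nrm; apply/funext => x.
by rewrite /bdiff /fdiff addrK; ring.
Qed.

Lemma fdiffM i f g x :
  D i (fun x => f x * g x) x = f x * D i g x + D i f x * g (x + e i).
Proof. by rewrite /fdiff; ring. Qed.

Lemma shift_fdiff i f x : f (x + e i) = f x + h * D i f x.
Proof. by rewrite /fdiff mulrC divfK ?gt_eqF //; ring. Qed.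

Variable a : 'I_n -> 'I_n -> G -> R.

(** Because of the sign of [bdiff], this is the lattice form of lam^2 U + d_i (a_ij d_j U). *)
Definition elliptic_residual (lam : R) (U : G -> R) (x : G) : R :=
  lam ^+ 2 * U x - \sum_i \sum_j Ds i (fun y => a i j y * D j U y) x.

Variables (A L nu : R).
Hypothesis aC : forall i j x, a i j x = a j i x.
Hypothesis aA : forall i j x, `|a i j x| <= A.
Hypothesis aL : forall k i j x, `|D k (a i j) x| <= L.
Hypothesis nu0 : 0 < nu.
Hypothesis a_ell : forall x (xi : 'I_n -> R),
  nu * (\sum_i xi i ^+ 2) <= \sum_i \sum_j a i j x * xi i * xi j.

Lemma coercivity g :
  nu * (\sum_i nrm (D i g) ^+ 2)
    <= \sum_i \sum_j ip (fun x => a i j x * D j g x) (D i g).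
Proof.
have -> : \sum_i nrm (D i g) ^+ 2 = \sum_x \sum_i D i g x ^+ 2.
  rewrite exchange_big /=; apply: eq_bigr => i _; rewrite nrm_sqr.
  by apply: eq_bigr => x _; rewrite expr2.
have -> : \sum_i \sum_j ip (fun x => a i j x * D j g x) (D i g)
   = \sum_x \sum_i \sum_j a i j x * D i g x * D j g x.
  rewrite exchange_big /= exchange_big /= [RHS]exchange_big /=.
  apply: eq_bigr => i _; rewrite [RHS]exchange_big /=; apply: eq_bigr => j _.
  by apply: eq_bigr => x _; ring.
by rewrite mulr_sumr ler_sum.
Qed.

Variables (lam : R) (U : G -> R) (Z : R).
Local Notation f := (elliptic_residual lam U).
Hypothesis lam1 : 1 <= lam.
Hypothesis UZ : lam * nrm U <= Z.
Hypothesis DUZ : forall i, nrm (D i U) <= Z.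
Hypothesis fZ : nrm f <= Z.

Let lam0 : 0 < lam. Proof. exact: lt_le_trans lam1. Qed.
Let Z0 : 0 <= Z.
Proof. by apply: le_trans UZ; rewrite mulr_ge0 ?nrm_ge0 // ltW. Qed.

Lemma weak_form phi :
  \sum_i \sum_j ip (fun x => a i j x * D j U x) (D i phi)
    = ip (fun x => lam ^+ 2 * U x - f x) phi.
Proof.
have -> : (fun x => lam ^+ 2 * U x - f x) =
   (fun x => \sum_i \sum_j Ds i (fun y => a i j y * D j U y) x).
  by apply/funext => x; rewrite /elliptic_residual opprB addrC subrK.
rewrite ip_suml; apply: eq_bigr => i _; rewrite ip_suml; apply: eq_bigr => j _.
by rewrite ipC ip_fdiff ipC.
Qed.

Let N : R := n%:R.
Definition H2_const : R := (2 + N ^+ 2 * L) / nu.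
Local Notation CH := H2_const.

(** Regularity by difference quotients: test the weak form with [Ds k (D k U)]. Moving [D k] through
    the coefficients leaves the coercive form of [D k U] and a commutator controlled by [L]. The
    factor [lam] comes from lam^2 |U|, of which only the bound lam Z is known. *)
Lemma H2_bound i k : nrm (D i (D k U)) <= CH * (lam * Z).
Proof.
have L0 : 0 <= L by apply: le_trans (aL i i i 0); exact: normr_ge0.
pose g := D k U; pose S := \sum_i nrm (D i g) ^+ 2.
have S0 : 0 <= S by apply: sumr_ge0 => j _; rewrite sqr_ge0.
pose s := Num.sqrt S.
have s0 : 0 <= s by exact: sqrtr_ge0.
have ns j : nrm (D j g) <= s.
  rewrite -[nrm _]ger0_norm ?nrm_ge0 // -sqrtr_sqr ler_wsqrtr //.
  by rewrite /S (bigD1 j) //= lerDl sumr_ge0 // => ? _; rewrite sqr_ge0.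
have W := weak_form (Ds k g).
have E : \sum_i \sum_j ip (fun x => a i j x * D j U x) (D i (Ds k g)) =
   \sum_i \sum_j ip (fun x => a i j x * D j g x) (D i g)
   + \sum_i \sum_j ip (fun x => D k (a i j) x * D j U (x + e k)) (D i g).
  rewrite -big_split; apply: eq_bigr => i1 _ /=; rewrite -big_split /=.
  apply: eq_bigr => j _; rewrite fdiff_bdiffC -ip_fdiff -ipDl; congr ip.
  by apply/funext => x; rewrite fdiffM /g [D j (D k U)]fdiffC.
have B1 : `|\sum_i \sum_j ip (fun x => D k (a i j) x * D j U (x + e k)) (D i g)|
    <= N ^+ 2 * (L * Z * s).
  apply: norm_sum2_le => i1 j; apply: ip_le_bound (ns _).
  apply: le_trans (nrmM (c := L) (fun x => D j U (x + e k)) _) _ => //.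
  by rewrite (nrm_shift (e k) (D j U)) ler_wpM2l.
have B2 : `|ip (fun x => lam ^+ 2 * U x - f x) (Ds k g)| <= (2 * (lam * Z)) * s.
  apply: ip_le_bound; last by rewrite nrm_bdiff.
  apply: le_trans (nrmB _ _) _; rewrite nrmZ ger0_norm ?sqr_ge0 //.
  have : lam ^+ 2 * nrm U <= lam * Z by rewrite expr2 -mulrA ler_wpM2l // ltW.
  have : Z <= lam * Z by rewrite ler_peMl.
  by move: fZ; lra.
have C := coercivity g.
have : nu * s ^+ 2 <= (2 + N ^+ 2 * L) * (lam * Z) * s.
  have -> : s ^+ 2 = S by rewrite /s sqr_sqrtr.
  apply: le_trans C _.
  have -> : \sum_i \sum_j ip (fun x => a i j x * D j g x) (D i g) =
    ip (fun x => lam ^+ 2 * U x - f x) (Ds k g) -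
    \sum_i \sum_j ip (fun x => D k (a i j) x * D j U (x + e k)) (D i g).
    by rewrite -W E addrK.
  apply: le_trans (ler_norm _) _; apply: le_trans (ler_normB _ _) _.
  apply: le_trans (lerD B2 B1) _.
  have : N ^+ 2 * (L * Z * s) <= N ^+ 2 * (L * (lam * Z) * s).
    apply: ler_wpM2l; first exact: sqr_ge0.
    by rewrite ler_wpM2r // ler_wpM2l // ler_peMl.
  by lra.
move=> H; apply: le_trans (ns i) _.
have [->|sn0] := eqVneq s 0.
  by rewrite /H2_const !mulr_ge0 ?invr_ge0 ?addr_ge0 ?mulr_ge0 ?sqr_ge0 // ltW.
have sp : 0 < s by rewrite lt_def sn0.
rewrite /H2_const mulrAC ler_pdivlMr // mulrC.
by rewrite -(ler_pM2r sp) -mulrA -expr2.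
Qed.

(** * The Rellich argument in one direction *)

Section Direction.
Variables (P : (G -> R) -> G -> R) (mu kap delta : R).
Hypothesis PD : forall f g x, P (fun x => f x + g x) x = P f x + P g x.
Hypothesis PZ : forall c f x, P (fun x => c * f x) x = c * P f x.
Hypothesis Psh : forall s f x, P (fun x => f (x + s)) x = P f (x + s).
Hypothesis Pn : forall f, nrm (P f) <= nrm f.
Hypothesis Pa : forall i j g,
  nrm (fun x => P (fun y => a i j y * g y) x - a i j x * P g x) <= mu * nrm g.
Hypothesis Pap : forall g, nrm (fun x => g x - P g x) <= mu * \sum_k nrm (D k g).
Hypothesis mu0 : 0 <= mu.
Hypothesis mukap : mu * lam <= kap.
Variables (t : 'I_n) (q : G -> R) (S : pred G).
Hypothesis delta0 : 0 <= delta.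
Hypothesis delta1 : delta <= 1.
Hypothesis kap1 : kap <= 1.
Hypothesis qd : forall x, 0 <= q x <= delta.
Hypothesis qi : forall i x, i != t -> q (x + e i) = q x.
Hypothesis qt : forall x, ~~ S (x + e t) -> q (x + e t) = q x + h.
(** [P] commutes with shifts, hence exactly with differences, and with the coefficients up to [mu];
    so [v] solves the equation of [U] with a small extra flux [r]. It is [v], and not [U], that few
    linear conditions force to vanish on the slices [S] where the sawtooth [q] drops. *)
Let v := P U.
Hypothesis vS : forall x, S x -> v x = 0 /\ forall i, v (x + e i) = 0.

Let PB f g x : P (fun x => f x - g x) x = P f x - P g x.
Proof.
have -> : (fun x => f x - g x) = (fun x => f x + -1 * g x).
  by apply/funext => y; rewrite mulN1r.
by rewrite PD PZ mulN1r.
Qed.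

Let PDi i f : P (D i f) = D i (P f).
Proof.
apply/funext => x; rewrite {1}/fdiff.
have -> : (fun x => (f (x + e i) - f x) / h) =
          (fun x => h^-1 * (f (x + e i) - f x)) by apply/funext => y; rewrite mulrC.
by rewrite PZ PB Psh mulrC.
Qed.

Let PDs i f : P (Ds i f) = Ds i (P f).
Proof.
apply/funext => x; rewrite {1}/bdiff.
have -> : (fun x => (f (x - e i) - f x) / h) =
          (fun x => h^-1 * (f (x - e i) - f x)) by apply/funext => y; rewrite mulrC.
by rewrite PZ PB (Psh (- e i)) mulrC.
Qed.

Let P0 x : P (fun _ => 0) x = 0.
Proof.
have -> : (fun _ : G => 0 : R) = (fun x => 0 * (fun _ => 0) x).
  by apply/funext => y; rewrite mul0r.
by rewrite PZ mul0r.
Qed.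

Let Psum (r : seq 'I_n) (F : 'I_n -> G -> R) x :
  P (fun x => \sum_(i <- r) F i x) x = \sum_(i <- r) P (F i) x.
Proof.
elim: r => [|i r IH].
  by under eq_fun do rewrite big_nil; rewrite P0 big_nil.
under eq_fun do rewrite big_cons.
by rewrite PD IH big_cons.
Qed.

Let r i x := \sum_j (P (fun y => a i j y * D j U y) x - a i j x * D j v x).

Lemma r_bound i : nrm (r i) <= N * (mu * Z).
Proof.
apply: le_trans (nrm_sum _ _) _.
apply: le_trans (ler_norm _) _; apply: norm_sum_le => j.
rewrite ger0_norm ?nrm_ge0 // /v -PDi.
by apply: le_trans (Pa _ _ _) _; rewrite ler_wpM2l.
Qed.

Lemma weak_form_v phi :
  \sum_i \sum_j ip (fun x => a i j x * D j v x) (D i phi)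
  + \sum_i ip (r i) (D i phi)
    = ip (fun x => lam ^+ 2 * v x - P f x) phi.
Proof.
have -> : (fun x => lam ^+ 2 * v x - P f x) =
   (fun x => \sum_i Ds i (fun y => \sum_j a i j y * D j v y + r i y) x).
  apply/funext => x.
  have -> : P f x = lam ^+ 2 * v x -
      \sum_i \sum_j Ds i (P (fun y => a i j y * D j U y)) x.
    rewrite /elliptic_residual PB PZ Psum; congr (_ - _).
    by apply: eq_bigr => i _; rewrite Psum; apply: eq_bigr => j _; rewrite PDs.
  rewrite opprB addrC subrK; apply: eq_bigr => i _.
  have E y : \sum_j a i j y * D j v y + r i y =
             \sum_j P (fun y => a i j y * D j U y) y.
    by rewrite /r -big_split; apply: eq_bigr => j _; rewrite /= addrC subrK.
  by rewrite /bdiff -mulr_suml sumrB !E.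
rewrite [RHS]ip_suml -big_split; apply: eq_bigr => i _ /=.
by rewrite [RHS]ipC -ip_fdiff [RHS]ipC ipDl; congr (_ + _); rewrite ip_suml.
Qed.

Let vZ : lam * nrm v <= Z.
Proof. exact: le_trans (ler_wpM2l (ltW lam0) (Pn U)) UZ. Qed.

Let Dv i : nrm (D i v) <= Z.
Proof. by rewrite /v -PDi (le_trans (Pn _)). Qed.

Let DDv i j : nrm (D i (D j v)) <= CH * (lam * Z).
Proof. by rewrite /v -!PDi (le_trans (Pn _)) // H2_bound. Qed.

Let Q := \sum_i \sum_j ip (fun x => a i j x * D j v x) (D i v).

(** Testing the equation of [v] with [v]: the flux [r] costs [mu], and the residual costs 1/lam
    because lam |v| is at most [Z]. *)
Lemma energy_identity :
  `|Q - lam ^+ 2 * ip v v| <= (N ^+ 2 * mu + lam^-1) * Z ^+ 2.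
Proof.
have := weak_form_v v; rewrite ipBl ipZl -/Q => E.
have -> : Q - lam ^+ 2 * ip v v = - (\sum_i ip (r i) (D i v)) - ip (P f) v.
  by apply/eqP; rewrite subr_eq -subr_eq0 -(addKr (\sum_i ip (r i) (D i v)) Q)
      [_ + Q]addrC E; apply/eqP; ring.
apply: le_trans (ler_normB _ _) _; rewrite normrN mulrDl; apply: lerD.
  have -> : N ^+ 2 * mu * Z ^+ 2 = N * (N * (mu * Z) * Z) by ring.
  by apply: norm_sum_le => i; apply: ip_le_bound => //; exact: r_bound.
have -> : lam^-1 * Z ^+ 2 = Z * (lam^-1 * Z) by ring.
apply: ip_le_bound; first exact: le_trans (Pn _) _.
by rewrite mulrC ler_pdivlMr // mulrC.
Qed.

Let g := D t v.

(** In the product rule the difference of [q] multiplies [g (x + e t)]. It equals 1 except where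
    [x + e t] lies in [S]; there [v] vanishes on the slice and on the next one, so [g] is 0 and the
    drop of [q] is invisible. *)
Let Dqg i : D i (fun x => q x * g x) =
  (fun x => q x * D i g x + (i == t)%:R * g (x + e t)).
Proof.
apply/funext => x; rewrite fdiffM.
have [->|it] := eqVneq i t; last first.
  have -> : D i q x = 0 by rewrite /fdiff qi // subrr mul0r.
  by rewrite !mul0r.
rewrite mul1r; congr (_ + _).
have [Sx|nSx] := boolP (S (x + e t)).
  have [v0 vi] := vS Sx.
  have -> : g (x + e t) = 0 by rewrite /g /fdiff vi v0 subrr mul0r.
  by rewrite mulr0.
have -> : D t q x = 1; last by rewrite mul1r.
by rewrite /fdiff qt // [q x + h]addrC addrK divff // gt_eqF.
Qed.

Let q_le x : `|q x| <= delta.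
Proof. by have /andP[? ?] := qd x; rewrite ger0_norm. Qed.

Let qn F c : nrm F <= c -> nrm (fun x => q x * F x) <= delta * c.
Proof.
by move=> Fc; apply: le_trans (nrmM (c := delta) _ q_le) _; rewrite ler_wpM2l.
Qed.

Let A0 : 0 <= A. Proof. by apply: le_trans (aA t t 0). Qed.
Let L0 : 0 <= L. Proof. by apply: le_trans (aL t t t 0). Qed.

Let an i j F c : nrm F <= c -> nrm (fun x => a i j x * F x) <= A * c.
Proof.
by move=> Fc; apply: le_trans (nrmM (c := A) _ (aA i j)) _; rewrite ler_wpM2l.
Qed.

(** Summation by parts against a function of slope 1: the drops of [q] sit on [S], where [W]
    vanishes. *)
Let ip_qDs W : (forall x, S x -> W x = 0) -> ip q (D t W) = - \sum_x W x.
Proof.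
move=> WS; rewrite ipC ip_fdiff ipC /ip -sumrN; apply: eq_bigr => x _.
have [Sx|nSx] := boolP (S x); first by rewrite WS // mulr0 oppr0.
have := qt (x := x - e t); rewrite subrK => /(_ nSx) E.
by rewrite /bdiff E opprD addrA subrr sub0r mulNr divff ?gt_eqF // mulN1r.
Qed.

Let B := \sum_i \sum_j ip (fun x => a i j x * D j v x) (fun x => q x * D i g x).

(** Pair [q] with the difference in direction [t] of a_ij D_i v D_j v. By [ip_qDs] the result is
    exactly [- Q]. By the product rule and the symmetry of [a] it is [2 * B], plus the quadratic
    term [E1] of the discrete product rule, with a factor [h], plus [E2] from the coefficients, with
    a factor [delta * L]. *)
Lemma rellich_principal :
  `|2 * B + Q| <= (N ^+ 2 * (h * (delta * (A * (CH * lam) ^+ 2)))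
                   + N ^+ 2 * (delta * L)) * Z ^+ 2.
Proof.
pose W i j x := a i j x * D i v x * D j v x.
pose E1 i j := h * ip (fun x => q x * (a i j x * D t (D i v) x)) (D t (D j v)).
pose E2 i j := ip (fun x => D t (a i j) x * D i v (x + e t))
                  (fun x => q x * D j v (x + e t)).
have WE i j x : D t (W i j) x =
    a i j x * (D t (D i v) x * D j v x + D i v x * D t (D j v) x
               + h * (D t (D i v) x * D t (D j v) x))
    + D t (a i j) x * (D i v (x + e t) * D j v (x + e t)).
  rewrite -{1}/(W i j); have -> : W i j = (fun x => a i j x * (D i v x * D j v x)).
    by apply/funext => y; rewrite /W mulrA.
  by rewrite fdiffM fdiffM [D j v (x + e t)]shift_fdiff; ring.
have E : \sum_i \sum_j ip q (D t (W i j)) =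
    2 * B + \sum_i \sum_j E1 i j + \sum_i \sum_j E2 i j.
  have -> : 2 * B = \sum_i \sum_j
      ip q (fun x => a i j x * (D t (D i v) x * D j v x + D i v x * D t (D j v) x)).
    rewrite (_ : 2 * B = B + B); last by ring.
    have {1}-> : B = \sum_i \sum_j ip q (fun x => a i j x * (D t (D i v) x * D j v x)).
      apply: eq_bigr => i _; apply: eq_bigr => j _; apply: eq_bigr => x _.
      by rewrite /g [D i (D t v)]fdiffC; ring.
    have -> : B = \sum_i \sum_j ip q (fun x => a i j x * (D i v x * D t (D j v) x)).
      rewrite /B exchange_big; apply: eq_bigr => i _; apply: eq_bigr => j _.
      by apply: eq_bigr => x _; rewrite /g [D j (D t v)]fdiffC (aC j i); ring.
    rewrite -big_split; apply: eq_bigr => i _; rewrite -big_split.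
    by apply: eq_bigr => j _; rewrite /= -ipDr; apply: eq_bigr => x _; ring.
  rewrite -!big_split; apply: eq_bigr => i _ /=; rewrite -!big_split.
  apply: eq_bigr => j _ /=; rewrite /E1 /E2 -ipZl /ip -!big_split /=.
  by apply: eq_bigr => x _; rewrite WE; ring.
have E' : \sum_i \sum_j ip q (D t (W i j)) = - Q.
  rewrite /Q -sumrN; apply: eq_bigr => i _; rewrite -sumrN; apply: eq_bigr => j _.
  rewrite ip_qDs; last first.
    move=> x /vS[v0 vi]; have Dv0 : D i v x = 0 by rewrite /fdiff vi v0 subrr mul0r.
    by rewrite /W Dv0 mulr0 mul0r.
  by congr (- _); apply: eq_bigr => x _; rewrite /W; ring.
have -> : 2 * B + Q = - (\sum_i \sum_j E1 i j + \sum_i \sum_j E2 i j).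
  by move: E; rewrite E' => /eqP; rewrite eqr_oppLR => /eqP ->; ring.
rewrite normrN mulrDl; apply: le_trans (ler_normD _ _) _; apply: lerD.
- have -> : N ^+ 2 * (h * (delta * (A * (CH * lam) ^+ 2))) * Z ^+ 2 =
    N ^+ 2 * (h * (delta * (A * (CH * (lam * Z))) * (CH * (lam * Z)))) by ring.
  apply: norm_sum2_le => i j; rewrite /E1 normrM (gtr0_norm h0) ler_pM2l //.
  by apply: ip_le_bound => //; apply: qn; apply: an.
- have -> : N ^+ 2 * (delta * L) * Z ^+ 2 = N ^+ 2 * (L * Z * (delta * Z)) by ring.
  apply: norm_sum2_le => i j; apply: ip_le_bound.
    apply: le_trans (nrmM (c := L) (fun x => D i v (x + e t)) _) _ => //.
    by rewrite (nrm_shift (e t) (D i v)) ler_wpM2l.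
  by apply: qn; rewrite (nrm_shift (e t) (D j v)).
Qed.

Let Gv := \sum_j ip (fun x => a t j x * D j v x) (D t v).

(** The multiplier [q * D t v] in the weak form: its second differences give [B], the slope of [q]
    gives [Gv], and the term in lam^2 sums by parts to half of lam^2 |v|^2. Eliminating [B] with
    [rellich_principal] leaves only terms containing [h], [delta] or [mu]. *)
Lemma rellich_identity :
  `|2 * Gv - (Q - lam ^+ 2 * ip v v)| <=
   (N ^+ 2 * (h * (delta * (A * (CH * lam) ^+ 2))) + N ^+ 2 * (delta * L)
   + 2 * (N * (h * (A * (CH * lam)))) + 2 * (N * (N * (mu * (delta * (CH * lam)))))
   + 2 * (N * mu) + lam ^+ 2 * (h * delta) + 2 * delta) * Z ^+ 2.
Proof.
pose T1 := \sum_j ip (fun x => a t j x * D j v x) (fun x => h * D t g x).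
pose T2 := \sum_i ip (r i) (fun x => q x * D i g x).
pose T3 := ip (r t) (fun x => g (x + e t)).
pose T4 := ip (P f) (fun x => q x * g x).
pose T5 := ip (fun x => q x * g x) g.
have E := weak_form_v (fun x => q x * g x).
have E1 : \sum_i \sum_j ip (fun x => a i j x * D j v x) (D i (fun x => q x * g x))
   = B + (Gv + T1).
  have -> : Gv + T1 =
      \sum_j ip (fun x => a t j x * D j v x) (fun x => g (x + e t)).
    rewrite /Gv /T1 -big_split /=; apply: eq_bigr => j _; rewrite -ipDr.
    by congr ip; apply/funext => x; rewrite [g (x + e t)]shift_fdiff.
  have -> : \sum_j ip (fun x => a t j x * D j v x) (fun x => g (x + e t)) =
    \sum_i \sum_j ip (fun x => a i j x * D j v x) (fun x => (i == t)%:R * g (x + e t)).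
    rewrite [RHS](bigD1 t) //= [X in _ + X]big1 ?addr0; last first.
      by move=> i /negPf ->; apply: big1 => j _; rewrite ipZr mul0r.
    by apply: eq_bigr => j _; rewrite eqxx ipZr mul1r.
  rewrite /B -big_split; apply: eq_bigr => i _; rewrite -big_split.
  by apply: eq_bigr => j _; rewrite Dqg /= ipDr.
have E2 : \sum_i ip (r i) (D i (fun x => q x * g x)) = T2 + T3.
  have -> : T3 = \sum_i ip (r i) (fun x => (i == t)%:R * g (x + e t)).
    rewrite [RHS](bigD1 t) //= [X in _ + X]big1 ?addr0; last first.
      by move=> i /negPf ->; rewrite ipZr mul0r.
    by rewrite eqxx ipZr mul1r.
  by rewrite /T2 -big_split; apply: eq_bigr => i _; rewrite Dqg /= ipDr.
(* Twice v D_t v is the difference of v^2 up to -h (D_t v)^2, and [ip_qDs] applies to v^2. *)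
have E3 : 2 * ip v (fun x => q x * g x) = - ip v v - h * T5.
  have <- : ip q (D t (fun x => v x * v x)) = - ip v v.
    by rewrite ip_qDs // => x /vS[-> _]; rewrite mulr0.
  rewrite -ipZl -ipZr /ip -sumrB; apply: eq_bigr => x _.
  by rewrite fdiffM [v (x + e t)]shift_fdiff /g; ring.
have M : 2 * Gv - (Q - lam ^+ 2 * ip v v) =
   - (2 * B + Q) - 2 * T1 - 2 * T2 - 2 * T3 - lam ^+ 2 * (h * T5) - 2 * T4.
  move: E; rewrite E1 E2 ipBl ipZl -/T4 => E.
  have E4 : 2 * (lam ^+ 2 * ip v (fun x => q x * g x)) =
            lam ^+ 2 * (- ip v v - h * T5) by rewrite -E3; ring.
  have -> : 2 * Gv = 2 * (B + (Gv + T1) + (T2 + T3)) - 2 * B - 2 * T1 - 2 * T2 - 2 * T3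
    by ring.
  by rewrite E mulrBr E4; ring.
have gZ : nrm g <= Z := Dv t.
have b1 : `|T1| <= N * (h * (A * (CH * lam))) * Z ^+ 2.
  have -> : N * (h * (A * (CH * lam))) * Z ^+ 2 = N * (A * Z * (h * (CH * (lam * Z))))
    by ring.
  apply: norm_sum_le => j; apply: ip_le_bound; first exact: an.
  by rewrite nrmZ gtr0_norm // ler_pM2l // DDv.
have b2 : `|T2| <= N * (N * (mu * (delta * (CH * lam)))) * Z ^+ 2.
  have -> : N * (N * (mu * (delta * (CH * lam)))) * Z ^+ 2 =
     N * (N * (mu * Z) * (delta * (CH * (lam * Z)))) by ring.
  apply: norm_sum_le => j; apply: ip_le_bound; first exact: r_bound.
  by apply: qn; exact: DDv.
have b3 : `|T3| <= N * mu * Z ^+ 2.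
  have -> : N * mu * Z ^+ 2 = N * (mu * Z) * Z by ring.
  by apply: ip_le_bound; [exact: r_bound | rewrite (nrm_shift (e t) g)].
have b4 : `|T4| <= delta * Z ^+ 2.
  have -> : delta * Z ^+ 2 = Z * (delta * Z) by ring.
  by apply: ip_le_bound; [exact: le_trans (Pn _) _ | exact: qn].
have b5 : `|lam ^+ 2 * (h * T5)| <= lam ^+ 2 * (h * delta) * Z ^+ 2.
  have -> : lam ^+ 2 * (h * delta) * Z ^+ 2 = lam ^+ 2 * (h * (delta * Z * Z)) by ring.
  rewrite (normrM (lam ^+ 2)) (normrM h) (gtr0_norm h0) (ger0_norm (sqr_ge0 lam)).
  rewrite ler_wpM2l ?sqr_ge0 // ler_pM2l //.
  by apply: ip_le_bound => //; exact: qn.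
have b0 := rellich_principal.
have tri (x0 x1 x2 x3 x4 x5 : R) : `|- x0 - 2 * x1 - 2 * x2 - 2 * x3 - x5 - 2 * x4|
    <= `|x0| + 2 * `|x1| + 2 * `|x2| + 2 * `|x3| + `|x5| + 2 * `|x4|.
  have n2 (y : R) : `|2 * y| = 2 * `|y| by rewrite normrM ger0_norm.
  rewrite -(n2 x1) -(n2 x2) -(n2 x3) -(n2 x4) -(normrN x0).
  do 4 (apply: le_trans (ler_normB _ _) _; apply: lerD => //).
  exact: ler_normB.
rewrite M; apply: le_trans (tri _ _ _ _ _ _) _.
move: b0 b1 b2 b3 b4 b5; rewrite !mulrDl; move: (2 * B + Q) => X.
by lra.
Qed.

(** One summand for each error in [energy_identity] and [rellich_identity]; the last one pays for
    passing from [v] back to [U]. *)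
Definition rellich_const : R :=
  N ^+ 2 + 1 + N ^+ 2 * (A * CH ^+ 2) + N ^+ 2 * L + 2 * (N * (A * CH))
  + 2 * (N ^+ 2 * CH) + 2 * N + 3 + 4 * (N ^+ 2 * (A * CH)).

(** [2 * Gv] is the sum of the quantities bounded in [rellich_identity] and [energy_identity].
    Replacing [U] by [v] costs [mu] times the second differences of [U], that is mu lam Z by
    [H2_bound]; the hypothesis [mukap], which forces the degree of the kernel to grow like lam, is
    there for this. *)
Lemma rellich_direction :
  `|\sum_j ip (fun x => a t j x * D j U x) (D t U)| <=
    rellich_const * (delta + kap + lam^-1 + h * lam ^+ 2) * Z ^+ 2.
Proof.
have CH0 : 0 <= CH.
  by rewrite /H2_const divr_ge0 ?addr_ge0 ?mulr_ge0 ?sqr_ge0 // ltW.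
have N0 : 0 <= N by exact: ler0n.
have Wd i : nrm (fun x => D i U x - D i v x) <= N * (CH * kap) * Z.
  rewrite /v -PDi; apply: le_trans (Pap _) _.
  apply: (@le_trans _ _ (mu * (N * (CH * (lam * Z))))).
    apply: ler_wpM2l => //; apply: le_trans (ler_norm _) _; apply: norm_sum_le => k.
    by rewrite ger0_norm ?nrm_ge0 // H2_bound.
  have -> : mu * (N * (CH * (lam * Z))) = (N * CH * Z) * (mu * lam) by ring.
  have -> : N * (CH * kap) * Z = (N * CH * Z) * kap by ring.
  by apply: ler_wpM2l => //; exact: mulr_ge0 (mulr_ge0 N0 CH0) Z0.
have dif : `|\sum_j ip (fun x => a t j x * D j U x) (D t U) - Gv| <=
     2 * (N ^+ 2 * (A * CH)) * kap * Z ^+ 2.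
  rewrite /Gv -sumrB.
  have -> : 2 * (N ^+ 2 * (A * CH)) * kap * Z ^+ 2 =
     N * (A * (N * (CH * kap) * Z) * Z + A * Z * (N * (CH * kap) * Z)) by ring.
  apply: norm_sum_le => j.
  have -> : ip (fun x => a t j x * D j U x) (D t U) -
            ip (fun x => a t j x * D j v x) (D t v) =
    ip (fun x => a t j x * (D j U x - D j v x)) (D t U) +
    ip (fun x => a t j x * D j v x) (fun x => D t U x - D t v x).
    by rewrite ipBr /ip -!sumrB -big_split /=; apply: eq_bigr => x _; ring.
  apply: le_trans (ler_normD _ _) _; apply: lerD; apply: ip_le_bound => //;
    exact: an.
have E := energy_identity; have Rl := rellich_identity.
set X := \sum_j _ in dif *.
have li : 0 <= lam^-1 by rewrite invr_ge0 ltW.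
have mk : mu <= kap by apply: le_trans mukap; rewrite ler_peMr.
have kap0 : 0 <= kap by apply: le_trans mk.
have lam2 : lam <= lam ^+ 2 by rewrite expr2 ler_peMl // ltW.
set ee := delta + kap + lam^-1 + h * lam ^+ 2.
have hl0 : 0 <= h * lam ^+ 2 by rewrite mulr_ge0 ?sqr_ge0 // ltW.
have sum4 (x0 x1 x2 x3 : R) : 0 <= x0 -> 0 <= x1 -> 0 <= x2 -> 0 <= x3 ->
    [/\ x0 <= x0 + x1 + x2 + x3, x1 <= x0 + x1 + x2 + x3,
        x2 <= x0 + x1 + x2 + x3 & x3 <= x0 + x1 + x2 + x3].
  by move=> *; split; lra.
have [x4 xk x2 xh] := sum4 _ _ _ _ delta0 kap0 li hl0; rewrite -/ee in x4 xk x2 xh.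
have t0 : `|2 * Gv| <= (rellich_const - 2 * (2 * (N ^+ 2 * (A * CH)))) * ee * Z ^+ 2.
  have -> : 2 * Gv = (2 * Gv - (Q - lam ^+ 2 * ip v v)) + (Q - lam ^+ 2 * ip v v).
    by rewrite subrK.
  apply: le_trans (ler_normD _ _) _; apply: le_trans (lerD Rl E) _.
  rewrite -mulrDl; apply: ler_wpM2r; first exact: sqr_ge0.
  have key c x : 0 <= c -> x <= ee -> c * x <= c * ee by move=> *; rewrite ler_wpM2l.
  have x1 : mu <= ee := le_trans mk xk.
  have x3 : h * delta * lam ^+ 2 <= ee.
    by apply: le_trans xh; rewrite mulrAC ler_piMr.
  have x5 : h * lam <= ee.
    by apply: le_trans xh; rewrite ler_pM2l.
  have x6 : delta * (mu * lam) <= ee.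
    apply: le_trans xk; apply: le_trans mukap.
    by rewrite ler_piMl // mulr_ge0 // ltW.
  have NN : 0 <= N ^+ 2 by exact: sqr_ge0.
  have y1 := key _ _ NN x1.
  have y3 := key (N ^+ 2 * (A * CH ^+ 2)) _ (mulr_ge0 NN (mulr_ge0 A0 (sqr_ge0 _))) x3.
  have y4 := key _ _ (mulr_ge0 NN L0) x4.
  have y5 := key _ _ (mulr_ge0 N0 (mulr_ge0 A0 CH0)) x5.
  have y6 := key _ _ (mulr_ge0 NN CH0) x6.
  have y7 := key _ _ N0 x1.
  have -> : N ^+ 2 * (h * (delta * (A * (CH * lam) ^+ 2))) =
    N ^+ 2 * (A * CH ^+ 2) * (h * delta * lam ^+ 2) by ring.
  have -> : N ^+ 2 * (delta * L) = N ^+ 2 * L * delta by ring.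
  have -> : N * (h * (A * (CH * lam))) = N * (A * CH) * (h * lam) by ring.
  have -> : N * (N * (mu * (delta * (CH * lam)))) =
    N ^+ 2 * CH * (delta * (mu * lam)) by ring.
  have -> : lam ^+ 2 * (h * delta) = h * delta * lam ^+ 2 by ring.
  rewrite /rellich_const !mulrDl.
  by move: x2 y1 y3 y4 y5 y6 y7 x3 x4; lra.
have t1 : 2 * (N ^+ 2 * (A * CH)) * kap * Z ^+ 2 <= 2 * (N ^+ 2 * (A * CH)) * ee * Z ^+ 2.
  apply: ler_wpM2r; first exact: sqr_ge0.
  apply: ler_wpM2l; first exact: mulr_ge0 (ler0n _ 2) (mulr_ge0 (sqr_ge0 N) (mulr_ge0 A0 CH0)).
  exact: xk.
have -> : X = (X - Gv) + Gv by rewrite subrK.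
apply: le_trans (ler_normD _ _) _.
move: t0; rewrite normrM (ger0_norm (ler0n _ 2)).
have cz : 0 <= rellich_const * ee * Z ^+ 2.
  apply: mulr_ge0 (sqr_ge0 _); apply: mulr_ge0 (le_trans delta0 x4).
  have NN := sqr_ge0 N; have NCH := mulr_ge0 NN CH0.
  have p1 := mulr_ge0 NN (mulr_ge0 A0 (sqr_ge0 CH)); have p2 := mulr_ge0 NN L0.
  have p3 := mulr_ge0 N0 (mulr_ge0 A0 CH0); have p4 := mulr_ge0 NN (mulr_ge0 A0 CH0).
  by rewrite /rellich_const; move: NN NCH p1 p2 p3 p4 N0; lra.
by move: dif t1 cz; lra.
Qed.

End Direction.

End Differences.

Section JordanInequality.
Variable R : realType.

(** Halving the angle brings it into [0, pi/4], where the cosine is at least 1/2; the mean value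
    theorem bounds the sine of the half angle, and the duplication formula gives the claim. *)
Lemma sin_ge_quarter (x : R) : 0 <= x <= pi / 2 -> x / 4 <= sin x.
Proof.
move=> /andP[x0 xpi].
have pi2 : pi / 2 < 2 :> R := pihalf_lt2 R.
have pi0 : 0 < pi :> R := pi_gt0 R.
pose y := x / 2.
have xy : x = y *+ 2 by rewrite /y; lra.
have y0 : 0 <= y by rewrite /y; lra.
have y4 : y <= pi / 4 by rewrite /y; lra.
have cos4 : 1 / 2 <= cos (pi / 4 : R).
  have c0 : 0 <= cos (pi / 4 : R) by apply: cos_ge0_pihalf; apply/andP; split; lra.
  have E : cos (pi / 4 *+ 2 : R) = 0.
    by rewrite (_ : pi / 4 *+ 2 = pi / 2) ?cos_pihalf //; lra.
  move: E; rewrite cos_mulr2n => E.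
  have c1 := cos_le1 (pi / 4 : R).
  nra.
have cosy (z : R) : 0 <= z <= pi / 4 -> 1 / 2 <= cos z.
  move=> /andP[z0 z4]; apply: le_trans cos4 _.
  have [->//|zn] := eqVneq z (pi / 4).
  apply: ltW; rewrite ltr_cos ?in_itv /=; first by rewrite lt_neqAle zn.
    by apply/andP; split; lra.
  by apply/andP; split; lra.
have siny : y / 2 <= sin y.
  have [/eqP <-|yp] := boolP (0 == y); first by rewrite sin0 mul0r.
  have yp' : 0 < y by rewrite lt_def eq_sym yp y0.
  have [c + E] := MVT yp' (fun z _ => is_derive_sin z)
    (continuous_subspaceT (@continuous_sin R)).
  rewrite in_itv /= => /andP[c0 cy].
  move: E; rewrite sin0 !subr0 => ->.
  have : 1 / 2 <= cos c by apply: cosy; apply/andP; split; lra.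
  nra.
rewrite xy sin_mulr2n.
have : 1 / 2 <= cos y by apply: cosy; rewrite y0.
nra.
Qed.

End JordanInequality.

(** * Averaging along coordinate directions *)

Section Lattice.
Variables (R : realType) (n m : nat).
Let K := 'I_m.+2.
Let G := 'rV[K]_n.
Implicit Types (f g : G -> R) (i j k : 'I_n) (s : K) (x : G).

Definition axis i s : G := \row_j (if j == i then s else 0).

Lemma axisD i s1 s2 : axis i (s1 + s2) = axis i s1 + axis i s2.
Proof. by apply/rowP => j; rewrite !mxE; case: ifP; rewrite ?addr0. Qed.

Lemma axis_nat i (c : nat) : axis i (c%:R) = axis i 1 *+ c.
Proof.
elim: c => [|c IH]; last by rewrite -addn1 natrD axisD mulrnDr IH.
by apply/rowP => j; rewrite !mxE if_same.
Qed.

(** The distance from [s] to 0 on the cycle, that is the number of unit steps needed to realise the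
    shift by [s]. *)
Definition circ s : nat := minn s (m.+2 - s).

Lemma circ_rep s : s = (circ s)%:R \/ s = - (circ s)%:R.
Proof.
have sm := ltn_ord s.
rewrite /circ; case: leqP => H; [left|right]; apply/val_inj; rewrite Zp_nat /=.
  by rewrite modn_small.
case: (posnP s) => [s0|sp]; first by rewrite s0 in H *; lia.
by rewrite (modn_small (m := m.+2 - s)) ?subKn ?modn_small //; lia.
Qed.

Variable (h : R).
Hypothesis h0 : 0 < h.
Local Notation e := (fun i => axis i 1).
Local Notation D := (fdiff e h).

Lemma shift_bound (c : nat) k f :
  nrm (fun x => f (x + e k *+ c) - f x) <= h * c%:R * nrm (D k f).
Proof.
elim: c => [|c IH].
  rewrite mulr0 mul0r -(@nrm0 R G); apply: nrm_le => x.
  by rewrite mulr0n addr0 subrr.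
have -> : (fun x => f (x + e k *+ c.+1) - f x) =
  (fun x => h * D k f (x + e k *+ c) + (f (x + e k *+ c) - f x)).
  by apply/funext => x; rewrite mulrSr addrA [f (_ + _ + _)](shift_fdiff _ h0); ring.
apply: le_trans (nrmD _ _) _.
rewrite -natr1 mulrDr mulrDl mulr1 addrC lerD // nrmZ gtr0_norm //.
by rewrite (nrm_shift (e k *+ c) (D k f)).
Qed.

Lemma axis_shift_bound s k f :
  nrm (fun x => f (x + axis k s) - f x) <= h * (circ s)%:R * nrm (D k f).
Proof.
case: (circ_rep s) => E; rewrite {1}E ?axis_nat; first exact: shift_bound.
have -> : axis k (- (circ s)%:R) = - (e k *+ circ s).
  apply/eqP; rewrite -addr_eq0 -axis_nat -axisD addNr; apply/eqP/rowP => j.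
  by rewrite !mxE if_same.
rewrite -(nrm_shift (e k *+ circ s)) -nrmN.
under eq_fun do rewrite addrK opprB.
exact: shift_bound.
Qed.

Lemma axis_shift_sup L s k f x : (forall y, `|D k f y| <= L) ->
  `|f (x + axis k s) - f x| <= h * (circ s)%:R * L.
Proof.
move=> fL.
have B c y : `|f (y + e k *+ c) - f y| <= h * c%:R * L.
  elim: c => [|c IH]; first by rewrite mulr0n addr0 subrr normr0 mulr0 mul0r.
  have -> : f (y + e k *+ c.+1) - f y =
    h * D k f (y + e k *+ c) + (f (y + e k *+ c) - f y).
    by rewrite mulrSr addrA [f (_ + _ + _)](shift_fdiff _ h0); ring.
  apply: le_trans (ler_normD _ _) _.
  by rewrite -natr1 mulrDr mulrDl mulr1 addrC lerD // normrM gtr0_norm // ler_pM2l.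
case: (circ_rep s) => E; rewrite {1}E ?axis_nat; first exact: B.
have -> : axis k (- (circ s)%:R) = - (e k *+ circ s).
  apply/eqP; rewrite -addr_eq0 -axis_nat -axisD addNr; apply/eqP/rowP => j.
  by rewrite !mxE if_same.
by have := B (circ s) (x - e k *+ circ s); rewrite subrK distrC.
Qed.

Variable w : K -> R.
Hypothesis w0 : forall s, 0 <= w s.
Hypothesis w1 : \sum_s w s = 1.
Variable mu : R.
Hypothesis wmu : \sum_s w s * (h * (circ s)%:R) <= mu.

Definition conv k f x : R := \sum_s w s * f (x + axis k s).

Fixpoint convs (ks : seq 'I_n) f : G -> R :=
  if ks is k :: ks' then conv k (convs ks' f) else f.

Let mu0 : 0 <= mu.
Proof.
apply: le_trans wmu; apply: sumr_ge0 => s _.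
by rewrite mulr_ge0 // mulr_ge0 ?ler0n // ltW.
Qed.

Lemma nrm_conv k f : nrm (conv k f) <= nrm f.
Proof.
apply: le_trans (nrm_sum _ (fun s x => w s * f (x + axis k s))) _.
rewrite -[leRHS]mul1r -w1 mulr_suml; apply: ler_sum => s _.
by rewrite nrmZ ger0_norm // (nrm_shift (axis k s) f).
Qed.

Lemma convD k f g x : conv k (fun x => f x + g x) x = conv k f x + conv k g x.
Proof. by rewrite /conv -big_split; apply: eq_bigr => s _; rewrite mulrDr. Qed.

Lemma convZ k c f x : conv k (fun x => c * f x) x = c * conv k f x.
Proof. by rewrite /conv mulr_sumr; apply: eq_bigr => s _; rewrite mulrCA. Qed.

Lemma conv_shift k (y : G) f x : conv k (fun x => f (x + y)) x = conv k f (x + y).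
Proof. by apply: eq_bigr => s _; rewrite addrAC. Qed.

(** Each shift costs its length on the cycle times |D k f|, so the average costs the first moment
    [mu] of the weight. *)
Lemma conv_approx k f : nrm (fun x => f x - conv k f x) <= mu * nrm (D k f).
Proof.
have -> : (fun x => f x - conv k f x) =
  (fun x => \sum_s (- w s) * (f (x + axis k s) - f x)).
  apply/funext => x; rewrite -[f x in LHS]mul1r -w1 mulr_suml /conv -sumrB.
  by apply: eq_bigr => s _; ring.
apply: le_trans (nrm_sum _ (fun s x => - w s * (f (x + axis k s) - f x))) _.
apply: le_trans (ler_wpM2r (nrm_ge0 _) wmu); rewrite mulr_suml; apply: ler_sum => s _.
by rewrite nrmZ normrN ger0_norm // -mulrA ler_wpM2l // axis_shift_bound.
Qed.

(** The shift falls on the coefficient: the commutator averages a(x + s) - a(x), so no difference of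
    [f] appears. *)
Lemma conv_comm k (a : G -> R) L f : (forall x, `|D k a x| <= L) ->
  nrm (fun x => conv k (fun y => a y * f y) x - a x * conv k f x) <= L * mu * nrm f.
Proof.
move=> aL.
have L0 : 0 <= L by apply: le_trans (aL 0).
have -> : (fun x => conv k (fun y => a y * f y) x - a x * conv k f x) =
  (fun x => \sum_s w s * ((a (x + axis k s) - a x) * f (x + axis k s))).
  apply/funext => x; rewrite /conv mulr_sumr -sumrB.
  by apply: eq_bigr => s _; ring.
apply: le_trans (nrm_sum _
  (fun s x => w s * ((a (x + axis k s) - a x) * f (x + axis k s)))) _.
rewrite -mulrA mulrCA; apply: le_trans (ler_wpM2r _ wmu); last first.
  by rewrite mulr_ge0 ?nrm_ge0.
rewrite mulr_suml; apply: ler_sum => s _.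
rewrite nrmZ ger0_norm // -mulrA ler_wpM2l //.
apply: le_trans (nrmM (c := h * (circ s)%:R * L) (fun x => f (x + axis k s)) _) _.
  by move=> x; apply: axis_shift_sup.
by rewrite (nrm_shift (axis k s) f) mulrA.
Qed.

Lemma convsD ks f g x : convs ks (fun x => f x + g x) x = convs ks f x + convs ks g x.
Proof.
elim: ks x => // k ks IH x /=; rewrite -convD; congr conv.
by apply/funext => y; rewrite IH.
Qed.

Lemma convsZ ks c f x : convs ks (fun x => c * f x) x = c * convs ks f x.
Proof.
elim: ks x => // k ks IH x /=; rewrite -convZ; congr conv.
by apply/funext => y; rewrite IH.
Qed.

Lemma convs_shift ks (y : G) f x : convs ks (fun x => f (x + y)) x = convs ks f (x + y).
Proof.
elim: ks x => // k ks IH x /=; rewrite -conv_shift; congr conv.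
by apply/funext => z; rewrite IH.
Qed.

Lemma nrm_convs ks f : nrm (convs ks f) <= nrm f.
Proof. by elim: ks => //= k ks IH; apply: le_trans (nrm_conv _ _) IH. Qed.

Lemma convB k f g x : conv k (fun x => f x - g x) x = conv k f x - conv k g x.
Proof. by rewrite /conv -sumrB; apply: eq_bigr => s _; rewrite mulrBr. Qed.

(** Peel off one direction at a time; the outer convolution is a contraction, so it does not amplify
    the error of the inner ones. *)
Lemma convs_approx ks f : uniq ks ->
  nrm (fun x => f x - convs ks f x) <= mu * \sum_k nrm (D k f).
Proof.
move=> uks; apply: (@le_trans _ _ (mu * \sum_(k <- ks) nrm (D k f))); last first.
  rewrite ler_wpM2l // big_uniq //= big_mkcond /=; apply: ler_sum => k _.
  by case: ifP => // _; exact: nrm_ge0.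
elim: ks {uks} => [|k ks IH] /=.
  rewrite big_nil mulr0 -(@nrm0 R G); apply: nrm_le => x.
  by rewrite subrr normr0.
rewrite big_cons mulrDr.
have -> : (fun x => f x - conv k (convs ks f) x) =
  (fun x => (f x - conv k f x) + conv k (fun y => f y - convs ks f y) x).
  by apply/funext => x; rewrite convB; ring.
apply: le_trans (nrmD _ _) _; apply: lerD; first exact: conv_approx.
by apply: le_trans (nrm_conv _ _) _.
Qed.

Lemma convs_comm ks (a : G -> R) L f : (forall k x, `|D k a x| <= L) -> 0 <= L ->
  nrm (fun x => convs ks (fun y => a y * f y) x - a x * convs ks f x)
     <= (size ks)%:R * (L * mu) * nrm f.
Proof.
move=> aL L0; elim: ks => [|k ks IH] /=.
  rewrite !mul0r -(@nrm0 R G); apply: nrm_le => x.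
  by rewrite subrr normr0.
rewrite -natr1 !mulrDl mul1r.
have -> : (fun x => conv k (convs ks (fun y => a y * f y)) x - a x * conv k (convs ks f) x)
  = (fun x => conv k (fun y => convs ks (fun y => a y * f y) y - a y * convs ks f y) x
      + (conv k (fun y => a y * convs ks f y) x - a x * conv k (convs ks f) x)).
  by apply/funext => x; rewrite convB; ring.
apply: le_trans (nrmD _ _) _; apply: lerD.
  exact: le_trans (nrm_conv _ _) IH.
apply: le_trans (conv_comm _ (aL k)) _.
by rewrite ler_wpM2l ?nrm_convs // mulr_ge0.
Qed.

End Lattice.

(** * A nonnegative trigonometric kernel on the cycle *)

Section TrigKernel.
Variables (R : realType) (m : nat).
Let K := 'I_m.+2.
Implicit Types (s x : K) (z : int).
Let M : R := m.+2%:R.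
Let al : R := pi *+ 2 / M.
Let th (k : nat) : R := k%:R * al.

Let M0 : 0 < M. Proof. by rewrite ltr0n. Qed.
Let Mal : M * al = pi *+ 2. Proof. by rewrite /al mulrC divfK ?gt_eqF. Qed.

Let al0 : 0 < al.
Proof. by rewrite /al divr_gt0 // mulrn_wgt0 // pi_gt0. Qed.

Definition cosz z s : R := cos (z%:~R * th s).
Definition sinz z s : R := sin (z%:~R * th s).

Lemma cos_period (a : R) z : cos (a + z%:~R * (pi *+ 2)) = cos a.
Proof.
have H (k : nat) b : cos (b + k%:R * (pi *+ 2) : R) = cos b.
  elim: k => [|k IH]; first by rewrite mul0r addr0.
  by rewrite -natr1 mulrDl mul1r addrA cosD2pi.
case: z => k; first exact: H.
rewrite NegzE mulrNz mulNr -[LHS](H k.+1); congr cos.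
by rewrite addrNK.
Qed.

Lemma sin_period (a : R) z : sin (a + z%:~R * (pi *+ 2)) = sin a.
Proof. by rewrite -!cosBpihalf addrAC cos_period. Qed.

Let th_mod z k : z%:~R * th k = z%:~R * th (k %% m.+2) +
   (z * (k %/ m.+2)%:Z)%:~R * (pi *+ 2).
Proof.
rewrite {1}(divn_eq k m.+2) /th natrD natrM intrM -Mal /M.
by rewrite -pmulrn; ring.
Qed.

Lemma coszD z s x : cosz z (s + x) = cos (z%:~R * (th s + th x)).
Proof.
have -> : th s + th x = th (s + x)%N by rewrite /th natrD mulrDl.
by rewrite th_mod cos_period.
Qed.

Lemma sinzD z s x : sinz z (s + x) = sin (z%:~R * (th s + th x)).
Proof.
have -> : th s + th x = th (s + x)%N by rewrite /th natrD mulrDl.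
by rewrite th_mod sin_period.
Qed.

Lemma coszB z s x : cosz z (s - x) = cosz z s * cosz z x + sinz z s * sinz z x.
Proof.
have := coszD z (s - x) x; have := sinzD z (s - x) x; rewrite subrK => -> ->.
by rewrite -cosB; congr cos; rewrite /th; ring.
Qed.

(** Shifting the summation index rotates the pair of cosine and sine sums by the angle [b], so (1 -
    cos b) (C^2 + S^2) = 0; and cos b is not 1 because the frequency lies strictly between 0 and the
    period. *)
Lemma sum_cosz z : z != 0 -> (`|z| < m.+2)%N -> \sum_s cosz z s = 0.
Proof.
move=> z0 zm.
pose C := \sum_s cosz z s; pose S := \sum_s sinz z s.
pose b := z%:~R * al.
have th1 : th (nat_of_ord (1%R : K)) = al by rewrite /th /= mul1r.
have EC : C = C * cos b - S * sin b.
  rewrite {1}/C (reindex_inj (addIr (1%R : K))) /= /C /S !mulr_suml -sumrB.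
  apply: eq_bigr => s _; rewrite coszD mulrDr th1 cosD.
  by rewrite /cosz /sinz /b.
have ES : S = S * cos b + C * sin b.
  rewrite {1}/S (reindex_inj (addIr (1%R : K))) /= /C /S !mulr_suml -big_split.
  apply: eq_bigr => s _; rewrite sinzD mulrDr th1 sinD.
  by rewrite /cosz /sinz /b.
have E : (1 - cos b) * (C ^+ 2 + S ^+ 2) = 0.
  have -> : (1 - cos b) * (C ^+ 2 + S ^+ 2) =
     C * (C - C * cos b) + S * (S - S * cos b) by ring.
  have -> : C - C * cos b = - (S * sin b) by rewrite {1}EC; ring.
  have -> : S - S * cos b = C * sin b by rewrite {1}ES; ring.
  by ring.
have cb : cos b != 1.
  have -> : cos b = cos (`|z|%N%:R * al).
    rewrite /b; case: (z) => k //=.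
    by rewrite NegzE mulrNz mulNr cosN.
  have z1 : (0 < `|z|)%N by rewrite absz_gt0.
  pose y := `|z|%N%:R * al / 2.
  have -> : `|z|%N%:R * al = y *+ 2 by rewrite /y; lra.
  rewrite cos_mulr2n cos2sin2.
  have sy : 0 < sin y.
    apply: sin_gt0_pi; apply/andP; split.
      by rewrite /y divr_gt0 // mulr_gt0 // ltr0n.
    rewrite /y ltr_pdivrMr // mulr_natr -Mal ltr_pM2r //.
    by rewrite ltr_nat.
  have : 0 < sin y ^+ 2 by rewrite exprn_gt0.
  by move=> H; apply/eqP => E1; lra.
move/eqP: E; rewrite mulf_eq0 subr_eq0 eq_sym (negPf cb) /=.
rewrite paddr_eq0 ?sqr_ge0 // => /andP[/eqP]/eqP.
by rewrite sqrf_eq0 => /eqP.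
Qed.

Lemma sum_cosz_delta z : (`|z| < m.+2)%N -> \sum_s cosz z s = M * (z == 0)%:R.
Proof.
move=> zm; have [->|z0] := eqVneq z 0; last by rewrite sum_cosz // mulr0.
rewrite mulr1 (eq_bigr (fun=> 1)); last by move=> s _; rewrite /cosz mul0r cos0.
by rewrite sumr_const card_ord.
Qed.

Lemma cosz_mul1 z s : cosz z s * cosz 1 s = (cosz (z + 1) s + cosz (z - 1) s) / 2.
Proof.
rewrite /cosz; have -> : (z + 1)%:~R * th s = z%:~R * th s + 1%:~R * th s.
  by rewrite intrD mulrDl.
have -> : (z - 1)%:~R * th s = z%:~R * th s - 1%:~R * th s by rewrite intrB mulrBl.
rewrite cosD cosB.
by field.
Qed.

(** Turns the second moment of the kernel into its first Fourier coefficient. Follows from 1 - cos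
    2y = 2 sin^2 y and [sin_ge_quarter]; the 8 is generous. *)
Lemma circ_cosz s : ((circ s)%:R / M) ^+ 2 <= 8 * (1 - cosz 1 s).
Proof.
have sm := ltn_ord s.
have cosE : cosz 1 s = cos ((circ s)%:R * al).
  rewrite /cosz mul1r /th /circ; case: leqP => H //.
  rewrite natrB 1?ltnW // mulrBl -/M Mal addrC -[LHS]cosN.
  by rewrite -(cos_period _ 1) mul1r.
have cM : (circ s)%:R * 2 <= M.
  by rewrite /M -natrM ler_nat /circ; lia.
rewrite cosE; pose y := (circ s)%:R / M * pi.
have -> : (circ s)%:R * al = y *+ 2 by rewrite /al /y -mulr_natr; ring.
rewrite cos_mulr2n cos2sin2.
have c0 : 0 <= (circ s)%:R / M by rewrite divr_ge0 // ltW.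
have pi0 := pi_gt0 R; have pi2 := pi_ge2 R.
have := @sin_ge_quarter R y; rewrite /y.
have c2 : (circ s)%:R / M <= 1 / 2.
  by rewrite ler_pdivrMr // -ler_pdivrMl //; lra.
set c := (circ s)%:R / M in c0 c2 *.
have -> /= : 0 <= c * pi <= pi / 2 by apply/andP; split; nra.
move=> /(_ isT) H.
have cs : c <= 2 * sin (c * pi) by nra.
have : c ^+ 2 <= (2 * sin (c * pi)) ^+ 2.
  by rewrite ler_pXn2r ?nnegrE //; lra.
nra.
Qed.

Variable N : nat.
Hypothesis N0 : (0 < N)%N.
Hypothesis NM : (N.*2.+2 < m.+2)%N.

(** Tent-shaped coefficients: consecutive ones differ by at most 1 while the sum [E0] of squares is
    of order N^3. So 1 - E1/E0, which controls the second moment of the kernel, is of order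
    1/N^2. *)
Let c (l : nat) : R := (minn l (N.*2 - l))%:R.
Let B := N.*2.+1.
Let E0 : R := \sum_(l < B) c l ^+ 2.
Let E1 : R := \sum_(l < B) c l * c l.+1.

Let c0 : c 0 = 0. Proof. by rewrite /c min0n. Qed.
Let cB : c B = 0.
Proof. by rewrite /c /B (_ : N.*2 - N.*2.+1 = 0)%N ?minn0 //; lia. Qed.

Let E0_lb : N%:R ^+ 3 / 3 <= E0.
Proof.
have S (k : nat) : k%:R ^+ 3 / 3 <= \sum_(l < k.+1) (l%:R : R) ^+ 2.
  elim: k => [|k IH]; first by rewrite big_ord1 !expr0n /= mul0r.
  rewrite big_ord_recr /=; apply: le_trans (lerD IH (lexx _)).
  have k0 : 0 <= k%:R :> R by exact: ler0n.
  by rewrite -natr1; nra.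
apply: le_trans (S N) _.
have NB : (N.+1 <= B)%N by rewrite /B; lia.
rewrite /E0 (big_ord_widen _ (fun l => (l%:R : R) ^+ 2) NB) big_mkcond /=.
apply: ler_sum => l _; case: ifP => [lN|_]; last by rewrite sqr_ge0.
by rewrite /c (minn_idPl _) //; lia.
Qed.

Let N1 : 1 <= N%:R :> R. Proof. by rewrite ler1n. Qed.

Let E0_gt0 : 0 < E0.
Proof. by apply: lt_le_trans E0_lb; rewrite divr_gt0 // exprn_gt0 // ltr0n. Qed.

(** As [c] vanishes at both ends, twice the left side is the sum of the squares of the 2N + 1
    increments of [c]. *)
Let E01 : E0 - E1 <= 3 * N%:R / 2.
Proof.
have A : \sum_(l < B) c l.+1 ^+ 2 = E0.
  have : \sum_(l < B.+1) c l ^+ 2 = E0 by rewrite big_ord_recr /= cB expr0n /= addr0.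
  by rewrite big_ord_recl c0 expr0n /= add0r.
have : \sum_(l < B) (c l.+1 - c l) ^+ 2 <= \sum_(l < B) 1.
  apply: ler_sum => l _; have lB := ltn_ord l.
  rewrite /c; have [H|H] : minn l.+1 (N.*2 - l.+1) = (minn l (N.*2 - l)).+1 \/
     minn l (N.*2 - l) = (minn l.+1 (N.*2 - l.+1)).+1 \/
     minn l.+1 (N.*2 - l.+1) = minn l (N.*2 - l) by rewrite /B in lB; lia.
    by rewrite H -natr1 addrAC subrr add0r expr1n.
  case: H => H; last by rewrite H subrr expr0n ler01.
  by rewrite H -natr1 opprD addrA subrr add0r sqrrN expr1n.
rewrite sumr_const card_ord => H.
have E2 : \sum_(l < B) (c l.+1 - c l) ^+ 2 = 2 * (E0 - E1).
  rewrite (_ : 2 * (E0 - E1) = E0 + E0 - 2 * E1); last by ring.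
  rewrite -{1}A /E0 /E1 mulr_sumr -big_split -sumrB.
  by apply: eq_bigr => l _ /=; ring.
have {}H : 2 * (E0 - E1) <= N%:R * 2 + 1 by rewrite -E2 -natrM muln2 natr1.
move: N1 H; lra.
Qed.

Let p s := \sum_(l < B) c l * cosz l%:Z s.
Let p' s := \sum_(l < B) c l * sinz l%:Z s.

(** The squared modulus of the trigonometric polynomial with coefficients [c], normalised to sum 1:
    a discrete relative of the Jackson kernel, nonnegative and of degree at most 2N. *)
Definition kernel s : R := (p s ^+ 2 + p' s ^+ 2) / (M * E0).

Lemma kernel_ge0 s : 0 <= kernel s.
Proof. by rewrite divr_ge0 ?addr_ge0 ?sqr_ge0 // mulr_ge0 // ltW. Qed.

Let kernel_exp s : p s ^+ 2 + p' s ^+ 2 =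
  \sum_(l < B) \sum_(k < B) c l * c k * cosz (l%:Z - k%:Z) s.
Proof.
rewrite !expr2 /p /p' !mulr_suml -big_split; apply: eq_bigr => l _ /=.
rewrite !mulr_sumr -big_split; apply: eq_bigr => k _ /=.
have -> : cosz (l%:Z - k%:Z) s = cosz l s * cosz k s + sinz l s * sinz k s.
  by rewrite /cosz /sinz -cosB intrB mulrBl.
by ring.
Qed.

(** No aliasing: by [NM] all frequencies that occur stay below the period, so the orthogonality
    relation applies. *)
Let small (l k : 'I_B) z : (`|z| <= 1)%N -> (absz (l%:Z - k%:Z + z)%R < m.+2)%N.
Proof. by have := ltn_ord l; have := ltn_ord k; rewrite /B; lia. Qed.

Lemma sum_kernel : \sum_s kernel s = 1.
Proof.
rewrite /kernel -mulr_suml (eq_bigr _ (fun s _ => kernel_exp s)).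
rewrite exchange_big /= (eq_bigr (fun l : 'I_B => M * c l ^+ 2)); last first.
  move=> l _; rewrite exchange_big /= (bigD1 l) //= [X in _ + X]big1 ?addr0.
    rewrite -mulr_sumr sum_cosz_delta; last by rewrite subrr.
    by rewrite subrr eqxx mulr1; ring.
  move=> k kl; rewrite -mulr_sumr sum_cosz_delta; last by rewrite -[_ - _]addr0 small.
  rewrite subr_eq0 eqz_nat (_ : (l == k :> nat) = false) ?mulr0 //.
  by apply/negbTE; rewrite eq_sym.
rewrite -mulr_sumr -/E0 divff // mulf_neq0 // gt_eqF //.
Qed.

Let sum_kernel_cos : \sum_s kernel s * cosz 1 s = E1 / E0.
Proof.
have E : \sum_s (p s ^+ 2 + p' s ^+ 2) * cosz 1 s = M * E1.
  under eq_bigr do rewrite kernel_exp mulr_suml.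
  rewrite exchange_big /=.
  have F (l : 'I_B) : \sum_s (\sum_(k < B) c l * c k * cosz (l%:Z - k%:Z) s) * cosz 1 s
     = M / 2 * \sum_(k < B) (c l * c k * (k == l.+1 :> nat)%:R
                             + c l * c k * (l == k.+1 :> nat)%:R).
    under eq_bigr do rewrite mulr_suml.
    rewrite exchange_big /= mulr_sumr; apply: eq_bigr => k _.
    transitivity (c l * c k * (\sum_s (cosz (l%:Z - k%:Z + 1) s
                                        + cosz (l%:Z - k%:Z - 1) s)) / 2).
      rewrite mulr_sumr mulr_suml; apply: eq_bigr => s _.
      by rewrite -mulrA cosz_mul1 mulrA.
    rewrite big_split /= !sum_cosz_delta ?small //.
    have -> : (l%:Z - k%:Z + 1 == 0) = (k == l.+1 :> nat) by lia.
    have -> : (l%:Z - k%:Z - 1 == 0) = (l == k.+1 :> nat) by lia.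
    by ring.
  rewrite (eq_bigr _ (fun l _ => F l)) -mulr_sumr.
  under eq_bigr do rewrite big_split.
  rewrite big_split /=.
  have S1 : \sum_(l < B) \sum_(k < B) c l * c k * (k == l.+1 :> nat)%:R = E1.
    apply: eq_bigr => l _.
    have [lB|lB] := ltnP l.+1 B.
      rewrite (bigD1 (Ordinal lB)) //= eqxx mulr1 [X in _ + X]big1 ?addr0 //.
      by move=> k /negbTE kl; rewrite (_ : (k == l.+1 :> nat) = false) ?mulr0.
    have -> : l.+1 = B by have := ltn_ord l; lia.
    rewrite cB mulr0 big1 // => k _.
    by rewrite (_ : (k == B :> nat) = false) ?mulr0 //; have := ltn_ord k; lia.
  rewrite S1 exchange_big /=.
  under eq_bigr => k _ do under eq_bigr => l _ do rewrite (mulrC (c l)).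
  by rewrite S1; field.
under eq_bigr do rewrite mulrAC.
rewrite -mulr_suml E [M * E1]mulrC invfM mulrA mulfK ?gt_eqF //.
Qed.

(** The second moment is at most 8 (E0 - E1) / E0 <= 8 (9/2) / N^2 = 36 / N^2; a nonnegative
    variance bounds the first moment by its square root. *)
Lemma kernel_moment : \sum_s kernel s * ((circ s)%:R / M) <= 6 / N%:R.
Proof.
pose d s : R := (circ s)%:R / M.
have d0 s : 0 <= d s by rewrite divr_ge0 // ltW.
pose mu := \sum_s kernel s * d s.
have mu0 : 0 <= mu by apply: sumr_ge0 => s _; rewrite mulr_ge0 ?kernel_ge0.
have V : \sum_s kernel s * (d s - mu) ^+ 2 = \sum_s kernel s * d s ^+ 2 - mu ^+ 2.
  transitivity (\sum_s (kernel s * d s ^+ 2 - 2 * mu * (kernel s * d s)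
                        + mu ^+ 2 * kernel s)).
    by apply: eq_bigr => s _; ring.
  by rewrite big_split sumrB -!mulr_sumr sum_kernel -/mu /=; ring.
have V0 : 0 <= \sum_s kernel s * (d s - mu) ^+ 2.
  by apply: sumr_ge0 => s _; rewrite mulr_ge0 ?kernel_ge0 ?sqr_ge0.
have S2 : \sum_s kernel s * d s ^+ 2 <= 8 * ((E0 - E1) / E0).
  have -> : (E0 - E1) / E0 = \sum_s kernel s * (1 - cosz 1 s).
    under eq_bigr do rewrite mulrBr mulr1.
    by rewrite sumrB sum_kernel sum_kernel_cos; field; rewrite gt_eqF.
  rewrite mulr_sumr; apply: ler_sum => s _.
  by rewrite [leRHS]mulrCA ler_wpM2l ?kernel_ge0 // circ_cosz.
have S3 : (E0 - E1) / E0 <= 9 / 2 / N%:R ^+ 2.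
  rewrite ler_pdivrMr //; apply: le_trans E01 _.
  have n2 : 0 < N%:R ^+ 2 :> R by rewrite exprn_gt0 // ltr0n.
  apply: (@le_trans _ _ (9 / 2 / N%:R ^+ 2 * (N%:R ^+ 3 / 3))); last first.
    by apply: ler_wpM2l E0_lb; rewrite !divr_ge0 // ltW.
  rewrite le_eqVlt; apply/orP; left; apply/eqP; field.
  by rewrite pnatr_eq0; lia.
have n1 : 0 < N%:R :> R by rewrite ltr0n.
rewrite -/mu -(@ler_pXn2r _ 2) ?nnegrE ?divr_ge0 ?ler0n //.
apply: (@le_trans _ _ (8 * (9 / 2 / N%:R ^+ 2))); first by lra.
by rewrite le_eqVlt; apply/orP; left; apply/eqP; field; rewrite gt_eqF.
Qed.

Variables (n : nat).
Let G := 'rV[K]_n.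
Implicit Types (f g : G -> R) (i j k t : 'I_n) (y : G).

Definition mode (a : 'I_B * bool) s : R :=
  if a.2 then cosz a.1 s else sinz a.1 s.

(** Moves [y] along direction [k] to the point whose coordinate is [s], so that [fcoef] does not
    depend on the old coordinate. *)
Definition resample k s y : G := y + axis k (s - y 0 k).

Definition fcoef k a f y : R := \sum_s mode a s * f (resample k s y).

(** By the addition formula the translated kernel is a combination of the modes of degree at most
    2N, with coefficients depending on [y]. *)
Lemma conv_vanish k f y : (forall a, fcoef k a f y = 0) -> conv kernel k f y = 0.
Proof.
move=> H.
have sgnz (z : int) s s' : cosz z s * cosz z s' = cosz `|z|%N s * cosz `|z|%N s' /\
    sinz z s * sinz z s' = sinz `|z|%N s * sinz `|z|%N s'.
  case: z => l //=; rewrite NegzE /cosz /sinz mulrNz !mulNr !cosN !sinN.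
  by rewrite mulrNN.
have -> : conv kernel k f y = \sum_s kernel (s - y 0 k) * f (resample k s y).
  rewrite /conv (reindex_inj (addIr (- y 0 k))) /=.
  by apply: eq_bigr => s _; rewrite /resample.
have E s : kernel (s - y 0 k) = (M * E0)^-1 * \sum_(l < B) \sum_(q < B) c l * c q *
  (cosz `|l%:Z - q%:Z|%N s * cosz `|l%:Z - q%:Z|%N (y 0 k) +
   sinz `|l%:Z - q%:Z|%N s * sinz `|l%:Z - q%:Z|%N (y 0 k)).
  rewrite /kernel mulrC kernel_exp; congr (_ * _).
  apply: eq_bigr => l _; apply: eq_bigr => q _.
  by rewrite coszB; have [-> ->] := sgnz (l%:Z - q%:Z) s (y 0 k).
under eq_bigr do rewrite E -mulrA mulr_suml.
rewrite -mulr_sumr exchange_big /= big1 ?mulr0 // => l _.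
under eq_bigr do rewrite mulr_suml.
rewrite exchange_big /= big1 // => q _.
have lt : (`|l%:Z - q%:Z| < B)%N by have := ltn_ord l; have := ltn_ord q; lia.
have H1 := H (Ordinal lt, true); have H2 := H (Ordinal lt, false).
rewrite /fcoef /mode /= in H1 H2.
transitivity (c l * c q * (cosz `|l%:Z - q%:Z|%N (y 0 k) *
     \sum_s cosz `|l%:Z - q%:Z|%N s * f (resample k s y) +
     sinz `|l%:Z - q%:Z|%N (y 0 k) *
     \sum_s sinz `|l%:Z - q%:Z|%N s * f (resample k s y))).
  rewrite 2!mulr_sumr -big_split mulr_sumr; apply: eq_bigr => s _ /=.
  by ring.
by rewrite H1 H2 !mulr0 addr0 mulr0.
Qed.

Lemma conv_fcoef k j a f : j != k ->
  conv kernel j (fcoef k a f) = fcoef k a (conv kernel j f).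
Proof.
move=> jk; apply/funext => y; rewrite /conv /fcoef.
under eq_bigr do rewrite mulr_sumr.
rewrite exchange_big; apply: eq_bigr => s _ /=; rewrite mulr_sumr.
apply: eq_bigr => s' _; rewrite mulrCA; congr (_ * (_ * f _)).
rewrite /resample !mxE eq_sym (negPf jk) addr0.
by rewrite addrAC.
Qed.

Fixpoint fcoefs (ks : seq 'I_n) (md : seq ('I_B * bool)) f : G -> R :=
  match ks, md with
  | k :: ks', a :: md' => fcoefs ks' md' (fcoef k a f)
  | _, _ => f
  end.

Lemma convs_fcoef k ks a f : k \notin ks ->
  convs kernel ks (fcoef k a f) = fcoef k a (convs kernel ks f).
Proof.
elim: ks => //= j ks IH; rewrite inE negb_or => /andP[kj kks].
by rewrite IH // conv_fcoef // eq_sym.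
Qed.

(** Take coefficients in the first direction; they commute with the convolutions in the others, so
    induction applies to the function of coefficients. The points [y'] range over the slice through
    [y] spanned by [ks]. *)
Lemma convs_vanish ks f y : uniq ks ->
  (forall md y', size md = size ks -> (forall j, j \notin ks -> y' 0 j = y 0 j) ->
     fcoefs ks md f y' = 0) ->
  convs kernel ks f y = 0.
Proof.
elim: ks f y => [|k ks IH] f y /=.
  by move=> _ /(_ [::] y erefl (fun _ _ => erefl)).
move=> /andP[kks uks] H; apply: conv_vanish => a.
rewrite -convs_fcoef //; apply: IH => // md' y' sz yy'.
have := H (a :: md') y'; rewrite /= sz => /(_ erefl); apply => j.
by rewrite inE negb_or => /andP[_ /yy'].
Qed.

Lemma fcoefs_shift k ks md f : k \notin ks ->
  (forall s y, f (y + axis k s) = f y) ->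
  forall s y, fcoefs ks md f (y + axis k s) = fcoefs ks md f y.
Proof.
elim: ks md f => [|j ks IH] [|a md'] f //=.
rewrite inE negb_or => /andP[kj kks] fk; apply: IH => // s y.
apply: eq_bigr => s' _; rewrite /resample !mxE eq_sym (negPf kj) addr0.
by rewrite addrAC fk.
Qed.

(** Iterated coefficients do not see the coordinates in [ks]. A slice therefore needs one condition
    per tuple of modes, evaluated at a single point. *)
Lemma fcoefs_agree ks md f y y' : uniq ks -> size md = size ks ->
  (forall j, j \notin ks -> y' 0 j = y 0 j) ->
  fcoefs ks md f y' = fcoefs ks md f y.
Proof.
elim: ks md f y y' => [|k ks IH] [|a md'] f y y' //=.
  move=> _ _ H; congr f; apply/rowP => j; exact: H.
move=> /andP[kks uks] [sz] H.
have inv s (v : G) : fcoef k a f (v + axis k s) = fcoef k a f v.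
  apply: eq_bigr => s' _; congr (_ * f _); rewrite /resample -addrA -axisD.
  congr (_ + axis k _); rewrite !mxE eqxx opprD addrCA.
  by rewrite (addrCA s) subrr addr0.
rewrite -(fcoefs_shift md' kks inv (y 0 k - y' 0 k)); apply: IH => // j jks.
rewrite !mxE; have [->|jk] := eqVneq j k; first by rewrite addrC subrK.
by rewrite addr0 H // inE negb_or jk.
Qed.

Lemma fcoef_lin k a (cc : R) f g :
  fcoef k a (fun y => cc * f y + g y) = (fun y => cc * fcoef k a f y + fcoef k a g y).
Proof.
apply/funext => y; rewrite /fcoef mulr_sumr -big_split; apply: eq_bigr => s _ /=.
by ring.
Qed.

Lemma fcoefs_lin ks md (cc : R) f g y :
  fcoefs ks md (fun y => cc * f y + g y) y = cc * fcoefs ks md f y + fcoefs ks md g y.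
Proof.
elim: ks md f g => [|k ks IH] [|a md'] f g //=.
by rewrite fcoef_lin IH.
Qed.

End TrigKernel.

(** * The energy estimate on the lattice *)

Section LatticeEstimate.
Variables (R : realType) (n : nat) (A L nu : R).
Hypothesis n0 : (0 < n)%N.
Hypothesis A0 : 0 <= A.
Hypothesis L0 : 0 <= L.
Hypothesis nu0 : 0 < nu.

Definition others (t : 'I_n) : seq 'I_n := [seq i <- enum 'I_n | i != t].

Lemma size_others t : size (others t) = n.-1.
Proof.
have := count_predC (pred1 t) (enum 'I_n).
rewrite count_uniq_mem ?enum_uniq // mem_enum size_enum_ord /=.
by rewrite /others size_filter => H; rewrite -[in RHS]H add1n.
Qed.

Lemma others_uniq t : uniq (others t).
Proof. by rewrite filter_uniq // enum_uniq. Qed.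

Lemma mem_others t i : (i \in others t) = (i != t).
Proof. by rewrite mem_filter mem_enum andbT. Qed.

Definition lattice_const : R :=
  let C := rellich_const n A L nu in n%:R * C / nu + n%:R * C + 1.

Lemma rellich_const_ge0 : 0 <= rellich_const n A L nu.
Proof.
have N0 : 0 <= n%:R :> R by exact: ler0n.
have CH0 : 0 <= H2_const n L nu.
  by rewrite /H2_const divr_ge0 ?addr_ge0 ?mulr_ge0 ?sqr_ge0 // ltW.
have NN := sqr_ge0 (n%:R : R); have NCH := mulr_ge0 NN CH0.
have p1 := mulr_ge0 NN (mulr_ge0 A0 (sqr_ge0 (H2_const n L nu))).
have p2 := mulr_ge0 NN L0.
have p3 := mulr_ge0 N0 (mulr_ge0 A0 CH0); have p4 := mulr_ge0 NN (mulr_ge0 A0 CH0).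
by rewrite /rellich_const; move: NN NCH p1 p2 p3 p4 N0; lra.
Qed.

Variables (m : nat) (h : R) (h0 : 0 < h).
Let M := m.+2.
Hypothesis hM : h * M%:R <= 1.
Let G := 'rV['I_M]_n.
Local Notation e := (fun i : 'I_n => axis i (1 : 'I_M)).
Local Notation D := (fdiff e h).

Variable a : 'I_n -> 'I_n -> G -> R.
Hypothesis aC : forall i j x, a i j x = a j i x.
Hypothesis aA : forall i j x, `|a i j x| <= A.
Hypothesis aL : forall k i j x, `|D k (a i j) x| <= L.
Hypothesis a_ell : forall x (xi : 'I_n -> R),
  nu * (\sum_i xi i ^+ 2) <= \sum_i \sum_j a i j x * xi i * xi j.

Variables (N m' : nat) (lam kap : R) (U : G -> R).
Hypothesis N0 : (0 < N)%N.
Hypothesis NM : (N.*2.+2 < M)%N.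
Hypothesis m'2 : (1 < m')%N.
Hypothesis m'M : (m' %| M)%N.
Hypothesis lam1 : 1 <= lam.
Hypothesis kapN : (n%:R * L + 1) * (6 / N%:R) * lam <= kap.
Hypothesis kap1 : kap <= 1.
Hypothesis U_modes : forall [t] [s : 'I_M] [md], (s %% m' <= 1)%N -> size md = n.-1 ->
  fcoefs (R := R) (N := N) (others t) md U (axis t s) = 0.

Let valS (s : 'I_M) : nat_of_ord (s + 1) = (s.+1 %% M)%N.
Proof. by rewrite /= addn1. Qed.

Let f := elliptic_residual e h a lam U.
Let Z2 := lam ^+ 2 * nrm U ^+ 2 + \sum_i nrm (D i U) ^+ 2 + nrm f ^+ 2.
Let Z := Num.sqrt Z2.

Let S0 : 0 <= \sum_i nrm (D i U) ^+ 2.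
Proof. by apply: sumr_ge0 => i _; rewrite sqr_ge0. Qed.

Let Z20 : 0 <= Z2.
Proof. by rewrite /Z2 addr_ge0 ?sqr_ge0 // addr_ge0 // mulr_ge0 ?sqr_ge0. Qed.

Let leZ x : 0 <= x -> x ^+ 2 <= Z2 -> x <= Z.
Proof. by move=> x0 H; rewrite -(ger0_norm x0) -sqrtr_sqr ler_wsqrtr. Qed.

Let UZ : lam * nrm U <= Z.
Proof.
apply: leZ; first by rewrite mulr_ge0 ?nrm_ge0 //; move: lam1; lra.
have f0 := sqr_ge0 (nrm f); have s0 := S0.
by rewrite exprMn /Z2; move: f0 s0; lra.
Qed.

Let DUZ i : nrm (D i U) <= Z.
Proof.
apply: leZ; first exact: nrm_ge0.
have r0 : 0 <= \sum_(j | j != i) nrm (D j U) ^+ 2.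
  by apply: sumr_ge0 => j _; rewrite sqr_ge0.
have f0 := sqr_ge0 (nrm f).
have u0 := mulr_ge0 (sqr_ge0 lam) (sqr_ge0 (nrm U)).
by rewrite /Z2 (bigD1 i) //=; move: r0 f0 u0; lra.
Qed.

Let fZ : nrm f <= Z.
Proof.
apply: leZ; first exact: nrm_ge0.
have u0 := mulr_ge0 (sqr_ge0 lam) (sqr_ge0 (nrm U)); have s0 := S0.
by rewrite /Z2; move: u0 s0; lra.
Qed.

Let direction t :
  `|\sum_j ip (fun x => a t j x * D j U x) (D t U)| <=
    rellich_const n A L nu * (h * m'%:R + kap + lam^-1 + h * lam ^+ 2) * Z ^+ 2.
Proof.
pose P := convs (kernel R (m := m) N) (others t).
(* One number for both roles: n L (6/N) bounds the commutators of n - 1 convolutions, and 6/N the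
   distance to the identity. *)
pose mu : R := (n%:R * L + 1) * (6 / N%:R).
have nL0 : 0 <= n%:R * L by rewrite mulr_ge0.
have N60 : 0 <= 6 / N%:R :> R by rewrite divr_ge0.
(* The sawtooth has slope 1 and period [m']; it drops at residue 0. The Rellich argument needs [v]
   on such a slice and on the next one, which is why [U_modes] covers residues 0 and 1. *)
pose q (x : G) : R := h * (x 0%R t %% m')%:R.
pose S (x : G) : bool := (x 0%R t %% m' == 0)%N.
have moment : \sum_s kernel R (m := m) N s * (h * (circ s)%:R) <= 6 / N%:R.
  apply: le_trans (kernel_moment R N0 NM); apply: ler_sum => s _.
  rewrite ler_wpM2l ?kernel_ge0 // mulrC ler_wpM2l //.
  by rewrite -[leRHS]mul1r ler_pdivlMr // ltr0n.
have k0 := @kernel_ge0 R m N N0 NM; have k1 := @sum_kernel R m N N0 NM.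
apply: (@rellich_direction R G n e h h0 a A L nu aC aA aL nu0 a_ell lam U Z lam1 UZ DUZ
   fZ P mu kap (h * m'%:R) _ _ _ _ _ _ _ kapN t q S) => //.
- by move=> *; exact: convsD.
- by move=> *; exact: convsZ.
- by move=> *; exact: convs_shift.
- by move=> *; exact: nrm_convs.
- move=> i j g; apply: le_trans (@convs_comm R n m h h0 _ k0 k1 _ moment (others t) (a i j) L g
    (fun k => aL k i j) L0) _.
  rewrite ler_wpM2r ?nrm_ge0 // size_others /mu mulrA ler_wpM2r //.
  apply: le_trans (_ : n%:R * L <= _); last by lra.
  by rewrite ler_wpM2r // ler_nat leq_pred.
- move=> g; apply: le_trans (@convs_approx R n m h h0 _ k0 k1 _ moment (others t) g
    (others_uniq t)) _.
  rewrite ler_wpM2r //; first by apply: sumr_ge0 => k _; exact: nrm_ge0.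
  by rewrite /mu ler_peMl //; lra.
- by rewrite mulr_ge0 // addr_ge0.
- by rewrite mulr_ge0 // ltW.
- apply: le_trans hM; rewrite ler_pM2l // ler_nat.
  by rewrite dvdn_leq.
- move=> x; apply/andP; split; first by rewrite mulr_ge0 // ltW.
  rewrite /q (ler_pM2l h0) ler_nat; apply: ltnW.
  by rewrite ltn_mod; exact: ltnW m'2.
- by move=> i x it; rewrite /q !mxE eq_sym (negPf it) addr0.
- move=> x; rewrite /S /q !mxE eqxx valS modn_dvdm // modnS.
  by case: ifP => //= _ _; rewrite -natr1 mulrDr mulr1.
- have van (y : G) : (y 0%R t %% m' <= 1)%N -> P U y = 0.
    move=> yt; apply: convs_vanish => // [|md y' sz yy']; first exact: others_uniq.
    have sz' : size md = n.-1 by rewrite sz size_others.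
    rewrite -(@U_modes t _ _ yt sz').
    apply: fcoefs_agree => // [|j]; first exact: others_uniq.
    rewrite mem_others negbK => /eqP ->.
    by rewrite yy' ?mem_others ?eqxx // !mxE eqxx.
  move=> x /eqP xt; split; first by apply: van; rewrite xt.
  move=> i; apply: van; rewrite !mxE; case: ifP => _; last by rewrite addr0 xt.
  by rewrite valS modn_dvdm // modnS xt; case: ifP.
Qed.

(** Coercivity turns the sum over directions into a bound for all differences. The weak form tested
    with [U] then controls lam^2 |U|^2, with <f, U> <= Z^2 / lam; this is the summand 1 in
    [lattice_const]. *)
Lemma lattice_estimate :
  lam ^+ 2 * nrm U ^+ 2 + \sum_i nrm (D i U) ^+ 2 <=
  lattice_const * (h * m'%:R + kap + lam^-1 + h * lam ^+ 2) *
    (lam ^+ 2 * nrm U ^+ 2 + \sum_i nrm (D i U) ^+ 2 + nrm f ^+ 2).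
Proof.
rewrite -/Z2; set ee := h * m'%:R + _ + _ + _.
have C0 := rellich_const_ge0; set C := rellich_const n A L nu in C0 *.
have lam0 : 0 < lam by apply: lt_le_trans lam1.
have kap0 : 0 <= kap.
  apply: le_trans kapN; rewrite mulr_ge0 ?(ltW lam0) // mulr_ge0 ?divr_ge0 //.
  by rewrite addr_ge0 // mulr_ge0.
have li0 : 0 <= lam^-1 by rewrite invr_ge0 ltW.
have hm0 : 0 <= h * m'%:R by rewrite mulr_ge0 // ltW.
have hl0 : 0 <= h * lam ^+ 2 by rewrite mulr_ge0 ?sqr_ge0 // ltW.
have ee0 : 0 <= ee by rewrite /ee !addr_ge0.
have gen (x y z w : R) : 0 <= x -> 0 <= y -> 0 <= w -> z <= x + y + z + w.
  by move=> *; lra.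
have lie : lam^-1 <= ee by exact: gen.
have ZZ : Z ^+ 2 = Z2 by rewrite /Z sqr_sqrtr.
pose X := \sum_i \sum_j ip (fun x => a i j x * D j U x) (D i U).
have XB : X <= n%:R * (C * ee * Z2).
  apply: le_trans (ler_norm _) _; apply: norm_sum_le => t.
  by rewrite -ZZ; exact: direction.
have cX : nu * (\sum_i nrm (D i U) ^+ 2) <= X by exact: coercivity.
have SB : \sum_i nrm (D i U) ^+ 2 <= n%:R * C / nu * ee * Z2.
  rewrite -(ler_pM2l nu0); apply: le_trans cX _; apply: le_trans XB _.
  by rewrite le_eqVlt; apply/orP; left; apply/eqP; field; rewrite gt_eqF.
have W := weak_form e h a lam U U; rewrite -/X -/f ipBl ipZl -nrm_sqr in W.
have fU : ip f U <= lam^-1 * Z2.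
  apply: le_trans (ler_norm _) _; rewrite -ZZ.
  have -> : lam^-1 * Z ^+ 2 = Z * (lam^-1 * Z) by ring.
  by apply: ip_le_bound fZ _; rewrite mulrC ler_pdivlMr // mulrC.
have lZ : lam^-1 * Z2 <= ee * Z2 by rewrite ler_wpM2r.
rewrite /lattice_const -/C.
have -> : (n%:R * C / nu + n%:R * C + 1) * ee * Z2 =
  n%:R * C / nu * ee * Z2 + n%:R * (C * ee * Z2) + ee * Z2 by ring.
by move: W XB SB fU lZ; lra.
Qed.

End LatticeEstimate.

(** * Functions with bounded partial derivatives *)

Lemma cvg_bigsum (R : realType) (T : Type) (F : set_system T) (I : Type) (r : seq I)
    (f : I -> T -> R) (l : I -> R) : Filter F ->
  (forall i, f i x @[x --> F] --> l i) ->
  (\sum_(i <- r) f i x) @[x --> F] --> \sum_(i <- r) l i.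
Proof.
move=> FF H; elim: r => [|i r IH].
  by rewrite big_nil; under eq_fun do rewrite big_nil; exact: cvg_cst.
rewrite big_cons; under eq_fun do rewrite big_cons.
exact: cvgD.
Qed.

Section LineCalculus.
Variables (R : realType) (n : nat).
Local Notation E := 'rV[R]_n.
Local Notation e := (basis_vec R).
Local Notation "''d_' i" := (derive ^~ (e i)) (at level 8, i at level 2).
Implicit Types (f g : E -> R) (x y v : E) (i j k : 'I_n) (O : set E).

Definition pd i f : E -> R := fun x => 'D_(e i) f x.

Lemma is_derive_line f x i (t : R) : derivable f (x + t *: e i) (e i) ->
  is_derive t 1 (fun s : R => f (x + s *: e i)) (pd i f (x + t *: e i)).
Proof.
move=> H; rewrite /pd /derive.
have E : (fun h : R => h^-1 *: ((f \o shift (x + t *: e i)) (h *: e i) - f (x + t *: e i)))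
  = (fun h : R => h^-1 *: (((fun s : R => f (x + s *: e i)) \o shift t) (h *: 1)
        - (fun s : R => f (x + s *: e i)) t)).
  apply/funext => h /=; congr (_ *: (f _ - _)).
  by rewrite [h *: 1]mulr1 scalerDl addrCA addrA.
by move: H; rewrite /derivable E => H; apply: DeriveDef.
Qed.

Lemma MVT_line f x i (s : R) :
  (forall t, 0 <= t <= 1 -> derivable f (x + (t * s) *: e i) (e i)) ->
  exists2 t, 0 <= t <= 1 & f (x + s *: e i) - f x = s * pd i f (x + (t * s) *: e i).
Proof.
move=> H; pose g (u : R) := f (x + u *: e i).
have [->|s0] := eqVneq s 0.
  by exists 0; rewrite ?lexx ?ler01 // scale0r addr0 subrr mul0r.
have dg u : 0 <= u / s <= 1 -> is_derive u 1 g (pd i f (x + u *: e i)).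
  by move=> us; apply: is_derive_line; rewrite -[u](divfK s0); exact: H.
have gc a b : (forall u, a <= u <= b -> 0 <= u / s <= 1) ->
    {within `[a, b], continuous g}.
  move=> ab; apply: derivable_within_continuous => u; rewrite in_itv /= => /ab us.
  by have [] := dg _ us.
have [sp|sn|E0] := ltrgtP 0 s; last by rewrite -E0 eqxx in s0.
  have ab u : 0 <= u <= s -> 0 <= u / s <= 1.
    by move=> /andP[u0 us]; rewrite divr_ge0 ?(ltW sp) // ler_pdivrMr // mul1r us.
  have dgo u : u \in `]0, s[ -> is_derive u 1 g (pd i f (x + u *: e i)).
    by rewrite in_itv /= => /andP[u0 us]; apply: dg; apply: ab; rewrite !ltW.
  have [c] := MVT sp dgo (gc _ _ ab).
  rewrite in_itv /= => /andP[c0 cs]; rewrite /g scale0r addr0 subr0 => ->.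
  exists (c / s); last by rewrite divfK // mulrC.
  by apply: ab; rewrite !ltW.
have ab u : s <= u <= 0 -> 0 <= u / s <= 1.
  move=> /andP[us u0]; rewrite -mulrNN -invrN divr_ge0 ?oppr_ge0 ?(ltW sn) //=.
  by rewrite ler_pdivrMr ?oppr_gt0 // mul1r lerN2.
have dgo u : u \in `]s, 0[ -> is_derive u 1 g (pd i f (x + u *: e i)).
  by rewrite in_itv /= => /andP[u0 us]; apply: dg; apply: ab; rewrite !ltW.
have [c] := MVT sn dgo (gc _ _ ab).
rewrite in_itv /= => /andP[c0 cs]; rewrite /g scale0r addr0 sub0r => Hc.
exists (c / s); first by apply: ab; rewrite !ltW.
by rewrite divfK // -opprB Hc mulrN opprK mulrC.
Qed.

Lemma basisE i j : e i 0 j = (j == i)%:R.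
Proof. by rewrite mxE eqxx. Qed.

Lemma shift_coord x i (t : R) j : (x + t *: e i) 0 j = x 0 j + (if j == i then t else 0).
Proof. by rewrite mxE [X in _ + X]mxE basisE; case: eqP; rewrite (mulr1, mulr0). Qed.

(** Vertices of the path from 0 to [v] that changes one coordinate at a time, so that only partial
    derivatives are needed along it. *)
Definition upto v (l : nat) : E := \row_j (if (j < l)%N then v 0 j else 0).

Lemma uptoS v i : upto v i.+1 = upto v i + v 0 i *: e i.
Proof.
apply/rowP => j; rewrite shift_coord !mxE ltnS leq_eqVlt -val_eqE /=.
have [ji|ij|/val_inj ->] := ltngtP (j : nat) i; rewrite ?addr0 ?add0r //.
Qed.

Lemma path_telescope f x v :
  f (x + v) - f x = \sum_(i < n) (f (x + upto v i.+1) - f (x + upto v i)).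
Proof.
pose F l := f (x + upto v l).
rewrite -(big_mkord xpredT (fun l => F l.+1 - F l)) telescope_sumr // /F.
congr (f _ - f _); apply/esym.
  by congr (_ + _); apply/rowP => j; rewrite mxE ltn_ord.
rewrite -[RHS]addr0; congr (_ + _); apply/rowP => j; by rewrite !mxE.
Qed.

Lemma coord_le_norm x j : `|x 0 j| <= `|x|.
Proof.
rewrite [leRHS]/Num.Def.normr /= mx_normrE.
exact: (le_trans _ (le_bigmax _ (fun k : 'I_1 * 'I_n => `|x k.1 k.2|) (0, j))).
Qed.

Lemma norm_leP x (c : R) : 0 <= c -> (forall j, `|x 0 j| <= c) -> `|x| <= c.
Proof.
move=> c0 H; rewrite [leLHS]/Num.Def.normr /= mx_normrE.
by apply: bigmax_le => //= k _; rewrite ord1.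
Qed.

Lemma upto_step_norm v i (t : R) : 0 <= t <= 1 -> `|upto v i + (t * v 0 i) *: e i| <= `|v|.
Proof.
move=> /andP[t0 t1]; apply: norm_leP => // j; rewrite shift_coord !mxE -val_eqE /=.
have [ji|ij|ji] := ltngtP (j : nat) i; rewrite ?addr0 ?coord_le_norm ?normr0 //.
rewrite add0r normrM ger0_norm //.
by apply: le_trans (coord_le_norm v i); rewrite ler_piMl.
Qed.

(** The mean value theorem on each edge of the coordinate path; the partial derivatives need be
    continuous at [x] only. Dividing by n + 1 rather than n avoids a zero denominator. *)
Lemma frechet_estimate O f x (eps : R) : open O -> O x -> 0 < eps ->
  (forall i y, O y -> derivable f y (e i)) ->
  (forall i, {for x, continuous (pd i f)}) ->
  \forall v \near (0 : E), `|f (x + v) - f x - \sum_i v 0 i * pd i f x| <= eps * `|v|.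
Proof.
move=> oO Ox e0 df cf.
have en : 0 < eps / n.+1%:R by rewrite divr_gt0.
have nO : \forall y \near x, O y by exact: open_nbhs_nbhs.
have nc : \forall y \near x, forall i, `|pd i f x - pd i f y| < eps / n.+1%:R.
  have H i : \forall y \near x, `|pd i f x - pd i f y| < eps / n.+1%:R.
    by have /cvgrPdist_lt/(_ _ en) := cf i.
  exact: (@filter_forall _ _ (fun i y => `|pd i f x - pd i f y| < eps / n.+1%:R)
            (nbhs x) _ H).
have /nbhs_ballP[r /= r0 Hr] : \forall y \near x, O y /\
   forall i, `|pd i f x - pd i f y| < eps / n.+1%:R by apply: filterI.
apply/nbhs_ballP; exists r => //= v; rewrite -ball_normE /= sub0r normrN => vr.
have inb w : `|w| <= `|v| -> O (x + w) /\
    forall i, `|pd i f x - pd i f (x + w)| < eps / n.+1%:R.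
  move=> wv; apply: Hr; rewrite -ball_normE /= opprD addrA subrr sub0r normrN.
  exact: le_lt_trans vr.
rewrite path_telescope -sumrB.
have H i : `|f (x + upto v i.+1) - f (x + upto v i) - v 0 i * pd i f x|
    <= `|v| * (eps / n.+1%:R).
  rewrite uptoS addrA.
  have [t t01 ->] : exists2 t, 0 <= t <= 1 &
      f (x + upto v i + v 0 i *: e i) - f (x + upto v i) =
      v 0 i * pd i f (x + upto v i + (t * v 0 i) *: e i).
    apply: MVT_line => t t01; apply: df; rewrite -addrA.
    by have [] := inb _ (@upto_step_norm v i t t01).
  rewrite -mulrBr normrM; apply: ler_pM => //; first exact: coord_le_norm.
  rewrite distrC -addrA.
  by have [_ /(_ i)/ltW] := inb _ (@upto_step_norm v i t t01).
apply: le_trans (ler_norm_sum _ _ _) _.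
apply: le_trans (ler_sum _ (fun i _ => H i)) _.
rewrite sumr_const card_ord -[leLHS]mulr_natl mulrCA [leRHS]mulrC ler_wpM2l //.
rewrite mulrA ler_pdivrMr // mulrC ler_wpM2l ?(ltW e0) // ler_nat.
by [].
Qed.

Lemma line_cvg (V : normedModType R) (f : V -> E) (x0 v0 : V) :
  (forall j, derivable (fun z => f z 0 j) x0 v0) -> derivable f x0 v0.
Proof. by move=> H; apply/derivable_mxP => i j; rewrite ord1. Qed.

Lemma chain_rule (V : normedModType R) O f (Psi : V -> E) (x0 v0 : V) :
  open O -> O (Psi x0) ->
  (forall i y, O y -> derivable f y (e i)) ->
  (forall i, {for Psi x0, continuous (pd i f)}) ->
  (forall j, derivable (fun z => Psi z 0 j) x0 v0) ->
  is_derive x0 v0 (f \o Psi)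
    (\sum_j 'D_v0 (fun z => Psi z 0 j) x0 * pd j f (Psi x0)).
Proof.
move=> oO Ox df cf dPsi.
have dP : derivable Psi x0 v0 by exact: line_cvg.
set y := Psi x0 in Ox cf *.
pose w (h : R) := Psi (h *: v0 + x0) - y.
pose q (h : R) : E := h^-1 *: w h.
have qc : q h @[h --> 0^'] --> 'D_v0 Psi x0 by [].
have wc : w h @[h --> 0^'] --> (0 : E).
  have : (fun h : R => h *: q h) h @[h --> 0^'] --> (0 : R) *: 'D_v0 Psi x0.
    by apply: cvgZ => //; exact: nbhs_dnbhs.
  rewrite scale0r; apply: cvg_trans; apply: near_eq_cvg; near=> h.
  rewrite /q scalerA divff ?scale1r //.
  by near: h; exact: nbhs_dnbhs_neq.
have L : h^-1 *: ((f \o Psi \o shift x0) (h *: v0) - (f \o Psi) x0) @[h --> 0^'] -->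
    \sum_j 'D_v0 (fun z => Psi z 0 j) x0 * pd j f y.
  pose A (h : R) := \sum_j q h 0 j * pd j f y.
  have Ac : A h @[h --> 0^'] --> \sum_j 'D_v0 (fun z => Psi z 0 j) x0 * pd j f y.
    apply: cvg_bigsum => j; apply: cvgM; last exact: cvg_cst.
    rewrite (_ : 'D_v0 _ x0 = ('D_v0 Psi x0) 0 j); last by rewrite derive_mx // mxE.
    apply: (@cvg_comp _ _ _ q (fun z : E => z 0 j)); first exact: qc.
    exact: coord_continuous.
  apply/cvgrPdist_le => eps e0.
  (* Eventually bounds the difference quotient [q h] of [Psi], so that the little-o of [w h] is a
     little-o of [h]. *)
  pose C := `|'D_v0 Psi x0| + 1.
  have C0 : 0 < C by rewrite ltr_wpDl.
  have e2 : 0 < eps / 2 by rewrite divr_gt0.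
  have e3 : 0 < eps / 2 / C by rewrite divr_gt0.
  have F := frechet_estimate oO Ox e3 df cf.
  near=> h.
  have h0 : h != 0 by near: h; exact: nbhs_dnbhs_neq.
  have qC : `|q h| <= C.
    have : `|'D_v0 Psi x0 - q h| <= 1.
      near: h; move/cvgrPdist_le : qc; exact.
    move=> H; rewrite -[q h](subrK ('D_v0 Psi x0)) /C addrC.
    by apply: le_trans (ler_normD _ _) _; rewrite lerD2l distrC.
  have Fh : `|f (y + w h) - f y - \sum_i w h 0 i * pd i f y| <= eps / 2 / C * `|w h|.
    by near: h; exact: (wc _ F).
  have Ah : `|\sum_j 'D_v0 (fun z => Psi z 0 j) x0 * pd j f y - A h| <= eps / 2.
    by near: h; move/cvgrPdist_le : Ac; exact.
  rewrite /= -/y; set D := \sum_j _ in Ah *.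
  have -> : f (Psi (h *: v0 + x0)) = f (y + w h) by rewrite /w [y + _]addrC subrK.
  have -> : D - h^-1 *: (f (y + w h) - f y) =
     (D - A h) - h^-1 * (f (y + w h) - f y - \sum_i w h 0 i * pd i f y).
    rewrite [in RHS]mulrBr mulr_sumr (_ : \sum_i h^-1 * _ = A h).
      have -> : h^-1 *: (f (y + w h) - f y) = h^-1 * (f (y + w h) - f y) by [].
      by ring.
    by apply: eq_bigr => j _; rewrite /q [(h^-1 *: w h) 0 j]mxE mulrA.
  apply: le_trans (ler_normB _ _) _; rewrite [leRHS]splitr; apply: lerD => //.
  rewrite normrM; apply: (@le_trans _ _ (`|h^-1| * (eps / 2 / C * `|w h|))).
    by rewrite ler_wpM2l.
  rewrite mulrCA -normrZ -/(q h).
  by rewrite mulrAC ler_pdivrMr // ler_wpM2l // ltW.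
by apply: DeriveDef; [apply/cvg_ex; eexists; exact: L | exact: cvg_lim L].
Unshelve. all: by end_near. Qed.

End LineCalculus.

(** * Calculus of functions with bounded derivatives *)

Section BoundedSmooth.
Variables (R : realType) (n : nat).
Local Notation E := 'rV[R]_n.
Local Notation e := (basis_vec R).
Implicit Types (f g : E -> R) (x y v : E) (i j : 'I_n) (O : set E) (B : R) (k : nat).

(* C^k on O with all partial derivatives of order at most k, itself included,
   bounded by B. *)
Fixpoint CB B k O f : Prop :=
  (forall x, O x -> {for x, continuous f} /\ `|f x| <= B) /\
  if k is k'.+1 then
    forall i, (forall x, O x -> derivable f x (e i)) /\ CB B k' O (pd i f)
  else True.

Lemma CB0P B k O f : CB B k O f ->
  forall x, O x -> {for x, continuous f} /\ `|f x| <= B.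
Proof. by case: k => [|k] []. Qed.

Lemma CB_bound B k O f x : CB B k O f -> O x -> `|f x| <= B.
Proof. by move=> /CB0P H /H[]. Qed.

Lemma CB_cont B k O f x : CB B k O f -> O x -> {for x, continuous f}.
Proof. by move=> /CB0P H /H[]. Qed.

Lemma CB_pd B k O f i : CB B k.+1 O f -> CB B k O (pd i f).
Proof. by move=> [_ /(_ i)[]]. Qed.

Lemma CB_der B k O f i x : CB B k.+1 O f -> O x -> derivable f x (e i).
Proof. by move=> [_ /(_ i)[H _]] /H. Qed.

Lemma near_open O (P : E -> Prop) x : open O -> O x -> (forall y, O y -> P y) ->
  \forall y \near x, P y.
Proof.
move=> oO Ox H; have nO : nbhs x O by exact: open_nbhs_nbhs.
exact: (@filterS _ (nbhs x) _ O P H).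
Qed.

Lemma pd_eq O f g i x : open O -> O x -> (forall y, O y -> f y = g y) ->
  pd i f x = pd i g x.
Proof. by move=> oO Ox H; apply: near_eq_derive; exact: near_open oO Ox H. Qed.

Lemma derivable_eq O f g i x : open O -> O x -> (forall y, O y -> f y = g y) ->
  derivable f x (e i) -> derivable g x (e i).
Proof. by move=> oO Ox H; apply: near_eq_derivable; exact: near_open oO Ox H. Qed.

Lemma cont_eq O f g x : open O -> O x -> (forall y, O y -> f y = g y) ->
  {for x, continuous f} -> {for x, continuous g}.
Proof.
move=> oO Ox H cf.
have cg : g y @[y --> x] --> f x.
  apply: cvg_trans cf.
  have H' : {near x, f =1 g} by exact: near_open oO Ox H.
  exact: near_eq_cvg H'.
by move: cg; rewrite (H x Ox).
Qed.

Lemma CB_eq B k O f g : open O -> (forall x, O x -> f x = g x) ->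
  CB B k O f -> CB B k O g.
Proof.
move=> oO; elim: k f g => [|k IH] f g H [H0 H1]; split => //.
- by move=> x Ox; have [cf bf] := H0 x Ox; rewrite -H //; split => //; exact: cont_eq oO Ox H cf.
- by move=> x Ox; have [cf bf] := H0 x Ox; rewrite -H //; split => //; exact: cont_eq oO Ox H cf.
move=> i; have [df cf] := H1 i; split.
  by move=> x Ox; exact: derivable_eq oO Ox H (df x Ox).
by apply: IH cf => x Ox; exact: pd_eq oO Ox H.
Qed.

Lemma CB_le B B' k O f : B <= B' -> CB B k O f -> CB B' k O f.
Proof.
move=> BB; elim: k f => [|k IH] f [H0 H1]; split => //.
- by move=> x /H0[? ?]; split => //; apply: le_trans BB.
- by move=> x /H0[? ?]; split => //; apply: le_trans BB.
by move=> i; have [df cf] := H1 i; split => //; exact: IH.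
Qed.

Lemma CB_sub B k O O' f : O' `<=` O -> CB B k O f -> CB B k O' f.
Proof.
move=> OO; elim: k f => [|k IH] f [H0 H1]; split => //.
- by move=> x /OO/H0.
- by move=> x /OO/H0.
by move=> i; have [df cf] := H1 i; split => [x /OO/df //|]; exact: IH.
Qed.

Lemma CB_S B k O f : CB B k.+1 O f -> CB B k O f.
Proof.
elim: k f => [|k IH] f [H0 H1]; split => // i.
by have [df cf] := H1 i; split => //; exact: IH.
Qed.

Lemma CB_leq B k k' O f : (k' <= k)%N -> CB B k O f -> CB B k' O f.
Proof.
elim: k => [|k IH]; first by rewrite leqn0 => /eqP ->.
rewrite leq_eqVlt => /orP[/eqP ->//|]; rewrite ltnS => kk /CB_S; exact: IH.
Qed.

Lemma CB_cst k O (c : R) : CB `|c| k O (fun=> c).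
Proof.
have H B k' (d : R) : `|d| <= B -> CB B k' O (fun=> d).
  elim: k' d => [|k' IH] d dB; split => //.
  - by move=> x _; split => //; exact: cst_continuous.
  - by move=> x _; split => //; exact: cst_continuous.
  move=> i; split; first by move=> x _; exact: derivable_cst.
  have -> : pd i (fun=> d) = (fun=> 0) by apply/funext => x; exact: derive_cst.
  by apply: IH; rewrite normr0; exact: le_trans dB.
exact: H.
Qed.

Lemma CB_add B B' k O f g : open O -> CB B k O f -> CB B' k O g ->
  CB (B + B') k O (fun x => f x + g x).
Proof.
move=> oO; elim: k f g => [|k IH] f g Hf Hg; split => //.
- move=> x Ox; split; last exact: le_trans (ler_normD _ _) (lerD (CB_bound Hf Ox) (CB_bound Hg Ox)).
  exact: (continuousD (CB_cont Hf Ox) (CB_cont Hg Ox)).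
- move=> x Ox; split; last exact: le_trans (ler_normD _ _) (lerD (CB_bound Hf Ox) (CB_bound Hg Ox)).
  exact: (continuousD (CB_cont Hf Ox) (CB_cont Hg Ox)).
move=> i; split.
  by move=> x Ox; apply: derivableD; [exact: CB_der Hf Ox|exact: CB_der Hg Ox].
apply: CB_eq (IH _ _ (CB_pd i Hf) (CB_pd i Hg)) => // x Ox.
by rewrite /pd -deriveD //; [exact: CB_der Hf Ox|exact: CB_der Hg Ox].
Qed.

Lemma pd_mul k B B' O f g i x : CB B k.+1 O f -> CB B' k.+1 O g -> O x ->
  pd i (fun x => f x * g x) x = f x * pd i g x + pd i f x * g x.
Proof.
move=> Hf Hg Ox; rewrite /pd (deriveM (f := f) (g := g)).
- by congr (_ + _); rewrite mulrC.
- exact: CB_der Hf Ox.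
- exact: CB_der Hg Ox.
Qed.

Lemma CB_mul B B' k O f g : open O -> 0 <= B -> 0 <= B' ->
  CB B k O f -> CB B' k O g -> CB (2 ^+ k * (B * B')) k O (fun x => f x * g x).
Proof.
move=> oO B0 B0'.
have H0 k' f' g' : CB B k' O f' -> CB B' k' O g' -> forall x, O x ->
    {for x, continuous (fun x => f' x * g' x)} /\ `|f' x * g' x| <= B * B'.
  move=> Hf Hg x Ox; split.
    exact: (continuousM (CB_cont Hf Ox) (CB_cont Hg Ox)).
  by rewrite normrM ler_pM // ?(CB_bound Hf Ox) ?(CB_bound Hg Ox).
elim: k f g => [|k IH] f g Hf Hg.
  by split => // x Ox; rewrite expr0 mul1r; exact: H0 Hf Hg x Ox.
split.
  move=> x Ox; have [? b] := H0 _ _ _ Hf Hg x Ox; split => //.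
  by apply: le_trans b _; rewrite ler_peMl ?mulr_ge0 // exprn_ege1 // ler1n.
move=> i; split.
  by move=> x Ox; apply: derivableM; [exact: CB_der Hf Ox|exact: CB_der Hg Ox].
have K1 := IH _ _ (CB_S Hf) (CB_pd i Hg).
have K2 := IH _ _ (CB_pd i Hf) (CB_S Hg).
have -> : 2 ^+ k.+1 * (B * B') = 2 ^+ k * (B * B') + 2 ^+ k * (B * B').
  by rewrite exprS; ring.
by apply: CB_eq (CB_add oO K1 K2) => // x Ox; rewrite (pd_mul i Hf Hg Ox).
Qed.

(** Recursion of the chain rule: a derivative of a composite is a sum of n products, each bounded
    through [CB_mul] at the cost of 2^k. *)
Definition comp_const (BP : R) := fix c (k : nat) : R :=
  if k is k'.+1 then 1 + n%:R * (2 ^+ k' * (BP * c k')) else 1.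

Lemma comp_const_ge1 BP k : 0 <= BP -> 1 <= comp_const BP k.
Proof.
move=> BP0; elim: k => //= k IH; rewrite lerDl mulr_ge0 // mulr_ge0 ?exprn_ge0 //.
by rewrite mulr_ge0 //; exact: le_trans IH.
Qed.

Lemma CB_bigsum (I : Type) (r : seq I) (F : I -> E -> R) B k O : open O ->
  (forall l : I, CB B k O (F l)) -> CB ((size r)%:R * B) k O (fun x => \sum_(i <- r) F i x).
Proof.
move=> oO H; elim: r => [|l r IH] /=.
  rewrite mul0r; under eq_fun do rewrite big_nil.
  by have := CB_cst k O 0; rewrite normr0.
under eq_fun do rewrite big_cons.
rewrite -add1n natrD mulrDl mul1r.
exact: (CB_add oO (H l) IH).
Qed.

Lemma CB_sum (I : finType) (F : I -> E -> R) B k O : open O ->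
  (forall l : I, CB B k O (F l)) -> CB (#|I|%:R * B) k O (fun x => \sum_i F i x).
Proof. by move=> oO H; rewrite cardT enumT; apply: CB_bigsum. Qed.

Definition CBe k O f := exists2 B, 0 <= B & CB B k O f.

Lemma CBe_eq k O f g : open O -> (forall x, O x -> f x = g x) -> CBe k O f -> CBe k O g.
Proof. by move=> oO H [B B0 C]; exists B => //; exact: CB_eq C. Qed.

Lemma CBe_cst k O (c : R) : CBe k O (fun=> c).
Proof. by exists `|c| => //; exact: CB_cst. Qed.

Lemma CBe_add k O f g : open O -> CBe k O f -> CBe k O g -> CBe k O (fun x => f x + g x).
Proof.
by move=> oO [B B0 C] [B' B0' C']; exists (B + B'); [exact: addr_ge0|exact: CB_add].
Qed.

Lemma CBe_mul k O f g : open O -> CBe k O f -> CBe k O g -> CBe k O (fun x => f x * g x).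
Proof.
move=> oO [B B0 C] [B' B0' C']; exists (2 ^+ k * (B * B')); last exact: CB_mul.
by rewrite mulr_ge0 ?exprn_ge0 // mulr_ge0.
Qed.

Lemma CBe_opp k O f : open O -> CBe k O f -> CBe k O (fun x => - f x).
Proof.
move=> oO H; have -> : (fun x => - f x) = (fun x => -1 * f x).
  by apply/funext => x; rewrite mulN1r.
by apply: CBe_mul => //; exact: CBe_cst.
Qed.

Lemma CBe_sum (I : Type) (r : seq I) (F : I -> E -> R) k O : open O ->
  (forall l : I, CBe k O (F l)) -> CBe k O (fun x => \sum_(i <- r) F i x).
Proof.
move=> oO H; elim: r => [|l r IH].
  by under eq_fun do rewrite big_nil; exact: CBe_cst.
by under eq_fun do rewrite big_cons; exact: CBe_add.
Qed.

Lemma CBe_prod (I : Type) (r : seq I) (F : I -> E -> R) k O : open O ->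
  (forall l : I, CBe k O (F l)) -> CBe k O (fun x => \prod_(i <- r) F i x).
Proof.
move=> oO H; elim: r => [|l r IH].
  by under eq_fun do rewrite big_nil; exact: CBe_cst.
by under eq_fun do rewrite big_cons; exact: CBe_mul.
Qed.

Lemma CBe_sub k O O' f : O' `<=` O -> CBe k O f -> CBe k O' f.
Proof. by move=> H [B B0 C]; exists B => //; exact: CB_sub C. Qed.

Lemma CBe_leq k k' O f : (k' <= k)%N -> CBe k O f -> CBe k' O f.
Proof. by move=> H [B B0 C]; exists B => //; exact: CB_leq C. Qed.

Lemma CBe_pd k O f i : CBe k.+1 O f -> CBe k O (pd i f).
Proof. by move=> [B B0 C]; exists B => //; exact: CB_pd. Qed.

Lemma pd_inv k O f i x : CBe k.+1 O f -> O x -> f x != 0 ->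
  is_derive x (e i) (fun x => (f x)^-1) (- ((f x)^-1 * (f x)^-1 * pd i f x)).
Proof.
move=> [B _ H] Ox fx; have df : derivable f x (e i) := CB_der H Ox.
apply: DeriveDef; first exact: derivableV.
rewrite deriveV // expr2 invfM /pd.
by rewrite -[LHS]/(- ((f x)^-1 * (f x)^-1) * _) mulNr.
Qed.

(** Induction on the order: the derivative - f^-2 f' contains the inverse at the previous order. The
    lower bound [c] makes the estimates uniform on [O]. *)
Lemma CBe_inv k O f (c : R) : open O -> 0 < c -> (forall x, O x -> c <= `|f x|) ->
  CBe k O f -> CBe k O (fun x => (f x)^-1).
Proof.
move=> oO c0 fc.
have fn0 x : O x -> f x != 0.
  by move=> /fc H; rewrite -normr_gt0; exact: lt_le_trans H.
have H0 k' : CBe k' O f -> forall x, O x ->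
    {for x, continuous (fun x => (f x)^-1)} /\ `|(f x)^-1| <= c^-1.
  move=> [B _ C] x Ox; split.
    exact: (continuousV (fn0 x Ox) (CB_cont C Ox)).
  by rewrite normfV lef_pV2 ?posrE ?normr_gt0 ?fn0 // fc.
elim: k => [|k IH] Hf.
  by exists c^-1; [rewrite invr_ge0 ltW|split => //; exact: H0 Hf].
have [B1 B10 C1] : CBe k O (fun x => (f x)^-1) by apply: IH; exact: CBe_leq Hf.
have D i : CBe k O (fun x => - ((f x)^-1 * (f x)^-1 * pd i f x)).
  apply: CBe_opp => //; apply: CBe_mul => //; last exact: CBe_pd.
  by apply: CBe_mul => //; exists B1.
pose Bi i := sval (cid2 (D i)).
have Bi0 i : 0 <= Bi i by rewrite /Bi; case: cid2.
have CBi i : CB (Bi i) k O (fun x => - ((f x)^-1 * (f x)^-1 * pd i f x)).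
  by rewrite /Bi; case: cid2.
have S0 : 0 <= \sum_i Bi i by apply: sumr_ge0.
exists (c^-1 + \sum_i Bi i); first by rewrite addr_ge0 // invr_ge0 ltW.
split.
  by move=> x Ox; have [? b] := H0 _ Hf x Ox; split => //; apply: le_trans b _; rewrite lerDl.
move=> i; split.
  by move=> x Ox; have [] := pd_inv i Hf Ox (fn0 x Ox).
have ci0 : 0 <= c^-1 by rewrite invr_ge0 ltW.
have BB : Bi i <= c^-1 + \sum_i Bi i.
  rewrite (bigD1 i) //= addrCA lerDl addr_ge0 //.
  by apply: sumr_ge0.
apply: CB_le BB _; apply: CB_eq (CBi i) => // x Ox.
by have [_ <-] := pd_inv i Hf Ox (fn0 x Ox).
Qed.

Lemma CBe_det k O (m : nat) (A : E -> 'M[R]_m) : open O ->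
  (forall (i j : 'I_m), CBe k O (fun x => A x i j)) -> CBe k O (fun x => \det (A x)).
Proof.
move=> oO H; rewrite /determinant; apply: CBe_sum => // s.
by apply: CBe_mul => //; [exact: CBe_cst|apply: CBe_prod => // i; exact: H].
Qed.

Lemma CBe_invmx k O (m : nat) (A : E -> 'M[R]_m) (c : R) : open O -> 0 < c ->
  (forall x, O x -> c <= `|\det (A x)|) ->
  (forall (i j : 'I_m), CBe k O (fun x => A x i j)) ->
  forall (i j : 'I_m), CBe k O (fun x => invmx (A x) i j).
Proof.
move=> oO c0 dc H i j.
have : CBe k O (fun x => (\det (A x))^-1 * cofactor (A x) j i).
  apply: CBe_mul => //; first by apply: (CBe_inv _ c0) => //; exact: CBe_det.
  rewrite /cofactor; apply: CBe_mul => //; first exact: CBe_cst.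
  apply: CBe_det => // i' j'.
  by have := H (lift j i') (lift i j'); apply: CBe_eq => // x _; rewrite !mxE.
apply: CBe_eq => // x Ox.
have u : A x \in unitmx.
  by rewrite unitmxE unitfE -normr_gt0; exact: lt_le_trans (dc x Ox).
by rewrite /invmx u !mxE.
Qed.

Lemma CBe_mulmx k O (p q r : nat) (A : E -> 'M[R]_(p, q)) (C : E -> 'M[R]_(q, r)) : open O ->
  (forall (i : 'I_p) (j : 'I_q), CBe k O (fun x => A x i j)) -> (forall (i : 'I_q) (j : 'I_r), CBe k O (fun x => C x i j)) ->
  forall (i : 'I_p) (j : 'I_r), CBe k O (fun x => (A x *m C x) i j).
Proof.
move=> oO HA HC i j.
have : CBe k O (fun x => \sum_l A x i l * C x l j).
  by apply: CBe_sum => // l; exact: CBe_mul.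
by apply: CBe_eq => // x _; rewrite mxE.
Qed.

End BoundedSmooth.

Section Composition.
Variables (R : realType) (n p : nat).
Local Notation E := 'rV[R]_n.
Local Notation F := 'rV[R]_p.

Lemma cont_coords (Psi : E -> F) x :
  (forall j, {for x, continuous (fun y => Psi y 0 j)}) -> {for x, continuous Psi}.
Proof.
move=> H; apply/(@cvgrPdist_le _ _ _ (nbhs x) (nbhs_filter x)) => eps e0.
have K j : \forall y \near x, `|Psi x 0 j - Psi y 0 j| <= eps.
  by have /cvgrPdist_le/(_ _ e0) := H j.
have K' : \forall y \near x, forall j, `|Psi x 0 j - Psi y 0 j| <= eps.
  exact: (@filter_forall _ _ (fun j y => `|Psi x 0 j - Psi y 0 j| <= eps) (nbhs x) _ K).
apply: filterS K' => y Hy; apply: norm_leP; first exact: ltW.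
by move=> j; rewrite !mxE.
Qed.

Lemma CB_comp (BP : R) k (O : set E) (O' : set F) (Psi : E -> F) B f :
  open O -> open O' -> 0 <= BP -> 0 <= B ->
  (forall x, O x -> O' (Psi x)) -> (forall j, CB BP k O (fun x => Psi x 0 j)) ->
  CB B k O' f -> CB (comp_const p BP k * B) k O (fun x => f (Psi x)).
Proof.
move=> oO oO' BP0 B0 OO.
have H0 k' f' : CB B k' O' f' -> (forall j, CB BP k' O (fun x => Psi x 0 j)) ->
    forall x, O x -> {for x, continuous (fun x => f' (Psi x))} /\ `|f' (Psi x)| <= B.
  move=> Hf HP x Ox; split; last exact: CB_bound Hf (OO x Ox).
  apply: (@continuous_comp _ _ _ Psi f'); last exact: CB_cont Hf (OO x Ox).
  by apply: cont_coords => j; exact: CB_cont (HP j) Ox.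
elim: k f => [|k IH] f HP Hf.
  by split => // x Ox; rewrite mul1r; exact: H0 Hf HP x Ox.
have c1 := comp_const_ge1 p k.+1 BP0; have c1' := comp_const_ge1 p k BP0.
have ck0 : 0 <= comp_const p BP k by exact: le_trans c1'.
split.
  move=> x Ox; have [? b] := H0 _ _ Hf HP x Ox; split => //.
  by apply: le_trans b _; rewrite ler_peMl.
have der i x : O x -> is_derive x (basis_vec R i) (f \o Psi)
    (\sum_j pd i (fun z => Psi z 0 j) x * pd j f (Psi x)).
  move=> Ox; apply: (chain_rule oO' (OO x Ox)).
  - by move=> j y Oy; exact: CB_der Hf Oy.
  - by move=> j; exact: CB_cont (CB_pd j Hf) (OO x Ox).
  - by move=> j; exact: CB_der (HP j) Ox.
move=> i; split; first by move=> x Ox; have [] := der i x Ox.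
have HP' j : CB BP k O (fun x => Psi x 0 j) by exact: CB_S.
have K j : CB (2 ^+ k * (BP * (comp_const p BP k * B))) k O
    (fun x => pd i (fun z => Psi z 0 j) x * pd j f (Psi x)).
  apply: CB_mul => //; first exact: mulr_ge0.
    exact: CB_pd (HP j).
  by apply: IH => //; exact: CB_pd.
have := CB_sum oO K; rewrite card_ord => KK.
have le : p%:R * (2 ^+ k * (BP * (comp_const p BP k * B))) <= comp_const p BP k.+1 * B.
  rewrite /= mulrDl mul1r !mulrA lerDr //.
apply: CB_le le _; apply: CB_eq KK => // x Ox.
by have [_ <-] := der i x Ox.
Qed.

Lemma CBe_comp k (O : set E) (O' : set F) (Psi : E -> F) f :
  open O -> open O' -> (forall x, O x -> O' (Psi x)) ->
  (forall j, CBe k O (fun x => Psi x 0 j)) -> CBe k O' f -> CBe k O (fun x => f (Psi x)).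
Proof.
move=> oO oO' OO HP [B B0 Hf].
pose Bi j := sval (cid2 (HP j)).
have Bi0 j : 0 <= Bi j by rewrite /Bi; case: cid2.
have CBi j : CB (Bi j) k O (fun x => Psi x 0 j) by rewrite /Bi; case: cid2.
have S0 : 0 <= \sum_j Bi j by apply: sumr_ge0.
have HP' j : CB (\sum_j Bi j) k O (fun x => Psi x 0 j).
  by apply: CB_le (CBi j); rewrite (bigD1 j) //= lerDl sumr_ge0.
exists (comp_const p (\sum_j Bi j) k * B).
  by rewrite mulr_ge0 //; apply: le_trans (comp_const_ge1 p k S0).
exact: (CB_comp oO oO' S0 B0 OO HP' Hf).
Qed.

End Composition.

Section SecondDifferences.
Variables (R : realType) (n : nat).
Local Notation E := 'rV[R]_n.
Local Notation e := (basis_vec R).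
Implicit Types (f g : E -> R) (x y v : E) (i j : 'I_n) (O : set E) (B : R) (k : nat).

Lemma derivable_shift f c x i : derivable f (x + c) (e i) ->
  is_derive x (e i) (fun y => f (y + c)) (pd i f (x + c)).
Proof.
have E : (fun h : R => h^-1 *: ((f \o shift (x + c)) (h *: e i) - f (x + c))) =
  (fun h : R => h^-1 *: (((fun y => f (y + c)) \o shift x) (h *: e i) - f (x + c))).
  by apply/funext => h /=; rewrite addrA.
by rewrite /pd /derive /derivable E => H; apply: DeriveDef.
Qed.

(** Two mean value theorems: first in direction [i] for the increment [phi] in direction [j], then
    in direction [j] for the partial derivative. Only points of the rectangle are visited. *)
Lemma second_difference B O f x i j (s s' : R) : CB B 2 O f ->
  (forall t t', 0 <= t <= 1 -> 0 <= t' <= 1 ->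
     O (x + (t * s) *: e i + (t' * s') *: e j)) ->
  exists t t', [/\ 0 <= t <= 1, 0 <= t' <= 1 &
    f (x + s *: e i + s' *: e j) - f (x + s *: e i) - (f (x + s' *: e j) - f x) =
    s * s' * pd j (pd i f) (x + (t * s) *: e i + (t' * s') *: e j)].
Proof.
move=> Hf HO.
have u01 : 0 <= (1 : R) <= 1 by rewrite ler01 lexx.
have z01 : 0 <= (0 : R) <= 1 by rewrite ler01 lexx.
have HO0 t : 0 <= t <= 1 -> O (x + (t * s) *: e i).
  by move=> t01; have := HO t 0 t01 z01; rewrite mul0r scale0r addr0.
have HO1 t : 0 <= t <= 1 -> O (x + (t * s) *: e i + s' *: e j).
  by move=> t01; have := HO t 1 t01 u01; rewrite mul1r.
pose phi y := f (y + s' *: e j) - f y.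
have dphi t : 0 <= t <= 1 -> is_derive (x + (t * s) *: e i) (e i) phi
   (pd i f (x + (t * s) *: e i + s' *: e j) - pd i f (x + (t * s) *: e i)).
  move=> t01; have d1 := derivable_shift (CB_der (i := i) Hf (HO1 t t01)).
  have d2 : is_derive (x + (t * s) *: e i) (e i) f (pd i f (x + (t * s) *: e i)).
    by apply: DeriveDef => //; exact: CB_der Hf (HO0 t t01).
  exact: is_deriveB.
have [t t01 Et] : exists2 t, 0 <= t <= 1 &
    phi (x + s *: e i) - phi x = s * pd i phi (x + (t * s) *: e i).
  by apply: MVT_line => t t01; have [] := dphi t t01.
have [t' t'01 Et'] : exists2 t', 0 <= t' <= 1 &
    pd i f (x + (t * s) *: e i + s' *: e j) - pd i f (x + (t * s) *: e i) =
    s' * pd j (pd i f) (x + (t * s) *: e i + (t' * s') *: e j).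
  apply: MVT_line => t' t'01.
  exact: CB_der (CB_pd i Hf) (HO t t' t01 t'01).
exists t, t'; split => //.
rewrite -mulrA -Et'; have [_ <-] := dphi t t01.
by rewrite -[LHS]/(phi (x + s *: e i) - phi x) Et.
Qed.

Lemma norm_scale_basis (c : R) i : `|c *: e i| <= `|c|.
Proof.
apply: norm_leP => // j; rewrite -[_ *: _]add0r shift_coord mxE add0r.
by case: ifP => // _; rewrite normr0.
Qed.

(** One and the same second difference equals a value of either mixed derivative at a point near
    [x]; continuity does the rest. The side r/4 keeps the rectangle in the ball of radius r. *)
Lemma schwarz B O f x i j : open O -> O x -> CB B 2 O f ->
  pd i (pd j f) x = pd j (pd i f) x.
Proof.
move=> oO Ox Hf; apply/eqP; rewrite -subr_eq0 -normr_le0.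
apply/ler_addgt0Pr => eps e0; rewrite add0r.
have e2 : 0 < eps / 2 by rewrite divr_gt0.
have ci := CB_cont (CB_pd j (CB_pd i Hf)) Ox.
have cj := CB_cont (CB_pd i (CB_pd j Hf)) Ox.
have Ni : \forall y \near x, `|pd j (pd i f) x - pd j (pd i f) y| <= eps / 2.
  by have /(@cvgrPdist_le _ _ _ (nbhs x) (nbhs_filter x))/(_ _ e2) := ci.
have Nj : \forall y \near x, `|pd i (pd j f) x - pd i (pd j f) y| <= eps / 2.
  by have /(@cvgrPdist_le _ _ _ (nbhs x) (nbhs_filter x))/(_ _ e2) := cj.
have NO : \forall y \near x, O y by exact: open_nbhs_nbhs.
have NA := filterI NO (filterI Ni Nj).
have [r /= r0 Hr] : nbhs_ball x (O `&` ([set y | `|pd j (pd i f) x - pd j (pd i f) y| <= eps / 2] `&`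
    [set y | `|pd i (pd j f) x - pd i (pd j f) y| <= eps / 2])).
  by apply/nbhs_ballP; exact: NA.
pose s := r / 4; have s0 : 0 < s by rewrite divr_gt0.
have inb (k l : 'I_n) (t t' : R) : 0 <= t <= 1 -> 0 <= t' <= 1 ->
    ball x r (x + (t * s) *: e k + (t' * s) *: e l).
  move=> /andP[t0 t1] /andP[t0' t1']; rewrite -ball_normE /= -addrA opprD addrA subrr.
  rewrite sub0r normrN; apply: le_lt_trans (ler_normD _ _) _.
  have b1 := norm_scale_basis (t * s) k; have b2 := norm_scale_basis (t' * s) l.
  have c1 : `|t * s| <= s by rewrite normrM !ger0_norm ?(ltW s0) // ler_piMl // ltW.
  have c2 : `|t' * s| <= s by rewrite normrM !ger0_norm ?(ltW s0) // ler_piMl // ltW.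
  apply: le_lt_trans (lerD (le_trans b1 c1) (le_trans b2 c2)) _.
  by rewrite /s; lra.
have HO (k l : 'I_n) (t t' : R) : 0 <= t <= 1 -> 0 <= t' <= 1 ->
    O (x + (t * s) *: e k + (t' * s) *: e l).
  by move=> t01 t01'; have [] := Hr _ (inb k l t t' t01 t01').
have [t1 [t1' [h1 h1' E1]]] := second_difference Hf (HO i j).
have [t2 [t2' [h2 h2' E2]]] := second_difference Hf (HO j i).
have [_ [Bi _]] := Hr _ (inb i j _ _ h1 h1').
have [_ [_ Bj]] := Hr _ (inb j i _ _ h2 h2').
have E : pd j (pd i f) (x + (t1 * s) *: e i + (t1' * s) *: e j) =
         pd i (pd j f) (x + (t2 * s) *: e j + (t2' * s) *: e i).
  have ss : s * s != 0 by rewrite mulf_neq0 // gt_eqF.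
  have swap (a b c d : R) : a - b - (c - d) = a - c - (b - d) by ring.
  move: E1 E2; rewrite (addrAC x (s *: e j) (s *: e i)) swap => -> E2.
  exact: (mulfI ss E2).
move: Bi Bj; rewrite /= -E => Bi Bj.
have tri (a b c : R) : `|b - c| <= eps / 2 -> `|a - c| <= eps / 2 -> `|a - b| <= eps.
  move=> h3 h4; have -> : a - b = (a - c) - (b - c) by ring.
  by apply: le_trans (ler_normB _ _) _; rewrite [leRHS]splitr; exact: lerD.
exact: tri Bi Bj.
Qed.

End SecondDifferences.

(** * Positive definite matrices *)

Section PosDef.
Variables (R : realType) (n : nat) (G : 'M[R]_n).
Hypothesis Gs : G^T = G.
Hypothesis Gp : forall v : 'rV[R]_n, v != 0 -> 0 < bilin G v v.
Implicit Types v w : 'rV[R]_n.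

Lemma posdef_unit : G \in unitmx.
Proof.
rewrite -row_free_unit -kermx_eq0; apply/rowV0P => v /sub_kermxP vG.
apply/eqP; rewrite -[_ == _]negbK; apply/negP => /Gp.
by rewrite /bilin vG mul0mx mxE ltxx.
Qed.

Let bilinC v w : bilin G v w = bilin G w v.
Proof.
rewrite /bilin -[in LHS]Gs.
have -> : v *m G^T *m w^T = (w *m G *m v^T)^T.
  by rewrite !trmx_mul trmxK mulmxA.
by rewrite mxE.
Qed.

Let bilin_ge0 v : 0 <= bilin G v v.
Proof.
have [->|/Gp/ltW//] := eqVneq v 0.
by rewrite /bilin !mul0mx mxE.
Qed.

Let bilinBl v1 v2 w : bilin G (v1 - v2) w = bilin G v1 w - bilin G v2 w.
Proof. by rewrite /bilin !mulmxBl [LHS]mxE [X in _ + X]mxE. Qed.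

Let bilinZl (c : R) v w : bilin G (c *: v) w = c * bilin G v w.
Proof. by rewrite /bilin -!scalemxAl [LHS]mxE. Qed.

Lemma bilin_cauchy_schwarz v w : bilin G v w ^+ 2 <= bilin G v v * bilin G w w.
Proof.
have [->|/Gp w0] := eqVneq w 0.
  by rewrite /bilin trmx0 !mulmx0 mxE expr0n /= mulr0.
pose al := bilin G w w; pose be := bilin G v w.
have := bilin_ge0 (al *: v - be *: w).
have -> : bilin G (al *: v - be *: w) (al *: v - be *: w) =
  al * (bilin G v v * al - be ^+ 2).
  rewrite bilinBl !bilinZl !(bilinC _ (al *: v - be *: w)) !bilinBl !bilinZl.
  by rewrite (bilinC w v) -/al -/be; ring.
by rewrite pmulr_rge0 // subr_ge0.
Qed.

(** Put w = v G^-1. Then |v|^2 = G(w, v), and Cauchy-Schwarz for [G] gives |v|^4 <= G^-1(v, v) G(v,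
    v), where G(v, v) <= n C |v|^2; divide by |v|^2. *)
Lemma posdef_inv_elliptic (C : R) (xi : 'I_n -> R) :
  0 <= C -> (forall i j, `|G i j| <= C) ->
  \sum_i xi i ^+ 2 <= n%:R * C * \sum_i \sum_j invmx G i j * xi i * xi j.
Proof.
move=> C0 GC; pose v : 'rV[R]_n := \row_i xi i; pose w := v *m invmx G.
have wG : w *m G = v by rewrite /w mulmxKV // posdef_unit.
pose S := \sum_i xi i ^+ 2.
have S0 : 0 <= S by apply: sumr_ge0 => i _; rewrite sqr_ge0.
have Ewv : bilin G w v = S.
  by rewrite /bilin wG mxE; apply: eq_bigr => i _; rewrite !mxE expr2.
have Eww : bilin G w w = \sum_i \sum_j invmx G i j * xi i * xi j.
  rewrite /bilin wG mxE exchange_big /=; apply: eq_bigr => i _.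
  rewrite !mxE mulr_sumr; apply: eq_bigr => j _; rewrite !mxE; ring.
have Evv : bilin G v v <= n%:R * C * S.
  have -> : n%:R * C * S = \sum_i \sum_j C * (xi i ^+ 2 + xi j ^+ 2) / 2.
    have H1 : \sum_i \sum_(j < n) (xi i ^+ 2) = n%:R * S.
      rewrite mulr_sumr; apply: eq_bigr => i _.
      by rewrite sumr_const card_ord mulr_natl.
    have H2 : \sum_(i < n) \sum_j (xi j ^+ 2) = n%:R * S.
      by rewrite sumr_const card_ord mulr_natl.
    transitivity (C / 2 * (\sum_i \sum_(j < n) (xi i ^+ 2) +
                           \sum_(i < n) \sum_j (xi j ^+ 2))).
      by rewrite H1 H2; field.
    rewrite -big_split mulr_sumr; apply: eq_bigr => i _.
    rewrite -big_split mulr_sumr; apply: eq_bigr => j _ /=.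
    by ring.
  rewrite /bilin mxE [leLHS](eq_bigr (fun j => \sum_i xi i * G i j * xi j)); last first.
    by move=> j _; rewrite !mxE mulr_suml; apply: eq_bigr => i _; rewrite !mxE.
  rewrite exchange_big /=; apply: ler_sum => i _; apply: ler_sum => j _.
  apply: le_trans (ler_norm _) _; rewrite !normrM.
  apply: (@le_trans _ _ (C * (`|xi i| * `|xi j|))).
    rewrite mulrAC mulrC; apply: ler_wpM2r => //; exact: mulr_ge0.
  rewrite -mulrA; apply: ler_wpM2l => //.
  have := sqr_ge0 (`|xi i| - `|xi j|).
  rewrite sqrrB !real_normK ?num_real //.
  set u := `|xi i| * `|xi j|; rewrite -mulr_natr; lra.
have Q0 := bilin_ge0 w; rewrite Eww in Q0.
have := bilin_cauchy_schwarz w v; rewrite Ewv Eww.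
set Q := \sum_i \sum_j _ in Q0 *; rewrite -/S => H.
have [->|Sn0] := eqVneq S 0; first by rewrite !mulr_ge0.
have Sp : 0 < S by rewrite lt_def Sn0.
rewrite -(ler_pM2r Sp) -expr2; apply: le_trans H _.
by rewrite mulrC mulrAC; apply: ler_wpM2r.
Qed.

(** The segment from the identity to [G] consists of positive definite, hence invertible matrices.
    The determinant is a polynomial along it with value 1 at the start, so it cannot change sign. *)
Lemma posdef_det_gt0 : 0 < \det G.
Proof.
have Gn0 : \det G != 0 by have := posdef_unit; rewrite unitmxE unitfE.
rewrite lt_neqAle eq_sym Gn0 /= leNgt; apply/negP => Gneg.
pose P : 'M[{poly R}]_n :=
  \matrix_(i, j) ((1 - 'X) * ((i == j)%:R)%:P + 'X * (G i j)%:P).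
have ev t : (\det P).[t] = \det ((1 - t) *: 1%:M + t *: G).
  rewrite -horner_evalE -det_map_mx; congr (\det _); apply/matrixP => i j.
  by rewrite [LHS]mxE [P i j]mxE -[LHS]/((_ * _ + _ * _).[t]) !hornerE !mxE.
have [|t /andP[t0 t1]] := @poly_ivt R (- \det P) 0 1 ler01.
  rewrite !hornerN !ev subr0 scale1r scale0r addr0 det1 subrr scale0r add0r scale1r.
  by rewrite oppr_le0 ler01 oppr_ge0 ltW.
rewrite rootN /root ev => /eqP dt.
have Hp v : v != 0 -> 0 < bilin ((1 - t) *: 1%:M + t *: G) v v.
  move=> v0; have -> : bilin ((1 - t) *: 1%:M + t *: G) v v =
     (1 - t) * (v *m v^T) 0 0 + t * bilin G v v.
    by rewrite /bilin mulmxDr mulmxDl -!scalemxAr -!scalemxAl mulmx1 !mxE.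
  have vv : 0 < (v *m v^T) 0 0.
    have [j vj] : exists j, v 0 j != 0.
      by apply/rV0Pn.
    rewrite mxE (bigD1 j) //= !mxE ltr_pwDl //; first by rewrite -expr2 exprn_even_gt0.
    by apply: sumr_ge0 => k _; rewrite !mxE -expr2 sqr_ge0.
  have := Gp v0; move: t0; rewrite le_eqVlt => /orP[/eqP <-|tp gp].
    by rewrite subr0 mul1r mul0r addr0.
  by rewrite ltr_wpDl ?mulr_gt0 // mulr_ge0 ?subr_ge0 // ltW.
have [v v0 vK] : exists2 v : 'rV[R]_n, v != 0 & v *m ((1 - t) *: 1%:M + t *: G) = 0.
  apply/det0P; exact/eqP.
by have := Hp v v0; rewrite /bilin vK mul0mx mxE ltxx.
Qed.

End PosDef.

(** * Invariance of the Laplacian under changes of coordinates *)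

Section DeriveBig.
Variables (R : realType) (V : normedModType R) (x v : V).

Lemma is_derive_mul (f g : V -> R) (df dg : R) :
  is_derive x v f df -> is_derive x v g dg ->
  is_derive x v (fun y => f y * g y) (f x * dg + df * g x).
Proof.
move=> Hf Hg; have H := is_deriveM Hf Hg; apply: is_derive_eq.
by rewrite [X in _ + X = _](_ : _ = df * g x) // mulrC.
Qed.

Lemma is_derive_bigsum (I : Type) (r : seq I) (F : I -> V -> R) (dF : I -> R) :
  (forall i, is_derive x v (F i) (dF i)) ->
  is_derive x v (fun y => \sum_(i <- r) F i y) (\sum_(i <- r) dF i).
Proof.
move=> H; elim: r => [|i r IH].
  by rewrite big_nil; under eq_fun do rewrite big_nil; exact: is_derive_cst.
rewrite big_cons; under eq_fun do rewrite big_cons.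
exact: is_deriveD.
Qed.

Lemma is_derive_bigprod (I : eqType) (r : seq I) (F : I -> V -> R) (dF : I -> R) :
  uniq r -> (forall i, is_derive x v (F i) (dF i)) ->
  is_derive x v (fun y => \prod_(i <- r) F i y)
    (\sum_(i <- r) dF i * \prod_(j <- r | j != i) F j x).
Proof.
move=> ur H; elim: r ur => [|i r IH] /=.
  by rewrite big_nil; under eq_fun do rewrite big_nil; move=> _; exact: is_derive_cst.
move=> /andP[ir ur]; rewrite big_cons; under eq_fun do rewrite big_cons.
apply: is_derive_eq (is_derive_mul (H i) (IH ur)) _.
rewrite addrC; congr (_ + _).
  congr (_ * _); rewrite big_cons eqxx /= [LHS]big_seq [RHS]big_seq_cond.
  apply: eq_bigl => j; case: (boolP (j \in r)) => //= jr.
  by apply/esym; apply: contraNneq ir => <-.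
rewrite mulr_sumr [LHS]big_seq [RHS]big_seq; apply: eq_bigr => j jr.
rewrite big_cons ifT; first by rewrite mulrCA.
by apply: contraNneq ir => ->.
Qed.

(** In the Leibniz formula the product rule differentiates one row at a time; the terms for row [k]
    form the determinant with that row replaced, to be expanded along it. *)
Lemma jacobi_formula (m : nat) (A : V -> 'M[R]_m) (dA : 'M[R]_m) :
  (forall i j, is_derive x v (fun y => A y i j) (dA i j)) ->
  is_derive x v (fun y => \det (A y)) (\sum_k \sum_j dA k j * cofactor (A x) k j).
Proof.
move=> H; rewrite /determinant.
have K (s : 'S_m) : is_derive x v (fun y => (-1) ^+ s * \prod_i A y i (s i))
    ((-1) ^+ s * \sum_k dA k (s k) * \prod_(i | i != k) A x i (s i)).
  have P := is_derive_bigprod (index_enum_uniq 'I_m) (fun i => H i (s i)).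
  apply: is_derive_eq (is_derive_mul (is_derive_cst ((-1) ^+ s : R) x v) P) _.
  by rewrite mul0r addr0.
apply: is_derive_eq (is_derive_bigsum _ K) _.
under eq_bigr do rewrite mulr_sumr.
rewrite exchange_big /=; apply: eq_bigr => k _.
pose Ak : 'M[R]_m := \matrix_(i, j) (if i == k then dA k j else A x i j).
transitivity (\det Ak).
  rewrite /determinant; apply: eq_bigr => s _; congr (_ * _).
  rewrite [RHS](bigD1 k) //= mxE eqxx; congr (_ * _).
  by apply: eq_bigr => i /negPf ik; rewrite mxE ik.
rewrite (expand_det_row _ k); apply: eq_bigr => j _; rewrite mxE eqxx; congr (_ * _).
rewrite /cofactor; congr (_ * \det _); apply/matrixP => i l; rewrite !mxE.
by rewrite eq_sym (negPf (neq_lift _ _)).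
Qed.

End DeriveBig.

Section Invariance.
Variables (R : realType) (n : nat).
Local Notation E := 'rV[R]_n.
Local Notation e := (basis_vec R).
Implicit Types (f g : E -> R) (x y v : E) (i j : 'I_n) (O : set E) (B : R) (k : nat).

Lemma CBe_is_derive k O f x i : CBe k.+1 O f -> O x -> is_derive x (e i) f (pd i f x).
Proof. by move=> [B _ H] Ox; apply: DeriveDef => //; exact: CB_der H Ox. Qed.

Lemma CBe_continuous k O f x : CBe k O f -> O x -> {for x, continuous f}.
Proof. by move=> [B _ H] Ox; exact: CB_cont H Ox. Qed.

Lemma CBe_sqrt O f (c : R) : open O -> 0 < c -> (forall x, O x -> c <= f x) ->
  CBe 1 O f -> CBe 1 O (fun x => Num.sqrt (f x)).
Proof.
move=> oO c0 fc Hf; have [B B0 Cf] := Hf.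
have fp x : O x -> 0 < f x by move=> /fc; exact: lt_le_trans.
have sc0 : 0 < Num.sqrt c by rewrite sqrtr_gt0.
have cs x : O x -> {for x, continuous (fun x => Num.sqrt (f x))}.
  move=> Ox; apply: (@continuous_comp _ _ _ f (@Num.sqrt R)); first exact: CB_cont Cf Ox.
  exact: sqrt_continuous.
have ds x i : O x -> is_derive x (e i) (fun x => Num.sqrt (f x))
    ((2 * Num.sqrt (f x))^-1 * pd i f x).
  move=> Ox; have /derivable1P d1 := CB_der (i := i) Cf Ox.
  pose l (t : R) := f (t *: e i + x).
  have l0 : l 0 = f x by rewrite /l scale0r add0r.
  have dl : is_derive (0 : R) 1 l (pd i f x).
    apply: DeriveDef => //; rewrite /pd /derive.
    rewrite (_ : (fun h : R => h^-1 *: ((l \o shift 0) (h *: 1) - l 0)) =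
      (fun h : R => h^-1 *: ((f \o shift x) (h *: e i) - f x))) //.
    by apply/funext => t /=; rewrite /l addr0 scale0r add0r [t *: 1]mulr1.
  have dsq : is_derive (l 0) 1 (@Num.sqrt R) (2 * Num.sqrt (l 0))^-1.
    by apply: is_derive1_sqrt; rewrite l0 fp.
  have H : is_derive (0 : R) 1 (@Num.sqrt R \o l) ((2 * Num.sqrt (l 0))^-1 * pd i f x).
    exact: is_derive1_comp.
  rewrite l0 in H; have [d2 v2] := H.
  apply: DeriveDef; first exact/derivable1P.
  rewrite -v2 /derive.
  rewrite (_ : (fun h : R => h^-1 *: (((Num.sqrt \o l) \o shift 0) (h *: 1) - (Num.sqrt \o l) 0)) =
      (fun h : R => h^-1 *: (((fun x => Num.sqrt (f x)) \o shift x) (h *: e i) - Num.sqrt (f x)))) //.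
  by apply/funext => t /=; rewrite /l addr0 scale0r add0r [t *: 1]mulr1.
pose B1 := Num.sqrt B + (2 * Num.sqrt c)^-1 * B.
have s2 : 0 <= (2 * Num.sqrt c)^-1 * B.
  by rewrite mulr_ge0 // invr_ge0 mulr_ge0 // ltW.
exists B1; first by rewrite addr_ge0 // sqrtr_ge0.
split.
  move=> x Ox; split; first exact: cs.
  rewrite ger0_norm ?sqrtr_ge0 // ler_wpDr // ler_wsqrtr //.
  by apply: le_trans (ler_norm _) _; exact: CB_bound Cf Ox.
move=> i; split; first by move=> x Ox; have [] := ds x i Ox.
have H0 x : O x -> {for x, continuous (fun x => (2 * Num.sqrt (f x))^-1 * pd i f x)} /\
    `|(2 * Num.sqrt (f x))^-1 * pd i f x| <= B1.
  move=> Ox; split.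
    apply: (@continuousM _ _ (fun x => (2 * Num.sqrt (f x))^-1) (pd i f)); last first.
      exact: CB_cont (CB_pd i Cf) Ox.
    apply: continuousV; first by rewrite mulf_neq0 // gt_eqF // sqrtr_gt0 fp.
    apply: (@continuousM _ _ (fun=> 2) (fun x => Num.sqrt (f x))); last exact: cs.
    exact: cst_continuous.
  rewrite /B1 ler_wpDl ?sqrtr_ge0 // normrM ler_pM //.
    rewrite ger0_norm ?invr_ge0 ?mulr_ge0 ?sqrtr_ge0 //.
    rewrite lef_pV2 ?posrE ?mulr_gt0 ?sqrtr_gt0 ?fp //.
    by rewrite ler_pM2l // ler_wsqrtr // fc.
  exact: CB_bound (CB_pd i Cf) Ox.
split => // x Ox; have [c1 b1] := H0 x Ox.
have eqp y : O y -> (2 * Num.sqrt (f y))^-1 * pd i f y = pd i (fun x => Num.sqrt (f x)) y.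
  by move=> Oy; have [_ <-] := ds y i Oy.
by split; [exact: cont_eq oO Ox eqp c1|rewrite -eqp].
Qed.

Section Piola.
Variables (O : set E) (J : E -> 'M[R]_n) (x : E).
Hypothesis oO : open O.
Hypothesis Ox : O x.
Hypothesis HJ : forall i j, CBe 1 O (fun y => J y i j).
Hypothesis J0 : \det (J x) != 0.
Hypothesis Jsym : forall i j m, pd i (fun y => J y j m) x = pd j (fun y => J y i m) x.

Lemma CBe_adj k (A : E -> 'M[R]_n) : (forall i j, CBe k O (fun y => A y i j)) ->
  forall l i, CBe k O (fun y => (\adj (A y)) l i).
Proof.
move=> HA l i; apply: (@CBe_eq _ _ _ _ (fun y => cofactor (A y) i l)) => //.
  by move=> y _; rewrite mxE.
rewrite /cofactor; apply: CBe_mul => //; first exact: CBe_cst.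
apply: CBe_det => // i' j'.
by have := HA (lift i i') (lift l j'); apply: CBe_eq => // y _; rewrite !mxE.
Qed.

(** Piola identity: the adjugate of a Jacobian is divergence free. Differentiating adj J * J = det J
    gives the derivative of the adjugate, Jacobi's formula that of the determinant, and the two
    resulting sums cancel by the symmetry [Jsym] of second derivatives. *)
Lemma piola l : \sum_i pd i (fun y => (\adj (J y)) l i) x = 0.
Proof.
pose dJ i : 'M[R]_n := \matrix_(a, b) pd i (fun y => J y a b) x.
pose dA i : 'M[R]_n := \matrix_(a, b) pd i (fun y => (\adj (J y)) a b) x.
pose dD i := pd i (fun y => \det (J y)) x.
pose D := \det (J x); pose K := invmx (J x).
have Ju : J x \in unitmx by rewrite unitmxE unitfE.
have adjE : \adj (J x) = D *: K.
  by rewrite /K /invmx Ju scalerA divff // scale1r.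
have dDE i : dD i = D * \sum_a \sum_b dJ i a b * K b a.
  have H a b : is_derive x (e i) (fun y => J y a b) (dJ i a b).
    by rewrite mxE; exact: CBe_is_derive (HJ a b) Ox.
  have [_ E] := jacobi_formula H; rewrite /dD /pd E mulr_sumr.
  apply: eq_bigr => a _; rewrite mulr_sumr; apply: eq_bigr => b _.
  have -> : cofactor (J x) a b = D * K b a.
    by have := congr1 (fun A : 'M[R]_n => A b a) adjE; rewrite /= !mxE.
  by rewrite mulrCA.
have prod i : dA i *m J x + \adj (J x) *m dJ i = (dD i)%:M.
  apply/matrixP => a b; rewrite !mxE.
  have H c : is_derive x (e i) (fun y => (\adj (J y)) a c * J y c b)
     ((\adj (J x)) a c * dJ i c b + dA i a c * J x c b).
    rewrite [dJ i c b]mxE [dA i a c]mxE; apply: is_derive_mul.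
      exact: CBe_is_derive (CBe_adj HJ a c) Ox.
    exact: CBe_is_derive (HJ c b) Ox.
  have [_ E] := is_derive_bigsum (index_enum 'I_n) H.
  rewrite addrC -big_split /= -E.
  have -> : (fun y => \sum_c (\adj (J y)) a c * J y c b) =
            (fun y => \det (J y) * (a == b)%:R).
    apply/funext => y; have := congr1 (fun A : 'M[R]_n => A a b) (mul_adj_mx (J y)).
    by rewrite /= !mxE mulr_natr.
  have dd : is_derive x (e i) (fun y => \det (J y)) (dD i).
    exact: CBe_is_derive (CBe_det oO HJ) Ox.
  have [_ ->] := is_derive_mul dd (is_derive_cst ((a == b)%:R : R) x (e i)).
  by rewrite mulr0 add0r mulr_natr.
have dAE i : dA i = (dD i) *: K - \adj (J x) *m dJ i *m K.
  have : dA i *m J x = (dD i)%:M - \adj (J x) *m dJ i by rewrite -(prod i) addrK.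
  move=> /(congr1 (mulmx^~ K)); rewrite /= mulmxK // => ->.
  by rewrite mulmxBl mul_scalar_mx.
transitivity (\sum_i dA i l i); first by apply: eq_bigr => i _; rewrite mxE.
pose T i a b := dJ i a b * K b a * K l i.
transitivity (D * (\sum_i \sum_a \sum_b T i a b) -
              D * (\sum_i \sum_a \sum_b T i a b)); last by rewrite subrr.
have -> : \sum_i dA i l i = \sum_i (dD i * K l i) -
          \sum_i (\adj (J x) *m dJ i *m K) l i.
  by rewrite -sumrB; apply: eq_bigr => i _; rewrite dAE 3!mxE.
congr (_ - _).
  rewrite mulr_sumr; apply: eq_bigr => i _; rewrite dDE -mulrA; congr (_ * _).
  rewrite mulr_suml; apply: eq_bigr => a _; rewrite mulr_suml.
  by apply: eq_bigr => b _; rewrite /T.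
have -> : \sum_i \sum_a \sum_b T i a b = \sum_i \sum_a \sum_b T a i b.
  by rewrite exchange_big.
rewrite mulr_sumr; apply: eq_bigr => i _.
rewrite mxE exchange_big mulr_sumr /=; apply: eq_bigr => b _.
rewrite adjE -scalemxAl mxE mulr_sumr [in LHS]mxE mulr_sumr mulr_suml.
by apply: eq_bigr => a _; rewrite /T !mxE (Jsym i); ring.
Qed.

End Piola.

Definition lapl (G : E -> 'M[R]_n) f x : R :=
  (Num.sqrt (\det (G x)))^-1 *
  \sum_i pd i (fun y => Num.sqrt (\det (G y)) *
                        \sum_j invmx (G y) i j * pd j f y) x.

(** Rows are directions of differentiation, as in [transition_jacobian]; in this convention a metric
    pulls back as J G J^T and gradients as J times a column. *)
Definition jac (Psi : E -> E) x : 'M[R]_n := \matrix_(i, j) pd i (fun y => Psi y 0 j) x.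

Section Transform.
Variables (O O' : set E) (Psi : E -> E) (G G' : E -> 'M[R]_n) (w : E -> R) (c : R).
Hypotheses (oO : open O) (oO' : open O').
Hypothesis OO : forall x, O x -> O' (Psi x).
Hypothesis HPsi : forall j, CBe 2 O (fun x => Psi x 0 j).
Hypothesis HG' : forall i j, CBe 1 O' (fun x => G' x i j).
Hypothesis c0 : 0 < c.
Hypothesis dG' : forall x, O' x -> c <= \det (G' x).
Hypothesis Hw : CBe 2 O' w.
Hypothesis GE : forall x, O x -> G x = jac Psi x *m G' (Psi x) *m (jac Psi x)^T.
Hypothesis J0 : forall x, O x -> \det (jac Psi x) != 0.

Lemma pd_comp k f x i : O x -> CBe k.+1 O' f ->
  pd i (fun y => f (Psi y)) x = \sum_m jac Psi x i m * pd m f (Psi x).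
Proof.
move=> Ox [B B0 Hf].
have H : is_derive x (e i) (f \o Psi)
    (\sum_j pd i (fun z => Psi z 0 j) x * pd j f (Psi x)).
  apply: (chain_rule oO' (OO Ox)).
  - by move=> j y Oy; exact: CB_der Hf Oy.
  - by move=> j; exact: CB_cont (CB_pd j Hf) (OO Ox).
  - by move=> j; have [B' _ H] := HPsi j; exact: CB_der H Ox.
transitivity (\sum_j pd i (fun z => Psi z 0 j) x * pd j f (Psi x)); first by case: H.
by apply: eq_bigr => m _; rewrite mxE.
Qed.

(** The weighted gradient of the composite is, up to the sign of det J, the adjugate applied to the
    weighted gradient [P] of [w] at [Psi]. In its divergence the derivatives of the adjugate cancel
    by [piola], and adj J * J = det J leaves the divergence of [P]. *)
Lemma lapl_transform x : O x -> lapl G (fun y => w (Psi y)) x = lapl G' w (Psi x).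
Proof.
move=> Ox; pose J := jac Psi; pose rho' y := Num.sqrt (\det (G' y)).
pose P l y := rho' y * \sum_m invmx (G' y) l m * pd m w y.
have HJ i j : CBe 1 O (fun y => J y i j).
  by apply: CBe_eq (CBe_pd i (HPsi j)) => // y _; rewrite mxE.
have dGp y : O' y -> 0 < \det (G' y) by move=> /dG'; exact: lt_le_trans.
have HP l : CBe 1 O' (P l).
  apply: CBe_mul => //; first by apply: (CBe_sqrt oO' c0 dG'); exact: CBe_det.
  apply: CBe_sum => // m; apply: CBe_mul => //; last exact: CBe_pd.
  apply: (CBe_invmx oO' c0) => // y Oy; rewrite ger0_norm ?dG' // ltW //; exact: dGp.
pose D y := \det (J y); pose sg : R := Num.sg (D x).
have sgD : `|D x| = sg * D x by rewrite /sg normrEsg.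
have D0 : D x != 0 := J0 Ox.
have sg1 : sg * sg = 1 by rewrite /sg -expr2 sqr_sg D0.
have cD : {for x, continuous D} := CBe_continuous (CBe_det oO HJ) Ox.
(* The sign of det J is constant near [x], so the absolute value from the square root of det G can
   be differentiated. *)
have nearD : \forall y \near x, O y /\ `|D y| = sg * D y.
  have sD : 0 < `|D x| by rewrite normr_gt0.
  have N1 : \forall y \near x, `|D x - D y| < `|D x|.
    by have /(@cvgrPdist_lt _ _ _ (nbhs x) (nbhs_filter x))/(_ _ sD) := cD.
  have N2 : \forall y \near x, O y by exact: open_nbhs_nbhs.
  apply: filterS (filterI N1 N2) => y [H Oy]; split => //.
  have : 0 < sg * D y.
    have : `|sg * D x - sg * D y| < sg * D x.
      by rewrite -mulrBr normrM -sgD /sg normr_sg D0 mul1r.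
    by rewrite ltr_distlC => /andP[]; rewrite subrr.
  move=> H1; rewrite -[RHS]gtr0_norm // normrM /sg normr_sg D0 mul1r //.
have GdetE y : O y -> Num.sqrt (\det (G y)) = `|D y| * rho' (Psi y).
  move=> Oy; rewrite GE // !det_mulmx det_tr -/(J y) -/(D y).
  rewrite mulrAC -expr2 sqrtrM ?sqr_ge0 // sqrtr_sqr //.
have innerE y i : O y -> `|D y| = sg * D y ->
   Num.sqrt (\det (G y)) * (\sum_j invmx (G y) i j * pd j (fun y => w (Psi y)) y) =
   sg * \sum_l (\adj (J y)) l i * P l (Psi y).
  move=> Oy Dy; rewrite GdetE // Dy.
  have Ju : J y \in unitmx by rewrite unitmxE unitfE J0.
  have Gu : G' (Psi y) \in unitmx by rewrite unitmxE unitfE gt_eqF // dGp //; exact: OO.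
  pose gr : 'cV[R]_n := \col_m pd m w (Psi y).
  pose gy : 'cV[R]_n := \col_j pd j (fun y => w (Psi y)) y.
  have gyE : gy = J y *m gr.
    apply/colP => j; rewrite mxE (pd_comp j Oy Hw) mxE.
    by apply: eq_bigr => m _; rewrite !mxE.
  have iG : invmx (G y) = (invmx (J y))^T *m invmx (G' (Psi y)) *m invmx (J y).
    have Gyu : G y \in unitmx by rewrite GE // !unitmx_mul unitmx_tr Ju Gu.
    apply: (can_inj (mulmxK Gyu)); rewrite mulVmx // GE // -/(J y) !mulmxA.
    rewrite mulmxKV // -!mulmxA; rewrite (mulmxA (invmx (G' _))) mulVmx // mul1mx.
    by rewrite trmx_inv mulVmx // unitmx_tr.
  have -> : \sum_j invmx (G y) i j * pd j (fun y => w (Psi y)) y = (invmx (G y) *m gy) i 0.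
    by rewrite mxE; apply: eq_bigr => j _; rewrite mxE.
  have -> : invmx (G y) *m gy = (invmx (J y))^T *m (invmx (G' (Psi y)) *m gr).
    by rewrite gyE iG -!mulmxA; congr (_ *m (_ *m _)); rewrite mulKmx.
  rewrite mxE -!mulrA; congr (_ * _); rewrite mulr_sumr mulr_sumr.
  apply: eq_bigr => l _.
  have -> : (\adj (J y)) l i = D y * invmx (J y) l i.
    by rewrite /invmx Ju [X in _ = _ * X]mxE mulrA divff ?mul1r // J0.
  rewrite mxE /P -!mulrA; congr (_ * _); rewrite mulrCA; congr (_ * (_ * _)).
  by rewrite mxE; apply: eq_bigr => m _; rewrite mxE.
have dE i : is_derive x (e i) (fun y => sg * \sum_l (\adj (J y)) l i * P l (Psi y))
    (sg * \sum_l ((\adj (J x)) l i * (\sum_m J x i m * pd m (P l) (Psi x)) +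
                  pd i (fun y => (\adj (J y)) l i) x * P l (Psi x))).
  have H l : is_derive x (e i) (fun y => (\adj (J y)) l i * P l (Psi y))
     ((\adj (J x)) l i * (\sum_m J x i m * pd m (P l) (Psi x)) +
                  pd i (fun y => (\adj (J y)) l i) x * P l (Psi x)).
    apply: is_derive_mul; first exact: CBe_is_derive (CBe_adj oO HJ l i) Ox.
    rewrite -(pd_comp i Ox (HP l)).
    have : CBe 1 O (fun y => P l (Psi y)).
      by apply: (CBe_comp oO oO' OO) => // j; exact: CBe_leq (HPsi j).
    by move=> H; exact: CBe_is_derive H Ox.
  have H2 := is_derive_mul (is_derive_cst sg x (e i)) (is_derive_bigsum (index_enum 'I_n) H).
  by apply: is_derive_eq H2 _; rewrite mul0r addr0.
have step i : pd i (fun y => Num.sqrt (\det (G y)) *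
      \sum_j invmx (G y) i j * pd j (fun y => w (Psi y)) y) x =
    sg * \sum_l ((\adj (J x)) l i * (\sum_m J x i m * pd m (P l) (Psi x)) +
                  pd i (fun y => (\adj (J y)) l i) x * P l (Psi x)).
  have [_ <-] := dE i; apply: near_eq_derive.
  by apply: filterS nearD => y [Oy Dy]; exact: innerE.
have lE : lapl G (fun y => w (Psi y)) x = (Num.sqrt (\det (G x)))^-1 * \sum_i
    (sg * \sum_l ((\adj (J x)) l i * (\sum_m J x i m * pd m (P l) (Psi x)) +
                  pd i (fun y => (\adj (J y)) l i) x * P l (Psi x))).
  rewrite /lapl; congr (_ * _); apply: eq_bigr => i _; exact: step.
rewrite lE {lE}.
rewrite -mulr_sumr exchange_big /=.
have Jsym i j m : pd i (fun y => J y j m) x = pd j (fun y => J y i m) x.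
  have F a b : pd a (fun y => J y b m) x = pd a (pd b (fun y => Psi y 0 m)) x.
    by apply: (pd_eq _ oO Ox) => y _; rewrite mxE.
  have [B _ HB] := HPsi m.
  by rewrite !F; exact: schwarz oO Ox HB.
have S l : \sum_i ((\adj (J x)) l i * (\sum_m J x i m * pd m (P l) (Psi x)) +
                  pd i (fun y => (\adj (J y)) l i) x * P l (Psi x)) =
           D x * pd l (P l) (Psi x).
  rewrite big_split /= -[X in _ + X]mulr_suml (piola oO Ox HJ D0 Jsym) mul0r addr0.
  under eq_bigr do rewrite mulr_sumr.
  rewrite exchange_big /=.
  transitivity (\sum_m (\adj (J x) *m J x) l m * pd m (P l) (Psi x)).
    apply: eq_bigr => m _; rewrite mxE mulr_suml.
    by apply: eq_bigr => i _; rewrite mulrA.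
  rewrite mul_adj_mx (bigD1 l) //= mxE eqxx mulr1n [X in _ + X]big1 ?addr0 //.
  by move=> m ml; rewrite mxE eq_sym (negPf ml) mulr0n mul0r.
rewrite (eq_bigr _ (fun l _ => S l)).
have sn0 : sg * D x != 0 by rewrite -sgD normr_eq0.
have alg (a r s : R) : a != 0 -> (a * r)^-1 * (a * s) = r^-1 * s.
  by move=> a0; rewrite invfM mulrACA mulVf // mul1r.
by rewrite /lapl -mulr_sumr GdetE // sgD (mulrA sg) alg.
Qed.

End Transform.
End Invariance.

(** * Sampling on a cube cut by a hyperplane *)

Section SplitCube.
Variables (R : realType) (n : nat) (i0 : 'I_n).
Local Notation E := 'rV[R]_n.
Local Notation e := (basis_vec R).
Variables (z : E) (r : R).
Implicit Types (f g w : E -> R) (x y v : E) (i j : 'I_n) (B : R) (k : nat).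

(** The plane is removed because functions and coefficients extended by reflection are only
    Lipschitz, respectively C^1 with Lipschitz gradient, across it. *)
Definition split_cube : set E := [set x | `|x - z| < r /\ x 0 i0 != 0].
Local Notation O := split_cube.

Lemma open_split_cube : open O.
Proof.
have -> : O = ball z r `&` (fun x : E => x 0 i0) @^-1` [set t | t != 0].
  by apply/seteqP; split => x /=; rewrite -ball_normE /= distrC.
apply: openI; first exact: ball_open.
apply: open_comp; first by move=> x _; exact: coord_continuous.
exact: open_neq.
Qed.

Lemma cube_convex x v (tau : 'I_n -> R) (p : E) : `|x - z| < r -> `|x + v - z| < r ->
  (forall j, 0 <= tau j <= 1) -> (forall j, p 0 j = x 0 j + tau j * v 0 j) -> `|p - z| < r.
Proof.
move=> xr yr t01 pE; apply: (@le_lt_trans _ _ (Num.max `|x - z| `|x + v - z|)).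
  apply: norm_leP; first by rewrite le_max normr_ge0.
  move=> j; rewrite !mxE pE; have /andP[t0 t1] := t01 j.
  have -> : x 0 j + tau j * v 0 j - z 0 j =
    (1 - tau j) * (x - z) 0 j + tau j * (x + v - z) 0 j by rewrite !mxE; ring.
  set m := Num.max _ _.
  have b1 : `|(x - z) 0 j| <= m.
    by rewrite /m le_max; apply/orP; left; exact: coord_le_norm.
  have b2 : `|(x + v - z) 0 j| <= m.
    by rewrite /m le_max; apply/orP; right; exact: coord_le_norm.
  apply: le_trans (ler_normD _ _) _; rewrite !normrM (ger0_norm t0).
  rewrite ger0_norm ?subr_ge0 //.
  have -> : m = (1 - tau j) * m + tau j * m by ring.
  by apply: lerD; apply: ler_wpM2l; rewrite ?subr_ge0.
by rewrite gt_max xr yr.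
Qed.

Lemma line_in_cube x i (s t : R) : `|x - z| < r -> `|x + s *: e i - z| < r ->
  0 <= t <= 1 -> `|x + (t * s) *: e i - z| < r.
Proof.
move=> xr yr t01; apply: (@cube_convex x (s *: e i) (fun=> t)) => // j.
by rewrite shift_coord [in RHS]mxE basisE; case: eqP; rewrite ?mulr1 ?mulr0 ?addr0.
Qed.

(* The two points may lie on different sides of the hyperplane. *)
Definition LL B f : Prop := forall x i (s : R), O x -> O (x + s *: e i) ->
  `|f (x + s *: e i) - f x| <= B * `|s|.

Lemma LL_le B B' f : B <= B' -> LL B f -> LL B' f.
Proof.
move=> BB H x i s Ox Oy; apply: le_trans (H x i s Ox Oy) _.
by rewrite ler_wpM2r.
Qed.

Lemma LL_add B B' f g : LL B f -> LL B' g -> LL (B + B') (fun x => f x + g x).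
Proof.
move=> Hf Hg x i s Ox Oy; rewrite mulrDl.
have -> : f (x + s *: e i) + g (x + s *: e i) - (f x + g x) =
  (f (x + s *: e i) - f x) + (g (x + s *: e i) - g x).
  by rewrite opprD addrACA.
by apply: le_trans (ler_normD _ _) _; apply: lerD; [exact: Hf|exact: Hg].
Qed.

Lemma LL_mul B B' C C' f g : LL B f -> LL B' g ->
  (forall x, O x -> `|f x| <= C) -> (forall x, O x -> `|g x| <= C') ->
  LL (C * B' + B * C') (fun x => f x * g x).
Proof.
move=> Hf Hg fC gC x i s Ox Oy.
have alg (a b a' b' : R) : a' * b' - a * b = a' * (b' - b) + (a' - a) * b by ring.
rewrite alg; apply: le_trans (ler_normD _ _) _; rewrite !normrM.
rewrite mulrDl -[C * B' * _]mulrA [B * C' * _]mulrAC.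
by apply: lerD; apply: ler_pM => //; [exact: fC|exact: Hg|exact: Hf|exact: gC].
Qed.

Lemma line_same_side x i (s : R) : O x -> O (x + s *: e i) ->
  0 < x 0 i0 * (x + s *: e i) 0 i0 ->
  forall t, 0 <= t <= 1 -> O (x + (t * s) *: e i).
Proof.
move=> [xr x0] [yr y0] xy t t01; split; first exact: line_in_cube.
move: xy; rewrite !shift_coord; case: ifP => [_|_ _]; last by rewrite addr0.
move=> xy; have /andP[t0 t1] := t01.
have H : 0 < x 0 i0 * (x 0 i0 + t * s).
  have -> : x 0 i0 * (x 0 i0 + t * s) =
    (1 - t) * x 0 i0 ^+ 2 + t * (x 0 i0 * (x 0 i0 + s)) by ring.
  have x2 : 0 < x 0 i0 ^+ 2 by rewrite exprn_even_gt0.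
  move: t0; rewrite le_eqVlt => /orP[/eqP <-|tp]; first by rewrite subr0 mul1r mul0r addr0.
  by apply: ltr_wpDl; [rewrite mulr_ge0 ?subr_ge0 // ltW|exact: mulr_gt0].
by apply: contraTneq H => ->; rewrite mulr0 ltxx.
Qed.

Lemma mvt_same_side B w x i (s : R) : CB B 1 O w -> O x -> O (x + s *: e i) ->
  0 < x 0 i0 * (x + s *: e i) 0 i0 ->
  exists t, [/\ 0 <= t <= 1, O (x + (t * s) *: e i) &
     w (x + s *: e i) - w x = s * pd i w (x + (t * s) *: e i)].
Proof.
move=> Hw Ox Oy xy; have L := line_same_side Ox Oy xy.
have [t t01 Et] : exists2 t, 0 <= t <= 1 &
    w (x + s *: e i) - w x = s * pd i w (x + (t * s) *: e i).
  by apply: MVT_line => t t01; exact: CB_der Hw (L t t01).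
by exists t; split => //; exact: L.
Qed.

(** On either side of the plane the mean value theorem applies and the derivative is Lipschitz even
    across it. If the segment crosses, a short piece around the crossing is bridged by the Lipschitz
    bound on [w] and then shrunk. *)
Lemma line_taylor B w x i (s : R) : 0 <= B -> CB B 1 O w -> LL B w -> LL B (pd i w) ->
  O x -> O (x + s *: e i) ->
  `|w (x + s *: e i) - w x - s * pd i w x| <= B * s ^+ 2.
Proof.
move=> B0 Hw Lw Lp Ox Oy.
have same y (u : R) : O y -> O (y + u *: e i) -> 0 < y 0 i0 * (y + u *: e i) 0 i0 ->
    (forall t, 0 <= t <= 1 -> exists2 c, `|c| <= `|s| & y + (t * u) *: e i = x + c *: e i) ->
    `|w (y + u *: e i) - w y - u * pd i w x| <= B * `|s| * `|u|.
  move=> Oy' Ou yu H; have [t [t01 Ot ->]] := mvt_same_side Hw Oy' Ou yu.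
  rewrite -mulrBr normrM mulrC ler_wpM2r //.
  have [c cs cE] := H t t01; rewrite cE in Ot *.
  by apply: le_trans (Lp x i c Ox Ot) _; rewrite ler_wpM2l.
have s2 : s ^+ 2 = `|s| * `|s| by rewrite -normrM -expr2 ger0_norm ?sqr_ge0.
have [xy|] := ltP 0 (x 0 i0 * (x + s *: e i) 0 i0).
  rewrite s2 mulrA; apply: same => // t /andP[t0 t1].
  by exists (t * s) => //; rewrite normrM ger0_norm // ler_piMl.
have [_ x0] := Ox; have [_ y0] := Oy.
move: y0; rewrite shift_coord; case: ifP => [/eqP ii0 y0|_ y0]; last first.
  have x2 : 0 < x 0 i0 ^+ 2 by rewrite exprn_even_gt0.
  by rewrite addr0 -expr2 leNgt x2.
subst i => xy0; pose xi := x 0 i0.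
have xy : xi * (xi + s) < 0 by rewrite lt_neqAle xy0 mulf_neq0.
have s0 : s != 0.
  apply: contraTneq xy => ->; rewrite addr0 -expr2 -leNgt; exact: sqr_ge0.
apply/ler_addgt0Pr => eps e0.
(* Relative length of the bridged piece, from parameter [a] to [b] around the crossing [c]; its
   total cost 2 B |s| tau is below [eps]. *)
pose tau := Num.min (1 / 2) (eps / (2 * B * `|s| + 1)).
have den : 0 < 2 * B * `|s| + 1 by rewrite ltr_wpDl // !mulr_ge0.
have tau0 : 0 < tau by rewrite lt_min !divr_gt0.
have tauh : tau <= 1 / 2 by rewrite ge_min lexx.
have taue : 2 * B * `|s| * tau <= eps.
  apply: (@le_trans _ _ ((2 * B * `|s| + 1) * (eps / (2 * B * `|s| + 1)))); last first.
    by rewrite mulrC divfK // gt_eqF.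
  apply: ler_pM; rewrite ?mulr_ge0 ?(ltW tau0) //; first by rewrite lerDl.
  by rewrite /tau ge_min lexx orbT.
pose c := - xi / s.
have c01 : 0 < c < 1.
  have : 0 < c * (1 - c).
    have -> : c * (1 - c) = - (xi * (xi + s)) / s ^+ 2.
      by rewrite /c; field.
    by rewrite divr_gt0 ?oppr_gt0 // exprn_even_gt0.
  by move=> H; apply/andP; split; nra.
have /andP[c0 c1] := c01.
have xiE : xi = - (c * s) by rewrite /c divfK // opprK.
pose a := c * (1 - tau); pose b := c + tau * (1 - c).
have a01 : 0 <= a <= 1 by rewrite /a; apply/andP; split; nra.
have b01 : 0 <= b <= 1 by rewrite /b; apply/andP; split; nra.
have ab : b - a = tau by rewrite /a /b; ring.
have [[xr _] [yr _]] := (Ox, Oy).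
have Opt t : 0 <= t <= 1 -> t != c -> O (x + (t * s) *: e i0).
  move=> t01 tc; split; first exact: line_in_cube.
  rewrite shift_coord eqxx -/xi xiE -mulNr -mulrDl mulf_neq0 //.
  by rewrite addrC subr_eq0.
have ca : a != c by rewrite /a; apply/eqP => H; nra.
have cb : b != c by rewrite /b; apply/eqP => H; nra.
have Oa := Opt a a01 ca; have Ob := Opt b b01 cb.
have shift (t t' : R) : x + (t * s) *: e i0 + ((t' - t) * s) *: e i0 = x + (t' * s) *: e i0.
  by rewrite -addrA -scalerDl -mulrDl; congr (_ + (_ * _) *: _); ring.
have E1 : `|w (x + (a * s) *: e i0) - w x - (a * s) * pd i0 w x| <= B * `|s| * `|a * s|.
  apply: same => //.
    rewrite shift_coord eqxx -/xi xiE.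
    have -> : - (c * s) * (- (c * s) + a * s) = c * (c - a) * s ^+ 2 by ring.
    rewrite mulr_gt0 // ?exprn_even_gt0 // mulr_gt0 // /a; nra.
  move=> t /andP[t0 t1]; exists (t * (a * s)) => //.
  have /andP[a0 a1] := a01.
  by rewrite (normrM t) (normrM a) (ger0_norm t0) (ger0_norm a0) mulrA ler_piMl // mulr_ile1.
have E2 : `|w (x + s *: e i0) - w (x + (b * s) *: e i0) - ((1 - b) * s) * pd i0 w x|
     <= B * `|s| * `|(1 - b) * s|.
  have H := shift b 1; rewrite mul1r in H; rewrite -H.
  apply: same => //; first by rewrite H.
    rewrite H !shift_coord eqxx -/xi xiE.
    have -> : (- (c * s) + b * s) * (- (c * s) + s) = (1 - c) * (b - c) * s ^+ 2 by ring.
    rewrite mulr_gt0 // ?exprn_even_gt0 // mulr_gt0 // ?subr_gt0 // /b; nra.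
  move=> t /andP[t0 t1]; exists ((b + t * (1 - b)) * s); last first.
    by rewrite -addrA -scalerDl; congr (_ + _ *: _); ring.
  have /andP[b0 b1] := b01.
  have q0 : 0 <= b + t * (1 - b) by nra.
  rewrite normrM (ger0_norm q0) ler_piMl //; nra.
have E3 : `|w (x + (b * s) *: e i0) - w (x + (a * s) *: e i0)| <= B * `|(b - a) * s|.
  by rewrite -(shift a b); apply: Lw => //; rewrite shift.
have Pb : `|pd i0 w x| <= B := CB_bound (CB_pd i0 Hw) Ox.
set P := pd i0 w x in E1 E2 Pb *.
set w1 := w (x + s *: e i0) in E2 *; set wb := w (x + (b * s) *: e i0) in E2 E3.
set wa := w (x + (a * s) *: e i0) in E1 E3; set wx := w x in E1 *.
have -> : w1 - wx - s * P = (wa - wx - a * s * P) + (w1 - wb - (1 - b) * s * P)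
   + (wb - wa) - (b - a) * s * P by ring.
have na : `|a * s| = a * `|s| by rewrite normrM ger0_norm //; case/andP: a01.
have nb : `|(1 - b) * s| = (1 - b) * `|s|.
  by rewrite normrM ger0_norm // subr_ge0; case/andP: b01.
have nab : `|(b - a) * s| = tau * `|s| by rewrite ab normrM gtr0_norm.
apply: le_trans (ler_normB _ _) _; apply: le_trans (lerD (ler_normD _ _) (lexx _)) _.
apply: le_trans (lerD (lerD (ler_normD _ _) (lexx _)) (lexx _)) _.
have E4 : `|(b - a) * s * P| <= tau * `|s| * B.
  by rewrite normrM nab ler_wpM2l // mulr_ge0 // ltW.
rewrite na in E1; rewrite nb in E2; rewrite nab in E3.
apply: le_trans (lerD (lerD (lerD E1 E2) E3) E4) _.
have bE : b = a + tau by rewrite -ab; ring.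
rewrite s2 bE.
set S := `|s| in taue *.
have -> : B * S * (a * S) + B * S * ((1 - (a + tau)) * S) + B * (tau * S) + tau * S * B =
  B * (S * S) - tau * (B * (S * S)) + 2 * B * S * tau by ring.
have S0 : 0 <= S by exact: normr_ge0.
have := mulr_ge0 (ltW tau0) (mulr_ge0 B0 (mulr_ge0 S0 S0)).
move: taue; move: (2 * B * S * tau) (tau * (B * (S * S))) (B * (S * S)) => A1 A2 A3.
lra.
Qed.

Lemma lip_side B f x y : 0 <= B -> CB B 1 O f -> O x -> O y -> 0 < x 0 i0 * y 0 i0 ->
  `|f y - f x| <= n%:R * B * `|y - x|.
Proof.
move=> B0 Hf Ox Oy xy; pose v := y - x.
have yE : y = x + v by rewrite /v addrC subrK.
have [[xr x0] [yr y0]] := (Ox, Oy).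
have Op (tau : 'I_n -> R) (p : E) : (forall j, 0 <= tau j <= 1) ->
    (forall j, p 0 j = x 0 j + tau j * v 0 j) -> O p.
  move=> t01 pE; split; first by apply: (cube_convex xr _ t01 pE); rewrite -yE.
  rewrite pE; have /andP[t0 t1] := t01 i0.
  have H : 0 < x 0 i0 * (x 0 i0 + tau i0 * v 0 i0).
    have -> : x 0 i0 * (x 0 i0 + tau i0 * v 0 i0) =
      (1 - tau i0) * x 0 i0 ^+ 2 + tau i0 * (x 0 i0 * y 0 i0).
      by rewrite /v !mxE; ring.
    have x2 : 0 < x 0 i0 ^+ 2 by rewrite exprn_even_gt0.
    move: t0; rewrite le_eqVlt => /orP[/eqP <-|tp]; first by rewrite subr0 mul1r mul0r addr0.
    by apply: ltr_wpDl; [rewrite mulr_ge0 ?subr_ge0 // ltW|exact: mulr_gt0].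
  by apply: contraTneq H => ->; rewrite mulr0 ltxx.
rewrite {1}yE path_telescope.
have -> : n%:R * B * `|y - x| = \sum_(i < n) B * `|y - x|.
  by rewrite sumr_const card_ord -[RHS]mulr_natl mulrA.
apply: le_trans (ler_norm_sum _ _ _) _; apply: ler_sum => i _.
rewrite uptoS addrA.
have step t : 0 <= t <= 1 -> O (x + upto v i + (t * v 0 i) *: e i).
  move=> t01; apply: (Op (fun j => if (j < i)%N then 1 else if j == i then t else 0)).
    by move=> j; case: ifP => _; [|case: ifP => _ //]; rewrite ler01 lexx.
  move=> j; rewrite shift_coord !mxE -val_eqE /=.
  by have [ji|ij|/val_inj ->] := ltngtP (j : nat) i; rewrite ?mul1r ?mul0r ?addr0.
have [t t01 ->] : exists2 t, 0 <= t <= 1 &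
    f (x + upto v i + v 0 i *: e i) - f (x + upto v i) =
    v 0 i * pd i f (x + upto v i + (t * v 0 i) *: e i).
  by apply: MVT_line => t t01; exact: CB_der Hf (step t t01).
rewrite normrM mulrC; apply: ler_pM => //; last exact: coord_le_norm.
exact: CB_bound (CB_pd i Hf) (step t t01).
Qed.

End SplitCube.

(** * Sampling on the lattice of cell centres *)

Section Sampling.
Variables (R : realType) (n : nat) (i0 : 'I_n) (m : nat).
Local Notation E := 'rV[R]_n.
Local Notation e := (basis_vec R).
Let M := m.+2.
Let G := 'rV['I_M]_n.
Variables (z : E) (r : R).
Hypothesis r0 : 0 < r.
Implicit Types (x y : E) (k : G) (i j : 'I_n).

Definition mesh : R := 2 * r / M%:R.
Local Notation h := mesh.

Definition pt k : E := \row_i (z 0 i - r + ((k 0 i)%:R + 1 / 2) * h).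

Local Notation O := (split_cube i0 z r).
Local Notation ax i := (axis i (1 : 'I_M)).
Local Notation D := (fdiff (fun i : 'I_n => ax i) h).
Local Notation Ds := (bdiff (fun i : 'I_n => ax i) h).

Let M0 : 0 < M%:R :> R. Proof. by rewrite ltr0n. Qed.

Lemma mesh_gt0 : 0 < h.
Proof. by rewrite /h divr_gt0 // mulr_gt0. Qed.
Let h0 := mesh_gt0.

Let Mh : M%:R * h = 2 * r.
Proof. by rewrite /h mulrC divfK // gt_eqF. Qed.

Lemma pt_coord_bound k i : `|(pt k - z) 0 i| <= r - h / 2.
Proof.
rewrite !mxE.
have k0 : 0 <= (k 0 i)%:R :> R by rewrite ler0n.
have kM : (k 0 i)%:R + 1 <= M%:R :> R by rewrite natr1 ler_nat ltn_ord.
have lo : 0 <= (k 0 i)%:R * h by rewrite mulr_ge0 // ltW.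
have hi : (k 0 i)%:R * h + h <= 2 * r by rewrite -Mh -[X in _ + X <= _]mul1r -mulrDl ler_pM2r.
set c := (k 0 i)%:R in lo hi *.
have -> : z 0 i - r + (c + 1 / 2) * h - z 0 i = c * h + h / 2 - r by ring.
rewrite ler_norml; move: lo hi; move: (c * h) => ch; lra.
Qed.

Lemma pt_norm_bound k : `|pt k - z| <= r - h / 2.
Proof.
apply: norm_leP; last exact: pt_coord_bound.
have h2r : h <= r.
  by rewrite /h ler_pdivrMr // mulrC ler_pM2l // ler_nat.
by move: h2r r0; lra.
Qed.

Lemma pt_in_cube k : `|pt k - z| < r.
Proof. by apply: le_lt_trans (pt_norm_bound k) _; move: h0; lra. Qed.

Lemma val_succ (s : 'I_M) : (s.+1 < M)%N -> nat_of_ord (s + 1) = s.+1.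
Proof. by move=> sM; rewrite /= addn1 modn_small. Qed.

Lemma pt_succ k i : ((k 0%R i).+1 < M)%N -> pt (k + ax i) = pt k + h *: e i.
Proof.
move=> kM; apply/rowP => j; rewrite shift_coord !mxE.
case: eqP => [->|_]; last by rewrite !addr0.
by rewrite val_succ // -natr1; ring.
Qed.

Lemma pt_succ_wrap k i : (k 0%R i).+1 = M ->
  (pt k - z) 0 i = r - h / 2 /\ (pt (k + ax i) - z) 0 i = - (r - h / 2).
Proof.
move=> kM; rewrite !mxE eqxx.
have -> : nat_of_ord (k 0 i + 1) = 0%N by rewrite /= addn1 kM modnn.
have kE : (k 0 i)%:R = M%:R - 1 :> R by move: (congr1 (fun t : nat => t%:R : R) kM); rewrite -natr1 => <-; rewrite addrK.
split; last by field.
rewrite kE; have -> : z 0 i - r + (M%:R - 1 + 1 / 2) * h - z 0 i = M%:R * h - h / 2 - r.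
  by field.
by rewrite Mh; field.
Qed.

Lemma pt_step k i : `|pt k - z| < r - h / 2 -> pt (k + ax i) = pt k + h *: e i.
Proof.
move=> H; apply: pt_succ; have := ltn_ord (k 0 i).
rewrite ltnS leq_eqVlt => /orP[/eqP kE|//].
have [E1 _] := pt_succ_wrap (i := i) (congr1 succn kE).
have := coord_le_norm (pt k - z) i; rewrite E1.
by move=> /(le_trans (ler_norm _)) H1; move: (le_lt_trans H1 H); rewrite ltxx.
Qed.

Lemma pt_norm_step k i : `|pt k - z| - h <= `|pt (k + ax i) - z|.
Proof.
have := ltn_ord (k 0 i); rewrite leq_eqVlt => /orP[/eqP kE|kM].
  have [_ E2] := pt_succ_wrap kE.
  have := coord_le_norm (pt (k + ax i) - z) i; rewrite E2 normrN.
  move=> /(le_trans (ler_norm _)).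
  by have := pt_norm_bound k; move: h0; lra.
rewrite (pt_succ kM) lerBlDr.
have -> : pt k - z = (pt k + h *: e i - z) - h *: e i.
  by rewrite addrAC addrK.
apply: le_trans (ler_normB _ _) _; rewrite lerD2l.
by apply: le_trans (norm_scale_basis _ _) _; rewrite gtr0_norm.
Qed.

Lemma pt_back k i : `|pt k - z| < r - h / 2 -> pt (k - ax i) = pt k + (- h) *: e i.
Proof.
move=> H; set k' := k - ax i.
have kE : k = k' + ax i by rewrite /k' subrK.
have := ltn_ord (k' 0 i); rewrite leq_eqVlt => /orP[/eqP k'E|kM].
  have [_ E2] := pt_succ_wrap k'E; rewrite -kE in E2.
  have := coord_le_norm (pt k - z) i; rewrite E2 normrN.
  by move=> /(le_trans (ler_norm _)) H1; move: (le_lt_trans H1 H); rewrite ltxx.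
by rewrite kE (pt_succ kM) scaleNr addrK.
Qed.

Lemma pt_norm_back k i : `|pt k - z| - h <= `|pt (k - ax i) - z|.
Proof.
set k' := k - ax i; have kE : k = k' + ax i by rewrite /k' subrK.
have := ltn_ord (k' 0 i); rewrite leq_eqVlt => /orP[/eqP k'E|kM].
  have [E1 _] := pt_succ_wrap k'E.
  have := coord_le_norm (pt k' - z) i; rewrite E1.
  move=> /(le_trans (ler_norm _)).
  by have := pt_norm_bound k; move: h0; lra.
rewrite {1}kE (pt_succ kM) lerBlDr addrAC.
apply: le_trans (ler_normD _ _) _; rewrite lerD2l.
by apply: le_trans (norm_scale_basis _ _) _; rewrite gtr0_norm.
Qed.

Hypothesis pt0 : forall k, pt k 0 i0 != 0.
Hypothesis hr : h <= r / 64.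
Hypothesis h1 : h <= 1.

Lemma pt_split k : O (pt k).
Proof. by split; [exact: pt_in_cube|exact: pt0]. Qed.

(** Nested scales: sampled functions vanish beyond 12/16 of the radius, this factor is 1 up to 13/16
    and 0 from 14/16 on. The seam of the periodic lattice lies beyond, so the coefficients become
    periodic without affecting the equation. *)
Definition cutoff x : R := Num.min 1 (Num.max 0 (14 - 16 * (`|x - z| / r))).

Lemma cutoff01 x : 0 <= cutoff x <= 1.
Proof. by rewrite /cutoff le_min ler01 le_max lexx ge_min lexx. Qed.

Lemma cutoff1 x : `|x - z| <= 13 / 16 * r -> cutoff x = 1.
Proof.
move=> H; apply/min_idPl; rewrite le_max; apply/orP; right.
have : `|x - z| / r <= 13 / 16 by rewrite ler_pdivrMr.
lra.
Qed.

Lemma cutoff0 x : 14 / 16 * r <= `|x - z| -> cutoff x = 0.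
Proof.
move=> H; have H' : 14 / 16 <= `|x - z| / r by rewrite ler_pdivlMr.
rewrite /cutoff (max_idPl _) ?(min_idPr _) ?ler01 //.
lra.
Qed.

Lemma cutoff_lip x y : `|cutoff x - cutoff y| <= 16 / r * `|x - y|.
Proof.
have mx (a b : R) : Num.max 0 a - Num.max 0 b <= `|a - b|.
  have H1 := ler_norm (a - b); have H2 := normr_ge0 (a - b); move: (`|a - b|) H1 H2 => c H1 H2.
  by case: (ltP 0 a) => Ha; case: (ltP 0 b) => Hb; lra.
have mn (a b : R) : Num.min 1 a - Num.min 1 b <= `|a - b|.
  have H1 := ler_norm (a - b); have H2 := normr_ge0 (a - b); move: (`|a - b|) H1 H2 => c H1 H2.
  by case: (ltP 1 a) => Ha; case: (ltP 1 b) => Hb; lra.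
have mx' (a b : R) : `|Num.max 0 a - Num.max 0 b| <= `|a - b|.
  by rewrite ler_norml mx lerNl opprB distrC mx.
have cl (a b : R) : `|Num.min 1 (Num.max 0 a) - Num.min 1 (Num.max 0 b)| <= `|a - b|.
  by apply: le_trans (mx' _ _); rewrite ler_norml mn lerNl opprB distrC mn.
apply: le_trans (cl _ _) _.
have -> : 14 - 16 * (`|x - z| / r) - (14 - 16 * (`|y - z| / r)) =
   16 / r * (`|y - z| - `|x - z|) by field; rewrite gt_eqF.
rewrite normrM (ger0_norm (divr_ge0 (ler0n _ 16) (ltW r0))) ler_wpM2l ?divr_ge0 ?(ltW r0) //.
apply: le_trans (ler_dist_dist _ _) _.
by rewrite opprB addrA subrK distrC.
Qed.

Section Coefficients.
Variables (a : 'I_n -> 'I_n -> E -> R) (A nu : R).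
Hypothesis A0 : 0 <= A.
Hypothesis aC : forall i j x, O x -> a i j x = a j i x.
Hypothesis aA : forall i j, CB A 2 O (a i j).
Hypothesis aL : forall i j, LL i0 z r A (a i j).
Hypothesis nu0 : 0 < nu.
Hypothesis a_ell : forall x (xi : 'I_n -> R), O x ->
  nu * (\sum_i xi i ^+ 2) <= \sum_i \sum_j a i j x * xi i * xi j.

(** A convex combination with the identity matrix, which preserves symmetry, ellipticity and
    Lipschitz bounds. *)
Definition acut i j k : R :=
  cutoff (pt k) * a i j (pt k) + (1 - cutoff (pt k)) * (i == j)%:R.

Lemma acut_sym i j k : acut i j k = acut j i k.
Proof. by rewrite /acut aC ?(eq_sym i) //; exact: pt_split. Qed.

Lemma acut_bound i j k : `|acut i j k| <= A + 1.
Proof.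
have /andP[t0 t1] := cutoff01 (pt k); rewrite /acut; set t := cutoff _ in t0 t1 *.
have aB : `|a i j (pt k)| <= A := CB_bound (aA i j) (pt_split k).
apply: le_trans (ler_normD _ _) _; rewrite !normrM (ger0_norm t0).
rewrite (ger0_norm (_ : 0 <= 1 - t)) ?subr_ge0 // normr_nat; apply: lerD.
  by apply: le_trans (ler_piMl _ t1) _.
rewrite -[leRHS]mul1r; apply: ler_pM; rewrite ?subr_ge0 //; first by rewrite gerBl.
by case: (_ == _); rewrite ?ler01 ?lexx.
Qed.

Lemma acut_lip l i j k : `|D l (acut i j) k| <= A + 16 / r * (A + 1).
Proof.
have C0 : 0 <= A + 16 / r * (A + 1).
  by rewrite addr_ge0 // mulr_ge0 ?divr_ge0 ?(ltW r0) // addr_ge0.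
rewrite /fdiff normrM normfV (gtr0_norm h0) ler_pdivrMr //.
have := ltn_ord (k 0 l); rewrite leq_eqVlt => /orP[/eqP kE|kM].
  have [E1 E2] := pt_succ_wrap kE.
  have c1 : cutoff (pt k) = 0.
    apply: cutoff0; apply: le_trans (coord_le_norm _ l).
    by rewrite E1; apply: le_trans (ler_norm _); move: hr r0; lra.
  have c2 : cutoff (pt (k + ax l)) = 0.
    apply: cutoff0; apply: le_trans (coord_le_norm _ l).
    by rewrite E2 normrN; apply: le_trans (ler_norm _); move: hr r0; lra.
  by rewrite /acut c1 c2 !mul0r subrr normr0 mulr_ge0 // ltW.
rewrite /acut (pt_succ kM).
have O1 := pt_split k; have O2 : O (pt k + h *: e l) by rewrite -(pt_succ kM); exact: pt_split.
set x := pt k in O1 O2 *; set y := x + _ in O2 *.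
have /andP[t0 t1] := cutoff01 y.
have dc : `|cutoff y - cutoff x| <= 16 / r * h.
  apply: le_trans (cutoff_lip _ _) _; rewrite ler_wpM2l ?divr_ge0 ?(ltW r0) //.
  have -> : y - x = h *: e l by rewrite /y addrC addKr.
  by apply: le_trans (norm_scale_basis _ _) _; rewrite gtr0_norm.
have da : `|a i j y - a i j x| <= A * h.
  by have := aL i j O1 O2; rewrite (gtr0_norm h0).
have ax_ : `|a i j x| <= A := CB_bound (aA i j) O1.
have alg (s t b c d : R) : t * b + (1 - t) * d - (s * c + (1 - s) * d) =
   t * (b - c) + (t - s) * (c - d) by ring.
rewrite alg; apply: le_trans (ler_normD _ _) _; rewrite [leRHS]mulrDl !normrM; apply: lerD.
  by apply: le_trans da; rewrite ler_piMl // ger0_norm.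
rewrite mulrAC; apply: ler_pM => //.
apply: le_trans (ler_normB _ _) _; apply: lerD => //.
by rewrite normr_nat; case: (_ == _); rewrite ?ler01 ?lexx.
Qed.

Lemma acut_elliptic k (xi : 'I_n -> R) :
  Num.min nu 1 * (\sum_i xi i ^+ 2) <= \sum_i \sum_j acut i j k * xi i * xi j.
Proof.
have /andP[t0 t1] := cutoff01 (pt k); set t := cutoff (pt k) in t0 t1.
set S := \sum_i xi i ^+ 2.
have S0 : 0 <= S by apply: sumr_ge0 => i _; rewrite sqr_ge0.
have -> : \sum_i \sum_j acut i j k * xi i * xi j =
   t * (\sum_i \sum_j a i j (pt k) * xi i * xi j) + (1 - t) * S.
  rewrite /S !mulr_sumr -big_split; apply: eq_bigr => i _ /=.
  rewrite mulr_sumr.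
  have -> : (1 - t) * xi i ^+ 2 = \sum_j (1 - t) * (i == j)%:R * xi i * xi j.
    rewrite (bigD1 i) //= eqxx mulr1 [X in _ = _ + X]big1 ?addr0; first by rewrite expr2 mulrA.
    by move=> j /negPf ji; rewrite eq_sym ji mulr0 !mul0r.
  by rewrite -big_split; apply: eq_bigr => j _; rewrite /acut -/t /=; ring.
have H := a_ell xi (pt_split k); rewrite -/S in H.
have m1 : Num.min nu 1 <= nu by rewrite ge_min lexx.
have m2 : Num.min nu 1 <= 1 by rewrite ge_min lexx orbT.
set mn := Num.min nu 1 in m1 m2 *.
have -> : mn * S = t * (mn * S) + (1 - t) * (mn * S) by ring.
apply: lerD; apply: ler_wpM2l; rewrite ?subr_ge0 //.
  by apply: le_trans H; rewrite ler_wpM2r.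
by rewrite ler_piMl.
Qed.

Section Residual.
Variables (w : E -> R) (B lam : R).
Hypothesis B0 : 0 <= B.
Hypothesis wB : CB B 3 O w.
Hypothesis wL : LL i0 z r B w.
Hypothesis dwL : forall j, LL i0 z r B (pd j w).
Hypothesis w0 : forall x, 3 / 4 * r <= `|x - z| -> w x = 0.

Let U k := w (pt k).
Let f := elliptic_residual (fun i : 'I_n => ax i) h acut lam U.

(** The continuous counterpart of [elliptic_residual]; the Riemannian density is left out and will
    reappear as a drift. *)
Definition cont_operator x : R :=
  lam ^+ 2 * w x + \sum_i \sum_j pd i (fun y => a i j y * pd j w y) x.

(** With a mesh of at most r/64, two steps from a far point still end beyond 3r/4, where the
    function vanishes, and one step from a near point stays below 13r/16, where the cutoff is 1. *)
Let far k := 25 / 32 * r <= `|pt k - z|.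

Let open_far : open [set x : E | 3 / 4 * r < `|x - z|].
Proof.
have -> : [set x : E | 3 / 4 * r < `|x - z|] = (fun x : E => `|x - z|) @^-1` [set t | 3 / 4 * r < t].
  by [].
apply: open_comp; last exact: open_gt.
move=> x _; apply: (@continuous_comp _ _ _ (fun x : E => x - z) Num.Def.normr).
  by apply: continuousB => //; exact: cst_continuous.
exact: norm_continuous.
Qed.

Lemma pd_far x j : 3 / 4 * r < `|x - z| -> pd j w x = 0.
Proof.
move=> xf; rewrite (pd_eq (g := fun=> 0) j open_far xf).
  by rewrite /pd derive_cst.
by move=> y /ltW /w0.
Qed.

Lemma cont_operator_far x : 3 / 4 * r < `|x - z| -> cont_operator x = 0.
Proof.
move=> xf; rewrite /cont_operator w0 1?ltW // mulr0 add0r big1 // => i _.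
apply: big1 => j _; rewrite (pd_eq (g := fun=> 0) i open_far xf).
  by rewrite /pd derive_cst.
by move=> y yf; rewrite pd_far ?mulr0.
Qed.

(** [line_taylor] makes this hold also for steps that cross the plane. *)
Lemma sample_diff k j : `|D j U k - pd j w (pt k)| <= B * h.
Proof.
have [kf|kn] := leP (25 / 32 * r) `|pt k - z|.
  rewrite pd_far; last by apply: lt_le_trans kf; move: r0; lra.
  have U1 : U (k + ax j) = 0.
    by apply: w0; apply: le_trans (pt_norm_step k j); move: kf hr r0; lra.
  have U2 : U k = 0 by apply: w0; apply: le_trans kf; move: r0; lra.
  by rewrite /fdiff U1 U2 !subrr mul0r subrr normr0 mulr_ge0 // ltW.
have st : pt (k + ax j) = pt k + h *: e j.
  by apply: pt_step; apply: lt_le_trans kn _; move: hr r0; lra.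
have O1 := pt_split k; have O2 := pt_split (k + ax j); rewrite st in O2.
have B1 : CB B 1 O w := CB_leq (isT : (1 <= 3)%N) wB.
have T := line_taylor B0 B1 wL (dwL j) O1 O2.
have -> : D j U k - pd j w (pt k) =
   (w (pt k + h *: e j) - w (pt k) - h * pd j w (pt k)) / h.
  by rewrite /fdiff /U st [RHS]mulrBl (mulrAC h) divff ?mul1r ?gt_eqF.
by rewrite normrM normfV (gtr0_norm h0) ler_pdivrMr // -[leRHS]mulrA -[h * h]expr2.
Qed.

Lemma residual_far k : far k -> f k = 0.
Proof.
move=> kf.
have U0 k' : 3 / 4 * r <= `|pt k' - z| -> U k' = 0 by exact: w0.
have n0 : 3 / 4 * r <= `|pt k - z| by apply: le_trans kf; move: r0; lra.
have n1 i : 3 / 4 * r <= `|pt (k + ax i) - z|.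
  by apply: le_trans (pt_norm_step k i); move: kf; rewrite /far; move: hr r0; lra.
have n2 i : 3 / 4 * r <= `|pt (k - ax i) - z|.
  by apply: le_trans (pt_norm_back k i); move: kf; rewrite /far; move: hr r0; lra.
have n3 i j : 3 / 4 * r <= `|pt (k - ax i + ax j) - z|.
  apply: le_trans (pt_norm_step _ j); have := pt_norm_back k i.
  by move: kf; rewrite /far; move: hr r0; lra.
rewrite /f /elliptic_residual U0 // mulr0 big1 ?subr0 // => i _; apply: big1 => j _.
by rewrite /bdiff /fdiff !U0 // subrr !mul0r !mulr0 subrr mul0r.
Qed.

Section Near.
Variables (k : G) (i j : 'I_n).
Hypothesis kn : `|pt k - z| < 25 / 32 * r.
Let x := pt k.
Let x' := x + (- h) *: e i.

Let backE : pt (k - ax i) = x'.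
Proof. by apply: pt_back; apply: lt_le_trans kn _; move: hr r0; lra. Qed.

Let x'n : `|x' - z| < 13 / 16 * r.
Proof.
rewrite /x' addrAC; apply: le_lt_trans (ler_normD _ _) _.
have := norm_scale_basis (- h) i; rewrite normrN (gtr0_norm h0).
by move: kn hr r0; rewrite -/x; lra.
Qed.

Let Ox : O x. Proof. exact: pt_split. Qed.
Let Ox' : O x'. Proof. by rewrite -backE; exact: pt_split. Qed.

Let flux k' := acut i j k' * D j U k'.

Let fluxE : Ds i flux k =
  ((a i j x' - a i j x) * D j U (k - ax i) + a i j x * (D j U (k - ax i) - D j U k)) / h.
Proof.
rewrite /bdiff /flux /acut backE -/x !cutoff1 ?(ltW x'n) //; last first.
  by apply: le_trans (ltW kn) _; move: r0; lra.
rewrite !mul1r !subrr !mul0r !addr0; congr (_ / _).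
by move: (D j U _) (D j U _) (a i j x) (a i j x') => *; ring.
Qed.

Let da : `|a i j x' - a i j x| <= A * h.
Proof. by have := aL i j Ox Ox'; rewrite normrN (gtr0_norm h0). Qed.

Let dw : `|pd j w x' - pd j w x| <= B * h.
Proof. by have := dwL j Ox Ox'; rewrite normrN (gtr0_norm h0). Qed.

Let Dx' : `|D j U (k - ax i) - pd j w x'| <= B * h.
Proof. by rewrite -backE; exact: sample_diff. Qed.

(** Only Lipschitz bounds enter, so the estimate holds next to the plane too: A h times 2B from the
    coefficient, A times 3B h from the gradient. *)
Lemma flux_bound : `|Ds i flux k| <= 5 * (A * B).
Proof.
rewrite fluxE normrM normfV (gtr0_norm h0) ler_pdivrMr //.
have pB : `|pd j w x'| <= B := CB_bound (CB_pd j wB) Ox'.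
have aB : `|a i j x| <= A := CB_bound (aA i j) Ox.
have Dx := sample_diff k j; rewrite -/x in Dx.
have d1 : `|D j U (k - ax i)| <= 2 * B.
  rewrite -[D j U (k - ax i)](subrK (pd j w x')).
  apply: le_trans (ler_normD _ _) _; apply: le_trans (lerD Dx' pB) _.
  by rewrite mulr2n mulrDl mul1r lerD2r ler_piMr.
have d2 : `|D j U (k - ax i) - D j U k| <= 3 * B * h.
  have alg (p q s t : R) : p - q = (p - s) + (s - t) - (q - t) by ring.
  rewrite (alg _ _ (pd j w x') (pd j w x)).
  apply: le_trans (ler_normB _ _) _.
  apply: le_trans (lerD (ler_normD _ _) (lexx _)) _.
  apply: le_trans (lerD (lerD Dx' dw) Dx) _.
  by rewrite le_eqVlt; apply/orP; left; apply/eqP; ring.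
move: (D j U (k - ax i)) (D j U k) d1 d2 => p q d1 d2.
apply: le_trans (ler_normD _ _) _; rewrite !normrM.
have -> : 5 * (A * B) * h = A * h * (2 * B) + A * (3 * B * h) by ring.
by apply: lerD; apply: ler_pM.
Qed.

Hypothesis kg : 2 * h < `|x 0 i0|.

(** Farther than two steps from the plane, the whole stencil stays on one side, where second
    derivatives exist and are Lipschitz. *)
Let near_pt p : `|p - x| <= 2 * h -> O p /\ 0 < x 0 i0 * p 0 i0.
Proof.
move=> px; have xp : 0 < x 0 i0 * p 0 i0.
  have pxE : (p - x) 0 i0 = p 0 i0 - x 0 i0 by rewrite mxE; congr (_ + _); rewrite mxE.
  have := coord_le_norm (p - x) i0; rewrite pxE => c.
  have H : `|p 0 i0 - x 0 i0| < `|x 0 i0| by apply: le_lt_trans c _; exact: le_lt_trans px kg.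
  have alg (s t : R) : s != 0 -> `|t - s| < `|s| -> 0 < s * t.
    move=> s0; case: (ltgtP s 0) s0 => // s0 _.
      by rewrite (ltr0_norm s0) ltr_norml => /andP[H1 H2]; nra.
    by rewrite (gtr0_norm s0) ltr_norml => /andP[H1 H2]; nra.
  by apply: alg H; case: Ox.
split => //; split; last by apply: contraTneq xp => ->; rewrite mulr0 ltxx.
have -> : p - z = (p - x) + (x - z) by rewrite addrA subrK.
apply: le_lt_trans (ler_normD _ _) _.
by move: px kn hr r0; rewrite -/x; lra.
Qed.

(** Discrete product rule: the increment of the coefficient and the second difference of [w] are
    replaced by derivatives at nearby points ([Et], [Es]), which differ from those at [x] by O(h);
    [schwarz] puts the mixed derivative in the right order. *)
Lemma flux_limit :
  `|- Ds i flux k - pd i (fun y => a i j y * pd j w y) x| <= (4 * n%:R + 2) * (A * B) * h.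
Proof.
have oO : open O by exact: open_split_cube.
have nb t l : 0 <= t <= 1 -> `|(t * h) *: e l| <= h.
  move=> /andP[t0 t1]; apply: le_trans (norm_scale_basis _ _) _.
  by rewrite normrM (gtr0_norm h0) ger0_norm // ler_piMl // ltW.
have [t [t01 Ot Et]] : exists t, [/\ 0 <= t <= 1, O (x + (t * - h) *: e i) &
     a i j (x + - h *: e i) - a i j x = - h * pd i (a i j) (x + (t * - h) *: e i)].
  apply: (mvt_same_side (B := A)) => //.
  - exact: CB_leq (aA i j).
  - have [|_ ->//] := near_pt (p := x + - h *: e i).
    rewrite addrC addrA addNr add0r; apply: le_trans (norm_scale_basis _ _) _.
    by rewrite normrN (gtr0_norm h0); move: h0; lra.
set eta := x + _ in Ot Et.
have eta_x : `|eta - x| <= h.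
  rewrite /eta addrC addrA addNr add0r mulrN scaleNr normrN; exact: nb.
have d1 : `|pd i (a i j) eta - pd i (a i j) x| <= n%:R * A * h.
  have [|_ se] := near_pt (p := eta); first by move: eta_x h0; lra.
  apply: le_trans (lip_side A0 (CB_pd i (aA i j)) Ox Ot se) _.
  by rewrite ler_wpM2l // mulr_ge0.
have rect s s' : 0 <= s <= 1 -> 0 <= s' <= 1 ->
    `|x' + (s * h) *: e i + (s' * h) *: e j - x| <= 2 * h.
  move=> /andP[s0 s1] s'01; rewrite /x'.
  have alg (X v1 v2 : E) (c d : R) :
      X + (- d) *: v1 + (c * d) *: v1 + v2 - X = - (((1 - c) * d) *: v1) + v2.
    by apply/rowP => l; rewrite !mxE; ring.
  rewrite alg.
  apply: le_trans (ler_normD _ _) _; rewrite normrN.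
  have -> : 2 * h = h + h by ring.
  by apply: lerD; apply: nb => //; rewrite subr_ge0 s1 gerBl.
have [s [s' [s01 s'01 Es]]] : exists t t', [/\ 0 <= t <= 1, 0 <= t' <= 1 &
    w (x' + h *: e i + h *: e j) - w (x' + h *: e i) - (w (x' + h *: e j) - w x') =
    h * h * pd j (pd i w) (x' + (t * h) *: e i + (t' * h) *: e j)].
  apply: (second_difference (O := O) (B := B)); first exact: CB_leq wB.
  by move=> s s' s01 s'01; have [] := near_pt (rect s s' s01 s'01).
set xi := x' + (s * h) *: e i + (s' * h) *: e j in Es.
have d2 : `|pd j (pd i w) xi - pd i (pd j w) x| <= n%:R * B * (2 * h).
  have sw : pd i (pd j w) x = pd j (pd i w) x.
    exact: (schwarz i j oO Ox (CB_leq (isT : (2 <= 3)%N) wB)).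
  have [Oxi sxi] := near_pt (rect s s' s01 s'01).
  have C1 : CB B 1 O (pd j (pd i w)) by apply: CB_pd; exact: CB_pd.
  have H : `|pd j (pd i w) xi - pd j (pd i w) x| <= n%:R * B * `|xi - x|.
    exact: (lip_side B0 C1 Ox Oxi sxi).
  rewrite sw; apply: (le_trans H).
  by apply: ler_wpM2l; [rewrite mulr_ge0|exact: rect].
have DD : D j U (k - ax i) - D j U k = - (h * pd j (pd i w) xi).
  have xx' : x' + h *: e i = x by rewrite /x' scaleNr subrK.
  have p1 : pt (k - ax i + ax j) = x' + h *: e j.
    rewrite -backE; apply: pt_step; rewrite backE; apply: lt_le_trans x'n _.
    by move: hr r0; lra.
  have p2 : pt (k + ax j) = x + h *: e j.
    by apply: pt_step; apply: lt_le_trans kn _; move: hr r0; lra.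
  rewrite xx' in Es; rewrite /fdiff /U p1 p2 backE -/x.
  have alg (p q u v d : R) : p - q - (u - v) = h * h * d ->
     (u - v) / h - (p - q) / h = - (h * d).
    move=> H; have -> : (u - v) / h - (p - q) / h = - ((p - q - (u - v)) / h) by ring.
    by rewrite H; field; rewrite gt_eqF.
  exact: alg Es.
have B1 : CBe 1 O (a i j).
  by exists A => //; exact: CB_leq (aA i j).
have pdE : pd i (fun y => a i j y * pd j w y) x =
   a i j x * pd i (pd j w) x + pd i (a i j) x * pd j w x.
  have Ha : CB A 1 O (a i j) := CB_leq (isT : (1 <= 2)%N) (aA i j).
  have Hw : CB B 1 O (pd j w) by apply: CB_leq (CB_pd j wB).
  exact: pd_mul Ha Hw Ox.
rewrite pdE fluxE -/x' DD Et.
have aB : `|a i j x| <= A := CB_bound (aA i j) Ox.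
have paB : `|pd i (a i j) x| <= A := CB_bound (CB_pd i (aA i j)) Ox.
have pB : `|pd j w x'| <= B := CB_bound (CB_pd j wB) Ox'.
have Db : `|D j U (k - ax i)| <= 2 * B.
  rewrite -[D j U (k - ax i)](subrK (pd j w x')).
  apply: le_trans (ler_normD _ _) _; apply: le_trans (lerD Dx' pB) _.
  by rewrite mulr2n mulrDl mul1r lerD2r ler_piMr.
have Dd : `|D j U (k - ax i) - pd j w x| <= 2 * B * h.
  have alg (p q u : R) : p - q = (p - u) + (u - q) by ring.
  rewrite (alg _ _ (pd j w x')); apply: le_trans (ler_normD _ _) _.
  by apply: le_trans (lerD Dx' dw) _; rewrite -mulrA mulr2n mulrDl mul1r.
move: (D j U (k - ax i)) Db Dd => d Db Dd.
move: (pd i (a i j) eta) d1 => pe d1; move: (pd j (pd i w) xi) d2 => pp d2.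
have alg (ax_ px dx ppx : R) :
  - ((- h * pe * d + ax_ * - (h * pp)) / h) - (ax_ * ppx + px * dx) =
  (pe - px) * d + px * (d - dx) + ax_ * (pp - ppx).
  by field; rewrite gt_eqF.
rewrite alg.
apply: le_trans (ler_normD _ _) _; apply: le_trans (lerD (ler_normD _ _) (lexx _)) _.
rewrite !normrM.
have -> : (4 * n%:R + 2) * (A * B) * h =
  n%:R * A * h * (2 * B) + A * (2 * B * h) + A * (n%:R * B * (2 * h)) by ring.
by apply: lerD; [apply: lerD|]; apply: ler_pM.
Qed.

End Near.

Lemma residual_bound k : `|f k| <= lam ^+ 2 * B + n%:R ^+ 2 * (5 * (A * B)).
Proof.
have [kf|kn] := leP (25 / 32 * r) `|pt k - z|.
  rewrite residual_far // normr0; apply: addr_ge0; first exact: mulr_ge0 (sqr_ge0 lam) B0.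
  exact: mulr_ge0 (sqr_ge0 _) (mulr_ge0 (ler0n _ 5) (mulr_ge0 A0 B0)).
have -> : f k = lam ^+ 2 * w (pt k) -
    \sum_i \sum_j Ds i (fun k' => acut i j k' * D j U k') k by [].
apply: le_trans (ler_normB _ _) _; apply: lerD.
  rewrite normrM (ger0_norm (sqr_ge0 lam)) ler_wpM2l ?sqr_ge0 //.
  exact: CB_bound wB (pt_split k).
by apply: norm_sum2_le => i j; exact: flux_bound.
Qed.

(** Consistency holds off a slab of a few layers along the plane. On the slab [residual_bound] is
    all that is known, and enough because the slab holds a fraction O(h) of the points. *)
Lemma residual_limit k : 2 * h < `|pt k 0 i0| ->
  `|f k - cont_operator (pt k)| <= n%:R ^+ 2 * ((4 * n%:R + 2) * (A * B) * h).
Proof.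
move=> kg; have [kf|kn] := leP (25 / 32 * r) `|pt k - z|.
  rewrite residual_far // cont_operator_far; last by apply: lt_le_trans kf; move: r0; lra.
  have c0 : 0 <= 4 * n%:R + 2 :> R by rewrite addr_ge0 // mulr_ge0.
  rewrite subrr normr0; apply: mulr_ge0 (sqr_ge0 _) _.
  exact: mulr_ge0 (mulr_ge0 c0 (mulr_ge0 A0 B0)) (ltW h0).
have -> : f k - cont_operator (pt k) = \sum_i \sum_j
   (- Ds i (fun k' => acut i j k' * D j U k') k -
    pd i (fun y => a i j y * pd j w y) (pt k)).
  have -> : f k = lam ^+ 2 * w (pt k) -
    \sum_i \sum_j Ds i (fun k' => acut i j k' * D j U k') k by [].
  rewrite /cont_operator opprD addrACA subrr add0r -opprD -big_split -sumrN.
  apply: eq_bigr => i _ /=; rewrite -big_split -sumrN.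
  by apply: eq_bigr => j _ /=; rewrite opprD.
by apply: norm_sum2_le => i j; exact: flux_limit.
Qed.

End Residual.
End Coefficients.
End Sampling.

(** * Smooth enough cutoff functions and their commutators *)

Section PositivePower.
Variables (R : realType) (n : nat).
Local Notation E := 'rV[R]_n.
Local Notation e := (basis_vec R).
Implicit Types (f g : E -> R) (x y v : E) (i j : 'I_n) (O : set E) (k : nat).

Lemma is_derive_pospow p (t : R) :
  is_derive t 1 (fun s : R => Num.max 0 s ^+ p.+2) (p.+2%:R * Num.max 0 t ^+ p.+1).
Proof.
have [t0|t0|->] := ltgtP t 0.
- have N : \forall s \near t, (0 : R) = Num.max 0 s ^+ p.+2.
    near=> s; have s0 : s < 0 by near: s; exact: lt_nbhsl.
    by rewrite (max_idPl (ltW s0)) expr0n.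
  have H : is_derive t 1 (fun=> 0 : R) 0 by exact: is_derive_cst.
  rewrite expr0n mulr0; apply: DeriveDef.
    by apply: near_eq_derivable N _; have [] := H.
  by rewrite -(near_eq_derive _ N); have [] := H.
- have N : \forall s \near t, s ^+ p.+2 = Num.max 0 s ^+ p.+2.
    near=> s; have s0 : 0 < s by near: s; exact: lt_nbhsr.
    by rewrite (max_idPr (ltW s0)).
  have H : is_derive t 1 (fun s : R => s ^+ p.+2) (p.+2%:R * t ^+ p.+1).
    have := is_deriveX p.+2 (is_derive_id t 1); rewrite exprfctE => H.
    by apply: (is_derive_eq H); rewrite -[LHS]/(_ * 1) mulr1.
  apply: DeriveDef.
    by apply: near_eq_derivable N _; have [] := H.
  by rewrite -(near_eq_derive _ N); have [] := H.
pose S (s : R) : R := Num.max 0 s ^+ p.+2.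
have L : (fun s : R => s^-1 * S s) @ 0^' --> (0 : R).
  apply/cvgrPdist_le => eps e0.
  near=> s.
  have s0 : s != 0 by near: s; exact: nbhs_dnbhs_neq.
  have s1 : `|s| <= Num.min 1 eps.
    near: s; apply: nbhs_dnbhs; apply: (@nbhs0_le _ R); rewrite lt_min ltr01 e0 //.
  rewrite sub0r normrN /S.
  have m0 : 0 <= Num.max 0 s by rewrite le_max lexx.
  have ms : Num.max 0 s <= `|s| by rewrite ge_max normr_ge0 ler_norm.
  rewrite normrM normfV ler_pdivrMl ?normr_gt0 // normrX (ger0_norm m0).
  have [s1' s2'] : `|s| <= 1 /\ `|s| <= eps.
    by split; apply: le_trans s1 _; rewrite ge_min lexx ?orbT.
  rewrite exprS; apply: ler_pM => //; first by rewrite exprn_ge0.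
  rewrite exprS; apply: le_trans (_ : Num.max 0 s <= _); last exact: le_trans s2'.
  rewrite ler_piMr //; apply: exprn_ile1 => //; exact: le_trans s1'.
have Q : (fun h : R => h^-1 *: ((S \o shift 0) (h *: 1) - S 0)) = (fun s => s^-1 * S s).
  by apply/funext => t' /=; rewrite /S addr0 maxxx expr0n subr0 [t' *: 1]mulr1.
rewrite expr0n mulr0; apply: DeriveDef.
  by rewrite -/S /derivable Q; apply/cvg_ex; exists 0.
by rewrite -/S /derive Q; exact/cvg_lim.
Unshelve. all: by end_near.
Qed.

Lemma is_derive_comp1 f (phi : R -> R) x v (d d' : R) :
  is_derive x v f d -> is_derive (f x) 1 phi d' -> is_derive x v (fun y => phi (f y)) (d' * d).
Proof.
move=> [/derivable1P d1 v1] Hphi.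
pose l (t : R) := f (t *: v + x).
have l0 : l 0 = f x by rewrite /l scale0r add0r.
have dl : is_derive (0 : R) 1 l d.
  apply: DeriveDef => //; rewrite -v1 /derive.
  rewrite (_ : (fun h : R => h^-1 *: ((l \o shift 0) (h *: 1) - l 0)) =
    (fun h : R => h^-1 *: ((f \o shift x) (h *: v) - f x))) //.
  by apply/funext => t /=; rewrite /l addr0 scale0r add0r [t *: 1]mulr1.
rewrite -l0 in Hphi.
have [d2 v2] : is_derive (0 : R) 1 (phi \o l) (d' * d) by exact: is_derive1_comp.
apply: DeriveDef; first exact/derivable1P.
rewrite -v2 /derive.
rewrite (_ : (fun h : R => h^-1 *: (((phi \o l) \o shift 0) (h *: 1) - (phi \o l) 0)) =
    (fun h : R => h^-1 *: (((fun x => phi (f x)) \o shift x) (h *: v) - phi (f x)))) //.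
by apply/funext => t /=; rewrite /l addr0 scale0r add0r [t *: 1]mulr1.
Qed.

Lemma CBe_bound_all (I : finType) (F : I -> E -> R) k O :
  (forall c : I, CBe k O (F c)) -> exists2 B, 0 <= B & forall c : I, CB B k O (F c).
Proof.
move=> H; pose Bi (c : I) := sval (cid2 (H c)).
have Bi0 (c : I) : 0 <= Bi c by rewrite /Bi; case: cid2.
have CBi (c : I) : CB (Bi c) k O (F c) by rewrite /Bi; case: cid2.
exists (\sum_c Bi c); first by apply: sumr_ge0.
by move=> i; apply: CB_le (CBi i); rewrite (bigD1 i) //= lerDl sumr_ge0.
Qed.

Lemma CBe_intro k O f (df : 'I_n -> E -> R) : open O ->
  (forall x i, O x -> is_derive x (e i) f (df i x)) -> (forall i, CBe k O (df i)) ->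
  CBe 0 O f -> CBe k.+1 O f.
Proof.
move=> oO D /CBe_bound_all[B B0 HB] [B' B'0 [H0 _]].
exists (B' + B); first exact: addr_ge0.
split; first by move=> x Ox; have [c b] := H0 x Ox; split => //; apply: le_trans b _; rewrite lerDl.
move=> i; split; first by move=> x Ox; have [] := D x i Ox.
apply: CB_eq (CB_le _ (HB i)) => //; last by rewrite lerDr.
by move=> x Ox; have [_ <-] := D x i Ox.
Qed.

(** Each derivative lowers the power of the positive part by one, and a positive first power is
    still continuous; hence power k + 1 for order k. *)
Lemma CBe_pospow k O f : open O -> CBe k O f ->
  CBe k O (fun x => Num.max 0 (f x) ^+ k.+1).
Proof.
move=> oO; have H0 p k' : CBe k' O f -> CBe 0 O (fun x => Num.max 0 (f x) ^+ p).
  move=> [B B0 HB]; exists (B ^+ p); first exact: exprn_ge0.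
  split => // x Ox; split.
    apply: (@continuous_comp _ _ _ (fun x => Num.max 0 (f x)) (fun t : R => t ^+ p)).
      apply: (@continuous_max _ _ (fun=> 0) f); first exact: cst_continuous.
      exact: CB_cont HB Ox.
    exact: exprn_continuous.
  have m0 : 0 <= Num.max 0 (f x) by rewrite le_max lexx.
  rewrite normrX (ger0_norm m0) lerXn2r ?nnegrE // ge_max B0 /=.
  by apply: le_trans (ler_norm _) _; exact: CB_bound HB Ox.
elim: k f H0 => [|k IH] f H0 Hf; first exact: (H0 1%N 0%N).
apply: (CBe_intro (df := fun i x => k.+2%:R * Num.max 0 (f x) ^+ k.+1 * pd i f x)) => //.
- move=> x i Ox.
  exact: (is_derive_comp1 (phi := fun t => Num.max 0 t ^+ k.+2) (CBe_is_derive i Hf Ox)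
    (is_derive_pospow k (f x))).
- move=> i; apply: CBe_mul => //; last exact: CBe_pd.
  apply: CBe_mul => //; first exact: CBe_cst.
  by apply: IH => //; exact: CBe_leq Hf.
exact: (H0 _ _ Hf).
Qed.

Lemma is_derive_coord x i j : is_derive x (e j) (fun y : E => y 0 i) (i == j)%:R.
Proof.
have L : (fun s : R => s^-1 *: (((fun y : E => y 0 i) \o shift x) (s *: e j) - x 0 i)) @ 0^' -->
    ((i == j)%:R : R).
  apply: cvg_near_cst; near=> s.
  have s0 : s != 0 by near: s; exact: nbhs_dnbhs_neq.
  rewrite -[((fun y : E => y 0 i) \o shift x) (s *: e j)]/((s *: e j + x) 0 i).
  rewrite (addrC (s *: e j)) shift_coord addrC addKr; case: eqP => _; last by rewrite scaler0.
  by rewrite [_ *: _]mulVf.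
apply: DeriveDef; first by apply/cvg_ex; exists (i == j)%:R.
exact/cvg_lim.
Unshelve. all: by end_near.
Qed.

Lemma CBe_coord k O i b : open O -> (forall x, O x -> `|x| <= b) -> CBe k O (fun x => x 0 i).
Proof.
move=> oO Ob.
have H0 : CBe 0 O (fun x : E => x 0 i).
  have [x0|noO] := pselect (exists x, O x); last first.
    by exists 0 => //; split => // x Ox; case: noO; exists x.
  exists b; first by case: x0 => x /Ob; exact: le_trans.
  split => // x Ox; split; first exact: coord_continuous.
  by apply: le_trans (coord_le_norm _ _) _; exact: Ob.
case: k => [//|k].
apply: (CBe_intro (df := fun j _ => (i == j)%:R)) => //.
  by move=> x j _; exact: is_derive_coord.
by move=> j; exact: CBe_cst.
Qed.

End PositivePower.

Section Plateau.
Variables (R : realType) (n : nat).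
Local Notation E := 'rV[R]_n.
Variables (z : E) (r : R).
Hypothesis r0 : 0 < r.
Implicit Types (x y : E).

(** Each factor vanishes at |x_i - z_i| = r/2, and the 6 makes it at least 1 up to 9r/32, since 6
    (1/4 - 81/1024) > 1. As 9/32 > 1/4, the cutoff is 1 on a neighbourhood of the inner cube and
    derivatives agree there. *)
Definition plateau_profile x : R :=
  \prod_(i < n) Num.max 0 (6 * (1 / 4 - ((x 0 i - z 0 i) / r) ^+ 2)) ^+ 4.

(* The fourth powers make the cutoff C^3; it equals 1 wherever the profile is at least 1. *)
Definition plateau x : R := 1 - Num.max 0 (1 - plateau_profile x) ^+ 4.

Let pos4 (t : R) : 0 <= Num.max 0 t ^+ 4.
Proof. by rewrite exprn_ge0 // le_max lexx. Qed.

Lemma plateau_profile_ge0 x : 0 <= plateau_profile x.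
Proof. by apply: prodr_ge0 => i _; exact: pos4. Qed.

Lemma plateau01 x : 0 <= plateau x <= 1.
Proof.
rewrite /plateau subr_ge0 gerBl pos4 andbT exprn_ile1 // ?le_max ?lexx //.
by rewrite ge_max ler01 gerBl plateau_profile_ge0.
Qed.

Lemma plateau_inner x : `|x - z| <= 9 / 32 * r -> plateau x = 1.
Proof.
move=> H; have P1 : 1 <= plateau_profile x.
  rewrite /plateau_profile; elim/big_ind: _ => //.
    by move=> a b a1 b1; rewrite -[1]mulr1 ler_pM.
  move=> i _; have c := coord_le_norm (x - z) i; rewrite !mxE in c.
  have t4 : `|(x 0 i - z 0 i) / r| <= 9 / 32.
    rewrite normrM normfV (gtr0_norm r0) ler_pdivrMr //.
    exact: le_trans c _.
  rewrite exprn_ege1 // le_max; apply/orP; right.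
  have : ((x 0 i - z 0 i) / r) ^+ 2 <= (9 / 32) ^+ 2.
    by rewrite -real_normK ?num_real // lerXn2r ?nnegrE ?divr_ge0.
  move: (((x 0 i - z 0 i) / r) ^+ 2) => s; lra.
by rewrite /plateau (max_idPl _) ?expr0n ?subr0 // subr_le0.
Qed.

Lemma plateau_outer x : r / 2 <= `|x - z| -> plateau x = 0.
Proof.
move=> H; suff P0 : plateau_profile x = 0.
  by rewrite /plateau P0 subr0 (max_idPr ler01) expr1n subrr.
have [i Hi] : exists i : 'I_n, r / 2 <= `|(x - z) 0 i|.
  apply: contrapT => /forallNP Hn.
  have r2 : 0 < r / 2 by rewrite divr_gt0.
  pose mx := \big[Num.max/0]_i `|(x - z) 0 i|.
  have mlt : mx < r / 2.
    rewrite /mx; elim/big_ind: _ => //.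
      by move=> a b a1 b1; rewrite gt_max a1.
    by move=> i _; rewrite ltNge; apply/negP/Hn.
  have : `|x - z| <= mx.
    apply: norm_leP; first by rewrite /mx; elim/big_ind: _ => // a b a0 b0; rewrite le_max a0.
    by move=> j; rewrite /mx (bigD1 j) //= le_max lexx.
  by move=> /(le_lt_trans)/(_ mlt); rewrite ltNge H.
rewrite /plateau_profile (bigD1 i) //= (max_idPl _) ?expr0n ?mul0r //.
rewrite !mxE in Hi; rewrite pmulr_rle0 // subr_le0.
have t4 : 1 / 2 <= `|(x 0 i - z 0 i) / r|.
  rewrite normrM normfV (gtr0_norm r0) ler_pdivlMr //.
  by apply: le_trans Hi; rewrite mulrC mul1r.
have : (1 / 2) ^+ 2 <= ((x 0 i - z 0 i) / r) ^+ 2.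
  by rewrite -[leRHS]real_normK ?num_real // lerXn2r ?nnegrE ?divr_ge0.
move: (((x 0 i - z 0 i) / r) ^+ 2) => s; lra.
Qed.

Lemma CBe_plateau : CBe 3 (ball z r) plateau.
Proof.
have oQ : open (ball z r) by exact: ball_open.
have bQ x : ball z r x -> `|x| <= `|z| + r.
  rewrite -ball_normE /= => H; rewrite -[x](subrK z) addrC.
  by apply: le_trans (ler_normD _ _) _; rewrite lerD2l distrC ltW.
apply: CBe_add => //; first exact: CBe_cst.
apply: CBe_opp => //; apply: CBe_pospow => //.
apply: CBe_add => //; first exact: CBe_cst.
apply: CBe_opp => //; apply: CBe_prod => // i; apply: CBe_pospow => //.
apply: CBe_mul => //; first exact: CBe_cst.
apply: CBe_add => //; first exact: CBe_cst.
apply: CBe_opp => //.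
have H : CBe 3 (ball z r) (fun x => (x 0 i - z 0 i) / r).
  apply: CBe_mul => //; last exact: CBe_cst.
  apply: CBe_add => //; last exact: CBe_cst.
  exact: CBe_coord bQ.
have -> : (fun x : E => ((x 0 i - z 0 i) / r) ^+ 2) =
   (fun x => ((x 0 i - z 0 i) / r) * ((x 0 i - z 0 i) / r)).
  by apply/funext => x; rewrite expr2.
exact: CBe_mul.
Qed.

End Plateau.

Section Operator.
Variables (R : realType) (n : nat).
Local Notation E := 'rV[R]_n.
Local Notation e := (basis_vec R).
Implicit Types (x y : E) (i j : 'I_n).
Variables (O : set E) (a : 'I_n -> 'I_n -> E -> R) (chi : E -> R).
Hypothesis oO : open O.
Hypothesis Ha : forall i j, CBe 1 O (a i j).
Hypothesis Hchi : CBe 2 O chi.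

Lemma cont_operator_zero (O' : set E) w lam x : open O' -> O' x ->
  (forall y, O' y -> w y = 0) -> cont_operator a w lam x = 0.
Proof.
move=> oO' Ox w0; have p0 j y : O' y -> pd j w y = 0.
  move=> Oy; rewrite (pd_eq (g := fun=> 0) j oO' Oy w0).
  by rewrite /pd derive_cst.
rewrite /cont_operator w0 // mulr0 add0r big1 // => i _.
apply: big1 => j _; rewrite (pd_eq (g := fun=> 0) i oO' Ox).
  by rewrite /pd derive_cst.
by move=> y Oy; rewrite p0 ?mulr0.
Qed.

Lemma pd_product u i x : CBe 1 O u -> O x ->
  pd i (fun y => chi y * u y) x = chi x * pd i u x + pd i chi x * u x.
Proof.
move=> [B _ Hu] Ox; have [B' _ H] := CBe_leq (isT : (1 <= 2)%N) Hchi.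
exact: pd_mul H Hu Ox.
Qed.

Lemma cont_operator_product u lam x : CBe 2 O u -> O x ->
  cont_operator a (fun y => chi y * u y) lam x = chi x * cont_operator a u lam x +
  \sum_i \sum_j (pd i (fun y => a i j y * pd j chi y) x * u x +
    a i j x * pd j chi x * pd i u x + pd i chi x * (a i j x * pd j u x)).
Proof.
move=> Hu Ox; have Hu1 : CBe 1 O u by exact: CBe_leq Hu.
have Hc1 : CBe 1 O chi by exact: CBe_leq Hchi.
rewrite /cont_operator mulrDr mulrCA -addrA; congr (_ + _).
rewrite mulr_sumr -big_split; apply: eq_bigr => i _ /=.
rewrite mulr_sumr -big_split; apply: eq_bigr => j _ /=.
have E1 y : O y -> a i j y * pd j (fun y => chi y * u y) y =
    (a i j y * pd j chi y) * u y + chi y * (a i j y * pd j u y).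
  move=> Oy; rewrite pd_product //.
  by move: (pd j u y) (pd j chi y) (a i j y) (chi y) (u y) => *; ring.
rewrite (pd_eq i oO Ox E1).
have Hac : CBe 1 O (fun y => a i j y * pd j chi y) by apply: CBe_mul => //; exact: CBe_pd.
have Hau : CBe 1 O (fun y => a i j y * pd j u y) by apply: CBe_mul => //; exact: CBe_pd.
have D1 := is_derive_mul (CBe_is_derive i Hac Ox) (CBe_is_derive i Hu1 Ox).
have D2 := is_derive_mul (CBe_is_derive i Hc1 Ox) (CBe_is_derive i Hau Ox).
have [_ D] := is_deriveD D1 D2; rewrite /pd in D *; rewrite D.
have alg (p q s t : R) : p + q + (s + t) = s + (q + p + t) by ring.
exact: alg.
Qed.

(** The commutator of the operator with [chi] is of first order and free of [lam]. So cutting off an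
    eigenfunction leaves a residual bounded by its value and gradient, with [K] depending only on
    the geometry. *)
Lemma cont_operator_bound C1 : 0 <= C1 -> (forall x, O x -> `|chi x| <= 1) ->
  exists2 K, 0 <= K & forall u lam, CBe 2 O u ->
    (forall x, O x -> `|cont_operator a u lam x| <= C1 * \sum_l `|pd l u x|) ->
    forall x, O x -> cont_operator a (fun y => chi y * u y) lam x ^+ 2 <=
      K * (u x ^+ 2 + \sum_l pd l u x ^+ 2).
Proof.
move=> C10 chi1.
have [K1 K10 H1] : exists2 B, 0 <= B & forall ij : 'I_n * 'I_n,
    CB B 1 O (fun y => a ij.1 ij.2 y * pd ij.2 chi y).
  by apply: CBe_bound_all => -[i j] /=; apply: CBe_mul => //; exact: CBe_pd.
have [K2 K20 H2] : exists2 B, 0 <= B & forall ij : 'I_n * 'I_n,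
    CB B 1 O (fun y => pd ij.1 chi y * a ij.1 ij.2 y).
  by apply: CBe_bound_all => -[i j] /=; apply: CBe_mul => //; exact: CBe_pd.
pose K3 := C1 * n%:R + n%:R ^+ 2 * (K1 + K1 + K2).
have K30 : 0 <= K3 by rewrite addr_ge0 // mulr_ge0 ?sqr_ge0 // !addr_ge0.
exists (K3 ^+ 2); first exact: sqr_ge0.
move=> u lam Hu PDE x Ox; rewrite cont_operator_product //.
set s2 := u x ^+ 2 + _.
have s20 : 0 <= s2 by rewrite addr_ge0 ?sqr_ge0 // sumr_ge0 // => l _; exact: sqr_ge0.
pose s := Num.sqrt s2; have s0 : 0 <= s := sqrtr_ge0 _.
have us : `|u x| <= s.
  rewrite -sqrtr_sqr ler_wsqrtr // lerDl sumr_ge0 // => l _; exact: sqr_ge0.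
have ps l : `|pd l u x| <= s.
  rewrite -sqrtr_sqr ler_wsqrtr // /s2 (bigD1 l) //= addrCA lerDl addr_ge0 ?sqr_ge0 //.
  by rewrite sumr_ge0 // => l' _; exact: sqr_ge0.
have -> : s2 = s ^+ 2 by rewrite /s sqr_sqrtr.
rewrite -exprMn -[leLHS]real_normK ?num_real // lerXn2r ?nnegrE ?mulr_ge0 //.
apply: le_trans (ler_normD _ _) _; rewrite /K3 mulrDl; apply: lerD.
  rewrite normrM -mulrA; apply: le_trans (ler_piMl _ (chi1 x Ox)) _ => //.
  apply: le_trans (PDE x Ox) _; rewrite ler_wpM2l //.
  have -> : n%:R * s = \sum_(l < n) s by rewrite sumr_const card_ord -[RHS]mulr_natl.
  by apply: ler_sum => l _.
rewrite -mulrA; apply: norm_sum2_le => i j.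
apply: le_trans (ler_normD _ _) _; rewrite !mulrDl; apply: lerD.
  apply: le_trans (ler_normD _ _) _; rewrite !(normrM _ (u x)) !(normrM _ (pd i u x)).
  apply: lerD; apply: ler_pM => //.
    exact: CB_bound (CB_pd i (H1 (i, j))) Ox.
  exact: CB_bound (H1 (i, j)) Ox.
rewrite mulrA (normrM _ (pd j u x)); apply: ler_pM => //.
exact: CB_bound (H2 (i, j)) Ox.
Qed.

End Operator.

Lemma sum_indicator (R : numDomainType) (T : finType) (P : pred T) (F : T -> R) :
  \sum_(k | P k) F k = \sum_k (P k)%:R * F k.
Proof.
rewrite big_mkcond; apply: eq_bigr => k _.
by case: (P k); rewrite ?mul1r ?mul0r.
Qed.

Lemma sum_card (R : pzSemiRingType) (T : finType) (c : R) : \sum_(k : T) c = #|T|%:R * c.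
Proof. by rewrite big_const iter_addr_0 mulr_natl. Qed.

Lemma card_close_le (M : nat) (P : pred 'I_M) (q : nat) :
  (forall s t, P s -> P t -> (s <= t + q)%N) -> (#|P| <= q.*2.+1)%N.
Proof.
move=> H; have [t0 Pt0|P0] := pickP P; last by rewrite eq_card0.
pose f (s : 'I_M) : 'I_q.*2.+1 := inord (s + q - t0).
rewrite -(card_in_imset (f := f) (D := P)); first by apply: leq_trans (max_card _) _; rewrite card_ord.
move=> s t Ps Pt /(congr1 (@nat_of_ord _)).
have [h1 h2] := (H s t0 Ps Pt0, H t0 s Pt0 Ps).
have [h3 h4] := (H t t0 Pt Pt0, H t0 t Pt0 Pt).
rewrite !inordK; [|lia|lia] => E; apply: val_inj => /=; lia.
Qed.

Section Slab.
Variables (R : realType) (n m : nat) (z : 'rV[R]_n) (r : R) (i0 : 'I_n).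
Hypothesis r0 : 0 < r.
Let M := m.+2.
Let G := 'rV['I_M]_n.
Local Notation h := (mesh m r).

Definition slab (k : G) : bool := `|pt z r k 0 i0| <= 2 * h.

(** Double counting: translations in direction [i0] permute the lattice, and every line in that
    direction meets the slab in at most 9 points, because any two of them are at most 4 steps
    apart. *)
Lemma card_slab : (#|[pred k | slab k]| * M <= 9 * #|{: G}|)%N.
Proof.
have h0 : 0 < h by exact: mesh_gt0.
have shiftE (s : 'I_M) : #|[pred k : G | slab (k + axis i0 s)]| = #|[pred k : G | slab k]|.
  rewrite -!sum1_card; apply/esym.
  by rewrite (reindex_inj (addIr (axis i0 s))) /=.
have -> : (#|[pred k : G | slab k]| * M = \sum_(s < M) #|[pred k : G | slab (k + axis i0 s)%R]|)%N.
  under eq_bigr do rewrite shiftE.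
  by rewrite sum_nat_const card_ord mulnC.
under eq_bigr do rewrite -sum1_card big_mkcond /=.
rewrite exchange_big /= mulnC -sum_nat_const; apply: leq_sum => k _.
rewrite -big_mkcond sum1_card.
pose P := [pred t : 'I_M | `|z 0 i0 - r + (t%:R + 1 / 2) * h| <= 2 * h].
have PE (s : 'I_M) : slab (k + axis i0 s) = (k 0 i0 + s \in P).
  by rewrite /slab !mxE inE eqxx.
have -> : #|(fun s : 'I_M => slab (k + axis i0 s))| = #|P|.
  rewrite -(card_imset P (addrI (- k 0 i0))); apply: eq_card => s.
  rewrite [LHS]PE; apply/idP/imsetP => [H|[t Pt ->]]; last by rewrite addNKr.
  by exists (k 0 i0 + s) => //; rewrite addKr.
rewrite -[9%N]/(4.*2.+1); apply: card_close_le => s t; rewrite !inE => Hs Ht.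
rewrite leqNgt; apply/negP => lt.
have st : t%:R + 5 <= s%:R :> R by rewrite -natrD ler_nat; lia.
have : (t%:R + 5) * h <= s%:R * h by rewrite ler_wpM2r // ltW.
move: Hs Ht; rewrite !ler_norml => /andP[_ H1] /andP[H2 _].
have E1 (q : R) : (q + 1 / 2) * h = q * h + h / 2 by field.
have E2 (q : R) : (q + 5) * h = q * h + 5 * h by ring.
rewrite E1 in H1; rewrite E1 in H2; rewrite E2.
move: (s%:R * h) (t%:R * h) H1 H2 => sh th; lra.
Qed.

End Slab.

(** * The estimate on one cube *)

Section LocalEstimate.
Variables (R : realType) (n : nat) (i0 : 'I_n).
Local Notation E := 'rV[R]_n.
Variables (z : E) (r : R).
Hypothesis r0 : 0 < r.
Hypothesis r1 : 2 * r <= 1.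
Local Notation O := (split_cube i0 z r).
Variables (a : 'I_n -> 'I_n -> E -> R) (A nu C1 : R).
Hypothesis A0 : 0 <= A.
Hypothesis aC : forall i j x, O x -> a i j x = a j i x.
Hypothesis aA : forall i j, CB A 2 O (a i j).
Hypothesis aL : forall i j, LL i0 z r A (a i j).
Hypothesis nu0 : 0 < nu.
Hypothesis a_ell : forall x (xi : 'I_n -> R), O x ->
  nu * (\sum_i xi i ^+ 2) <= \sum_i \sum_j a i j x * xi i * xi j.
Hypothesis C10 : 0 <= C1.

Let oO : open O. Proof. exact: open_split_cube. Qed.

Definition energy (lam : R) (u : E -> R) x := lam ^+ 2 * u x ^+ 2 + \sum_j pd j u x ^+ 2.

Lemma energy_ge0 lam u x : 0 <= energy lam u x.
Proof.
apply: addr_ge0; first exact: mulr_ge0 (sqr_ge0 _) (sqr_ge0 _).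
by apply: sumr_ge0 => j _; exact: sqr_ge0.
Qed.

Let chi := plateau z r.
Let QO : O `<=` ball z r.
Proof. by move=> x [xr _]; rewrite -ball_normE /= distrC. Qed.

Lemma LL_smooth B f : CB B 1 (ball z r) f -> LL i0 z r B f.
Proof.
move=> Hf x i s [xr _] [yr _].
have line t : 0 <= t <= 1 -> ball z r (x + (t * s) *: basis_vec R i).
  by move=> t01; rewrite -ball_normE /= distrC; exact: line_in_cube.
have [t t01 ->] : exists2 t, 0 <= t <= 1 & f (x + s *: basis_vec R i) - f x =
    s * pd i f (x + (t * s) *: basis_vec R i).
  by apply: MVT_line => t t01; exact: CB_der Hf (line t t01).
rewrite normrM mulrC ler_wpM2r //; exact: CB_bound (CB_pd i Hf) (line t t01).
Qed.

(** What survives reflection: three bounded derivatives on each side, and Lipschitz value and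
    gradient across the plane. Sampling uses just this. *)
Definition regular B (u : E -> R) :=
  [/\ CB B 3 O u, LL i0 z r B u & forall j, LL i0 z r B (pd j u)].

Lemma regular_plateau B : 0 <= B -> exists2 B', 0 <= B' &
  forall u, regular B u -> regular B' (fun y => chi y * u y).
Proof.
move=> B0; have [Bc Bc0 Hc] := CBe_plateau z r.
have HcO := CB_sub QO Hc.
have Hc1 : CB Bc 1 (ball z r) chi by exact: CB_leq Hc.
have Lc : LL i0 z r Bc chi by exact: LL_smooth.
have Lpc j : LL i0 z r Bc (pd j chi).
  by apply: LL_smooth; apply: CB_leq (CB_pd j Hc).
pose B1 := 2 ^+ 3 * (Bc * B); pose B2 := Bc * B + Bc * B.
have BB : 0 <= Bc * B by exact: mulr_ge0.
have B10 : 0 <= B1 by rewrite mulr_ge0 // exprn_ge0.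
have B20 : 0 <= B2 by exact: addr_ge0.
exists (B1 + (B2 + B2)); first by rewrite !addr_ge0.
move=> u [Hu Lu Lpu]; split.
- apply: CB_le (CB_mul oO Bc0 B0 HcO Hu); rewrite lerDl; exact: addr_ge0.
- apply: (@LL_le _ _ _ _ _ B2); first by rewrite addrCA lerDl addr_ge0.
  by apply: LL_mul => // x Ox; [exact: CB_bound HcO Ox|exact: CB_bound Hu Ox].
move=> j; apply: (@LL_le _ _ _ _ _ (B2 + B2)); first by rewrite lerDr.
have E1 x : O x -> pd j (fun y => chi y * u y) x = chi x * pd j u x + pd j chi x * u x.
  by move=> Ox; exact: pd_mul HcO Hu Ox.
move=> x i s Ox Oy; rewrite !E1 //.
have H : LL i0 z r (B2 + B2) (fun x => chi x * pd j u x + pd j chi x * u x).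
  apply: LL_add; apply: LL_mul => // y Oy'.
  - exact: CB_bound HcO Oy'.
  - exact: CB_bound (CB_pd j Hu) Oy'.
  - exact: CB_bound (CB_pd j HcO) Oy'.
  - exact: CB_bound Hu Oy'.
exact: H.
Qed.

Definition slope_bound := A + 16 / r * (A + 1).

Lemma slope_bound_ge0 : 0 <= slope_bound.
Proof. by rewrite addr_ge0 // mulr_ge0 ?divr_ge0 ?(ltW r0) // addr_ge0. Qed.

Let Lc := lattice_const n (A + 1) slope_bound (Num.min nu 1).

Let nu1 : 0 < Num.min nu 1. Proof. by rewrite lt_min nu0 ltr01. Qed.

Let Lc0 : 0 <= Lc.
Proof.
have C0 : 0 <= rellich_const n (A + 1) slope_bound (Num.min nu 1).
  by apply: rellich_const_ge0 => //; [exact: addr_ge0|exact: slope_bound_ge0].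
by rewrite /Lc /lattice_const addr_ge0 // addr_ge0 ?divr_ge0 ?mulr_ge0 // ltW.
Qed.

Section Lattice.
Variables (m : nat).
Let M := m.+2.
Local Notation h := (mesh m r).
Hypothesis pt0 : forall k : 'rV['I_M]_n, pt z r k 0 i0 != 0.
Hypothesis hr : h <= r / 64.
Let h0 : 0 < h. Proof. exact: mesh_gt0. Qed.
Let Mh : h * M%:R = 2 * r.
Proof. by rewrite /mesh divfK // pnatr_eq0. Qed.
Let h1 : h <= 1.
Proof. by apply: le_trans hr _; move: r1 r0; lra. Qed.
Let hM : h <= M%:R^-1.
Proof. by rewrite -[leRHS]mul1r ler_pdivlMr ?ltr0n // Mh. Qed.
Let W : R := #|{: 'rV['I_M]_n}|%:R.
Local Notation e := (fun i : 'I_n => axis i (1 : 'I_M)).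

(** Off the slab the residual is within B h of the operator, which is bounded by the energy and
    vanishes outside the half cube; on the slab the crude bound [F] is multiplied by the small
    number of points of [card_slab]. *)
Lemma sum_residual lam u w F K B : 0 <= F -> 0 <= B -> 1 <= lam ->
  (forall k : 'rV['I_M]_n,
     `|elliptic_residual e h (acut z r a) lam (fun k => w (pt z r k)) k| <= F) ->
  (forall k : 'rV['I_M]_n, 2 * h < `|pt z r k 0 i0| ->
     `|elliptic_residual e h (acut z r a) lam (fun k => w (pt z r k)) k
        - cont_operator a w lam (pt z r k)| <= B * h) ->
  0 <= K ->
  (forall x, O x -> cont_operator a w lam x ^+ 2 <= K * (u x ^+ 2 + \sum_l pd l u x ^+ 2)) ->
  (forall x, r / 2 < `|x - z| -> cont_operator a w lam x = 0) ->
  nrm (elliptic_residual e h (acut z r a) lam (fun k => w (pt z r k))) ^+ 2 <=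
   2 * K * (\sum_(k : 'rV['I_M]_n | `|pt z r k - z| <= r / 2) energy lam u (pt z r k)) +
   (2 * B ^+ 2 + 9 * F ^+ 2) * (W / M%:R).
Proof.
move=> F0 B0 lam1 fF fB K0 opK op0; rewrite nrm_sqr /ip.
set f := elliptic_residual _ _ _ _ _ in fF fB *.
pose P (k : 'rV['I_M]_n) : bool := `|pt z r k - z| <= r / 2.
have bnd k : f k * f k <= 2 * K * ((P k)%:R * energy lam u (pt z r k)) +
    2 * B ^+ 2 * M%:R^-1 + (slab z r i0 k)%:R * F ^+ 2.
  have E0 := energy_ge0 lam u (pt z r k).
  have t1 : 0 <= 2 * K * ((P k)%:R * energy lam u (pt z r k)).
    by rewrite mulr_ge0 ?mulr_ge0 // ler0n.
  have t2 : 0 <= 2 * B ^+ 2 * M%:R^-1 :> R by rewrite mulr_ge0 ?mulr_ge0 ?sqr_ge0 ?invr_ge0.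
  case: (boolP (slab z r i0 k)) => [_|]; last first.
    rewrite -ltNge mul0r addr0 => kg; have fk := fB k kg.
    set c := cont_operator _ _ _ _ in fk.
    have cK : c ^+ 2 <= K * ((P k)%:R * energy lam u (pt z r k)).
      case: (boolP (P k)) => [_|kf]; last first.
        by rewrite mul0r mulr0 /c op0 ?expr0n // ltNge.
      rewrite mul1r; apply: le_trans (opK _ _) _.
        by split; [exact: pt_in_cube|exact: pt0].
      rewrite ler_wpM2l // /energy lerD2r ler_peMl ?sqr_ge0 //.
      by rewrite expr2 -[1]mulr1 ler_pM.
    have dK : (f k - c) ^+ 2 <= B ^+ 2 * M%:R^-1.
      rewrite -real_normK ?num_real //; apply: (@le_trans _ _ ((B * h) ^+ 2)).
        by rewrite lerXn2r ?nnegrE ?mulr_ge0 // ltW.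
      rewrite exprMn ler_wpM2l ?sqr_ge0 //; apply: le_trans hM.
      by rewrite expr2 ler_piMl // ltW.
    have alg (p q X Y : R) : q ^+ 2 <= X -> (p - q) ^+ 2 <= Y -> p * p <= 2 * X + 2 * Y.
      by have := sqr_ge0 (p - q - q); nra.
    by rewrite -[2 * K * _]mulrA -[2 * B ^+ 2 * _]mulrA; exact: alg cK dK.
  rewrite mul1r; apply: (@le_trans _ _ (F ^+ 2)); last by rewrite lerDr addr_ge0.
  by rewrite -expr2 -real_normK ?num_real // lerXn2r ?nnegrE // fF.
apply: le_trans (ler_sum _ (fun k _ => bnd k)) _.
have S1 : \sum_k 2 * K * ((P k)%:R * energy lam u (pt z r k)) =
    2 * K * (\sum_(k : 'rV['I_M]_n | P k) energy lam u (pt z r k)).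
  by rewrite -mulr_sumr -sum_indicator.
have S2 : \sum_(k : 'rV['I_M]_n) 2 * B ^+ 2 * M%:R^-1 = 2 * B ^+ 2 * (W / M%:R).
  by rewrite sum_card -/W mulrCA.
have S3 : \sum_(k : 'rV['I_M]_n) (slab z r i0 k)%:R * F ^+ 2 <= 9 * F ^+ 2 * (W / M%:R).
  rewrite -mulr_suml -natr_sum mulrC -[leRHS]mulrA mulrCA ler_wpM2l ?sqr_ge0 //.
  rewrite mulrA ler_pdivlMr ?ltr0n // -natrM /W -natrM ler_nat.
  have := card_slab m z i0 r0; rewrite -sum1_card big_mkcond /=.
  by congr (_ * _ <= _)%N; apply: eq_bigr => k _; case: slab.
have alg (x y c d : R) : x <= d -> y + c + x <= y + (c + d) by lra.
have -> : (2 * B ^+ 2 + 9 * F ^+ 2) * (W / M%:R) =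
  2 * B ^+ 2 * (W / M%:R) + 9 * F ^+ 2 * (W / M%:R) by ring.
by rewrite big_split big_split /= S1 S2; exact: alg.
Qed.

Lemma sum_inner lam u w B : 0 <= B -> regular B w ->
  (forall x, 3 / 4 * r <= `|x - z| -> w x = 0) ->
  (forall k : 'rV['I_M]_n, `|pt z r k - z| <= r / 4 -> w (pt z r k) = u (pt z r k) /\
      forall j, pd j w (pt z r k) = pd j u (pt z r k)) ->
  \sum_(k : 'rV['I_M]_n | `|pt z r k - z| <= r / 4) energy lam u (pt z r k) <=
  2 * (lam ^+ 2 * nrm (fun k : 'rV['I_M]_n => w (pt z r k)) ^+ 2 +
       \sum_i nrm (fdiff e h i (fun k => w (pt z r k))) ^+ 2) +
  2 * n%:R * B ^+ 2 * (W / M%:R).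
Proof.
move=> B0 [wB wL dwL] w0 wu; set U := fun k : 'rV['I_M]_n => w (pt z r k).
pose g (k : 'rV['I_M]_n) := 2 * (lam ^+ 2 * (U k * U k)) +
   \sum_j (2 * (fdiff e h j U k * fdiff e h j U k) + 2 * (B ^+ 2 * M%:R^-1)).
have g0 k : 0 <= g k.
  rewrite addr_ge0 //; first by rewrite mulr_ge0 // -expr2 mulr_ge0 ?sqr_ge0.
  apply: sumr_ge0 => j _; rewrite addr_ge0 // mulr_ge0 // -?expr2 ?sqr_ge0 //.
  by rewrite mulr_ge0 ?sqr_ge0 ?invr_ge0.
apply: (@le_trans _ _ (\sum_k g k)).
  rewrite big_mkcond; apply: ler_sum => k _; case: ifP => // kin.
  have [wk pk] := wu k kin; rewrite /energy -wk; apply: lerD.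
    have alg (l q : R) : 0 <= l -> l * q ^+ 2 <= 2 * (l * (q * q)) by have := sqr_ge0 q; nra.
    exact: alg (sqr_ge0 lam).
  apply: ler_sum => j _; rewrite -pk.
  have D := sample_diff r0 pt0 hr B0 wB wL dwL w0 k j.
  have D2 : (fdiff e h j U k - pd j w (pt z r k)) ^+ 2 <= B ^+ 2 * M%:R^-1.
    rewrite -real_normK ?num_real //; apply: (@le_trans _ _ ((B * h) ^+ 2)).
      by rewrite lerXn2r ?nnegrE ?mulr_ge0 // ltW.
    rewrite exprMn ler_wpM2l ?sqr_ge0 //; apply: le_trans hM.
    by rewrite expr2 ler_piMl // ltW.
  move: (fdiff _ _ _ _ _) (pd j w _) (B ^+ 2 / _) D2 => p q s D2.
  by have := sqr_ge0 (p + p - q); nra.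
rewrite le_eqVlt; apply/orP; left; apply/eqP.
rewrite /g big_split /= mulrDr -addrA; congr (_ + _).
  by rewrite -!mulr_sumr nrm_sqr.
rewrite exchange_big /=; under eq_bigr do rewrite big_split /=.
rewrite big_split /=; congr (_ + _).
  by rewrite mulr_sumr; apply: eq_bigr => j _; rewrite -mulr_sumr nrm_sqr.
rewrite sum_card sum_card card_ord -/W.
by move: (n%:R : R) W (M%:R^-1 : R) (B ^+ 2) => *; ring.
Qed.

End Lattice.

(** The gain: the energy of the inner cube is a small multiple [Cl * ee] of that of the half cube.
    [Cl] is fixed before [B] and [lam]; [K] may depend on both, but not on the mesh, against which
    it is divided. *)
Lemma local_estimate : exists2 Cl, 0 <= Cl & forall B lam, 0 <= B -> 1 <= lam ->
  exists K, forall m N m' kap u,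
  (forall k : 'rV['I_m.+2]_n, pt z r k 0 i0 != 0) -> mesh m r <= r / 64 ->
  (0 < N)%N -> (N.*2.+2 < m.+2)%N -> (1 < m')%N -> (m' %| m.+2)%N ->
  (n%:R * slope_bound + 1) * (6 / N%:R) * lam <= kap ->
  regular B u ->
  (forall x, O x -> `|cont_operator a u lam x| <= C1 * \sum_l `|pd l u x|) ->
  (forall (t : 'I_n) (s : 'I_m.+2) md, (s %% m' <= 1)%N -> size md = n.-1 ->
     fcoefs (R := R) (N := N) (others t) md (fun k => chi (pt z r k) * u (pt z r k))
       (axis t s) = 0) ->
  let ee := mesh m r * m'%:R + kap + lam^-1 + mesh m r * lam ^+ 2 in
  Cl * ee <= 1 ->
  \sum_(k : 'rV['I_m.+2]_n | `|pt z r k - z| <= r / 4) energy lam u (pt z r k) <=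
  Cl * ee * (\sum_(k : 'rV['I_m.+2]_n | `|pt z r k - z| <= r / 2) energy lam u (pt z r k)) +
  K * (#|{: 'rV['I_m.+2]_n}|%:R / m.+2%:R).
Proof.
have chi1 x : O x -> `|chi x| <= 1.
  by move=> _; have /andP[c0 c1] := plateau01 z r x; rewrite ger0_norm.
have Hchi : CBe 2 O chi.
  by apply: CBe_leq (CBe_sub QO (CBe_plateau z r)).
have Ha i j : CBe 1 O (a i j) by exists A => //; exact: CB_leq (aA i j).
have [K K0 opK] := cont_operator_bound oO Ha Hchi C10 chi1.
(* The 2 makes [Lc * ee] at most 1/2, so that the energy on the right of [lattice_estimate] is
   absorbed. The 8 collects three factors 2: from this absorption, from [sum_residual] and from
   [sum_inner]. *)
exists ((8 * K + 2) * Lc); first by rewrite mulr_ge0 // addr_ge0 // mulr_ge0.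
move=> B lam B0 lam1; have [B' B'0 HB'] := regular_plateau B0.
pose F := lam ^+ 2 * B' + n%:R ^+ 2 * (5 * (A * B')).
pose F1 := n%:R ^+ 2 * ((4 * n%:R + 2) * (A * B')).
have AB : 0 <= A * B' by exact: mulr_ge0.
have F0 : 0 <= F by rewrite addr_ge0 // mulr_ge0 ?sqr_ge0 // mulr_ge0.
have F10 : 0 <= F1 by rewrite mulr_ge0 ?sqr_ge0 // mulr_ge0 // addr_ge0 // mulr_ge0.
pose K2 := 2 * F1 ^+ 2 + 9 * F ^+ 2; pose K3 := 2 * n%:R * B' ^+ 2.
exists (2 * K2 + K3) => m N m' kap u pt0 hr N0 NM m'2 m'M kapN ru PDE modes ee Cee.
have h0 : 0 < mesh m r by exact: mesh_gt0.
have [Hu _ _] := ru.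
have [wB wL dwL] := HB' u ru; set w := fun y => chi y * u y in wB wL dwL.
have w0 x : r / 2 <= `|x - z| -> w x = 0 by move=> H; rewrite /w /chi plateau_outer ?mul0r.
have w0' x : 3 / 4 * r <= `|x - z| -> w x = 0.
  by move=> H; apply: w0; apply: le_trans H; move: r0; lra.
have h1 : mesh m r <= 1 by apply: le_trans hr _; move: r1 r0; lra.
pose U (k : 'rV['I_m.+2]_n) := w (pt z r k).
pose e := fun i : 'I_n => axis i (1 : 'I_m.+2).
set V := \sum_(k : 'rV['I_m.+2]_n | `|pt z r k - z| <= r / 2) energy lam u (pt z r k).
pose E1 := lam ^+ 2 * nrm U ^+ 2 + \sum_i nrm (fdiff e (mesh m r) i U) ^+ 2.
pose f := elliptic_residual e (mesh m r) (acut z r a) lam U.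
set WM := _%:R / _.
have WM0 : 0 <= WM by rewrite divr_ge0.
have V0 : 0 <= V by apply: sumr_ge0 => k _; exact: energy_ge0.
have E10 : 0 <= E1.
  apply: addr_ge0; first exact: mulr_ge0 (sqr_ge0 _) (sqr_ge0 _).
  by apply: sumr_ge0 => i _; exact: sqr_ge0.
have Hlat : E1 <= Lc * ee * (E1 + nrm f ^+ 2).
  apply: (lattice_estimate (addr_ge0 A0 ler01) slope_bound_ge0 nu1 h0 _ _ _ _ _ N0 NM m'2 m'M
     lam1 kapN modes).
  - by rewrite /mesh divfK ?pnatr_eq0.
  - by move=> i j k; apply: (acut_sym r0 pt0 aC).
  - by move=> i j k; apply: (acut_bound r0 pt0 aA).
  - by move=> l i j k; apply: (acut_lip r0 pt0 hr A0 aA aL).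
  - by move=> k xi; apply: (acut_elliptic r0 pt0 a_ell).
have Hf : nrm f ^+ 2 <= 2 * K * V + K2 * WM.
  apply: (@sum_residual m pt0 hr lam u w F K F1) => //.
  - exact: (residual_bound r0 pt0 hr h1 A0 aA aL lam B'0 wB wL dwL w0').
  - move=> k kg; rewrite /F1 -mulrA.
    exact: (residual_limit r0 pt0 hr h1 A0 aA lam B'0 wB wL dwL w0' kg).
  - have Hu2 : CBe 2 O u by exists B => //; exact: (CB_leq (isT : (2 <= 3)%N) Hu).
    exact: (opK u lam Hu2 PDE).
  move=> x xf; apply: (@cont_operator_zero _ _ a [set y | r / 2 < `|y - z|]) => //.
    have -> : [set x : E | r / 2 < `|x - z|] = (fun x : E => `|x - z|) @^-1` [set t | r / 2 < t].
      by [].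
    apply: open_comp; last exact: open_gt.
    move=> y _; apply: (@continuous_comp _ _ _ (fun x : E => x - z) Num.Def.normr).
      by apply: continuousB => //; exact: cst_continuous.
    exact: norm_continuous.
  by move=> y /ltW; exact: w0.
have Hin := @sum_inner m pt0 hr lam u w B' B'0 (And3 wB wL dwL) w0' _.
have {}Hin := Hin _; apply: le_trans (Hin _) _.
  move=> k kin.
  have Ok : O (pt z r k) by split; [exact: pt_in_cube|exact: pt0].
  have w1 x : ball z (9 / 32 * r) x -> w x = u x.
    by rewrite -ball_normE /= distrC => H; rewrite /w /chi plateau_inner ?mul1r // ltW.
  have kb : ball z (9 / 32 * r) (pt z r k).
    by rewrite -ball_normE /= distrC; apply: le_lt_trans kin _; move: r0; lra.
  split; first exact: w1.
  by move=> j; apply: (pd_eq j (@ball_open _ _ z (9 / 32 * r)) kb w1).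
rewrite -/U -/E1 -/K3 -/WM.
have lam0 : 0 <= lam := le_trans ler01 lam1.
have kap0 : 0 <= kap.
  apply: le_trans kapN; apply: mulr_ge0 => //; apply: mulr_ge0; last exact: divr_ge0.
  by apply: addr_ge0 => //; apply: mulr_ge0 => //; exact: slope_bound_ge0.
have ee00 : 0 <= ee.
  apply: addr_ge0; last exact: mulr_ge0 (ltW h0) (sqr_ge0 _).
  apply: addr_ge0; last by rewrite invr_ge0.
  by apply: addr_ge0 => //; exact: mulr_ge0 (ltW h0) (ler0n _ _).
have ee0 : 0 <= Lc * ee by exact: mulr_ge0.
have c2 : 2 * (Lc * ee) <= 1.
  apply: le_trans Cee; rewrite -[leRHS]mulrA; apply: ler_wpM2r => //.
  by rewrite lerDr; exact: mulr_ge0.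
have K20 : 0 <= K2.
  apply: addr_ge0; first exact: mulr_ge0 (ler0n _ 2) (sqr_ge0 _).
  exact: mulr_ge0 (ler0n _ 9) (sqr_ge0 _).
have -> : (8 * K + 2) * Lc * ee * V = 8 * (K * ((Lc * ee) * V)) + 2 * ((Lc * ee) * V) by ring.
have H1 : 0 <= (Lc * ee) * V by exact: mulr_ge0.
have KWM : 0 <= K2 * WM by exact: mulr_ge0.
set c := Lc * ee in Hlat ee0 c2 H1 *.
have f0 : 0 <= nrm f ^+ 2 by exact: sqr_ge0.
have s1 : E1 <= 2 * c * nrm f ^+ 2.
  have alg (x d t : R) : 0 <= x -> 2 * d <= 1 -> x <= d * (x + t) -> x <= 2 * d * t by nra.
  exact: alg E10 c2 Hlat.
have s2 : 2 * c * nrm f ^+ 2 <= 2 * c * (2 * K * V + K2 * WM).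
  by rewrite ler_wpM2l // mulr_ge0.
have s3 : 2 * c * (K2 * WM) <= K2 * WM by rewrite ler_piMl.
have s4 : 2 * c * (2 * K * V + K2 * WM) = 4 * (K * (c * V)) + 2 * c * (K2 * WM) by ring.
have -> : (2 * K2 + K3) * WM = 2 * (K2 * WM) + K3 * WM by ring.
have alg (x1 t s x y k3 q cy : R) : 0 <= q -> x1 <= t -> t <= s -> cy <= y ->
  s = 4 * x + cy -> 2 * x1 + k3 <= 8 * x + 2 * q + (2 * y + k3) by lra.
exact: alg H1 s1 s2 s3 s4.
Qed.

End LocalEstimate.

(** * Charts *)

Section HalfSpaceCalculus.
Variables (R : realType) (n : nat) (i0 : 'I_n).
Hypothesis i00 : i0 = 0%N :> nat.
Local Notation E := 'rV[R]_n.
Local Notation e := (basis_vec R).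
Local Notation H := (@half_space R n).
Implicit Types (x y : E) (f F : E -> R) (i j : 'I_n) (U W V : set E).

Lemma heightE x : height x = x 0 i0.
Proof. by rewrite /height (big_pred1 i0) // => i /=; rewrite -val_eqE /= i00. Qed.

Lemma half_spaceP x : H x <-> 0 <= x 0 i0.
Proof. by rewrite /half_space /= heightE. Qed.

Lemma nbhs_open x (P : set E) : nbhs x P -> exists U, [/\ open U, U x & U `<=` P].
Proof.
move=> nP; exists P^°; split; [exact: open_interior|exact: nP|exact: interior_subset].
Qed.

Lemma finite_nbhs_open (I : finType) x (P : I -> set E) : (forall c : I, nbhs x (P c)) ->
  exists U, [/\ open U, U x & forall c y, U y -> P c y].
Proof.
move=> nP; have K : \forall y \near x, forall c : I, P c y.
  exact: (@filter_forall _ _ (fun c y => P c y) (nbhs x) _ nP).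
have [U [oU Ux UP]] := nbhs_open K.
by exists U; split => // c y /UP; apply.
Qed.

(** Smoothness gives no uniform bounds on an open set; they are obtained by shrinking the
    neighbourhood, once per order and direction. *)
Lemma smooth_local k W f x : open W -> W x -> smooth_open W f ->
  exists U, [/\ open U, U x, U `<=` W & CBe k U f].
Proof.
move=> oW Wx; elim: k f => [|k IH] f sf.
  have c0 : {for x, continuous f} := (sf [::] x Wx).1.
  have nb : \forall y \near x, `|f y - f x| <= 1.
    move/(@cvgrPdist_le _ _ _ (nbhs x) (nbhs_filter x)) : (c0) => /(_ 1 ltr01) h.
    by apply: filterS h => y; rewrite distrC.
  have [U [oU Ux UP]] := nbhs_open (filterI (open_nbhs_nbhs (conj oW Wx)) nb).
  exists U; split => //; first by move=> y /UP[].
  exists (`|f x| + 1); first by rewrite addr_ge0.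
  split => // y Uy; have [Wy fy] := UP y Uy; split; first exact: (sf [::] y Wy).1.
  rewrite -[f y](subrK (f x)) addrC; apply: le_trans (ler_normD _ _) _.
  by rewrite lerD2l.
have spd i : smooth_open W (pd i f).
  by move=> s y Wy; have := sf (s ++ [:: i]) y Wy; rewrite /iter_partial foldr_cat.
have [U0 [oU0 U0x U0W H0]] : exists U, [/\ open U, U x, U `<=` W & CBe 0 U f].
  have c0 : {for x, continuous f} := (sf [::] x Wx).1.
  have nb : \forall y \near x, `|f y - f x| <= 1.
    move/(@cvgrPdist_le _ _ _ (nbhs x) (nbhs_filter x)) : (c0) => /(_ 1 ltr01) h.
    by apply: filterS h => y; rewrite distrC.
  have [U [oU Ux UP]] := nbhs_open (filterI (open_nbhs_nbhs (conj oW Wx)) nb).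
  exists U; split => //; first by move=> y /UP[].
  exists (`|f x| + 1); first by rewrite addr_ge0.
  split => // y Uy; have [Wy fy] := UP y Uy; split; first exact: (sf [::] y Wy).1.
  rewrite -[f y](subrK (f x)) addrC; apply: le_trans (ler_normD _ _) _.
  by rewrite lerD2l.
have Hi i := IH (pd i f) (spd i).
pose Ui i := sval (cid (Hi i)).
have UiP i : [/\ open (Ui i), Ui i x, Ui i `<=` W & CBe k (Ui i) (pd i f)].
  by rewrite /Ui; case: cid.
have [U [oU Ux UP]] : exists U, [/\ open U, U x & forall i y, U y -> (U0 `&` Ui i) y].
  apply: finite_nbhs_open => i; have [oi ix _ _] := UiP i.
  by apply: filterI; apply: open_nbhs_nbhs.
have [i1 _|no] := pickP (fun _ : 'I_n => true); last first.
  exists U0; split => //; apply: (CBe_intro (df := fun _ _ => 0)) => //.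
    by move=> y i; have := no i.
  by move=> i; have := no i.
exists U; split => //; first by move=> y /(UP i1)[/U0W].
apply: (CBe_intro (df := fun i => pd i f)) => //.
- move=> y i /(UP i)[/U0W Wy _]; apply: DeriveDef => //.
  exact: (sf [::] y Wy).2.
- by move=> i; have [_ _ _ h] := UiP i; apply: CBe_sub h => y /(UP i)[].
by apply: CBe_sub H0 => y /(UP i1)[].
Qed.

Lemma smooth_on_ext k V W0 f x : open W0 -> V = W0 `&` H -> smooth_on V f -> V x ->
  exists U F, [/\ open U, U x, CBe k U F & forall y, U y -> H y -> V y /\ F y = f y].
Proof.
move=> oW0 VE sf Vx; have [W [F [oW Wx sF EF]]] := sf x Vx.
have [U [oU Ux UW HU]] := smooth_local k oW Wx sF.
have W0x : W0 x by move: Vx; rewrite VE => -[].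
exists (U `&` W0), F; split => //; first exact: openI.
- by apply: CBe_sub HU => y [].
move=> y [Uy W0y] Hy; have Vy : V y by rewrite VE.
by split => //; apply: EF => //; exact: UW.
Qed.

Lemma right_dnbhs (P : set R) : (0 : R)^' P -> (0 : R)^'+ P.
Proof.
move=> nP; have nP0 : nbhs (0 : R) (fun t => t != 0 -> P t) by exact: nP.
suff : nbhs (0 : R) (fun t => 0 < t -> P t) by [].
by apply: filterS nP0 => t h t0; apply: h; rewrite gt_eqF.
Qed.

Lemma left_dnbhs (P : set R) : (0 : R)^' P -> (0 : R)^'- P.
Proof.
move=> nP; have nP0 : nbhs (0 : R) (fun t => t != 0 -> P t) by exact: nP.
suff : nbhs (0 : R) (fun t => t < 0 -> P t) by [].
by apply: filterS nP0 => t h t0; apply: h; rewrite lt_eqF.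
Qed.

(** Small positive increments always stay in the half-space, so the restricted filter is proper and
    the limit unique; along it [f] and its extension have the same quotients. *)
Lemma hpartial_ext U F f x i : open U -> U x -> H x -> derivable F x (e i) ->
  (forall y, U y -> H y -> F y = f y) -> hpartial i f x = pd i F x.
Proof.
move=> oU Ux Hx dF EF.
pose S := [set h : R | H (x + h *: e i)].
have SP : ProperFilter (within S (0 : R)^').
  apply: Build_ProperFilter_ex => P; rewrite /within /= => nP.
  have : \forall h \near (0 : R)^'+, S h -> P h by exact: right_dnbhs nP.
  move=> nP'; have /filter_ex[h [h0 Ph]] :
     \forall h \near (0 : R)^'+, 0 < h /\ (S h -> P h).
    by apply: filterI => //; exact: nbhs_right_gt.
  exists h; apply: Ph; rewrite /S /= half_spaceP shift_coord.
  move/half_spaceP : Hx => Hx; case: ifP => _; rewrite ?addr0 //.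
  by rewrite addr_ge0 // ltW.
have c1 : (fun h : R => h^-1 *: ((F \o shift x) (h *: e i) - F x)) @ within S 0^' --> pd i F x.
  by apply: cvg_within_filter; exact: dF.
have Fx : F x = f x by exact: EF.
rewrite /hpartial; apply: cvg_lim => //.
have [eps e0 Be] : exists2 eps : R, 0 < eps & forall y, `|y - x| < eps -> U y.
  have /nbhs_ballP[eps e0 B] : nbhs x U by exact: open_nbhs_nbhs.
  by exists eps => // y yx; apply: B; rewrite -ball_normE /= distrC.
have nn : \forall h \near (0 : R)^', S h ->
    h^-1 *: ((F \o shift x) (h *: e i) - F x) = h^-1 * (f (x + h *: e i) - f x).
  near=> h => Sh.
  have hU : U (x + h *: e i).
    apply: Be; rewrite addrC addKr; apply: le_lt_trans (norm_scale_basis _ _) _.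
    near: h; apply: nbhs_dnbhs; exact: (@nbhs0_lt _ R).
  rewrite /= -(EF _ hU Sh) -Fx.
  by rewrite -[LHS]/(h^-1 * (F (h *: e i + x) - F x)) (addrC (h *: e i)).
exact: cvg_trans (@near_eq_cvg _ _ (within S (0 : R)^') _ _ _ nn) c1.
Unshelve. all: by end_near.
Qed.

Lemma hpartial_interior f x i : 0 < x 0 i0 -> hpartial i f x = pd i f x.
Proof.
move=> x0; pose S := [set h : R | H (x + h *: e i)].
have nS : \forall h \near (0 : R)^', S h.
  near=> h; rewrite /S /= half_spaceP shift_coord.
  have : `|h| < x 0 i0 by near: h; apply: nbhs_dnbhs; exact: (@nbhs0_lt _ R).
  rewrite ltr_norml => /andP[h1 _]; case: ifP => _; rewrite ?addr0 ?ltW //.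
  by rewrite -ltrBlDl sub0r.
rewrite /hpartial /pd /derive.
have -> : within S (0 : R)^' = (0 : R)^'.
  apply/funext => P; apply/propext; rewrite /within /=; split => h.
    by apply: filterS2 nS h => t St; apply.
  by apply: filterS h.
have -> : (fun h : R => h^-1 *: ((f \o shift x) (h *: e i) - f x)) =
    (fun h : R => h^-1 * (f (x + h *: e i) - f x)) => //.
apply/funext => h /=.
by rewrite -[LHS]/(h^-1 * (f (h *: e i + x) - f x)) (addrC (h *: e i)).
Unshelve. all: by end_near.
Qed.

Lemma pd_line_cst F x i : (\forall h \near (0 : R), F (x + h *: e i) = F x) -> pd i F x = 0.
Proof.
move=> nF; rewrite /pd /derive; apply: cvg_lim => //; apply: cvg_near_cst.
apply: nbhs_dnbhs; apply: filterS nF => h /= E1.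
by rewrite (addrC (h *: e i)) E1 subrr scaler0.
Qed.

Lemma pd_local_min F x i : derivable F x (e i) -> (\forall y \near x, F x <= F y) -> pd i F x = 0.
Proof.
move=> dF nF.
have c1 : (fun h : R => h^-1 *: ((F \o shift x) (h *: e i) - F x)) @ 0^' --> pd i F x by exact: dF.
have [eps e0 Be] : exists2 eps : R, 0 < eps & forall y, `|y - x| < eps -> F x <= F y.
  have /nbhs_ballP[eps e0 B] := nF.
  by exists eps => // y yx; apply: B; rewrite -ball_normE /= distrC.
have Fh (h : R) : `|h| < eps -> 0 <= F (h *: e i + x) - F x.
  move=> he; rewrite subr_ge0; apply: Be; rewrite addrK.
  exact: le_lt_trans (norm_scale_basis _ _) he.
apply/eqP; rewrite eq_le; apply/andP; split; last first.
  have c2 : (fun h : R => h^-1 *: ((F \o shift x) (h *: e i) - F x)) @ 0^'+ --> pd i F x.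
    by move=> P /c1 h; exact: right_dnbhs h.
  rewrite -[leRHS](cvg_lim _ c2) //; apply: limr_ge; first by apply/cvg_ex; exists (pd i F x).
  near=> h; rewrite -[X in _ <= X]/(h^-1 * (F (h *: e i + x) - F x)).
  have h0 : 0 < h by near: h; exact: nbhs_right_gt.
  apply: mulr_ge0; first by rewrite invr_ge0 ltW.
  by apply: Fh; rewrite gtr0_norm //; near: h; exact: nbhs_right_lt.
have c2 : (fun h : R => h^-1 *: ((F \o shift x) (h *: e i) - F x)) @ 0^'- --> pd i F x.
  by move=> P /c1 h; exact: left_dnbhs h.
rewrite -[leLHS](cvg_lim _ c2) //; apply: limr_le; first by apply/cvg_ex; exists (pd i F x).
near=> h; rewrite -[X in X <= _]/(h^-1 * (F (h *: e i + x) - F x)).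
have h0 : h < 0 by near: h; exact: nbhs_left_lt.
apply: mulr_le0_ge0; first by rewrite invr_le0 ltW.
apply: Fh; rewrite ltr0_norm // ltrNl; near: h; apply: nbhs_left_gt.
by rewrite oppr_lt0.
Unshelve. all: by end_near.
Qed.

Lemma lapl_eq (G G' : E -> 'M[R]_n) f f' U x : open U -> U x ->
  (forall y, U y -> G y = G' y) -> (forall y, U y -> f y = f' y) -> lapl G f x = lapl G' f' x.
Proof.
move=> oU Ux EG Ef; rewrite /lapl (EG x Ux); apply: congr1; apply: eq_bigr => i _.
apply: (pd_eq i oU Ux) => y Uy; rewrite (EG y Uy); apply: congr1.
by apply: eq_bigr => j _; apply: congr1; exact: (pd_eq j oU Uy Ef).
Qed.

End HalfSpaceCalculus.

(** * Change of charts, boundary points and boundary conditions *)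

Section Charts.
Variables (R : realType) (n : nat) (i0 : 'I_n).
Hypothesis i00 : i0 = 0%N :> nat.
Variables (M : compact_manifold R n) (g : riemannian_metric M).
Local Notation E := 'rV[R]_n.
Local Notation e := (basis_vec R).
Local Notation H := (@half_space R n).
Implicit Types (a b : chart M) (p : M) (x y : E) (u : M -> R) (i j k : 'I_n) (U : set E).

Lemma img_half a x : img M a x -> H x.
Proof. by have [W _ ->] := img_open (c := M) a => -[]. Qed.

Lemma param_local a (D : set M) x : open D -> img M a x -> D (param M a x) ->
  exists U, [/\ open U, U x & forall y, U y -> H y -> img M a y /\ D (param M a y)].
Proof.
move=> oD ax Dx; have [W oW aE] := img_open (c := M) a.
have Wx : W x by move: ax; rewrite aE => -[].
have /subspace_continuousP/(_ x ax) c := @param_continuous _ _ M a.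
have nD : nbhs (param M a x) D by exact: open_nbhs_nbhs.
have : \forall y \near x, img M a y -> D (param M a y) by exact: c nD.
move=> nD'; have [U [oU Ux UP]] := nbhs_open (filterI (open_nbhs_nbhs (conj oW Wx)) nD').
exists U; split => // y /UP[Wy h] Hy; have ay : img M a y by rewrite aE.
by split => //; exact: h.
Qed.

Lemma coord_local a (W : set E) p : open W -> dom M a p -> W (coord M a p) ->
  exists D, [/\ open D, D p & forall q, D q -> dom M a q /\ W (coord M a q)].
Proof.
move=> oW ap Wp.
have /subspace_continuousP/(_ p ap) c := @Defs.coord_continuous _ _ M a.
have nW : nbhs (coord M a p) W by exact: open_nbhs_nbhs.
have nW' : \forall q \near p, dom M a q -> W (coord M a q) by exact: c nW.
have nd : nbhs p (dom M a) by apply: open_nbhs_nbhs; split => //; exact: dom_open.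
have nP := filterI nd nW'.
exists (dom M a `&` [set q | dom M a q -> W (coord M a q)])^°; split.
- exact: open_interior.
- exact: nP.
by move=> q /interior_subset[dq h]; split => //; exact: h.
Qed.

Lemma transition_ext r a b p : dom M a p -> dom M b p ->
  exists U (F : 'I_n -> E -> R), [/\ open U, U (coord M a p), forall j, CBe r U (F j) &
    forall y, U y -> H y -> [/\ img M a y, dom M b (param M a y) &
      forall j, F j y = coord M b (param M a y) 0 j]].
Proof.
move=> ap bp; have ax := coord_img ap.
have [U0 [oU0 U0x U0P]] : exists U, [/\ open U, U (coord M a p) &
    forall y, U y -> H y -> img M a y /\ dom M b (param M a y)].
  by apply: param_local => //; [exact: dom_open|rewrite coordK].
pose V := coord M a @` (dom M a `&` dom M b).
have Vx : V (coord M a p) by exists p.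
have VP y : U0 y -> H y -> V y.
  move=> U0y Hy; have [ay by_] := U0P y U0y Hy.
  by exists (param M a y); [split => //; exact: param_dom|exact: paramK].
have Hj j : exists UF : set E * (E -> R), [/\ open UF.1, UF.1 (coord M a p), CBe r UF.1 UF.2 &
    forall y, V y -> UF.1 y -> UF.2 y = coord M b (param M a y) 0 j].
  have [W [F [oW Wx sF EF]]] := transition_smooth (c := M) (a := a) (b := b) j Vx.
  have [U [oU Ux UW HU]] := smooth_local r oW Wx sF.
  by exists (U, F); split => // y Vy Uy; apply: EF => //; exact: UW.
pose UF j := sval (cid (Hj j)).
have UFP j : [/\ open (UF j).1, (UF j).1 (coord M a p), CBe r (UF j).1 (UF j).2 &
    forall y, V y -> (UF j).1 y -> (UF j).2 y = coord M b (param M a y) 0 j].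
  by rewrite /UF; case: cid.
have [U [oU Ux UP]] : exists U, [/\ open U, U (coord M a p) &
    forall j y, U y -> (U0 `&` (UF j).1) y].
  apply: finite_nbhs_open => j; have [oi ix _ _] := UFP j.
  by apply: filterI; apply: open_nbhs_nbhs.
exists U, (fun j => (UF j).2); split => //.
  by move=> j; have [_ _ h _] := UFP j; apply: CBe_sub h => y /(UP j)[].
move=> y Uy Hy; have [U0y _] := UP i0 y Uy; have [ay by_] := U0P y U0y Hy.
split => // j; have [_ _ _ h] := UFP j; apply: h; first exact: VP.
by have [] := UP j y Uy.
Qed.

Definition local_fun a u : E -> R := fun x => u (param M a x).

Lemma local_fun_ext r a u x : smooth_fun u -> img M a x ->
  exists U F, [/\ open U, U x, CBe r U F & forall y, U y -> H y -> img M a y /\ F y = local_fun a u y].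
Proof.
move=> su ax; have [W oW aE] := img_open (c := M) a.
exact: (smooth_on_ext r oW aE (su a) ax).
Qed.

Lemma hpartial_chain u a b p i : smooth_fun u -> dom M a p -> dom M b p ->
  hpartial i (local_fun a u) (coord M a p) =
  \sum_m transition_jacobian a b (coord M a p) i m * hpartial m (local_fun b u) (coord M b p).
Proof.
move=> su ap bp; set x := coord M a p.
have [U [F [oU Ux HF EF]]] := transition_ext 1 ap bp.
have [U' [h [oU' U'x Hh Eh]]] := local_fun_ext 1 su (coord_img bp).
have Hx : H x := img_half (coord_img ap).
have Hbx := img_half (coord_img bp).
pose Phi y : E := \row_j F j y.
have Phix : Phi x = coord M b p.
  by apply/rowP => j; rewrite mxE; have [_ _ ->] := EF x Ux Hx; rewrite coordK.
have cPhi : {for x, continuous Phi}.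
  apply: cont_coords => j; apply: (cont_eq oU Ux) (CBe_continuous (HF j) Ux) => y _.
  by rewrite mxE.
have nU' : \forall y \near x, U' (Phi y).
  by apply: cPhi; apply: open_nbhs_nbhs; rewrite Phix.
have [Q [oQ Qx QP]] := nbhs_open (filterI (open_nbhs_nbhs (conj oU Ux)) nU').
have dE j : is_derive x (e i) (fun y => Phi y 0 j) (pd i (F j) x).
  rewrite (_ : (fun y => Phi y 0 j) = F j); first exact: CBe_is_derive (HF j) Ux.
  by apply/funext => y; rewrite mxE.
have [d1 v1] : is_derive x (e i) (h \o Phi)
    (\sum_j 'D_(e i) (fun y => Phi y 0 j) x * pd j h (Phi x)).
  apply: (chain_rule oU').
  - by rewrite Phix.
  - by move=> j y U'y; have [B _ HB] := Hh; exact: CB_der HB U'y.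
  - by move=> j; rewrite Phix; have [B _ HB] := Hh; exact: CB_cont (CB_pd j HB) U'x.
  - by move=> j; have [] := dE j.
have -> : hpartial i (local_fun a u) x = pd i (h \o Phi) x.
  apply: (hpartial_ext i00 oQ Qx Hx d1) => y /QP[Uy U'y] Hy /=.
  have [ay by_ Fy] := EF y Uy Hy.
  have PE : Phi y = coord M b (param M a y) by apply/rowP => j; rewrite mxE Fy.
  have HPy : H (Phi y) by rewrite PE; exact: img_half (coord_img by_).
  have [_ ->] := Eh _ U'y HPy.
  by rewrite /local_fun PE coordK.
rewrite {1}/pd v1; apply: eq_bigr => m _; have [_ ->] := dE m; congr (_ * _).
  rewrite mxE; apply/esym; apply: (hpartial_ext i00 oU Ux Hx).
    by have [B _ HB] := HF m; exact: CB_der HB Ux.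
  by move=> y Uy Hy; have [_ _ ->] := EF y Uy Hy.
apply/esym; rewrite Phix; apply: (hpartial_ext i00 oU' U'x Hbx).
  by have [B _ HB] := Hh; exact: CB_der HB U'x.
by move=> y Uy Hy; have [_ ->] := Eh y Uy Hy.
Qed.

Lemma metric_det_gt0 a x : img M a x -> 0 < \det (g a x).
Proof. by move=> ax; apply: posdef_det_gt0; exact: metric_posdef. Qed.

(** Invariance of the boundary. If an interior point had height 0 in the chart [b], the height of
    the transition map would have a local minimum there, its gradient would vanish and the Jacobian
    would be singular, contradicting the transformation law of the metric. *)
Lemma interior_chart a b p : dom M a p -> dom M b p ->
  0 < coord M a p 0 i0 -> 0 < coord M b p 0 i0.
Proof.
move=> ap bp x0; set x := coord M a p in x0.
have /half_spaceP-/(_ _ i00) := img_half (coord_img bp).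
rewrite le_eqVlt => /orP[/eqP y0|//].
have [U [F [oU Ux HF EF]]] := transition_ext 1 ap bp.
have Hx : H x := img_half (coord_img ap).
have Fx : F i0 x = 0 by have [_ _ ->] := EF x Ux Hx; rewrite coordK.
have nH : \forall y \near x, 0 < (y : E) 0 i0.
  have : {for x, continuous (fun y : E => y 0 i0)} by exact: coord_continuous.
  by move=> /(_ [set t | 0 < t]); apply; apply: open_nbhs_nbhs; split => //; exact: open_gt.
have J0 i : transition_jacobian a b x i i0 = 0.
  have dF : derivable (F i0) x (e i) by have [B _ HB] := HF i0; exact: CB_der HB Ux.
  rewrite mxE (hpartial_ext i00 oU Ux Hx dF); last first.
    by move=> y Uy Hy; have [_ _ ->] := EF y Uy Hy.
  suff nmin : \forall y \near x, F i0 x <= F i0 y by exact: pd_local_min dF nmin.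
  apply: filterS2 (open_nbhs_nbhs (conj oU Ux)) nH => y Uy y1; rewrite Fx.
  have Hy : H y by apply/(half_spaceP i00); exact: ltW.
  have [_ by_ ->] := EF y Uy Hy.
  by apply/(half_spaceP i00); exact: img_half (coord_img by_).
have := metric_transition g ap bp; rewrite -/x /= => GE.
have := metric_det_gt0 (coord_img ap); rewrite -/x GE !det_mulmx.
have -> : \det (transition_jacobian a b x) = 0; last by rewrite !mul0r ltxx.
rewrite (expand_det_col _ i0) big1 // => i _; by rewrite J0 mul0r.
Qed.

Lemma interior_open x : 0 < x 0 i0 -> \forall y \near x, 0 < (y : E) 0 i0.
Proof.
move=> x0; have : {for x, continuous (fun y : E => y 0 i0)} by exact: coord_continuous.
by move=> /(_ [set t | 0 < t]); apply; apply: open_nbhs_nbhs; split => //; exact: open_gt.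
Qed.

Lemma open_interior_half : open [set y : E | 0 < y 0 i0].
Proof. by rewrite openE => x; exact: interior_open. Qed.

Lemma local_laplacian_interior a f x : 0 < x 0 i0 -> local_laplacian g a f x = lapl (g a) f x.
Proof.
move=> x0; rewrite /local_laplacian /lapl /density; apply: congr1.
apply: eq_bigr => i _; apply: etrans (hpartial_interior i00 _ i x0) _.
apply: (pd_eq i open_interior_half x0) => y y0; apply: congr1.
by apply: eq_bigr => j _; apply: congr1; exact: (hpartial_interior i00 f j y0).
Qed.

Lemma metric_local r a x i j : img M a x -> 0 < x 0 i0 ->
  exists U, [/\ open U, U x & CBe r U (fun y => g a y i j)].
Proof.
move=> ax x0; have [W oW aE] := img_open (c := M) a.
have [U [F [oU Ux HF EF]]] := smooth_on_ext r oW aE (metric_smooth g i j) ax.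
have oU' : open (U `&` [set y : E | 0 < y 0 i0]) by apply: openI => //; exact: open_interior_half.
exists (U `&` [set y : E | 0 < y 0 i0]); split => //.
apply: (CBe_eq oU') (CBe_sub _ HF); last by move=> y [].
move=> y [Uy y0]; have Hy : H y by apply/(half_spaceP i00); exact: ltW.
by have [_ ->] := EF y Uy Hy.
Qed.

Lemma lapl_chart u a b p : smooth_fun u -> dom M a p -> dom M b p -> 0 < coord M a p 0 i0 ->
  lapl (g a) (local_fun a u) (coord M a p) = lapl (g b) (local_fun b u) (coord M b p).
Proof.
move=> su ap bp x0; set x := coord M a p in x0 *.
have y0 : 0 < coord M b p 0 i0 := interior_chart ap bp x0.
have [U [F [oU Ux HF EF]]] := transition_ext 2 ap bp.
have [U' [h [oU' U'x Hh Eh]]] := local_fun_ext 2 su (coord_img bp).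
have Hx : H x := img_half (coord_img ap).
have gl (ij : 'I_n * 'I_n) := metric_local 1 ij.1 ij.2 (coord_img bp) y0.
pose Uij ij := sval (cid (gl ij)).
have UijP ij : [/\ open (Uij ij), Uij ij (coord M b p) & CBe 1 (Uij ij) (fun y => g b y ij.1 ij.2)].
  by rewrite /Uij; case: cid.
have [U1 [oU1 U1x U1P]] : exists U, [/\ open U, U (coord M b p) & forall ij y, U y -> Uij ij y].
  apply: finite_nbhs_open => ij; have [oi ix _] := UijP ij; exact: open_nbhs_nbhs.
have Hdet : CBe 1 U1 (fun y => \det (g b y)).
  apply: CBe_det => // i j; have [_ _ hij] := UijP (i, j).
  by apply: CBe_sub hij => y /(U1P (i, j)).
set c := \det (g b (coord M b p)) / 2.
have d0 := metric_det_gt0 (coord_img bp).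
have c0 : 0 < c by rewrite divr_gt0.
have nd : \forall y \near coord M b p, c <= \det (g b y).
  have := CBe_continuous Hdet U1x.
  move=> /(@cvgrPdist_lt _ _ _ (nbhs (coord M b p)) (nbhs_filter _)) /(_ c c0) hd.
  apply: filterS hd => y; rewrite ltr_distlC => /andP[h1 _]; apply: le_trans (ltW h1).
  by rewrite /c; move: (\det _) => d; lra.
have [Q' [oQ' Q'x Q'P]] := nbhs_open (filterI (filterI (open_nbhs_nbhs (conj oU' U'x))
   (open_nbhs_nbhs (conj oU1 U1x))) (filterI nd (interior_open y0))).
pose Phi y : E := \row_j F j y.
have PhiE j : (fun y => Phi y 0 j) = F j by apply/funext => y; rewrite mxE.
have Phix : Phi x = coord M b p.
  by apply/rowP => j; rewrite mxE; have [_ _ ->] := EF x Ux Hx; rewrite coordK.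
have cPhi : {for x, continuous Phi}.
  by apply: cont_coords => j; rewrite PhiE; exact: CBe_continuous (HF j) Ux.
have nO' : \forall y \near x, Q' (Phi y).
  by apply: cPhi; apply: open_nbhs_nbhs; rewrite Phix.
have [Q [oQ Qx QP]] := nbhs_open (filterI (open_nbhs_nbhs (conj oU Ux)) (filterI nO' (interior_open x0))).
have OO y : Q y -> Q' (Phi y) by move=> /QP[_ []].
have PE y : Q y -> [/\ img M a y, dom M b (param M a y) & Phi y = coord M b (param M a y)].
  move=> /QP[Uy [_ y1]]; have Hy : H y by apply/(half_spaceP i00); exact: ltW.
  have [ay by_ Fy] := EF y Uy Hy; split => //.
  by apply/rowP => j; rewrite mxE Fy.
have JE y : Q y -> transition_jacobian a b y = jac Phi y.
  move=> Qy; apply/matrixP => i j; rewrite !mxE.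
  have [_ [_ y1]] := QP y Qy; rewrite (hpartial_interior i00) //.
  by apply: (pd_eq i oQ Qy) => z Qz; have [_ _ ->] := PE z Qz.
have GE y : Q y -> g a y = jac Phi y *m g b (Phi y) *m (jac Phi y)^T.
  move=> Qy; have [ay by_ ->] := PE y Qy; rewrite -JE //.
  have := metric_transition g (param_dom ay) by_ => /=.
  by rewrite paramK.
have J0 y : Q y -> \det (jac Phi y) != 0.
  move=> Qy; have [ay _ _] := PE y Qy; have := metric_det_gt0 ay.
  rewrite GE // !det_mulmx; apply: contraTneq => ->.
  by rewrite !mul0r ltxx.
have Hw : CBe 2 Q' (local_fun b u).
  apply: (CBe_eq oQ') (CBe_sub _ Hh); last by move=> y /Q'P[[]].
  move=> y /Q'P[[Uy _] [_ y1]]; have Hy : H y by apply/(half_spaceP i00); exact: ltW.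
  by have [_ ->] := Eh y Uy Hy.
have HG i j : CBe 1 Q' (fun y => g b y i j).
  by have [_ _ hij] := UijP (i, j); apply: CBe_sub hij => y /Q'P[[_ /(U1P (i, j))]].
have HP j : CBe 2 Q (fun y => Phi y 0 j).
  by rewrite PhiE; apply: CBe_sub (HF j) => y /QP[].
have dG y : Q' y -> c <= \det (g b y) by move=> /Q'P[_ []].
have T := lapl_transform oQ oQ' OO HP HG c0 dG Hw GE J0 Qx.
have S : lapl (g a) (local_fun a u) (coord M a p) =
    lapl (g a) (fun y => local_fun b u (Phi y)) (coord M a p).
  apply: (lapl_eq oQ Qx (fun y _ => erefl)) => y Qy.
  by have [ay by_ ->] := PE y Qy; rewrite /local_fun coordK.
apply: (etrans S); apply: (etrans T); apply: congr1; exact: Phix.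
Qed.

(** [laplace_beltrami] is evaluated in [chart_at] of each point, so the equation in a fixed chart
    rests on the invariance [lapl_chart]. *)
Lemma eigen_chart bc mu u a x : laplace_eigenspace g bc mu u -> img M a x -> 0 < x 0 i0 ->
  lapl (g a) (local_fun a u) x = - (mu * u (param M a x)).
Proof.
move=> [su PDE _] ax x0; set p := param M a x.
have ap : dom M a p := param_dom ax.
have bp := chart_at_dom p.
have xE : coord M a p = x by exact: paramK.
have cp : 0 < coord M a p 0 i0 by rewrite xE.
rewrite -xE (lapl_chart su ap bp cp).
have := PDE p; rewrite /laplace_beltrami local_laplacian_interior.
  by move/eqP; rewrite addr_eq0 => /eqP.
exact: interior_chart ap bp cp.
Qed.

Lemma boundary_param a x : img M a x -> x 0 i0 = 0 -> boundary (param M a x).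
Proof.
move=> ax x0; exists a; first exact: param_dom.
by rewrite paramK // (heightE i00).
Qed.

Lemma boundary_chart a b p : dom M a p -> dom M b p ->
  coord M a p 0 i0 = 0 -> coord M b p 0 i0 = 0.
Proof.
move=> ap bp x0; apply/eqP; rewrite eq_le; apply/andP; split; last first.
  by apply/(half_spaceP i00); exact: img_half (coord_img bp).
rewrite leNgt; apply/negP => y0.
by have := interior_chart bp ap y0; rewrite x0 ltxx.
Qed.

(** Transition maps send the boundary plane to itself, so the height of the image is constant along
    tangential lines. *)
Lemma transition_jacobian_plane b a p k : dom M b p -> dom M a p -> coord M b p 0 i0 = 0 ->
  k != i0 -> transition_jacobian b a (coord M b p) k i0 = 0.
Proof.
move=> bp ap y0 ki; set y := coord M b p in y0 *.
have [U [F [oU Uy HF EF]]] := transition_ext 1 bp ap.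
have Hy : H y := img_half (coord_img bp).
have dF : derivable (F i0) y (e k) by have [B _ HB] := HF i0; exact: CB_der HB Uy.
rewrite mxE (hpartial_ext i00 oU Uy Hy dF); last first.
  by move=> z Uz Hz; have [_ _ ->] := EF z Uz Hz.
apply: pd_line_cst.
have [eps e0 Be] : exists2 eps : R, 0 < eps & forall z, `|z - y| < eps -> U z.
  have /nbhs_ballP[eps e0 B] : nbhs y U by exact: open_nbhs_nbhs.
  by exists eps => // z yx; apply: B; rewrite -ball_normE /= distrC.
have F0 z : U z -> z 0 i0 = 0 -> F i0 z = 0.
  move=> Uz z0; have Hz : H z by apply/(half_spaceP i00); rewrite z0.
  have [bz az ->] := EF z Uz Hz.
  apply: (boundary_chart (param_dom bz) az).
  by rewrite paramK.
near=> t; rewrite !F0 // ?shift_coord.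
  by apply: Be; rewrite addrC addKr; apply: le_lt_trans (norm_scale_basis _ _) _; near: t; exact: (@nbhs0_lt _ R).
by rewrite eq_sym (negPf ki) addr0.
Unshelve. all: by end_near.
Qed.

(** The unit normal in [chart_at] is a multiple of row [i0] of the inverse metric, so the Neumann
    condition kills the [i0] component of the gradient there. Gradients transform by J^T, and by
    [transition_jacobian_plane] the [i0] component depends only on the old [i0] component. *)
Lemma neumann_chart mu u a p : laplace_eigenspace g Neumann mu u -> dom M a p ->
  coord M a p 0 i0 = 0 ->
  \sum_j invmx (g a (coord M a p)) i0 j * hpartial j (local_fun a u) (coord M a p) = 0.
Proof.
move=> [su _ bcu] ap x0; set b := chart_at M p; have bp : dom M b p := chart_at_dom p.
set x := coord M a p in x0 *; set y := coord M b p.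
have y0 : y 0 i0 = 0 := boundary_chart ap bp x0.
set Ga := g a x; set Gb := g b y.
have Gbu : Gb \in unitmx by apply: posdef_unit; exact: (metric_posdef g) (coord_img bp).
have Gau : Ga \in unitmx by apply: posdef_unit; exact: (metric_posdef g) (coord_img ap).
have S := Defs.metric_sym g (coord_img bp).
have Gbs : Gb^T = Gb by exact: S.
set J := transition_jacobian b a y.
have GE : Gb = J *m Ga *m J^T by exact: (metric_transition g bp ap).
pose ha := \col_j hpartial j (local_fun a u) x; pose hb := \col_j hpartial j (local_fun b u) y.
have hE : hb = J *m ha.
  apply/colP => i; rewrite !mxE (hpartial_chain i su bp ap).
  by apply: eq_bigr => m _; rewrite !mxE.
have key : J^T *m (invmx Gb *m hb) = invmx Ga *m ha.
  have Ju : J \in unitmx by move: Gbu; rewrite GE !unitmx_mul => /andP[/andP[]].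
  apply: (can_inj (mulKmx Gau)); rewrite mulKVmx //.
  apply: (can_inj (mulKmx Ju)); rewrite -hE !mulmxA -GE.
  by rewrite -mulmxA mulKVmx.
(* Solves v Gb = e_i0, hence is orthogonal to the plane; [nu] is its outward normalisation. *)
pose v : E := delta_mx 0 i0 *m invmx Gb.
have invs : (invmx Gb)^T = invmx Gb by rewrite trmx_inv Gbs.
have vG (w : E) : (v *m Gb *m w^T) 0 0 = w 0 i0.
  rewrite /v mulmxKV // mxE (bigD1 i0) //= !mxE !eqxx mul1r big1 ?addr0 // => k ki.
  by rewrite !mxE (negPf ki) andbF mul0r.
have v0 : v != 0.
  apply/eqP => v0; have := vG (delta_mx 0 i0).
  by rewrite v0 !mul0mx !mxE !eqxx => /eqP; rewrite eq_sym oner_eq0.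
set s2 := v 0 i0.
have s20 : 0 < s2 by have := metric_posdef g (coord_img bp) v0; rewrite /bilin vG.
pose s := Num.sqrt s2; have s0 : 0 < s by rewrite sqrtr_gt0.
pose nu : E := - s^-1 *: v.
have nuG w : bilin Gb nu w = - s^-1 * w 0 i0 by rewrite /bilin /nu -!scalemxAl mxE vG.
have N1 : outward_unit_normal g p nu.
  split.
  - by rewrite (heightE i00) mxE nmulr_rlt0 // oppr_lt0 invr_gt0.
  - by move=> w; rewrite (heightE i00) => w0; rewrite -/b -/y -/Gb nuG w0 mulr0.
  rewrite -/b -/y -/Gb nuG; have -> : nu 0 i0 = - s^-1 * s2 by rewrite mxE.
  have -> : s2 = s * s by rewrite -expr2 sqr_sqrtr // ltW.
  have alg (t : R) : 0 < t -> - t^-1 * (- t^-1 * (t * t)) = 1.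
    by move=> t0; field; rewrite gt_eqF.
  exact: alg s0.
have bdp : boundary p by exists a => //; rewrite (heightE i00).
have := bcu p nu bdp N1; rewrite /dir_derivative -/b -/y => D0.
have vh : (v *m hb) 0 0 = 0.
  apply: (mulfI (_ : - s^-1 != 0)); first by rewrite oppr_eq0 invr_eq0 gt_eqF.
  rewrite mulr0 -D0 mxE mulr_sumr; apply: eq_bigr => i _.
  by rewrite /nu !mxE mulrA.
have -> : \sum_j invmx Ga i0 j * hpartial j (local_fun a u) x = (invmx Ga *m ha) i0 0.
  by rewrite mxE; apply: eq_bigr => j _; rewrite mxE.
rewrite -key mxE (bigD1 i0) //= [X in _ + X]big1 ?addr0; last first.
  by move=> k ki; rewrite mxE (transition_jacobian_plane bp ap y0 ki) mul0r.
have -> : (invmx Gb *m hb) i0 0 = (v *m hb) 0 0; last by rewrite vh mulr0.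
rewrite !mxE; apply: eq_bigr => j _; congr (_ * _).
rewrite /v mxE (bigD1 i0) //= mxE !eqxx mul1r big1 ?addr0 // => k ki.
by rewrite mxE (negPf ki) andbF mul0r.
Qed.

End Charts.

(** * Reflection across the boundary *)

Section Gluing.
Variables (R : realType) (n : nat) (i0 : 'I_n).
Local Notation E := 'rV[R]_n.
Local Notation e := (basis_vec R).
Implicit Types (x y q : E) (f : E -> R) (i j : 'I_n) (U D : set E).

Lemma mem_ballP (z x : E) (r : R) : ball z r x <-> `|x - z| < r.
Proof. by rewrite -ball_normE /= distrC. Qed.

Lemma CB_local (B : R) k D f : (forall x, D x -> exists2 D', D' x & CB B k D' f) -> CB B k D f.
Proof.
elim: k f => [|k IH] f H0.
  by split => // x /H0[D' D'x h]; split; [exact: CB_cont h D'x|exact: CB_bound h D'x].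
split.
  by move=> x /H0[D' D'x h]; split; [exact: CB_cont h D'x|exact: CB_bound h D'x].
move=> i; split; first by move=> x /H0[D' D'x h]; exact: CB_der h D'x.
by apply: IH => x /H0[D' D'x h]; exists D' => //; exact: CB_pd.
Qed.

Lemma near_ge k U f x : CBe k U f -> U x -> 0 < f x ->
  exists2 c, 0 < c & \forall y \near x, c <= f y.
Proof.
move=> Hf Ux f0; exists (f x / 2); first by rewrite divr_gt0.
have c0 : 0 < f x / 2 by rewrite divr_gt0.
have := CBe_continuous Hf Ux.
move=> /(@cvgrPdist_lt _ _ _ (nbhs x) (nbhs_filter _)) /(_ _ c0) hd.
apply: filterS hd => y; rewrite ltr_distlC => /andP[h1 _]; apply: le_trans (ltW h1).
by move: (f x) => d; lra.
Qed.

Lemma nbhs_cube x (P : set E) : nbhs x P -> exists2 r : R, 0 < r & forall y, `|y - x| < r -> P y.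
Proof.
move=> /nbhs_ballP[r r0 B]; exists r => // y yx; apply: B; exact/mem_ballP.
Qed.

Variables (z : E) (r : R).
Local Notation O := (split_cube i0 z r).
Local Notation Op := (O `&` [set x | 0 < x 0 i0]).
Local Notation Om := (O `&` [set x | x 0 i0 < 0]).

Lemma open_pos : open [set x : E | 0 < x 0 i0].
Proof.
apply: (@open_comp _ _ (fun x : E => x 0 i0) [set t | 0 < t]); last exact: open_gt.
by move=> x _; exact: coord_continuous.
Qed.

Lemma open_neg : open [set x : E | x 0 i0 < 0].
Proof.
apply: (@open_comp _ _ (fun x : E => x 0 i0) [set t | t < 0]); last exact: open_lt.
by move=> x _; exact: coord_continuous.
Qed.

Lemma open_upper : open Op.
Proof. by apply: openI; [exact: open_split_cube|exact: open_pos]. Qed.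

Lemma open_lower : open Om.
Proof. by apply: openI; [exact: open_split_cube|exact: open_neg]. Qed.

Lemma split_cases x : O x -> Op x \/ Om x.
Proof.
move=> Ox; have [_ x0] := Ox.
by case: (ltgtP (x 0 i0) 0) => H; [right|left|rewrite H eqxx in x0].
Qed.

Lemma CBe_split k f : CBe k Op f -> CBe k Om f -> CBe k O f.
Proof.
move=> [B B0 H] [B' B'0 H']; exists (B + B'); first exact: addr_ge0.
apply: CB_local => x /split_cases[h|h]; [exists Op|exists Om] => //.
  by apply: CB_le H; rewrite lerDl.
by apply: CB_le H'; rewrite lerDr.
Qed.

(** The limits from the two sides of the plane exist and agree, which is all that gluing
    requires. *)
Definition crosses f := forall q, `|q - z| < r -> q 0 i0 = 0 ->
  exists l : R, forall eps, 0 < eps -> \forall x \near q, O x -> `|f x - l| <= eps.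

(** A segment through the plane is cut just before and just after the crossing [q]; both pieces obey
    the mean value theorem, and near [q] the values are within [eps / 2] of the common limit [l]. *)
Lemma LL_cross (B : R) f : 0 <= B -> CB B 1 O f -> crosses f -> LL i0 z r B f.
Proof.
move=> B0 Hf Cf x i s Ox Oy.
have same x' y' (t : R) : y' = x' + t *: e i -> O x' -> O y' -> 0 < x' 0 i0 * y' 0 i0 ->
    `|f y' - f x'| <= B * `|t|.
  move=> -> Ox' Oy' xy; have [tt [_ Ot ->]] := mvt_same_side Hf Ox' Oy' xy.
  by rewrite normrM mulrC ler_wpM2r // (CB_bound (CB_pd i Hf) Ot).
have [xy|] := ltP 0 (x 0 i0 * (x + s *: e i) 0 i0); first exact: same.
have [[xr x0] [yr y0]] := (Ox, Oy).
move: y0; rewrite shift_coord; case: ifP => [/eqP ii0 y0|_ y0]; last first.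
  have x2 : 0 < x 0 i0 ^+ 2 by rewrite exprn_even_gt0.
  by rewrite addr0 -expr2 leNgt x2.
subst i => xy0; pose xi := x 0 i0.
have xy : xi * (xi + s) < 0 by rewrite lt_neqAle xy0 mulf_neq0.
have s0 : s != 0.
  apply: contraTneq xy => ->; rewrite addr0 -expr2 -leNgt; exact: sqr_ge0.
pose c := - xi / s.
have c01 : 0 < c < 1.
  have : 0 < c * (1 - c).
    have -> : c * (1 - c) = - (xi * (xi + s)) / s ^+ 2.
      by rewrite /c; field.
    by rewrite divr_gt0 ?oppr_gt0 // exprn_even_gt0.
  by move=> H; apply/andP; split; nra.
have /andP[c0 c1] := c01.
have xiE : xi = - (c * s) by rewrite /c divfK // opprK.
pose q := x + (c * s) *: e i0.
have qr : `|q - z| < r by apply: line_in_cube => //; rewrite !ltW.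
have q0 : q 0 i0 = 0 by rewrite shift_coord eqxx -/xi xiE addNr.
have [l Hl] := Cf q qr q0.
apply/ler_addgt0Pr => eps e0.
have e2 : 0 < eps / 2 by rewrite divr_gt0.
have [d d0 Hd] := nbhs_cube (Hl _ e2).
pose tau := Num.min (1 / 2) (d / (2 * `|s|)).
have ns : 0 < `|s| by rewrite normr_gt0.
have tau0 : 0 < tau by rewrite lt_min !divr_gt0 // mulr_gt0.
have tauh : tau <= 1 / 2 by rewrite ge_min lexx.
have taud : tau * `|s| < d.
  apply: (@le_lt_trans _ _ (d / (2 * `|s|) * `|s|)).
    by rewrite ler_wpM2r // /tau ge_min lexx orbT.
  have -> : d / (2 * `|s|) * `|s| = d / 2 by field; rewrite gt_eqF.
  by move: d0; lra.
pose a := c * (1 - tau); pose b := c + tau * (1 - c).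
have a01 : 0 <= a <= 1 by rewrite /a; apply/andP; split; nra.
have b01 : 0 <= b <= 1 by rewrite /b; apply/andP; split; nra.
have Opt t : 0 <= t <= 1 -> t != c -> O (x + (t * s) *: e i0).
  move=> t01 tc; split; first exact: line_in_cube.
  rewrite shift_coord eqxx -/xi xiE -mulNr -mulrDl mulf_neq0 //.
  by rewrite addrC subr_eq0.
have ca : a != c by rewrite /a; apply/eqP => H; nra.
have cb : b != c by rewrite /b; apply/eqP => H; nra.
have Oa := Opt a a01 ca; have Ob := Opt b b01 cb.
have fq t : 0 <= t <= 1 -> t != c -> `|t - c| <= tau -> `|f (x + (t * s) *: e i0) - l| <= eps / 2.
  move=> t01 tc tt; apply: Hd; last exact: Opt.
  rewrite /q opprD addrACA subrr add0r -scalerBl -mulrBl.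
  apply: le_lt_trans (norm_scale_basis _ _) _; rewrite normrM.
  by apply: le_lt_trans taud; rewrite ler_wpM2r.
have Fa : `|f (x + (a * s) *: e i0) - l| <= eps / 2.
  apply: fq => //; rewrite /a ler_norml; apply/andP; split; nra.
have Fb : `|f (x + (b * s) *: e i0) - l| <= eps / 2.
  apply: fq => //; rewrite /b ler_norml; apply/andP; split; nra.
have s2 : 0 < s ^+ 2 by rewrite exprn_even_gt0.
have E1 : `|f (x + (a * s) *: e i0) - f x| <= B * `|a * s|.
  apply: same => //; rewrite shift_coord eqxx -/xi xiE.
  have -> : - (c * s) * (- (c * s) + a * s) = c * (c - a) * s ^+ 2 by ring.
  rewrite mulr_gt0 // mulr_gt0 // /a; nra.
have E2 : `|f (x + s *: e i0) - f (x + (b * s) *: e i0)| <= B * `|(1 - b) * s|.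
  apply: same => //.
    by rewrite -addrA -scalerDl; congr (_ + _ *: _); ring.
  rewrite !shift_coord eqxx -/xi xiE.
  have -> : (- (c * s) + b * s) * (- (c * s) + s) = (1 - c) * (b - c) * s ^+ 2 by ring.
  rewrite mulr_gt0 // mulr_gt0 // ?subr_gt0 // /b; nra.
have na : `|a * s| = a * `|s| by rewrite normrM ger0_norm //; case/andP: a01.
have nb : `|(1 - b) * s| = (1 - b) * `|s|.
  by rewrite normrM ger0_norm // subr_ge0; case/andP: b01.
rewrite na in E1; rewrite nb in E2.
have alg (fy fx fa fb : R) : fy - fx = (fy - fb) + (fb - l) - (fa - l) + (fa - fx) by ring.
rewrite (alg _ _ (f (x + (a * s) *: e i0)) (f (x + (b * s) *: e i0))).
apply: le_trans (ler_normD _ _) _; apply: le_trans (lerD (ler_normB _ _) (lexx _)) _.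
apply: le_trans (lerD (lerD (ler_normD _ _) (lexx _)) (lexx _)) _.
apply: le_trans (lerD (lerD (lerD E2 Fb) Fa) E1) _.
have BS : 0 <= B * `|s| by exact: mulr_ge0.
have -> : B * ((1 - b) * `|s|) + eps / 2 + eps / 2 + B * (a * `|s|) =
  B * `|s| * (1 - b + a) + eps by field.
rewrite lerD2r ler_piMr //.
by rewrite /a /b; nra.
Qed.

End Gluing.

Section NonDivergence.
Variables (R : realType) (n : nat).
Local Notation E := 'rV[R]_n.
Local Notation e := (basis_vec R).
Variables (D : set E) (G : E -> 'M[R]_n) (c : R).
Hypothesis oD : open D.
Hypothesis HG : forall i j, CBe 1 D (fun x => G x i j).
Hypothesis c0 : 0 < c.
Hypothesis dG : forall x, D x -> c <= \det (G x).

Let det_norm x : D x -> c <= `|\det (G x)|.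
Proof. by move=> /dG H; apply: le_trans H _; exact: ler_norm. Qed.

(** Expanding the divergence splits off the derivative of the density: the Laplacian is d_i (g^ij
    d_j u) plus a drift. This brings the eigenvalue equation into the form of the lattice operator,
    with a right side of first order independent of [lam]. *)
Lemma lapl_nondivergence : exists (h : 'I_n -> E -> R) (C1 : R), [/\ 0 <= C1,
  forall l x, D x -> `|h l x| <= C1 & forall u lam x, CBe 2 D u -> D x ->
   lapl G u x = - (lam ^+ 2 * u x) ->
   cont_operator (fun i j y => invmx (G y) i j) u lam x = \sum_l h l x * pd l u x].
Proof.
pose rho y := Num.sqrt (\det (G y)).
have Hdet : CBe 1 D (fun y => \det (G y)) by exact: CBe_det.
have Hrho : CBe 1 D rho by exact: CBe_sqrt oD c0 dG Hdet.
have rho0 x : D x -> 0 < rho x.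
  by move=> Dx; rewrite sqrtr_gt0; exact: lt_le_trans (dG Dx).
have sc0 : 0 < Num.sqrt c by rewrite sqrtr_gt0.
have Hirho : CBe 1 D (fun y => (rho y)^-1).
  apply: (CBe_inv oD sc0) => // x Dx; apply: le_trans (ler_norm _).
  by rewrite ler_wsqrtr // dG.
have Hinv i j : CBe 1 D (fun y => invmx (G y) i j) by exact: CBe_invmx oD c0 det_norm HG i j.
pose h l x := - \sum_i (rho x)^-1 * pd i rho x * invmx (G x) i l.
have Hh l : CBe 0 D (h l).
  apply: CBe_opp => //; apply: CBe_sum => // i; apply: CBe_mul => //; last exact: CBe_leq (Hinv i l).
  by apply: CBe_mul => //; [exact: CBe_leq Hirho|exact: CBe_pd].
have [C1 C10 HC] := CBe_bound_all Hh.
exists h, C1; split => //; first by move=> l x Dx; exact: CB_bound (HC l) Dx.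
move=> u lam x Hu Dx Lu; rewrite /cont_operator.
have Hu1 : CBe 1 D u by exact: CBe_leq Hu.
pose F i y := \sum_j invmx (G y) i j * pd j u y.
have HF i : CBe 1 D (F i).
  apply: CBe_sum; first exact: oD.
  by move=> j; apply: CBe_mul; [exact: oD|exact: Hinv|exact: CBe_pd].
have pF i : pd i (F i) x = \sum_j pd i (fun y => invmx (G y) i j * pd j u y) x.
  have Hij j : CBe 1 D (fun y => invmx (G y) i j * pd j u y) by apply: CBe_mul => //; exact: CBe_pd.
  by have [_ S] := is_derive_bigsum (index_enum 'I_n) (fun j => CBe_is_derive i (Hij j) Dx); exact: S.
have prF i : pd i (fun y => rho y * F i y) x = rho x * pd i (F i) x + pd i rho x * F i x.
  by have [_ S] := is_derive_mul (CBe_is_derive i Hrho Dx) (CBe_is_derive i (HF i) Dx); exact: S.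
have r0 : rho x != 0 by rewrite gt_eqF // rho0.
have -> : \sum_i \sum_j pd i (fun y => invmx (G y) i j * pd j u y) x = \sum_i pd i (F i) x.
  by apply: eq_bigr => i _; rewrite pF.
have LE : lapl G u x = \sum_i pd i (F i) x + \sum_i (rho x)^-1 * pd i rho x * F i x.
  rewrite /lapl -/(rho x) mulr_sumr -big_split; apply: eq_bigr => i _ /=.
  apply: (etrans (congr1 _ (prF i))).
  by rewrite mulrDr mulKf // mulrA.
have lu : lam ^+ 2 * u x = - lapl G u x by rewrite Lu opprK.
rewrite lu LE opprD addrAC addNr add0r /h.
under [RHS]eq_bigr do rewrite mulNr mulr_suml.
rewrite sumrN exchange_big /=; congr (- _); apply: eq_bigr => i _.
by rewrite /F mulr_sumr; apply: eq_bigr => j _; rewrite mulrA.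
Qed.

End NonDivergence.

Section Compactness.
Variables (R : realType) (n : nat) (i0 : 'I_n).
Hypothesis i00 : i0 = 0%N :> nat.
Variables (M : compact_manifold R n).
Local Notation E := 'rV[R]_n.
Local Notation H := (@half_space R n).

Lemma half_cube_compact (z : E) (r : R) : compact [set y : E | `|y - z| <= r /\ H y].
Proof.
apply: bounded_closed_compact.
  exists (`|z| + r); split; first exact: num_real.
  move=> b br y [yz _]; rewrite -[y](subrK z) addrC.
  by apply: le_trans (ler_normD _ _) _; apply: le_trans (ltW br); rewrite lerD2l.
have -> : [set y : E | `|y - z| <= r /\ H y] =
  (fun y : E => `|y - z|) @^-1` [set t | t <= r] `&` (fun y : E => y 0 i0) @^-1` [set t | 0 <= t].
  apply/seteqP; split => y /= [yz Hy]; split => //; first exact/(half_spaceP i00).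
  exact/(half_spaceP i00).
apply: closedI; apply: closed_comp.
- move=> y _; apply: (@continuous_comp _ _ _ (fun x : E => x - z) Num.Def.normr).
    by apply: continuousB => //; exact: cst_continuous.
  exact: norm_continuous.
- exact: closed_le.
- by move=> y _; exact: coord_continuous.
- exact: closed_ge.
Qed.

Lemma upper_bound u (a : chart M) (z : E) (r : R) k : smooth_fun u ->
  (forall y, `|y - z| <= r -> H y -> img M a y) ->
  CBe k [set x : E | `|x - z| < r /\ 0 < x 0 i0] (local_fun a u).
Proof.
move=> su Ka; have cK0 : compact [set y : E | `|y - z| <= r /\ H y] by apply: half_cube_compact.
have cK := (compact_near_coveringP _).1 cK0.
pose P (B : R) (y : E) := 0 < y 0 i0 -> exists2 D, D y & CB B k D (local_fun a u).
have near_bd : \forall B \near +oo, [set y : E | `|y - z| <= r /\ H y] `<=` P B.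
  apply: cK => x [xz Hx]; have ax := Ka x xz Hx.
  have [U [F [oU Ux [B0 B00 HF] EF]]] := local_fun_ext k su ax.
  exists (U, [set B : R | B0 <= B]); first split => /=.
  - exact: open_nbhs_nbhs.
  - by apply: nbhs_pinfty_ge; exact: num_real.
  move=> [y B] /= [Uy BB] y0; exists (U `&` [set x : E | 0 < x 0 i0]); first by split.
  have oUp : open (U `&` [set x : E | 0 < x 0 i0]) by apply: openI => //; exact: open_pos.
  apply: (CB_eq oUp) (CB_le BB (CB_sub _ HF)); last by move=> ? [].
  move=> w [Uw w0]; have Hw : H w by apply/(half_spaceP i00); exact: ltW.
  by have [_ ->] := EF w Uw Hw.
have n0 : \forall B \near +oo, 0 <= (B : R) by apply: nbhs_pinfty_ge; exact: num_real.
have [B [B0 HB]] := filter_ex (filterI n0 near_bd).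
exists B => //; apply: CB_local => x [xz x0].
by apply: HB => //; split; [exact: ltW|apply/(half_spaceP i00); exact: ltW].
Qed.

End Compactness.

(** * The conormal reflection *)

Section Reflection.
Variables (R : realType) (n : nat) (i0 : 'I_n).
Local Notation E := 'rV[R]_n.
Local Notation e := (basis_vec R).
Variables (z : E) (R0 : R) (G : E -> 'M[R]_n) (c : R).
Implicit Types (x y q w : E).
Hypothesis R00 : 0 < R0.
Local Notation Q := (ball z R0).
Hypothesis HG : forall i j, CBe 3 Q (fun x => G x i j).
Hypothesis c0 : 0 < c.
Hypothesis dG : forall x, Q x -> c <= \det (G x).
Hypothesis sG : forall x, Q x -> c <= invmx (G x) i0 i0.
Hypothesis z0 : 0 <= z 0 i0.

(* Normalised conormal direction of the plane: the reflection below is the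
   one fixing the plane and reversing the metric normal. *)
Definition conormal y : E := \row_k (invmx (G y) i0 k / invmx (G y) i0 i0).

Definition reflection y : E := y - (2 * y 0 i0) *: conormal y.

(** Lets cubes above the plane, with the identity map, and cubes centred on it be treated alike. The
    determinant is squared because a reflection reverses orientation. *)
Record reflector (r R1 c' : R) (Psi : E -> E) : Prop := Reflector {
  reflector_smooth : forall j, CBe 3 (ball z r) (fun x => Psi x 0 j);
  reflector_maps : forall x, ball z r x -> ball z R1 (Psi x);
  reflector_low : forall x, ball z r x -> x 0 i0 < 0 -> 0 < Psi x 0 i0;
  reflector_det : forall x, ball z r x -> c' <= \det (jac Psi x) ^+ 2;
  reflector_plane : forall q, ball z r q -> q 0 i0 = 0 -> Psi q = q /\
    forall i j, jac Psi q i j = (i == j)%:R - 2 * (i == i0)%:R * conormal q 0 j;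
  reflector_lip : exists2 L, 0 <= L & forall x y, ball z r x -> ball z r y ->
    x 0 i0 < 0 -> y 0 i0 < 0 -> `|x - y| <= L * `|Psi x - Psi y| }.

Let oQ : open Q. Proof. exact: ball_open. Qed.

Let Hinv i j : CBe 3 Q (fun y => invmx (G y) i j).
Proof.
apply: (CBe_invmx oQ c0) => // x Qx; apply: le_trans (dG Qx) _; exact: ler_norm.
Qed.

Lemma CBe_conormal k : CBe 3 Q (fun y => conormal y 0 k).
Proof.
apply: (CBe_eq oQ (f := fun y => invmx (G y) i0 k * (invmx (G y) i0 i0)^-1)).
  by move=> y _; rewrite mxE.
apply: CBe_mul => //; apply: (CBe_inv oQ c0) => // x Qx.
by apply: le_trans (sG Qx) _; exact: ler_norm.
Qed.

Lemma CBe_reflect k : CBe 3 Q (fun y => reflection y 0 k).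
Proof.
have C i : CBe 3 Q (fun y : E => y 0 i).
  apply: (@CBe_coord _ _ _ _ _ (`|z| + R0)) => // x /mem_ballP xz; rewrite -[x](subrK z) addrC.
  by apply: le_trans (ler_normD _ _) _; rewrite lerD2l ltW.
apply: (CBe_eq oQ (f := fun y => y 0 k + - (2 * y 0 i0 * conormal y 0 k))).
  by move=> y _; rewrite !mxE.
apply: CBe_add => //; apply: CBe_opp => //; apply: CBe_mul => //; last exact: CBe_conormal.
by apply: CBe_mul => //; exact: CBe_cst.
Qed.

Lemma conormal_i0 y : Q y -> conormal y 0 i0 = 1.
Proof.
by move=> Qy; rewrite mxE divff // gt_eqF //; exact: lt_le_trans (sG Qy).
Qed.

Lemma reflect_i0 y : Q y -> reflection y 0 i0 = - y 0 i0.
Proof. by move=> Qy; rewrite /reflection mxE mxE mxE conormal_i0 // mulr1; ring. Qed.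

Lemma jac_reflect y i k : Q y -> jac reflection y i k =
  (i == k)%:R - 2 * (y 0 i0 * pd i (fun x => conormal x 0 k) y + (i == i0)%:R * conormal y 0 k).
Proof.
move=> Qy; rewrite mxE.
have D1 := is_derive_mul (is_derive_coord y i0 i) (CBe_is_derive i (CBe_conormal k) Qy).
have D2 := is_deriveB (is_derive_coord y k i) (is_derive_mul (is_derive_cst (2 : R) y (e i)) D1).
have -> : pd i (fun x => reflection x 0 k) y =
   pd i (fun x : E => x 0 k - 2 * (x 0 i0 * conormal x 0 k)) y.
  by congr (pd i _ y); apply/funext => x; rewrite !mxE mulrA.
have [_ S] := D2; apply: (etrans S).
by rewrite mul0r addr0 eq_sym (eq_sym i0).
Qed.

Lemma jac_reflect_plane q i k : Q q -> q 0 i0 = 0 ->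
  jac reflection q i k = (i == k)%:R - 2 * (i == i0)%:R * conormal q 0 k.
Proof. by move=> Qq q0; rewrite jac_reflect // q0 mul0r add0r mulrA. Qed.

(** On the plane J = 1 - 2 u w with w u = 1. It follows that det J^2 is 1 there, and bounded below
    nearby. *)
Lemma plane_involution q : Q q -> q 0 i0 = 0 -> jac reflection q *m jac reflection q = 1%:M.
Proof.
move=> Qq q0; pose u : 'cV[R]_n := delta_mx i0 0; pose w := conormal q.
have JE : jac reflection q = 1%:M - 2 *: (u *m w).
  apply/matrixP => i k; rewrite jac_reflect_plane // !mxE; congr (_ - _).
  rewrite big_ord1 !mxE -mulrA andbT; congr (_ * (_ * _)).
have wu : w *m u = 1%:M.
  apply/matrixP => i k; rewrite !ord1 mxE (bigD1 i0) //= big1 ?addr0; last first.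
    by move=> l li; rewrite !mxE (negPf li) mulr0.
  by rewrite conormal_i0 // mxE !eqxx mulr1 mxE.
rewrite JE mulmxBl mulmxBr mulmx1 mul1mx -!scalemxAl mulmxBr mulmx1 -scalemxAr.
rewrite !mulmxA -(mulmxA u) wu mulmx1 scalerBr scalerA.
have -> : 2 * 2 = 2 + 2 :> R by ring.
by rewrite scalerDl; apply/matrixP => i k; rewrite !mxE; ring.
Qed.

(** The conormal is row [i0] of the inverse metric up to scale, so w G = u^T, and the correction
    terms cancel. Thus the pulled-back metric agrees with [G] on the plane, which is why this
    reflection and not the Euclidean one is used. *)
Lemma plane_isometry q : Q q -> (G q)^T = G q -> q 0 i0 = 0 ->
  jac reflection q *m G q *m (jac reflection q)^T = G q.
Proof.
move=> Qq GS q0; pose u : 'cV[R]_n := delta_mx i0 0.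
pose t := 2 / invmx (G q) i0 i0; pose w := row i0 (invmx (G q)).
have Gu : G q \in unitmx by rewrite unitmxE unitfE gt_eqF //; exact: lt_le_trans (dG Qq).
have s0 : invmx (G q) i0 i0 != 0 by rewrite gt_eqF //; exact: lt_le_trans (sG Qq).
have JE : jac reflection q = 1%:M - t *: (u *m w).
  apply/matrixP => i k; rewrite jac_reflect_plane // !mxE; congr (_ - _).
  rewrite big_ord1 !mxE andbT /t.
  by move: (invmx (G q) i0 k) ((i == i0)%:R : R) => p d; ring.
have wG : w *m G q = u^T.
  by rewrite /w -row_mul mulVmx // /u trmx_delta; apply/rowP => k; rewrite !mxE /= eq_sym.
have Gw : G q *m w^T = u by rewrite -[G q]GS -trmx_mul wG trmxK.
have uw : u^T *m w^T = (invmx (G q) i0 i0)%:M.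
  apply/matrixP => i k; rewrite !ord1 mxE (bigD1 i0) //= big1 ?addr0; last first.
    by move=> l li; rewrite !mxE (negPf li) mul0r.
  by rewrite !mxE !eqxx mul1r mulr1n.
rewrite JE mulmxBl mul1mx -scalemxAl -mulmxA wG.
have JT : (1%:M - t *: (u *m w))^T = 1%:M - t *: (w^T *m u^T).
  by rewrite [LHS]linearB /= trmx1 [X in _ - X]linearZ /= trmx_mul.
rewrite JT mulmxBr mulmx1 mulmxBl.
rewrite -!scalemxAr -!scalemxAl mulmxA Gw -!mulmxA (mulmxA u^T) uw mul_scalar_mx -scalemxAr.
rewrite !scalerA /t.
have -> : 2 / invmx (G q) i0 i0 * (2 / invmx (G q) i0 i0) * invmx (G q) i0 i0 =
   2 / invmx (G q) i0 i0 + 2 / invmx (G q) i0 i0 by field.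
by rewrite scalerDl; apply/matrixP => i k; rewrite !mxE; ring.
Qed.

Lemma reflector_exists (R1 : R) : 0 < R1 -> R1 <= R0 -> exists r c' Psi, [/\
  0 < r /\ 2 * r <= 1, r <= R1, 0 < c',
  z 0 i0 = 0 \/ forall x, `|x - z| < r -> 0 < x 0 i0 & reflector r R1 c' Psi].
Proof.
move=> R10 R1R; have [zp|] := ltP 0 (z 0 i0).
  pose r := Num.min (1 / 2) (Num.min R1 (z 0 i0)).
  have r0 : 0 < r by rewrite !lt_min divr_gt0 // R10 zp.
  have r12 : r <= 1 / 2 by rewrite ge_min lexx.
  have rR : r <= R1 by rewrite !ge_min lexx orbT.
  have rz : r <= z 0 i0 by rewrite !ge_min lexx !orbT.
  have pos x : `|x - z| < r -> 0 < x 0 i0.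
    have := coord_le_norm (x - z) i0; rewrite !mxE => h h'.
    have := lt_le_trans (le_lt_trans h h') rz.
    by rewrite ltr_norml => /andP[h1 _]; move: h1; rewrite ltrBrDl addrN.
  have jid x : jac id x = 1%:M.
    by apply/matrixP => i j; rewrite !mxE eq_sym; have [_ D] := is_derive_coord x j i; exact: D.
  (* The cube lies above the plane, so the clauses about the plane and the lower side are
     vacuous. *)
  exists r, 1, id; split; [by split => //; move: r12; lra|exact: rR|exact: ltr01|by right|].
  apply: Reflector.
  - move=> j; apply: (@CBe_coord _ _ _ _ _ (`|z| + r)); first exact: ball_open.
    move=> x /mem_ballP xz; rewrite -[x](subrK z) addrC.
    by apply: le_trans (ler_normD _ _) _; rewrite lerD2l ltW.
  - by move=> x /mem_ballP xz; apply/mem_ballP; exact: lt_le_trans xz rR.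
  - by move=> x /mem_ballP /pos x0; rewrite ltNge ltW.
  - by move=> x _; rewrite jid det1 expr1n.
  - by move=> q /mem_ballP /pos; rewrite lt_neqAle eq_sym => /andP[/eqP].
  by exists 1 => // x y _ _ _ _; rewrite mul1r.
move=> zn; have zz : z 0 i0 = 0 by apply/eqP; rewrite eq_le zn z0.
have Qz : Q z by exact/ballxx.
have [Bb Bb0 HB] := CBe_bound_all CBe_conormal.
have Hd : CBe 2 Q (fun x => \det (jac reflection x) ^+ 2).
  have h : CBe 2 Q (fun x => \det (jac reflection x)).
    apply: CBe_det => // i j; apply: (CBe_eq oQ _ (CBe_pd i (CBe_reflect j))) => x _.
    by rewrite mxE.
  apply: (CBe_eq oQ _ (CBe_mul oQ h h)) => x _; by rewrite expr2.
have dz : 0 < \det (jac reflection z) ^+ 2.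
  by rewrite expr2 -det_mulmx plane_involution // det1.
have [c' c'0 nd] := near_ge Hd Qz dz.
have [r1 r10 Hr1] := nbhs_cube nd.
(* r (1 + 2 Bb) <= R1 keeps the image in the larger cube, and 4 r n Bb <= 1 makes the variation of
   the conormal absorbable in the inverse Lipschitz bound [key]. *)
pose bb := 1 + 2 * Bb + 4 * n%:R * Bb.
have nB : 0 <= n%:R * Bb by rewrite mulr_ge0.
have bb0 : 0 < bb by rewrite /bb -(mulrA 4); move: nB Bb0; lra.
pose r := Num.min (1 / 2) (Num.min (Num.min R1 r1) (Num.min (R1 / bb) bb^-1)).
have r0 : 0 < r by rewrite !lt_min R10 r10 !divr_gt0 // invr_gt0.
have r12 : r <= 1 / 2 by rewrite ge_min lexx.
have rR : r <= R1 by rewrite !ge_min lexx !orbT.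
have rr1 : r <= r1 by rewrite !ge_min lexx !orbT.
have rb : r * bb <= R1 by rewrite -ler_pdivlMr // !ge_min lexx !orbT.
have rb1 : r * bb <= 1 by rewrite -ler_pdivlMr // div1r !ge_min lexx !orbT.
have BQ x : ball z r x -> Q x.
  by move=> /mem_ballP xz; apply/mem_ballP; apply: lt_le_trans xz _; exact: le_trans R1R.
have x0r x : ball z r x -> `|x 0 i0| < r.
  move=> /mem_ballP; have := coord_le_norm (x - z) i0; rewrite !mxE zz subr0; exact: le_lt_trans.
have bd x k : Q x -> `|conormal x 0 k| <= Bb by move=> Qx; exact: CB_bound (HB k) Qx.
exists r, c', reflection; split; [by split => //; move: r12; lra|exact: rR|exact: c'0|by left|].
apply: Reflector.
- by move=> j; apply: CBe_sub (CBe_reflect j) => x; exact: BQ.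
- move=> x xr; have Qx := BQ x xr; apply/mem_ballP.
  apply: (@le_lt_trans _ _ (`|x - z| + 2 * `|x 0 i0| * Bb)).
    have -> : reflection x - z = (x - z) - (2 * x 0 i0) *: conormal x by rewrite /reflection addrAC.
    apply: le_trans (ler_normB _ _) _; rewrite lerD2l.
    apply: norm_leP; first by rewrite mulr_ge0 // mulr_ge0.
    move=> k; rewrite mxE !normrM normr_nat ler_wpM2l ?mulr_ge0 //; exact: bd.
  have h1 := x0r x xr; move/mem_ballP : xr => h2.
  apply: lt_le_trans rb; rewrite /bb -(mulrA 4).
  have h3 : `|x 0 i0| * Bb <= r * Bb by rewrite ler_wpM2r // ltW.
  have h4 : 0 <= r * (4 * (n%:R * Bb)) by rewrite mulr_ge0 ?(ltW r0) // mulr_ge0.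
  have -> : r * (1 + 2 * Bb + 4 * (n%:R * Bb)) = r + 2 * (r * Bb) + r * (4 * (n%:R * Bb)) by ring.
  rewrite -mulrA; move: h2 h3 h4; lra.
- by move=> x /BQ Qx x0; rewrite reflect_i0 // oppr_gt0.
- by move=> x /mem_ballP xr; apply: Hr1; exact: lt_le_trans xr rr1.
- move=> q /BQ Qq q0; split; last by move=> i j; exact: jac_reflect_plane.
  by rewrite /reflection q0 mulr0 scale0r subr0.
exists (2 * (1 + 2 * Bb)); first by rewrite mulr_ge0 // addr_ge0 // mulr_ge0.
move=> x y xr yr x0 y0; have [Qx Qy] := (BQ x xr, BQ y yr).
set d := `|reflection x - reflection y|.
have d00 : `|x 0 i0 - y 0 i0| <= d.
  have := coord_le_norm (reflection x - reflection y) i0.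
  by rewrite mxE [X in _ + X]mxE !reflect_i0 // opprK addrC distrC addrC.
have lipb k : `|conormal x 0 k - conormal y 0 k| <= n%:R * Bb * `|x - y|.
  have Cb : CB Bb 1 (split_cube i0 z r) (fun x => conormal x 0 k).
    apply: CB_sub (CB_leq (isT : (1 <= 3)%N) (HB k)) => w [wz _].
    by apply: BQ; exact/mem_ballP.
  apply: (lip_side Bb0 Cb); last by rewrite nmulr_rgt0.
    by split; [exact/mem_ballP|rewrite lt_eqF].
  by split; [exact/mem_ballP|rewrite lt_eqF].
have key : `|x - y| <= d * (1 + 2 * Bb) + `|x - y| / 2.
  have b1 : 0 <= 1 + 2 * Bb by rewrite addr_ge0 // mulr_ge0.
  apply: norm_leP; first by apply: addr_ge0; [exact: mulr_ge0 (normr_ge0 _) b1|exact: divr_ge0].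
  move=> k; have := coord_le_norm (reflection x - reflection y) k; rewrite -/d => dk.
  have alg (a b x1 y1 p q : R) : a - b = (a - 2 * x1 * p - (b - 2 * y1 * q)) +
     2 * (x1 * (p - q) + (x1 - y1) * q) by ring.
  have -> : (x - y) 0 k = (reflection x - reflection y) 0 k + 2 * (x 0 i0 *
      (conormal x 0 k - conormal y 0 k) + (x 0 i0 - y 0 i0) * conormal y 0 k).
    have RE w : reflection w 0 k = w 0 k - 2 * w 0 i0 * conormal w 0 k.
      by rewrite /reflection mxE; congr (_ + _); rewrite mxE mxE.
    have S2 (v w : E) : (v - w) 0 k = v 0 k - w 0 k by rewrite mxE; congr (_ + _); rewrite mxE.
    by rewrite (S2 x y) (S2 (reflection x) (reflection y)) !RE; exact: alg.
  have -> : d * (1 + 2 * Bb) + `|x - y| / 2 = d + (2 * (d * Bb) + `|x - y| / 2) by ring.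
  apply: le_trans (ler_normD _ _) _; apply: lerD; first exact: dk.
  rewrite normrM normr_nat.
  have h1 : `|x 0 i0 * (conormal x 0 k - conormal y 0 k)| <= r * (n%:R * Bb) * `|x - y|.
    rewrite normrM -mulrA; apply: ler_pM => //; exact: ltW (x0r x xr).
  have h2 : `|(x 0 i0 - y 0 i0) * conormal y 0 k| <= d * Bb.
    by rewrite normrM; apply: ler_pM => //; exact: bd.
  have h3 : 4 * (r * (n%:R * Bb)) <= 1.
    apply: le_trans rb1; rewrite /bb -(mulrA 4).
    have -> : r * (1 + 2 * Bb + 4 * (n%:R * Bb)) = r + 2 * (r * Bb) + 4 * (r * (n%:R * Bb)) by ring.
    have := mulr_ge0 (ltW r0) Bb0; move: r0; lra.
  have h4 : r * (n%:R * Bb) * `|x - y| <= `|x - y| / 4.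
    rewrite mulrC ler_wpM2l //; move: h3; lra.
  have alg2 (p q s A1 t D : R) : q <= A1 -> s <= D -> A1 <= t / 4 -> p <= q + s ->
    2 * p <= 2 * D + t / 2 by lra.
  exact: alg2 h1 h2 h4 (ler_normD _ _).
have alg3 (t D b : R) : t <= D * (1 + 2 * b) + t / 2 -> t <= 2 * (1 + 2 * b) * D by lra.
exact: alg3 key.
Qed.

End Reflection.

Section Linearity.
Variables (R : realType) (n : nat).
Local Notation E := 'rV[R]_n.
Variables (D : set E) (I : finType) (c : I -> R) (f : I -> E -> R).
Hypothesis oD : open D.

Lemma pd_lin k i x : (forall l, CBe k.+1 D (f l)) -> D x ->
  pd i (fun y => \sum_l c l * f l y) x = \sum_l c l * pd i (f l) x.
Proof.
move=> Hf Dx; have S l : is_derive x (basis_vec R i) (fun y => c l * f l y) (c l * pd i (f l) x).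
  apply: is_derive_eq (is_derive_mul (is_derive_cst (c l) x _) (CBe_is_derive i (Hf l) Dx)) _.
  by rewrite mul0r addr0.
by have [_ T] := is_derive_bigsum (index_enum I) S; exact: T.
Qed.

Lemma cont_operator_lin (a : 'I_n -> 'I_n -> E -> R) lam x : (forall i j, CBe 1 D (a i j)) ->
  (forall l, CBe 2 D (f l)) -> D x ->
  cont_operator a (fun y => \sum_l c l * f l y) lam x = \sum_l c l * cont_operator a (f l) lam x.
Proof.
move=> Ha Hf Dx; rewrite /cont_operator.
under [RHS]eq_bigr do rewrite mulrDr mulrCA.
rewrite big_split /= mulr_sumr; congr (_ + _).
under [RHS]eq_bigr do rewrite mulr_sumr.
rewrite [RHS]exchange_big; apply: eq_bigr => i _ /=.
under [RHS]eq_bigr do rewrite mulr_sumr.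
rewrite [RHS]exchange_big; apply: eq_bigr => j _ /=.
have Haf l : CBe 1 D (fun y => a i j y * pd j (f l) y).
  by apply: CBe_mul => //; exact: CBe_pd.
have S l : is_derive x (basis_vec R i) (fun y => c l * (a i j y * pd j (f l) y))
    (c l * pd i (fun y => a i j y * pd j (f l) y) x).
  apply: is_derive_eq (is_derive_mul (is_derive_cst (c l) x _) (CBe_is_derive i (Haf l) Dx)) _.
  by rewrite mul0r addr0.
have [_ T] := is_derive_bigsum (index_enum I) S; rewrite -[RHS]T.
apply: (pd_eq i oD Dx) => y Dy; rewrite (pd_lin j Hf Dy) mulr_sumr.
by apply: eq_bigr => l _; rewrite mulrCA.
Qed.

End Linearity.

Lemma cont_operator_eq (R : realType) (n : nat) (D : set 'rV[R]_n)
    (a a' : 'I_n -> 'I_n -> 'rV[R]_n -> R) u u' lam x : open D -> D x ->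
  (forall i j y, D y -> a i j y = a' i j y) -> (forall y, D y -> u y = u' y) ->
  cont_operator a u lam x = cont_operator a' u' lam x.
Proof.
move=> oD Dx Ea Eu; rewrite /cont_operator (Eu x Dx); apply: congr1.
apply: eq_bigr => i _; apply: eq_bigr => j _; apply: (pd_eq i oD Dx) => y Dy.
by rewrite (Ea i j y Dy); apply: congr1; exact: (pd_eq j oD Dy Eu).
Qed.

Section PosDefForms.
Variables (R : realType) (n : nat).
Implicit Types (G J : 'M[R]_n) (v : 'rV[R]_n).

Lemma bilinE G v : bilin G v v = \sum_i \sum_j G i j * v 0 i * v 0 j.
Proof.
rewrite /bilin mxE exchange_big; apply: eq_bigr => j _ /=; rewrite !mxE mulr_suml.
by apply: eq_bigr => i _; rewrite (mulrC (v 0 i)).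
Qed.

Lemma bilin_congr J G v : bilin (J *m G *m J^T) v v = bilin G (v *m J) (v *m J).
Proof. by rewrite /bilin trmx_mul !mulmxA. Qed.

Lemma posdef_congr J G : J \in unitmx -> (forall v, v != 0 -> 0 < bilin G v v) ->
  forall v, v != 0 -> 0 < bilin (J *m G *m J^T) v v.
Proof.
move=> Ju Gp v v0; rewrite bilin_congr; apply: Gp.
by apply: contraNneq v0 => v0; rewrite -(mulmxK Ju v) v0 mul0mx.
Qed.

Lemma posdef_invmx G : G^T = G -> (forall v, v != 0 -> 0 < bilin G v v) ->
  forall v, v != 0 -> 0 < bilin (invmx G) v v.
Proof.
move=> Gs Gp v v0; have Gu := posdef_unit Gp.
have -> : invmx G = invmx G *m G *m (invmx G)^T by rewrite mulVmx // mul1mx trmx_inv Gs.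
by apply: posdef_congr => //; rewrite unitmx_inv.
Qed.

Lemma posdef_lower G (C : R) v : G^T = G -> (forall v, v != 0 -> 0 < bilin G v v) -> 0 <= C ->
  (forall i j, `|invmx G i j| <= C) -> \sum_i v 0 i ^+ 2 <= n%:R * C * bilin G v v.
Proof.
move=> Gs Gp C0 GC; have Gu := posdef_unit Gp.
have invs : (invmx G)^T = invmx G by rewrite trmx_inv Gs.
have := posdef_inv_elliptic invs (posdef_invmx Gs Gp) (fun i => v 0 i) C0 GC.
by rewrite invmxK bilinE.
Qed.

End PosDefForms.

Section Crossing.
Variables (R : realType) (n : nat) (i0 : 'I_n).
Local Notation E := 'rV[R]_n.

Lemma crosses_intro (z : E) (r : R) f : (forall q, `|q - z| < r -> q 0 i0 = 0 ->
  exists f1 f2 : E -> R, [/\ {for q, continuous f1}, {for q, continuous f2}, f1 q = f2 q &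
    \forall x \near q, split_cube i0 z r x ->
      (0 < x 0 i0 -> f x = f1 x) /\ (x 0 i0 < 0 -> f x = f2 x)]) -> crosses i0 z r f.
Proof.
move=> Hf q qr q0; have [f1 [f2 [c1 c2 f12 nf]]] := Hf q qr q0.
exists (f1 q) => eps e0.
have n1 : \forall x \near q, `|f1 q - f1 x| <= eps.
  by move: c1 => /(@cvgrPdist_le _ _ _ (nbhs q) (nbhs_filter q)); apply.
have n2 : \forall x \near q, `|f2 q - f2 x| <= eps.
  by move: c2 => /(@cvgrPdist_le _ _ _ (nbhs q) (nbhs_filter q)); apply.
apply: filterS3 n1 n2 nf => x h1 h2 h Ox; have [ha hb] := h Ox.
have [_ x0] := Ox; case: (ltgtP (x 0 i0) 0) => xs.
- by rewrite hb // f12 distrC.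
- by rewrite ha // distrC.
by rewrite xs eqxx in x0.
Qed.

End Crossing.

(** * Coordinate cubes with their reflected functions *)

Section Pieces.
Variables (R : realType) (n : nat) (i0 : 'I_n).
Hypothesis i00 : i0 = 0%N :> nat.
Variables (M : compact_manifold R n) (g : riemannian_metric M) (bc : boundary_condition).
Local Notation E := 'rV[R]_n.
Local Notation e := (basis_vec R).
Local Notation H := (@half_space R n).
Implicit Types (x y q : E) (u : M -> R) (i j l : 'I_n).

Definition parity : R := if bc is Dirichlet then -1 else 1.

(* A coordinate cube; below the plane of the boundary functions are extended
   through the map [piece_refl], oddly or evenly according to [bc]. *)
Record piece := Piece {
  piece_chart : chart M; piece_center : E; piece_radius : R; piece_range : R;
  piece_refl : E -> E; piece_coef : 'I_n -> 'I_n -> E -> R; piece_drift : 'I_n -> E -> R;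
  piece_A : R; piece_nu : R; piece_C1 : R; piece_L : R; piece_mA : R; piece_mnu : R }.

Implicit Types c : piece.

Definition piece_cube c := split_cube i0 (piece_center c) (piece_radius c).

Definition piece_lift c x : E := if 0 < x 0 i0 then x else piece_refl c x.

Definition piece_rep c u x : R :=
  (if 0 < x 0 i0 then 1 else parity) * local_fun (piece_chart c) u (piece_lift c x).

(** Everything used about a cube after its construction. The constants stored in the piece depend on
    the geometry only; the bound in [gp_eigen] depends on the eigenfunction. The range exceeds the
    radius because reflected points may leave the cube. *)
Record good_piece c : Prop := GoodPiece {
  gp_r0 : 0 < piece_radius c; gp_r1 : 2 * piece_radius c <= 1;
  gp_range : piece_radius c <= piece_range c;
  gp_plane : piece_center c 0 i0 = 0 \/
    forall x, `|x - piece_center c| < piece_radius c -> 0 < x 0 i0;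
  gp_A0 : 0 <= piece_A c;
  gp_sym : forall i j x, piece_cube c x -> piece_coef c i j x = piece_coef c j i x;
  gp_CB : forall i j, CB (piece_A c) 2 (piece_cube c) (piece_coef c i j);
  gp_LL : forall i j, LL i0 (piece_center c) (piece_radius c) (piece_A c) (piece_coef c i j);
  gp_nu0 : 0 < piece_nu c;
  gp_elliptic : forall x (xi : 'I_n -> R), piece_cube c x ->
    piece_nu c * (\sum_i xi i ^+ 2) <= \sum_i \sum_j piece_coef c i j x * xi i * xi j;
  gp_C1 : 0 <= piece_C1 c;
  gp_drift : forall l x, piece_cube c x -> `|piece_drift c l x| <= piece_C1 c;
  gp_img : forall y, `|y - piece_center c| <= piece_range c -> H y -> img M (piece_chart c) y;
  gp_lift : forall x, piece_cube c x ->
    `|piece_lift c x - piece_center c| <= piece_range c /\ 0 < piece_lift c x 0 i0;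
  gp_L0 : 0 <= piece_L c;
  gp_lip : forall x y, piece_cube c x -> piece_cube c y -> 0 < x 0 i0 * y 0 i0 ->
    `|x - y| <= piece_L c * `|piece_lift c x - piece_lift c y|;
  gp_mA0 : 0 <= piece_mA c; gp_mnu0 : 0 < piece_mnu c;
  gp_metric : forall y, `|y - piece_center c| <= piece_range c -> H y ->
    (forall i j, `|g (piece_chart c) y i j| <= piece_mA c) /\
    forall v : E, piece_mnu c * (\sum_i v 0 i ^+ 2) <= bilin (g (piece_chart c) y) v v;
  gp_grad : forall x, piece_cube c x -> exists2 K : 'M[R]_n, forall i j, `|K i j| <= piece_L c &
    forall u, smooth_fun u -> forall j, pd j (piece_rep c u) x =
      \sum_m K j m * hpartial m (local_fun (piece_chart c) u) (piece_lift c x);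
  gp_eigen : forall lam u, laplace_eigenspace g bc (lam ^+ 2) u ->
    (forall x, piece_cube c x -> cont_operator (piece_coef c) (piece_rep c u) lam x =
       \sum_l piece_drift c l x * pd l (piece_rep c u) x) /\
    exists2 B, 0 <= B & regular i0 (piece_center c) (piece_radius c) B (piece_rep c u) }.

Section Construction.
Variables (a : chart M) (z : E) (R0 cG : R) (G : E -> 'M[R]_n).
Hypothesis R00 : 0 < R0.
Hypothesis az : img M a z.
Hypothesis HG : forall i j, CBe 3 (ball z R0) (fun x => G x i j).
Hypothesis cG0 : 0 < cG.
Hypothesis dG : forall x, ball z R0 x -> cG <= \det (G x).
Hypothesis sG : forall x, ball z R0 x -> cG <= invmx (G x) i0 i0.
Hypothesis EG : forall y, ball z R0 y -> H y -> img M a y /\ G y = g a y.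
Variables (r c' : R) (Psi : E -> E).
Let R1 := R0 / 2.
Hypothesis r0 : 0 < r.
Hypothesis r1 : 2 * r <= 1.
Hypothesis rR : r <= R1.
Hypothesis c'0 : 0 < c'.
Hypothesis zr : z 0 i0 = 0 \/ forall x, `|x - z| < r -> 0 < x 0 i0.
Hypothesis HPsi : reflector i0 z G r R1 c' Psi.

Local Notation O := (split_cube i0 z r).
Local Notation Op := (O `&` [set x | 0 < x 0 i0]).
Local Notation Om := (O `&` [set x | x 0 i0 < 0]).
Local Notation D1 := [set x : E | `|x - z| < R1 /\ 0 < x 0 i0].

Let R10 : 0 < R1. Proof. by rewrite divr_gt0. Qed.
Let R1R : R1 <= R0. Proof. by rewrite ler_pdivrMr // ler_peMr ?(ltW R00) // ler1n. Qed.

Let oD1 : open D1.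
Proof.
have -> : D1 = ball z R1 `&` [set x : E | 0 < x 0 i0].
  by apply/seteqP; split => x /= [xz x0]; split => //; exact/mem_ballP.
by apply: openI; [exact: ball_open|exact: open_pos].
Qed.

Let oOp : open Op. Proof. exact: open_upper. Qed.
Let oOm : open Om. Proof. exact: open_lower. Qed.
Let ob : open (ball z r). Proof. exact: ball_open. Qed.
Let oB0 : open (ball z R0). Proof. exact: ball_open. Qed.

Let posH x : 0 < x 0 i0 -> H x.
Proof. by move=> x0; apply/(half_spaceP i00); exact: ltW. Qed.

Let Ob x : O x -> ball z r x. Proof. by move=> [xr _]; exact/mem_ballP. Qed.
Let b01 x : ball z R1 x -> ball z R0 x.
Proof. by move=> /mem_ballP xr; apply/mem_ballP; exact: lt_le_trans xr R1R. Qed.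
Let br1 x : ball z r x -> ball z R1 x.
Proof. by move=> /mem_ballP xr; apply/mem_ballP; exact: lt_le_trans xr rR. Qed.
Let OpD x : Op x -> D1 x.
Proof. by move=> [/Ob /br1 /mem_ballP xr x0]. Qed.
Let OmD x : Om x -> D1 (Psi x).
Proof.
move=> [/Ob xr x0]; split; last exact: (reflector_low HPsi).
by apply/mem_ballP; exact: (reflector_maps HPsi).
Qed.
Let D1b x : D1 x -> ball z R0 x. Proof. by move=> [xr _]; apply: b01; exact/mem_ballP. Qed.
Let D1G x : D1 x -> img M a x /\ G x = g a x.
Proof. by move=> Dx; have [_ x0] := Dx; apply: EG; [exact: D1b|exact: posH]. Qed.

Let HPsi2 j : CBe 2 (ball z r) (fun x => Psi x 0 j).
Proof. exact: CBe_leq (reflector_smooth HPsi j). Qed.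

Let HJ i j : CBe 2 (ball z r) (fun x => jac Psi x i j).
Proof.
apply: (CBe_eq ob _ (CBe_pd i (reflector_smooth HPsi j))) => x _.
by rewrite mxE.
Qed.

Let J0 x : ball z r x -> \det (jac Psi x) != 0.
Proof.
move=> /(reflector_det HPsi) h; apply: contraTneq (lt_le_trans c'0 h) => ->.
by rewrite expr0n ltxx.
Qed.

(** The pullback of the metric by the reflection, which governs the side below the plane. *)
Let Gm x := jac Psi x *m G (Psi x) *m (jac Psi x)^T.

Let HGP i j : CBe 2 (ball z r) (fun x => G (Psi x) i j).
Proof.
apply: (@CBe_comp _ _ _ _ _ (ball z R0) Psi (fun y => G y i j)) => //.
- by move=> x xr; apply: b01; exact: (reflector_maps HPsi).
- exact: CBe_leq (HG i j).
Qed.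

Let HGm i j : CBe 2 (ball z r) (fun x => Gm x i j).
Proof.
have H1 i' j' : CBe 2 (ball z r) (fun x => (jac Psi x *m G (Psi x)) i' j').
  exact: (CBe_mulmx ob HJ HGP).
have HT i' j' : CBe 2 (ball z r) (fun x => (jac Psi x)^T i' j').
  by apply: (CBe_eq ob _ (HJ j' i')) => x _; rewrite [RHS]mxE.
exact: (CBe_mulmx ob H1 HT).
Qed.

Let dGm x : ball z r x -> c' * cG <= \det (Gm x).
Proof.
move=> xr; rewrite !det_mulmx det_tr mulrAC -expr2.
apply: ler_pM; [exact: ltW|exact: ltW| |].
  exact: (reflector_det HPsi).
by apply: dG; apply: b01; exact: (reflector_maps HPsi).
Qed.

Let cc0 : 0 < c' * cG. Proof. exact: mulr_gt0. Qed.

Let HiG i j : CBe 3 (ball z R0) (fun x => invmx (G x) i j).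
Proof.
have dn x : ball z R0 x -> cG <= `|\det (G x)|.
  by move=> xr; apply: le_trans (dG xr) _; exact: ler_norm.
exact: (CBe_invmx oB0 cG0 dn HG).
Qed.

Let HiGm i j : CBe 2 (ball z r) (fun x => invmx (Gm x) i j).
Proof.
have dn x : ball z r x -> c' * cG <= `|\det (Gm x)|.
  by move=> xr; apply: le_trans (dGm xr) _; exact: ler_norm.
exact: (CBe_invmx ob cc0 dn HGm).
Qed.

Let Gsym x : D1 x -> (G x)^T = G x.
Proof. by move=> /D1G[ax ->]; exact: (Defs.metric_sym g ax). Qed.
Let Gpos x : D1 x -> forall v : E, v != 0 -> 0 < bilin (G x) v v.
Proof. by move=> /D1G[ax ->]; exact: (metric_posdef g ax). Qed.
Let Gmsym x : Om x -> (Gm x)^T = Gm x.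
Proof. by move=> /OmD Dx; rewrite /Gm !trmx_mul trmxK Gsym // mulmxA. Qed.
Let Gmpos x : Om x -> forall v : E, v != 0 -> 0 < bilin (Gm x) v v.
Proof.
move=> Ox; apply: posdef_congr; last exact: Gpos (OmD Ox).
by rewrite unitmxE unitfE J0 //; apply: Ob; case: Ox.
Qed.

Let coef i j x := if 0 < x 0 i0 then invmx (G x) i j else invmx (Gm x) i j.

Let coefp i j x : Op x -> coef i j x = invmx (G x) i j.
Proof. by move=> [_ x0]; rewrite /coef x0. Qed.
Let coefm i j x : Om x -> coef i j x = invmx (Gm x) i j.
Proof. by move=> [_ x0]; rewrite /coef ltNge ltW. Qed.

Let Hcoef i j : CBe 2 O (coef i j).
Proof.
apply: CBe_split.
  apply: (CBe_eq oOp (f := fun x => invmx (G x) i j)); first by move=> x /coefp ->.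
  by apply: CBe_leq (CBe_sub _ (HiG i j)) => // x /OpD /D1b.
apply: (CBe_eq oOm (f := fun x => invmx (Gm x) i j)); first by move=> x /coefm ->.
by apply: CBe_sub (HiGm i j) => x [/Ob].
Qed.

Let plane_Gm q : ball z r q -> q 0 i0 = 0 -> Gm q = G q.
Proof.
move=> qr q0; have [Pq Jq] := reflector_plane HPsi qr q0.
have qb : ball z R0 q by apply: b01; exact: br1.
have JE : jac Psi q = jac (reflection i0 G) q.
  apply/matrixP => i j; rewrite Jq.
  by rewrite (jac_reflect_plane HG cG0 dG sG i j qb q0).
rewrite /Gm Pq JE; apply: (plane_isometry HG cG0 dG sG) => //.
have Hq : H q by apply/(half_spaceP i00); rewrite q0.
by have [aq ->] := EG qb Hq; exact: (Defs.metric_sym g aq).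
Qed.

Let coef_crosses i j : crosses i0 z r (coef i j).
Proof.
apply: crosses_intro => q qr q0; have qb : ball z r q by exact/mem_ballP.
exists (fun x => invmx (G x) i j), (fun x => invmx (Gm x) i j); split.
- by apply: CBe_continuous (HiG i j) _; apply: b01; exact: br1.
- exact: CBe_continuous (HiGm i j) qb.
- by rewrite plane_Gm.
by apply: filterE => x Ox; split => x0; [rewrite coefp|rewrite coefm].
Qed.

Section Functions.
Variable u : M -> R.
Hypothesis su : smooth_fun u.
Let f := local_fun a u.
Let rep x := (if 0 < x 0 i0 then 1 else parity) * f (if 0 < x 0 i0 then x else Psi x).

Let Hf k : CBe k D1 f.
Proof.
apply: upper_bound => // y yr Hy; apply: (EG _ Hy).1; apply/mem_ballP.
by apply: le_lt_trans yr _; rewrite ltr_pdivrMr // ltr_pMr // ltr1n.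
Qed.

Let repp x : Op x -> rep x = f x.
Proof. by move=> [_ x0]; rewrite /rep x0 mul1r. Qed.
Let repm x : Om x -> rep x = parity * f (Psi x).
Proof. by move=> [_ x0]; rewrite /rep ltNge ltW. Qed.

Let HPm k j : (k <= 3)%N -> CBe k Om (fun x => Psi x 0 j).
Proof. by move=> k3; apply: CBe_leq k3 (CBe_sub _ (reflector_smooth HPsi j)) => x [/Ob]. Qed.

Let HfP k : (k <= 3)%N -> CBe k Om (fun x => f (Psi x)).
Proof. by move=> k3; apply: (CBe_comp oOm oD1 OmD) => // j; exact: HPm. Qed.

Lemma piece_rep_CBe : CBe 3 O rep.
Proof.
apply: CBe_split.
  apply: (CBe_eq oOp (f := f)); first by move=> x /repp ->.
  exact: CBe_sub OpD (Hf 3).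
apply: (CBe_eq oOm (f := fun x => parity * f (Psi x))); first by move=> x /repm ->.
by apply: CBe_mul => //; [exact: CBe_cst|exact: HfP].
Qed.

Lemma piece_rep_pd_upper x j : Op x -> pd j rep x = pd j f x.
Proof. by move=> Ox; apply: (pd_eq j oOp Ox) => y /repp. Qed.

Lemma piece_rep_pd_lower x j : Om x ->
  pd j rep x = parity * \sum_m jac Psi x j m * pd m f (Psi x).
Proof.
move=> Ox; rewrite (pd_eq j oOm Ox repm).
have Hp2 m : CBe 2 Om (fun x => Psi x 0 m) by exact: HPm.
rewrite -(pd_comp oD1 OmD Hp2 j Ox (Hf 1)).
have HP1 : CBe 1 Om (fun x => f (Psi x)) by exact: HfP.
have [_ S] := is_derive_mul (is_derive_cst parity x (e j)) (CBe_is_derive j HP1 Ox).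
by apply: (etrans S); rewrite mul0r addr0.
Qed.

Section Eigen.
Variable lam : R.
Hypothesis eu : laplace_eigenspace g bc (lam ^+ 2) u.

Let lapl_upper x : D1 x -> lapl G f x = - (lam ^+ 2 * f x).
Proof.
move=> Dx; have [ax _] := D1G Dx; have [_ x0] := Dx.
rewrite -[RHS](eigen_chart i00 eu ax x0).
by apply: (lapl_eq oD1 Dx) => // y /D1G[].
Qed.

Let HGD1 i j : CBe 1 D1 (fun x => G x i j).
Proof. by apply: CBe_leq (CBe_sub D1b (HG i j)). Qed.

Let lapl_lower x : Om x -> lapl Gm (fun y => f (Psi y)) x = - (lam ^+ 2 * f (Psi x)).
Proof.
move=> Ox; rewrite -(lapl_upper (OmD Ox)).
apply: (lapl_transform oOm oD1 OmD _ HGD1 cG0 _ (Hf 2)) => //.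
- by move=> j; exact: HPm.
- by move=> y /D1b /dG.
- by move=> y [/Ob yr _]; exact: J0.
Qed.

(** Above the plane this is the eigenvalue equation in the chart; below, [lapl_transform] carries it
    to the pulled-back metric, and the constant [parity] factors out by linearity. *)
Lemma piece_rep_pde (hp hm : 'I_n -> E -> R) :
  (forall (v : E -> R) lam x, CBe 2 Op v -> Op x -> lapl G v x = - (lam ^+ 2 * v x) ->
    cont_operator (fun i j y => invmx (G y) i j) v lam x = \sum_l hp l x * pd l v x) ->
  (forall (v : E -> R) lam x, CBe 2 Om v -> Om x -> lapl Gm v x = - (lam ^+ 2 * v x) ->
    cont_operator (fun i j y => invmx (Gm y) i j) v lam x = \sum_l hm l x * pd l v x) ->
  forall x, O x -> cont_operator coef rep lam x =
    \sum_l (if 0 < x 0 i0 then hp l x else hm l x) * pd l rep x.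
Proof.
move=> Hp Hm x /split_cases[Ox|Ox].
  have -> : cont_operator coef rep lam x = cont_operator (fun i j y => invmx (G y) i j) f lam x.
    by apply: (cont_operator_eq lam oOp Ox) => // y; exact: repp.
  rewrite Hp //; [|exact: CBe_sub OpD (Hf 2)|exact: lapl_upper (OpD Ox)].
  by apply: eq_bigr => l _; rewrite piece_rep_pd_upper //; case: Ox => _ ->.
have HP2 : CBe 2 Om (fun x => f (Psi x)) by exact: HfP.
have sP l y : Om y -> pd l rep y = parity * pd l (fun y => f (Psi y)) y.
  move=> Oy; rewrite (pd_eq l oOm Oy repm).
  have [_ S] := is_derive_mul (is_derive_cst parity y (e l)) (CBe_is_derive l HP2 Oy).
  by apply: (etrans S); rewrite mul0r addr0.
(* Written as a sum with one term, to use [cont_operator_lin] for the factor [parity]. *)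
have -> : cont_operator coef rep lam x =
    cont_operator (fun i j y => invmx (Gm y) i j) (fun y => \sum_(t < 1) parity * f (Psi y)) lam x.
  by apply: (cont_operator_eq lam oOm Ox) => // y Oy; rewrite big_ord1 repm.
rewrite (cont_operator_lin (D := Om) (fun _ : 'I_1 => parity) oOm (f := fun _ y => f (Psi y))) //; last first.
  by move=> i j; apply: CBe_leq (CBe_sub _ (HiGm i j)) => // y [/Ob].
rewrite big_ord1 Hm //; last exact: lapl_lower.
rewrite mulr_sumr; apply: eq_bigr => l _; rewrite sP // mulrCA.
by case: Ox => _ x0; rewrite ltNge ltW.
Qed.

Let ext q : `|q - z| < r -> q 0 i0 = 0 -> exists U F, [/\ open U, U q, CBe 2 U F,
  forall y, U y -> H y -> img M a y /\ F y = f y & img M a q].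
Proof.
move=> qr q0; have qb : ball z R0 q by apply: b01; apply: br1; exact/mem_ballP.
have Hq : H q by apply/(half_spaceP i00); rewrite q0.
have [aq _] := EG qb Hq.
by have [U [F [oU Uq HF EF]]] := local_fun_ext 2 su aq; exists U, F.
Qed.

Let Psi_cont q : `|q - z| < r -> {for q, continuous Psi}.
Proof.
by move=> qr; apply: cont_coords => j; apply: CBe_continuous (HPsi2 j) _; exact/mem_ballP.
Qed.

Let near_Psi (U : set E) q : open U -> U q -> `|q - z| < r -> q 0 i0 = 0 ->
  \forall x \near q, U x /\ U (Psi x).
Proof.
move=> oU Uq qr q0; have qb : ball z r q by exact/mem_ballP.
have [Pq _] := reflector_plane HPsi qb q0.
apply: filterI; first exact: open_nbhs_nbhs.
by apply: (Psi_cont qr); apply: open_nbhs_nbhs; rewrite Pq.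
Qed.

Let dirichlet_zero q : bc = Dirichlet -> img M a q -> q 0 i0 = 0 -> f q = 0.
Proof.
move=> bE aq q0; case: eu => _ _; rewrite bE; apply.
exact: (boundary_param i00 aq q0).
Qed.

Lemma piece_rep_crosses : crosses i0 z r rep.
Proof.
apply: crosses_intro => q qr q0; have [U [F [oU Uq HF EF aq]]] := ext qr q0.
have qb : ball z r q by exact/mem_ballP.
have [Pq _] := reflector_plane HPsi qb q0.
have Hq : H q by apply/(half_spaceP i00); rewrite q0.
exists F, (fun x => parity * F (Psi x)); split.
- exact: CBe_continuous HF Uq.
- apply: (@continuousM _ _ (fun=> parity)); first exact: cst_continuous.
  apply: (@continuous_comp _ _ _ Psi F); first exact: Psi_cont.
  by rewrite Pq; exact: CBe_continuous HF Uq.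
- rewrite Pq /parity; case E : bc; last by rewrite mul1r.
  by have [_ ->] := EF q Uq Hq; rewrite dirichlet_zero // mulr0.
apply: filterS (near_Psi oU Uq qr q0) => x [Ux UPx] Ox; split => x0.
  by rewrite repp //; have [_ ->] := EF x Ux (posH x0).
have [_ P0] : D1 (Psi x) by exact: OmD.
by rewrite repm //; have [_ ->] := EF _ UPx (posH P0).
Qed.

(** From below, the limit of the gradient is [parity] times d_j F - 2 [j = i0] (conormal . dF). For
    Neumann the conormal derivative vanishes. For Dirichlet the tangential derivatives vanish, so
    the conormal derivative is d_i0 F, and the signs of the odd extension and of the reflection
    cancel. *)
Lemma piece_rep_pd_crosses j : crosses i0 z r (pd j rep).
Proof.
apply: crosses_intro => q qr q0; have [U [F [oU Uq HF EF aq]]] := ext qr q0.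
have qb : ball z r q by exact/mem_ballP.
have qb0 : ball z R0 q by apply: b01; exact: br1.
have [Pq Jq] := reflector_plane HPsi qb q0.
have Hq : H q by apply/(half_spaceP i00); rewrite q0.
have [_ Gq] := EG qb0 Hq.
have dF m : derivable F q (e m) by have [B _ HB] := HF; exact: CB_der HB Uq.
have pF m y : U y -> 0 < y 0 i0 -> pd m f y = pd m F y.
  move=> Uy y0; have oU' : open (U `&` [set y : E | 0 < y 0 i0]) by apply: openI => //; exact: open_pos.
  apply: (pd_eq m oU') => // w [Uw w0]; by have [_ ->] := EF w Uw (posH w0).
exists (pd j F), (fun x => parity * \sum_m jac Psi x j m * pd m F (Psi x)); split.
- exact: CBe_continuous (CBe_pd j HF) Uq.
- apply: (@continuousM _ _ (fun=> parity)); first exact: cst_continuous.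
  have c1 m : {for q, continuous (fun x => jac Psi x j m * pd m F (Psi x))}.
    apply: (@continuousM _ _ (fun x => jac Psi x j m)); first exact: CBe_continuous (HJ j m) qb.
    apply: (@continuous_comp _ _ _ Psi (pd m F)); first exact: Psi_cont.
    by rewrite Pq; exact: CBe_continuous (CBe_pd m HF) Uq.
  exact: (@cvg_bigsum R _ (nbhs q) 'I_n (index_enum 'I_n)
    (fun m x => jac Psi x j m * pd m F (Psi x)) (fun m => jac Psi q j m * pd m F (Psi q))
    (nbhs_filter q) c1).
- rewrite Pq; under eq_bigr do rewrite Jq.
  have -> : \sum_m ((j == m)%:R - 2 * (j == i0)%:R * conormal i0 G q 0 m) * pd m F q =
     pd j F q - 2 * (j == i0)%:R * \sum_m conormal i0 G q 0 m * pd m F q.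
    rewrite mulr_sumr; under eq_bigr do rewrite mulrBl.
    rewrite sumrB; congr (_ - _); last by apply: eq_bigr => m _; rewrite mulrA.
    rewrite (bigD1 j) //= eqxx mul1r big1 ?addr0 // => m mj.
    by rewrite eq_sym (negPf mj) mul0r.
  rewrite /parity; case E : bc.
    have p0 m : m != i0 -> pd m F q = 0.
      move=> mi; apply: pd_line_cst; have [d d0 Hd] := nbhs_cube (open_nbhs_nbhs (conj oU Uq)).
      have Fz y : U y -> y 0 i0 = 0 -> F y = 0.
        move=> Uy y0; have Hy : H y by apply/(half_spaceP i00); rewrite y0.
        by have [ay ->] := EF y Uy Hy; exact: dirichlet_zero.
      near=> t; rewrite !Fz // ?shift_coord.
        by apply: Hd; rewrite addrC addKr; apply: le_lt_trans (norm_scale_basis _ _) _;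
           near: t; exact: (@nbhs0_lt _ R).
      by rewrite eq_sym (negPf mi) addr0.
    have -> : \sum_m conormal i0 G q 0 m * pd m F q = pd i0 F q.
      rewrite (bigD1 i0) //= (conormal_i0 cG0 sG qb0) mul1r big1 ?addr0 // => m mi.
      by rewrite p0 // mulr0.
    have [->|ji] := eqVneq j i0; first by rewrite (_ : true%:R = 1 :> R) //; move: (pd i0 F q) => p; ring.
    by rewrite p0 // mulr0 mul0r subrr mulr0.
  have -> : \sum_m conormal i0 G q 0 m * pd m F q = 0; last by rewrite mulr0 subr0 mul1r.
  have N := eu; rewrite E in N.
  have ap := param_dom aq.
  have := neumann_chart i00 N ap; rewrite paramK // => /(_ q0) Nz.
  have -> : \sum_m conormal i0 G q 0 m * pd m F q = (invmx (G q) i0 i0)^-1 *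
      \sum_m invmx (g a q) i0 m * hpartial m (local_fun a u) q; last by rewrite Nz mulr0.
  rewrite mulr_sumr; apply: eq_bigr => m _; rewrite mxE -Gq mulrA (mulrC (_^-1)).
  congr (_ * _); apply/esym; apply: (hpartial_ext i00 oU Uq Hq (dF m)) => y Uy Hy.
  by have [_ ->] := EF y Uy Hy.
apply: filterS (near_Psi oU Uq qr q0) => x [Ux UPx] Ox; split => x0.
  by rewrite piece_rep_pd_upper //; exact: pF.
have OmX : Om x by [].
have [_ P0] := OmD OmX.
rewrite piece_rep_pd_lower //; apply: congr1; apply: eq_bigr => m _; apply: congr1.
exact: pF.
Unshelve. all: by end_near.
Qed.

Lemma piece_rep_regular : exists2 B, 0 <= B & regular i0 z r B rep.
Proof.
have [B B0 HB] := piece_rep_CBe; exists B => //; split => //.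
  by apply: LL_cross piece_rep_crosses => //; exact: CB_leq HB.
by move=> j; apply: LL_cross (piece_rep_pd_crosses j) => //; exact: CB_leq (CB_pd j HB).
Qed.

End Eigen.
End Functions.

Lemma piece_construct : exists c, [/\ good_piece c, piece_chart c = a & piece_center c = z].
Proof.
have [A A0 HA] : exists2 A, 0 <= A & forall ij : 'I_n * 'I_n, CB A 2 O (coef ij.1 ij.2).
  by apply: CBe_bound_all => -[i j]; exact: Hcoef.
have OpB x : Op x -> ball z R0 x by move=> /OpD /D1b.
have HGp i j : CBe 1 Op (fun x => G x i j) by apply: CBe_leq (CBe_sub OpB (HG i j)).
have HGmm i j : CBe 1 Om (fun x => Gm x i j).
  by apply: CBe_leq (CBe_sub _ (HGm i j)) => // x [/Ob].
have dGp x : Op x -> cG <= \det (G x) by move=> /OpB /dG.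
have dGmm x : Om x -> c' * cG <= \det (Gm x) by move=> [/Ob xr _]; exact: dGm.
have [hp [Cp [Cp0 hpb Hp]]] := lapl_nondivergence oOp HGp cG0 dGp.
have [hm [Cm [Cm0 hmb Hm]]] := lapl_nondivergence oOm HGmm cc0 dGmm.
have [CG CG0 HCG] : exists2 B, 0 <= B & forall ij : 'I_n * 'I_n,
    CB B 3 (ball z R0) (fun x => G x ij.1 ij.2).
  by apply: CBe_bound_all => -[i j]; exact: HG.
have [CM CM0 HCM] : exists2 B, 0 <= B & forall ij : 'I_n * 'I_n,
    CB B 2 (ball z r) (fun x => Gm x ij.1 ij.2).
  by apply: CBe_bound_all => -[i j]; exact: HGm.
have [CI CI0 HCI] : exists2 B, 0 <= B & forall ij : 'I_n * 'I_n,
    CB B 3 (ball z R0) (fun x => invmx (G x) ij.1 ij.2).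
  by apply: CBe_bound_all => -[i j]; exact: HiG.
have [BJ BJ0 HBJ] : exists2 B, 0 <= B & forall ij : 'I_n * 'I_n,
    CB B 2 (ball z r) (fun x => jac Psi x ij.1 ij.2).
  by apply: CBe_bound_all => -[i j]; exact: HJ.
have [L L0 HL] := reflector_lip HPsi.
have n0 : 0 < n%:R :> R by rewrite ltr0n; exact: leq_ltn_trans (leq0n i0) (ltn_ord i0).
pose C0 := CG + CM + 1; pose C2 := CI + 1; pose pL := L + BJ + 1.
have C00 : 0 < C0 by rewrite ltr_wpDl ?addr_ge0.
have C20 : 0 < C2 by rewrite ltr_wpDl.
have pL0 : 0 <= pL by rewrite !addr_ge0.
have pL1 : 1 <= pL by rewrite lerDr addr_ge0.
have nC0 : 0 < n%:R * C0 by rewrite mulr_gt0.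
have nC2 : 0 < n%:R * C2 by rewrite mulr_gt0.
pose h l x := if 0 < x 0 i0 then hp l x else hm l x.
pose c := Piece a z r R1 Psi coef h A (n%:R * C0)^-1 (Cp + Cm) pL CG (n%:R * C2)^-1.
have liftp x : Op x -> piece_lift c x = x by move=> [_ x0]; rewrite /piece_lift x0.
have liftm x : Om x -> piece_lift c x = Psi x.
  by move=> [_ x0]; rewrite /piece_lift ltNge ltW.
exists c; split => //; split => //=.
- move=> i j x.
  have S (B : 'M[R]_n) : B^T = B -> invmx B i j = invmx B j i.
    move=> Bs; have : (invmx B)^T = invmx B by rewrite trmx_inv Bs.
    by move/matrixP/(_ j i); rewrite mxE.
  move=> /split_cases[Ox|Ox]; first by rewrite !coefp //; apply: S; apply: Gsym; exact: OpD.
  by rewrite !coefm //; apply: S; exact: Gmsym.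
- by move=> i j; exact: (HA (i, j)).
- move=> i j; apply: (LL_cross A0); last exact: coef_crosses.
  exact: CB_leq (HA (i, j)).
- by rewrite invr_gt0.
- move=> x xi /split_cases[Ox|Ox]; rewrite mulrC ler_pdivrMr // mulrC.
    have -> : \sum_i \sum_j coef i j x * xi i * xi j = \sum_i \sum_j invmx (G x) i j * xi i * xi j.
      by apply: eq_bigr => i _; apply: eq_bigr => j _; rewrite coefp.
    apply: (posdef_inv_elliptic (Gsym (OpD Ox)) (Gpos (OpD Ox)) xi (ltW C00)) => i j.
    apply: le_trans (CB_bound (HCG (i, j)) (OpB x Ox)) _.
    by rewrite /C0 -addrA lerDl addr_ge0.
  have -> : \sum_i \sum_j coef i j x * xi i * xi j = \sum_i \sum_j invmx (Gm x) i j * xi i * xi j.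
      by apply: eq_bigr => i _; apply: eq_bigr => j _; rewrite coefm.
  apply: (posdef_inv_elliptic (Gmsym Ox) (Gmpos Ox) xi (ltW C00)) => i j.
  have xr : ball z r x by case: Ox => /Ob.
  apply: le_trans (CB_bound (HCM (i, j)) xr) _.
  by rewrite /C0 addrAC lerDr addr_ge0.
- exact: addr_ge0.
- move=> l x /split_cases[Ox|Ox]; rewrite /h.
    by have [_ ->] := Ox; apply: le_trans (hpb l x Ox) _; rewrite lerDl.
  by have [_ x0] := Ox; rewrite (lt_gtF x0); apply: le_trans (hmb l x Ox) _; rewrite lerDr.
- move=> y yr Hy; apply: (EG _ Hy).1; apply/mem_ballP.
  by apply: le_lt_trans yr _; rewrite ltr_pdivrMr // ltr_pMr // ltr1n.
- move=> x /split_cases[Ox|Ox].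
    by rewrite liftp //; have [h1 h2] := OpD Ox; split => //; exact: ltW.
  by rewrite liftm //; have [h1 h2] := OmD Ox; split => //; exact: ltW.
- move=> x y /split_cases[Ox|Ox] /split_cases[Oy|Oy] xy.
  + by rewrite !liftp // ler_peMl.
  + have [[_ x0] [_ y0]] := (Ox, Oy).
    have h0 : x 0 i0 * y 0 i0 < 0 by rewrite pmulr_rlt0.
    by have := lt_trans xy h0; rewrite ltxx.
  + have [[_ x0] [_ y0]] := (Ox, Oy).
    have h0 : x 0 i0 * y 0 i0 < 0 by rewrite nmulr_rlt0.
    by have := lt_trans xy h0; rewrite ltxx.
  rewrite !liftm //; have [[/Ob xr x0] [/Ob yr y0]] := (Ox, Oy).
  apply: le_trans (HL x y xr yr x0 y0) _; rewrite ler_wpM2r //.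
  by rewrite /pL -addrA lerDl addr_ge0.
- by rewrite invr_gt0.
- move=> y yr Hy; have yb : ball z R0 y.
    apply/mem_ballP; apply: le_lt_trans yr _; rewrite ltr_pdivrMr // ltr_pMr // ltr1n //.
  have [ay Gy] := EG yb Hy; split.
    by move=> i j; rewrite -Gy; exact: CB_bound (HCG (i, j)) yb.
  move=> v; rewrite mulrC ler_pdivrMr // mulrC.
  apply: (posdef_lower v (Defs.metric_sym g ay) (metric_posdef g ay) (ltW C20)) => i j.
  rewrite -Gy; apply: le_trans (CB_bound (HCI (i, j)) yb) _.
  by rewrite lerDl.
- move=> x /split_cases[Ox|Ox].
    exists 1%:M; first by move=> i j; apply: le_trans pL1; rewrite mxE normr_nat; case: (i == j); rewrite ?lexx ?ler01.
    move=> u su j; rewrite liftp //.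
    have -> : pd j (piece_rep c u) x = pd j (local_fun a u) x by exact: piece_rep_pd_upper.
    rewrite (bigD1 j) //= mxE eqxx mulr1n mul1r big1 ?addr0; last first.
      by move=> m mj; rewrite mxE eq_sym (negPf mj) mul0r.
    by rewrite (hpartial_interior i00) //; case: Ox.
  exists (parity *: jac Psi x).
    have xr : ball z r x by case: Ox => /Ob.
    move=> i j; apply: (@le_trans _ _ BJ); last by rewrite /pL addrAC lerDr addr_ge0.
    rewrite mxE normrM (_ : `|parity| = 1) ?mul1r; first exact: CB_bound (HBJ (i, j)) xr.
    by rewrite /parity; case: bc; rewrite ?normrN normr1.
  move=> u su j; rewrite liftm //.
  have -> : pd j (piece_rep c u) x = parity * \sum_m jac Psi x j m * pd m (local_fun a u) (Psi x).
    exact: piece_rep_pd_lower.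
  rewrite mulr_sumr; apply: eq_bigr => m _.
  have -> : (parity *: jac Psi x) j m = parity * jac Psi x j m by rewrite [LHS]mxE.
  rewrite (hpartial_interior i00); [exact: mulrA | by case: (OmD Ox)].
move=> lam u eu; have su : smooth_fun u by case: eu.
split; last exact: (piece_rep_regular su eu).
exact: (piece_rep_pde su eu Hp Hm).
Qed.

End Construction.
Lemma piece_exists (p0 : M) : exists c, [/\ good_piece c, piece_chart c = chart_at M p0 &
  piece_center c = coord M (chart_at M p0) p0].
Proof.
set a := chart_at M p0; set z := coord M a p0.
have az : img M a z := coord_img (chart_at_dom p0).
have Hz : H z := img_half az.
have [W oW aE] := img_open (c := M) a.
have Hij (ij : 'I_n * 'I_n) : exists UF : set E * (E -> R), [/\ open UF.1, UF.1 z, CBe 3 UF.1 UF.2 &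
    forall y, UF.1 y -> H y -> img M a y /\ UF.2 y = g a y ij.1 ij.2].
  have [U [F [oU Uz HF EF]]] := smooth_on_ext 3 oW aE (metric_smooth g ij.1 ij.2) az.
  by exists (U, F).
pose UF ij := sval (cid (Hij ij)).
have UFP ij : [/\ open (UF ij).1, (UF ij).1 z, CBe 3 (UF ij).1 (UF ij).2 &
    forall y, (UF ij).1 y -> H y -> img M a y /\ (UF ij).2 y = g a y ij.1 ij.2].
  by rewrite /UF; case: cid.
pose G y : 'M[R]_n := \matrix_(i, j) (UF (i, j)).2 y.
have [U [oU Uz UP]] : exists U, [/\ open U, U z & forall ij y, U y -> (UF ij).1 y].
  by apply: finite_nbhs_open => ij; have [oi iz _ _] := UFP ij; exact: open_nbhs_nbhs.
have EG y : U y -> H y -> img M a y /\ G y = g a y.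
  move=> Uy Hy; have [_ _ _ h] := UFP (i0, i0); have [ay _] := h y (UP _ y Uy) Hy.
  split => //; apply/matrixP => i j; rewrite mxE; have [_ _ _ h'] := UFP (i, j).
  by have [_ ->] := h' y (UP _ y Uy) Hy.
have HG i j : CBe 3 U (fun y => G y i j).
  have [_ _ h _] := UFP (i, j); apply: (CBe_eq oU _ (CBe_sub (UP (i, j)) h)) => y _.
  by rewrite mxE.
have [_ Gz] := EG z Uz Hz.
have Gzs : (G z)^T = G z by rewrite Gz; exact: (Defs.metric_sym g az).
have Gzp v : v != 0 -> 0 < bilin (G z) v v by rewrite Gz; exact: (metric_posdef g az).
have Hdet : CBe 3 U (fun y => \det (G y)) by exact: CBe_det.
have [c1 c10 n1] := near_ge Hdet Uz (posdef_det_gt0 Gzp).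
have [U1 [oU1 U1z U1P]] := nbhs_open (filterI (open_nbhs_nbhs (conj oU Uz)) n1).
have HG1 i j : CBe 3 U1 (fun y => G y i j) by apply: CBe_sub (HG i j) => y /U1P[].
have dn y : U1 y -> c1 <= `|\det (G y)|.
  by move=> /U1P[_ h]; apply: le_trans h _; exact: ler_norm.
have Hinv i j : CBe 3 U1 (fun y => invmx (G y) i j) by exact: (CBe_invmx oU1 c10 dn HG1).
have iz : 0 < invmx (G z) i0 i0.
  have := posdef_invmx Gzs Gzp (v := delta_mx 0 i0).
  rewrite /bilin trmx_delta -rowE -colE !mxE; apply.
  by apply/eqP => /matrixP/(_ 0 i0); rewrite !mxE !eqxx => /eqP; rewrite oner_eq0.
have [c2 c20 n2] := near_ge (Hinv i0 i0) U1z iz.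
have [R0 R00 HR0] := nbhs_cube (filterI (open_nbhs_nbhs (conj oU1 U1z)) n2).
pose cG := Num.min c1 c2.
have cG0 : 0 < cG by rewrite lt_min c10.
have B1 y : ball z R0 y -> U1 y by move=> /mem_ballP /HR0[].
have BU y : ball z R0 y -> U y by move=> /B1 /U1P[].
have HGb i j : CBe 3 (ball z R0) (fun y => G y i j) by exact: CBe_sub BU (HG i j).
have dGb y : ball z R0 y -> cG <= \det (G y).
  by move=> /B1 /U1P[_ h]; apply: le_trans h; rewrite ge_min lexx.
have sGb y : ball z R0 y -> cG <= invmx (G y) i0 i0.
  by move=> /mem_ballP /HR0[_ h]; apply: le_trans h; rewrite ge_min lexx orbT.
have EGb y : ball z R0 y -> H y -> img M a y /\ G y = g a y by move=> /BU; exact: EG.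
have z0 : 0 <= z 0 i0 by exact/(half_spaceP i00).
have R10 : 0 < R0 / 2 by rewrite divr_gt0.
have R1R : R0 / 2 <= R0 by rewrite ler_pdivrMr // ler_peMr ?(ltW R00) // ler1n.
have [r [c' [Psi [[r0 r1] rR c'0 zr HPsi]]]] := reflector_exists R00 HGb cG0 dGb sGb z0 R10 R1R.
exact: (piece_construct R00 HGb cG0 dGb sGb EGb r0 r1 rR c'0 zr HPsi).
Qed.

End Pieces.

(** * Comparison of the full cubes with the inner cubes *)

Lemma sum_fiber_le (R : numDomainType) (T T' : finType) (phi : T -> T') (N : nat)
    (F : T -> R) (G : T' -> R) : (forall t', 0 <= G t') -> (forall t, F t <= G (phi t)) ->
  (forall t', (#|[pred t | phi t == t']| <= N)%N) -> \sum_t F t <= N%:R * \sum_t' G t'.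
Proof.
move=> G0 FG HN; apply: (@le_trans _ _ (\sum_t G (phi t))); first by apply: ler_sum.
rewrite (partition_big phi predT) //= mulr_sumr; apply: ler_sum => t' _.
rewrite (eq_bigr (fun=> G t')); last by move=> t /eqP ->.
rewrite sumr_const -[X in X <= _]mulr_natl; apply: ler_wpM2r => //.
by rewrite ler_nat; apply: leq_trans (HN t').
Qed.

Lemma card_box_le (n M q : nat) (P : pred 'rV['I_M]_n) :
  (forall k l i, P k -> P l -> (k 0%R i <= l 0%R i + q)%N) -> (#|P| <= q.*2.+1 ^ n)%N.
Proof.
move=> H; have [l Pl|P0] := pickP P; last by rewrite eq_card0.
pose f (k : 'rV['I_M]_n) : {ffun 'I_n -> 'I_q.*2.+1} := [ffun i => inord (k 0%R i + q - l 0%R i)].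
rewrite -(card_in_imset (f := f) (D := P)).
  by apply: leq_trans (max_card _) _; rewrite card_ffun !card_ord.
move=> k1 k2 P1 P2 /ffunP f12; apply/rowP => i; have := f12 i.
rewrite !ffunE => /(congr1 (@nat_of_ord _)).
have [h1 h2] := (H k1 l i P1 Pl, H l k1 i Pl P1).
have [h3 h4] := (H k2 l i P2 Pl, H l k2 i Pl P2).
rewrite /= !inordK => [Q||]; [apply: val_inj => /=; lia|lia|lia].
Qed.

Lemma sum_sqr_le (R : realFieldType) (T : finType) (f : T -> R) :
  (\sum_x f x) ^+ 2 <= #|T|%:R * \sum_x f x ^+ 2.
Proof.
have : 0 <= \sum_x \sum_y (f x - f y) ^+ 2.
  by apply: sumr_ge0 => x _; apply: sumr_ge0 => y _; exact: sqr_ge0.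
have -> : \sum_x \sum_y (f x - f y) ^+ 2 =
    2 * (#|T|%:R * \sum_x f x ^+ 2) - 2 * (\sum_x f x) ^+ 2.
  transitivity (\sum_x (#|T|%:R * f x ^+ 2 - 2 * (f x * \sum_y f y) + \sum_y f y ^+ 2)).
    apply: eq_bigr => x _; rewrite -sum_card mulr_sumr mulr_sumr -sumrB -big_split /=.
    by apply: eq_bigr => y _; ring.
  rewrite big_split /= sumrB -mulr_sumr sum_card -mulr_sumr -mulr_suml.
  by move: (\sum_x f x) (\sum_x f x ^+ 2) => a b; ring.
by rewrite subr_ge0 ler_pM2l.
Qed.

Section Cells.
Variables (R : realType) (n : nat) (i0 : 'I_n) (m : nat) (z : 'rV[R]_n) (r : R).
Hypothesis r0 : 0 < r.
Local Notation h := (mesh m r).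
Implicit Types (y : 'rV[R]_n) (k l : 'rV['I_m.+2]_n) (i : 'I_n).

Let Mh : m.+2%:R * h = 2 * r.
Proof. by rewrite /mesh mulrC divfK // pnatr_eq0. Qed.
Let h0 : 0 < h. Proof. exact: mesh_gt0. Qed.

Lemma mesh_le1 : 2 * r <= 1 -> h <= m.+2%:R^-1.
Proof. by move=> r1; rewrite /mesh ler_piMl // invr_ge0. Qed.

(** The coordinate is h/2 times an odd number minus the even number m + 2. *)
Lemma pt_off_plane k : ~~ odd m -> z 0 i0 = 0 -> pt z r k 0 i0 != 0.
Proof.
move=> om z0; rewrite mxE z0.
have -> : 0 - r + ((k 0 i0)%:R + 1 / 2) * h = h / 2 * ((k 0 i0).*2.+1%:R - m.+2%:R).
  by rewrite -[(k 0 i0).*2.+1]addn1 natrD -muln2 natrM; move: Mh; set c := _%:R; set d := _%:R; nra.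
rewrite mulf_neq0 //; first by rewrite gt_eqF // divr_gt0.
rewrite subr_eq0 eqr_nat; apply: contra om => /eqP/(congr1 odd) /=.
by rewrite odd_double negbK => <-.
Qed.

(** The cell is found by truncating coordinates. With an even number of cells around a centre on the
    plane, no cell straddles the plane, so the cell centre is on the side of [y]. *)
Lemma cell_exists y : `|y - z| < r -> exists k, `|pt z r k - y| <= h /\
  (z 0 i0 = 0 -> ~~ odd m -> 0 < y 0 i0 -> 0 < pt z r k 0 i0).
Proof.
move=> yz; pose t i := (y 0 i - z 0 i + r) / h.
have yi i : `|y 0 i - z 0 i| < r.
  by apply: le_lt_trans yz; have := coord_le_norm (y - z) i; rewrite !mxE.
have t0 i : 0 <= t i.
  by rewrite divr_ge0 ?(ltW h0) //; have := yi i; rewrite ltr_norml; move=> /andP[a b]; lra.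
have tM i : t i < m.+2%:R.
  by rewrite ltr_pdivrMr // Mh; have := yi i; rewrite ltr_norml; move=> /andP[a b]; lra.
pose k : 'rV['I_m.+2]_n := \row_i inord (Num.truncn (t i)).
have kE i : (k 0 i : nat) = Num.truncn (t i).
  rewrite mxE inordK // -(ltr_nat R); have /andP[h1 _] := truncn_itv (t0 i).
  exact: le_lt_trans h1 (tM i).
have th i : t i * h = y 0 i - z 0 i + r by rewrite divfK // gt_eqF.
exists k; split.
  apply: norm_leP => [|i]; first exact: ltW.
  rewrite !mxE -[inord _]/(inord _) -/(t i).
  have /andP[h1 h2] := truncn_itv (t0 i).
  have -> : (inord (Num.truncn (t i)) : 'I_m.+2) = k 0 i by rewrite mxE.
  rewrite kE; move: h1 h2; rewrite -natr1; set c := _%:R => h1 h2.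
  have {h1}h1 : c * h <= t i * h by rewrite ler_pM2r.
  have {h2}h2 : t i * h < c * h + h.
    by rewrite -[X in _ + X]mul1r -mulrDl ltr_pM2r.
  rewrite th in h1 h2; rewrite ler_norml.
  have -> : z 0 i - r + (c + 1 / 2) * h - y 0 i = c * h + h / 2 - (y 0 i - z 0 i + r) by ring.
  move: h1 h2 h0; move: (c * h) (y 0 i - z 0 i + r) => p q; lra.
move=> z0 om y0; rewrite mxE z0 kE.
have le : (m.+2./2 <= Num.truncn (t i0))%N.
  rewrite truncn_ge_nat // ler_pdivlMr // z0 subr0.
  have : m.+2./2%:R * 2 = m.+2%:R :> R.
    by rewrite -natrM muln2 halfK /= negbK (negPf om) subn0.
  by move: Mh; set c := _%:R; set d := _%:R; move: y0 => ? H1 H2; nra.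
have : m.+2%:R <= (Num.truncn (t i0))%:R * 2 :> R.
  rewrite -natrM ler_nat muln2 -[X in (X <= _)%N]odd_double_half /= negbK (negPf om) add0n.
  by rewrite -[X in (X <= _)%N]/(m.+2./2.*2) leq_double.
set c := (Num.truncn _)%:R; move: Mh; set d := _%:R => Mh' dc.
have : d * h <= c * 2 * h by rewrite ler_pM2r.
rewrite Mh' => H; move: h0; have -> : 0 - r + (c + 1 / 2) * h = c * h - r + h / 2 by ring.
have {}H : 2 * r <= 2 * (c * h) by rewrite (_ : 2 * (c * h) = c * 2 * h) //; ring.
by move: H; move: (c * h) => p; lra.
Qed.

Lemma pt_close k l (q : nat) i : `|pt z r k - pt z r l| <= q%:R * h -> (k 0%R i <= l 0%R i + q)%N.
Proof.
move=> H; have := le_trans (coord_le_norm _ i) H; rewrite !mxE.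
have -> : z 0 i - r + ((k 0 i)%:R + 1 / 2) * h - (z 0 i - r + ((l 0 i)%:R + 1 / 2) * h) =
  ((k 0 i)%:R - (l 0 i)%:R) * h by ring.
rewrite normrM (gtr0_norm h0) ler_pM2r // ler_norml => /andP[_].
by rewrite lerBlDl -natrD ler_nat.
Qed.

End Cells.

Section EnergyComparison.
Variables (R : realType) (n : nat) (i0 : 'I_n).
Local Notation E := 'rV[R]_n.
Implicit Types (x y : E) (u : E -> R).

Lemma energy_gradient (lam q : R) u v x y (Q : 'M[R]_n) : 0 <= q -> (forall i j, `|Q i j| <= q) ->
  u x ^+ 2 = v y ^+ 2 -> (forall j, pd j u x = \sum_l Q j l * pd l v y) ->
  energy lam u x <= (1 + n%:R ^+ 2 * q ^+ 2) * energy lam v y.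
Proof.
move=> q0 Qq uv dE; rewrite /energy uv; set S := \sum_j pd j v y ^+ 2.
have S0 : 0 <= S by apply: sumr_ge0 => j _; exact: sqr_ge0.
have : \sum_j pd j u x ^+ 2 <= \sum_(j < n) n%:R * q ^+ 2 * S.
  apply: ler_sum => j _; rewrite dE.
  apply: (@le_trans _ _ ((\sum_l q * `|pd l v y|) ^+ 2)).
    rewrite -[X in X <= _]real_normK ?num_real // ler_pXn2r ?nnegrE //; last first.
      by apply: sumr_ge0 => l _; rewrite mulr_ge0.
    apply: le_trans (ler_norm_sum _ _ _) _; apply: ler_sum => l _.
    by rewrite normrM ler_wpM2r.
  rewrite -mulr_sumr exprMn [X in _ <= X]mulrAC mulrC ler_wpM2r ?sqr_ge0 //.
  apply: le_trans (sum_sqr_le _) _; rewrite card_ord ler_wpM2l // ler_sum // => l _.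
  by rewrite real_normK ?num_real.
rewrite sum_card card_ord; set S' := \sum_j _.
have : 0 <= lam ^+ 2 * v y ^+ 2 by rewrite mulr_ge0 ?sqr_ge0.
have : 0 <= n%:R ^+ 2 * q ^+ 2 :> R by rewrite mulr_ge0 ?sqr_ge0.
have -> : n%:R * (n%:R * q ^+ 2 * S) = n%:R ^+ 2 * q ^+ 2 * S by ring.
move: (n%:R ^+ 2 * q ^+ 2) (lam ^+ 2 * v y ^+ 2) => A B A0 B0; nra.
Qed.

Lemma energy_near (lam B h : R) (z : E) (r : R) u x y : 0 <= B ->
  CB B 3 (split_cube i0 z r) u ->
  split_cube i0 z r x -> split_cube i0 z r y -> 0 < x 0 i0 * y 0 i0 -> `|x - y| <= h ->
  energy lam u x <= 2 * energy lam u y + 2 * (lam ^+ 2 + n%:R) * (n%:R * B * h) ^+ 2.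
Proof.
move=> B0 Hu Ox Oy xy xyh; set d := n%:R * B * h.
have alg (p q : R) : `|p - q| <= d -> p ^+ 2 <= 2 * q ^+ 2 + 2 * d ^+ 2.
  move=> pq; have : (p - q) ^+ 2 <= d ^+ 2.
    by rewrite -[X in X <= _]real_normK ?num_real // ler_pXn2r ?nnegrE // (le_trans _ pq).
  have := sqr_ge0 (p - 2 * q); lra.
have lip f : CB B 1 (split_cube i0 z r) f -> `|f x - f y| <= d.
  move=> Hf; apply: le_trans (lip_side B0 Hf Oy Ox _) _; first by rewrite mulrC.
  by rewrite ler_wpM2l // mulr_ge0.
rewrite /energy; set S := \sum_j pd j u y ^+ 2.
have : \sum_j pd j u x ^+ 2 <= \sum_(j < n) (2 * pd j u y ^+ 2 + 2 * d ^+ 2).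
  by apply: ler_sum => j _; apply: alg; apply: lip; apply: (CB_leq (k := 2)) (CB_pd j Hu).
rewrite big_split /= -mulr_sumr -/S sum_card card_ord.
have : lam ^+ 2 * u x ^+ 2 <= lam ^+ 2 * (2 * u y ^+ 2 + 2 * d ^+ 2).
  by rewrite ler_wpM2l ?sqr_ge0 //; apply: alg; apply: lip; apply: CB_leq Hu.
move: (lam ^+ 2) (u x ^+ 2) (u y ^+ 2) (d ^+ 2) (\sum_j _) => L a b D T; lra.
Qed.

End EnergyComparison.

Lemma finite_subcover (X : topologicalType) (T : Type) (V : T -> set X) : compact [set: X] ->
  (forall t, open (V t)) -> (forall p, exists t, V t p) ->
  exists N (t : 'I_N -> T), forall p, exists b, V (t b) p.
Proof.
move=> cX oV cV; have [[p0 _]|nX] := pselect (exists p : X, True); last first.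
  have t0 (b : 'I_0) : T by case: b.
  by exists 0%N, t0 => p; case: nX; exists p.
(* Cover compactness is applied to the space pointed at [p0]; the empty space was settled by the
   empty family. *)
pose pX : ptopologicalType := HB.pack (Topological.sort X) (isPointed.Build (Topological.sort X) p0).
have : @cover_compact pX [set: pX] by rewrite -compact_cover; exact: cX.
pose t p := sval (cid (cV p)); have tP p : V (t p) p by rewrite /t; case: cid.
move=> /(_ pX [set: pX] (fun p => V (t p))) [] => [p _|p _|D' _ cD].
- exact: oV.
- by exists p.
exists (size (finmap.enum_fset D')), (fun i => t (tnth (in_tuple (finmap.enum_fset D')) i)) => p.
have [q qD Vq] := cD p I; have qs : q \in finmap.enum_fset D' by [].
have iq : (index q (finmap.enum_fset D') < size (finmap.enum_fset D'))%N by rewrite index_mem.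
by exists (Ordinal iq); rewrite (tnth_nth q) /= nth_index.
Qed.

Section Matching.
Variables (R : realType) (n : nat) (i0 : 'I_n).
Hypothesis i00 : i0 = 0%N :> nat.
Variables (M : compact_manifold R n) (g : riemannian_metric M) (bc : boundary_condition).
Local Notation E := 'rV[R]_n.
Local Notation e := (basis_vec R).
Local Notation H := (@half_space R n).
Local Notation piece := (piece M).
Local Notation good_piece := (good_piece i0 g bc).
Local Notation piece_cube := (piece_cube i0).
Local Notation piece_lift := (piece_lift i0).
Local Notation piece_rep := (piece_rep i0 bc).
Implicit Types (x y q : E) (p : M) (u : M -> R) (i j l : 'I_n) (c a : piece).

Definition piece_point c x : M := param M (piece_chart c) (piece_lift c x).

Definition piece_window c (rho : R) : set M :=
  [set p | dom M (piece_chart c) p /\ `|coord M (piece_chart c) p - piece_center c| < rho].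

Lemma open_window c rho : open (piece_window c rho).
Proof.
rewrite openE => p [dp cp].
have [D [oD Dp DP]] := coord_local (ball_open (piece_center c) rho) dp (proj2 (mem_ballP _ _ _) cp).
rewrite /interior; apply: filterS (open_nbhs_nbhs (conj oD Dp)) => q /DP[dq bq].
by split => //; exact/mem_ballP.
Qed.

Lemma good_img c x : good_piece c -> piece_cube c x -> img M (piece_chart c) (piece_lift c x).
Proof.
move=> gc cx; have [h1 h2] := gp_lift gc cx; apply: (gp_img gc) => //.
by apply/(half_spaceP i00); exact: ltW.
Qed.

Lemma point_coord c x : good_piece c -> piece_cube c x ->
  dom M (piece_chart c) (piece_point c x) /\ coord M (piece_chart c) (piece_point c x) = piece_lift c x.
Proof.
by move=> gc cx; have ix := good_img gc cx; split; [exact: param_dom|exact: paramK].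
Qed.

Lemma window_coord c p rho : rho <= piece_radius c -> piece_window c rho p ->
  0 < coord M (piece_chart c) p 0 i0 -> piece_cube c (coord M (piece_chart c) p).
Proof.
move=> rr [dp cp] p0; split; last by rewrite gt_eqF.
exact: lt_le_trans cp rr.
Qed.

Lemma piece_rep_sqr c u x : piece_rep c u x ^+ 2 = u (piece_point c x) ^+ 2.
Proof.
rewrite /piece_rep /piece_rep exprMn /local_fun; case: ifP => _; first by rewrite expr1n mul1r.
by rewrite /parity; case: bc; rewrite ?sqrrN expr1n mul1r.
Qed.

Lemma piece_rep_sign c x : exists2 s : R, s ^+ 2 = 1 &
  forall u, piece_rep c u x = s * u (piece_point c x).
Proof.
exists (if 0 < x 0 i0 then 1 else parity R bc) => [|u]; last by [].
by case: ifP => _; rewrite ?expr1n // /parity; case: bc; rewrite ?sqrrN expr1n.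
Qed.

Lemma piece_rep_upper c u x : 0 < x 0 i0 -> piece_rep c u x = local_fun (piece_chart c) u x.
Proof. by move=> x0; rewrite /piece_rep /piece_lift x0 mul1r. Qed.

Lemma piece_rep_pd_pos c u x j : 0 < x 0 i0 ->
  pd j (piece_rep c u) x = hpartial j (local_fun (piece_chart c) u) x.
Proof.
move=> x0; rewrite (hpartial_interior i00) //.
have := @pd_eq R n [set y : E | 0 < y 0 i0] (piece_rep c u) (local_fun (piece_chart c) u) j x (@open_pos R n i0) x0.
by apply => y y0; exact: piece_rep_upper.
Qed.

Definition transfer_bound c a : R := n%:R * (piece_L c * (1 + piece_mA c / piece_mnu a)).

Lemma transfer_bound_ge0 c a : good_piece c -> good_piece a -> 0 <= transfer_bound c a.
Proof.
move=> gc ga; rewrite mulr_ge0 // mulr_ge0 ?(gp_L0 gc) // addr_ge0 //.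
by rewrite divr_ge0 ?(gp_mA0 gc) // ltW // (gp_mnu0 ga).
Qed.

(** The same point of the manifold seen in two cubes: values differ by a sign common to all
    functions, gradients by a bounded matrix. The transition Jacobian is bounded without
    compactness, because its rows have controlled length: the transformation law compares the two
    metrics. *)
Lemma piece_match c a x : good_piece c -> good_piece a -> piece_cube c x ->
  let p := piece_point c x in let y := coord M (piece_chart a) p in
  dom M (piece_chart a) p -> `|y - piece_center a| <= piece_range a ->
  [/\ 0 < y 0 i0, forall u, piece_rep c u x ^+ 2 = piece_rep a u y ^+ 2 &
  exists s (Q : 'M[R]_n), [/\ s ^+ 2 = 1, forall i j, `|Q i j| <= transfer_bound c a,
   forall u, piece_rep c u x = s * piece_rep a u y &
   forall u, smooth_fun u -> forall j, pd j (piece_rep c u) x = \sum_l Q j l * pd l (piece_rep a u) y]].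
Proof.
move=> gc ga cx p y ap yr; have [cp cy] := point_coord gc cx.
have [_ x0] := gp_lift gc cx.
have y0 : 0 < y 0 i0 by apply: (interior_chart i00 g cp ap); rewrite cy.
have repy u : piece_rep a u y = u p by rewrite piece_rep_upper // /local_fun coordK.
have [s s2 sE] := piece_rep_sign c x.
split=> // [u|]; first by rewrite piece_rep_sqr repy.
have [K KL KE] := gp_grad gc cx.
pose J := transition_jacobian (piece_chart c) (piece_chart a) (piece_lift c x).
have Hy : H y by exact: img_half (coord_img ap).
have JE := metric_transition g cp ap; rewrite cy -/y -/J /= in JE.
have mq0 : 0 <= piece_mA c / piece_mnu a by rewrite divr_ge0 ?(gp_mA0 gc) // ltW // (gp_mnu0 ga).
have J1 i l : `|J i l| <= 1 + piece_mA c / piece_mnu a.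
  have [_ Hb] := gp_metric ga yr Hy; have := Hb (row i J).
  have [xr _] := gp_lift gc cx.
  have Hx : H (piece_lift c x) by exact: img_half (good_img gc cx).
  have [Ha _] := gp_metric gc xr Hx; have := Ha i i; rewrite JE.
  have -> : (J *m g (piece_chart a) y *m J^T) i i = bilin (g (piece_chart a) y) (row i J) (row i J).
    have rE (A : 'M[R]_n) k : row i A 0 k = A i k by rewrite mxE.
    rewrite /bilin -row_mul [LHS]mxE [RHS]mxE; apply: eq_bigr => k _.
    by rewrite rE; congr (_ * _); rewrite [LHS]mxE [RHS]mxE rE.
  move=> h1 h2.
  have h3 : piece_mnu a * J i l ^+ 2 <= piece_mA c.
    apply: le_trans (le_trans h2 (le_trans (ler_norm _) h1)).
    rewrite ler_wpM2l ?(ltW (gp_mnu0 ga)) // (bigD1 l) //= [row i J 0 l]mxE lerDl.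
    by apply: sumr_ge0 => j _; exact: sqr_ge0.
  have {}h3 : `|J i l| ^+ 2 <= piece_mA c / piece_mnu a.
    by rewrite real_normK ?num_real // ler_pdivlMr ?(gp_mnu0 ga) // mulrC.
  by move: h3; have := normr_ge0 (J i l); move: `|_| (_ / _) => b q; nra.
exists s, (K *m J); split => // [i j|u|u su j].
- rewrite mxE; apply: le_trans (ler_norm_sum _ _ _) _.
  have -> : transfer_bound c a = \sum_(l < n) piece_L c * (1 + piece_mA c / piece_mnu a).
    by rewrite sum_card card_ord.
  by apply: ler_sum => l _; rewrite normrM ler_pM.
- by rewrite repy sE.
rewrite KE //.
transitivity (\sum_m \sum_l K j m * (J m l * pd l (piece_rep a u) y)).
  apply: eq_bigr => m _; rewrite -mulr_sumr; apply: congr1.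
  rewrite -[in LHS]cy (hpartial_chain i00 m su cp ap) cy -/J -/y.
  by apply: eq_bigr => l _; rewrite piece_rep_pd_pos.
rewrite exchange_big; apply: eq_bigr => l _.
by rewrite [in RHS]mxE mulr_suml; apply: eq_bigr => m _; rewrite mulrA.
Qed.

(* Either [p0] lies in the chart of [c], where the transition map is smooth, or a
   neighbourhood of [p0] misses the compact image of [c]. *)
Lemma lift_lipschitz c a p0 : good_piece c -> dom M (piece_chart a) p0 ->
  exists V L, [/\ open V, V p0, 0 <= L & forall x x', piece_cube c x -> piece_cube c x' ->
    V (piece_point c x) -> V (piece_point c x') ->
    `|piece_lift c x - piece_lift c x'| <=
      L * `|coord M (piece_chart a) (piece_point c x) - coord M (piece_chart a) (piece_point c x')|].
Proof.
move=> gc ap; have [cp|ncp] := pselect (dom M (piece_chart c) p0); last first.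
  pose S := param M (piece_chart c) @` [set y | `|y - piece_center c| <= piece_range c /\ H y].
  have cS : closed S.
    apply: (compact_closed (@carrier_hausdorff _ _ M)).
    apply: continuous_compact; last by apply: (half_cube_compact i00).
    apply: continuous_subspaceW (@param_continuous _ _ M (piece_chart c)).
    by move=> y [yr Hy]; exact: (gp_img gc).
  exists (~` S), 0; split => //; first exact: closed_openC.
    by move=> [y [yr Hy] yp]; apply: ncp; rewrite -yp; apply: param_dom; exact: (gp_img gc).
  move=> x x' cx _ []; exists (piece_lift c x) => //; have [h1 h2] := gp_lift gc cx.
  by split => //; apply/(half_spaceP i00); exact: ltW.
have [U [F [oU Up HF EF]]] := transition_ext i0 1 ap cp.
pose z := coord M (piece_chart a) p0.
have [rho rho0 Hrho] := nbhs_cube (open_nbhs_nbhs (conj oU Up)).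
have [B B0 HB] := CBe_bound_all HF.
have [D [oD Dp DP]] := coord_local (ball_open z rho) ap (ballxx _ rho0).
exists (D `&` dom M (piece_chart c)), (n%:R * B); split.
- by apply: openI => //; exact: dom_open.
- by split.
- by rewrite mulr_ge0.
move=> x x' cx cx' [/DP[dx bx] _] [/DP[dx' bx'] _].
have [dpx cpx] := point_coord gc cx; have [dpx' cpx'] := point_coord gc cx'.
set p := piece_point c x in dx bx dpx cpx *; set p' := piece_point c x' in dx' bx' dpx' cpx' *.
have sub y : split_cube i0 z rho y -> U y by move=> [yr _]; exact: Hrho.
have pos w (q : M) : piece_cube c w -> q = piece_point c w -> dom M (piece_chart a) q ->
    0 < coord M (piece_chart a) q 0 i0.
  move=> cw -> dq; have [dw ew] := point_coord gc cw.
  by apply: (interior_chart i00 g dw dq); rewrite ew; have [] := gp_lift gc cw.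
have y0 := pos x p cx erefl dx; have y0' := pos x' p' cx' erefl dx'.
have EE (q : M) : dom M (piece_chart a) q -> dom M (piece_chart c) q ->
    ball z rho (coord M (piece_chart a) q) -> forall j,
    F j (coord M (piece_chart a) q) = coord M (piece_chart c) q 0 j.
  move=> aq cq bq j; have [_ _ ->] := EF _ (Hrho _ (proj1 (mem_ballP _ _ _) bq)) (img_half (coord_img aq)).
  by rewrite coordK.
apply: norm_leP => [|j]; first by rewrite !mulr_ge0.
rewrite [X in `|X|]mxE [X in `|_ + X|]mxE -cpx -cpx' -!EE //.
apply: (@lip_side _ _ i0 z rho B (F j)) => //.
- exact: CB_sub sub (HB j).
- by split; [exact/mem_ballP|rewrite gt_eqF].
- by split; [exact/mem_ballP|rewrite gt_eqF].
- exact: mulr_gt0.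
Qed.

End Matching.

Section Covering.
Variables (R : realType) (n : nat) (i0 : 'I_n).
Hypothesis i00 : i0 = 0%N :> nat.
Variables (M : compact_manifold R n) (g : riemannian_metric M) (bc : boundary_condition).
Local Notation E := 'rV[R]_n.
Local Notation H := (@half_space R n).
Local Notation piece := (piece M).
Local Notation good_piece := (good_piece i0 g bc).
Local Notation piece_cube := (piece_cube i0).
Local Notation piece_lift := (piece_lift i0).
Local Notation piece_rep := (piece_rep i0 bc).
Local Notation piece_point := (piece_point i0).
Local Notation window c := (piece_window c (piece_radius c / 8)).
Implicit Types (x y : E) (p : M) (i j l : 'I_n) (c : piece).

Lemma cover_pieces : exists P (c : 'I_P -> piece),
  (forall a, good_piece (c a)) /\ forall p, exists a, window (c a) p.
Proof.
have [cc ccP] := choice (piece_exists i00 g bc).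
have [] := @finite_subcover M _ (fun p => window (cc p)) (@carrier_compact _ _ M).
- by move=> p; exact: open_window.
- move=> p; exists p; have [gp ep zp] := ccP p; rewrite /piece_window /= ep zp.
  by split; [exact: chart_at_dom|rewrite subrr normr0 divr_gt0 // (gp_r0 gp)].
move=> P [t tP]; exists P, (fun a => cc (t a)); split => // a.
by have [] := ccP (t a).
Qed.

Variables (P : nat) (c : 'I_P -> piece).
Hypothesis gc : forall a, good_piece (c a).
Hypothesis cov : forall p, exists a, window (c a) p.

Let lipschitz_on (V : set M) a L := forall b x x', piece_cube (c b) x -> piece_cube (c b) x' ->
    V (piece_point (c b) x) -> V (piece_point (c b) x') ->
    `|piece_lift (c b) x - piece_lift (c b) x'| <=
      L * `|coord M (piece_chart (c a)) (piece_point (c b) x) -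
            coord M (piece_chart (c a)) (piece_point (c b) x')|.

Lemma lift_lipschitz_all p0 : exists V a L, [/\ open V, V p0, 0 <= L,
  V `<=` window (c a) & lipschitz_on V a L].
Proof.
have [a [ap ar]] := cov p0.
have HV b : exists VL : set M * R, [/\ open VL.1, VL.1 p0, 0 <= VL.2 & forall x x',
    piece_cube (c b) x -> piece_cube (c b) x' ->
    VL.1 (piece_point (c b) x) -> VL.1 (piece_point (c b) x') ->
    `|piece_lift (c b) x - piece_lift (c b) x'| <=
      VL.2 * `|coord M (piece_chart (c a)) (piece_point (c b) x) -
            coord M (piece_chart (c a)) (piece_point (c b) x')|].
  by have [V [L HL]] := lift_lipschitz i00 (gc b) ap; exists (V, L).
have [VL VLP] := choice HV.
have N : nbhs p0 (window (c a) `&` [set q | forall b, (VL b).1 q]).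
  apply: filterI; first by apply: open_nbhs_nbhs; split; [exact: open_window|split].
  apply: (@filter_forall _ _ (fun b q => (VL b).1 q) (nbhs p0) _) => b; have [oV Vp _ _] := VLP b.
  exact: open_nbhs_nbhs.
exists (window (c a) `&` [set q | forall b, (VL b).1 q])^°, a, (\sum_b (VL b).2); split.
- exact: open_interior.
- exact: N.
- by apply: sumr_ge0 => b _; have [] := VLP b.
- by move=> q /interior_subset[].
move=> b x x' bx bx' /interior_subset[_ Vx] /interior_subset[_ Vx'].
have [_ _ L0 HL] := VLP b; apply: le_trans (HL x x' bx bx' (Vx b) (Vx' b)) _.
rewrite ler_wpM2r // (bigD1 b) //= lerDl; apply: sumr_ge0 => b' _.
by have [] := VLP b'.
Qed.

(** On each of these finitely many small open sets, all cubes have Lipschitz lifts with respect to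
    one reference chart. This will bound how many lattice points share a partner. *)
Lemma fine_cover : exists Q (V : 'I_Q -> set M) (a : 'I_Q -> 'I_P) (L : R), [/\ 0 <= L,
  forall p, exists s, V s p, forall s, V s `<=` window (c (a s)) &
  forall s, lipschitz_on (V s) (a s) L].
Proof.
have HW p : exists W : set M * 'I_P * R, [/\ open W.1.1, W.1.1 p, 0 <= W.2,
    W.1.1 `<=` window (c W.1.2) & lipschitz_on W.1.1 W.1.2 W.2].
  by have [V [a [L HL]]] := lift_lipschitz_all p; exists (V, a, L).
have [W WP] := choice HW.
have [] := @finite_subcover M _ (fun p => (W p).1.1) (@carrier_compact _ _ M).
- by move=> p; have [] := WP p.
- by move=> p; exists p; have [] := WP p.
move=> Q [t tP]; exists Q, (fun s => (W (t s)).1.1), (fun s => (W (t s)).1.2),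
  (\sum_s (W (t s)).2); split => //.
- by apply: sumr_ge0 => s _; have [] := WP (t s).
- by move=> s; have [] := WP (t s).
move=> s b x x' bx bx' Vx Vx'; have [_ _ L0 _ HL] := WP (t s).
apply: le_trans (HL b x x' bx bx' Vx Vx') _.
rewrite ler_wpM2r // (bigD1 s) //= lerDl; apply: sumr_ge0 => s' _.
by have [] := WP (t s').
Qed.

Section Combination.
Variables (d : nat) (co : 'I_d -> R) (u : 'I_d -> M -> R).

Definition combination c x : R := \sum_i co i * piece_rep c (u i) x.

Hypothesis su : forall b, smooth_fun (u b).
Hypothesis Cu : forall a b, CBe 1 (piece_cube (c a)) (piece_rep (c a) (u b)).

Lemma combination_match lam q a b x : 0 <= q -> transfer_bound (c a) (c b) <= q ->
  piece_cube (c a) x ->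
  let y := coord M (piece_chart (c b)) (piece_point (c a) x) in
  dom M (piece_chart (c b)) (piece_point (c a) x) ->
  `|y - piece_center (c b)| < piece_radius (c b) ->
  0 < y 0 i0 /\
  energy lam (combination (c a)) x <= (1 + n%:R ^+ 2 * q ^+ 2) * energy lam (combination (c b)) y.
Proof.
move=> q0 tq ax y dy yr.
have [|y0 _ [s [T [s2 Tq uE dE]]]] := piece_match i00 (gc a) (gc b) ax dy.
  by apply: le_trans (ltW yr) (gp_range (gc b)).
rewrite -/y in y0 uE dE *; split => //.
have yb : piece_cube (c b) y by split => //; rewrite gt_eqF.
apply: (@energy_gradient _ _ lam q _ _ x y T) => //.
- by move=> i j; apply: le_trans (Tq i j) tq.
- rewrite /combination; under eq_bigr do rewrite uE mulrCA.
  by rewrite -mulr_sumr exprMn s2 mul1r.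
move=> j; rewrite (pd_lin _ _ (Cu a)) //.
under [in RHS]eq_bigr do rewrite (pd_lin _ _ (Cu b)) //.
under [in LHS]eq_bigr do rewrite dE // mulr_sumr.
rewrite exchange_big; apply: eq_bigr => l _; rewrite mulr_sumr.
by apply: eq_bigr => i _; exact: mulrCA.
Qed.

End Combination.


(** The windows have radius r/8, so a lattice point within one mesh, at most r/64, still lies in the
    inner cube of radius r/4. *)
Lemma cell_of_point V b m (p : M) : (V : set M) `<=` window (c b) -> V p -> ~~ odd m ->
  mesh m (piece_radius (c b)) <= piece_radius (c b) / 64 ->
  0 < coord M (piece_chart (c b)) p 0 i0 -> exists k : 'rV['I_m.+2]_n,
  let y := pt (piece_center (c b)) (piece_radius (c b)) k in
  [/\ `|y - coord M (piece_chart (c b)) p| <= mesh m (piece_radius (c b)), 0 < y 0 i0 &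
      `|y - piece_center (c b)| <= piece_radius (c b) / 4].
Proof.
move=> VW Vp om hr y0; have [dp pr] := VW p Vp; set h := mesh _ _ in hr *.
have r0 := gp_r0 (gc b); set z := piece_center _ in pr *; set r := piece_radius _ in hr pr r0 *.
have [|k [k1 k2]] := cell_exists i0 m r0 (lt_trans pr (_ : r / 8 < r)).
  by rewrite ltr_pdivrMr // ltr_pMr // ltr1n.
exists k; split; first exact: k1.
  case: (gp_plane (gc b)) => [z0|H0]; first exact: k2.
  by apply: H0; exact: pt_in_cube.
rewrite -(subrK (coord M (piece_chart (c b)) p) (pt z r k)) -addrA.
apply: le_trans (ler_normD _ _) _; apply: le_trans (lerD k1 (ltW pr)) _.
have alg (s t : R) : 0 < t -> s <= t / 64 -> s + t / 8 <= t / 4 by lra.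
exact: alg r0 hr.
Qed.

(** Two members of [F] are close in the reference chart, hence close after lifting and, on one side
    of the plane, close in the cube: at most (piece_L L / r) h, that is [q] mesh steps. So [F] fits
    in a box. *)
Lemma fiber_bound V b a L (q m : nat) (F : pred 'rV['I_m.+2]_n) :
  let z := piece_center (c a) in let r := piece_radius (c a) in
  0 <= L -> lipschitz_on V b L ->
  piece_L (c a) * L / r <= q%:R ->
  (forall k : 'rV['I_m.+2]_n, pt z r k 0 i0 != 0) ->
  (forall k, F k -> V (piece_point (c a) (pt z r k))) ->
  (forall k (l : 'rV['I_m.+2]_n), F k -> F l -> 0 < pt z r k 0 i0 * pt z r l 0 i0 /\
     `|coord M (piece_chart (c b)) (piece_point (c a) (pt z r k)) -
       coord M (piece_chart (c b)) (piece_point (c a) (pt z r l))| <=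
     2 * mesh m (piece_radius (c b))) ->
  (#|F| <= q.*2.+1 ^ n)%N.
Proof.
move=> z r L0 HL Lq ptn FV FF; have r0 : 0 < r := gp_r0 (gc a).
have cube (k : 'rV['I_m.+2]_n) : piece_cube (c a) (pt z r k) by split; [exact: pt_in_cube|exact: ptn].
apply: card_box_le => k l i Fk Fl; apply: (pt_close (z := z) r0).
have [kl yy] := FF k l Fk Fl.
apply: le_trans (gp_lip (gc a) (cube k) (cube l) kl) _.
have h1 := le_trans (HL a _ _ (cube k) (cube l) (FV k Fk) (FV l Fl)) (ler_wpM2l L0 yy).
apply: le_trans (ler_wpM2l (gp_L0 (gc a)) h1) _.
have hb : mesh m (piece_radius (c b)) <= m.+2%:R^-1 by apply: mesh_le1 (gp_r1 (gc b)).
have -> : q%:R * mesh m r = (q%:R * r) * (2 * m.+2%:R^-1).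
  by rewrite /mesh; move: (m.+2%:R^-1 : R) => *; ring.
rewrite mulrA; apply: ler_pM.
- by rewrite mulr_ge0 ?(gp_L0 (gc a)).
- by rewrite mulr_ge0 ?(ltW (mesh_gt0 _ _)) ?(gp_r0 (gc b)).
- by rewrite -ler_pdivrMr.
- by rewrite ler_pM2l.
Qed.

Local Notation center a := (piece_center (c a)).
Local Notation radius a := (piece_radius (c a)).

(** Every lattice point of every cube is a point of the manifold, which lies in some window and so
    has a partner in an inner cube with comparable energy. Partners are shared a bounded number of
    times, whatever the mesh. *)
Lemma cover_comparison : exists2 C, 0 <= C & forall B lam, 0 <= B -> exists K,
  forall m d (co : 'I_d -> R) (u : 'I_d -> M -> R),
  ~~ odd m -> (forall a, mesh m (radius a) <= radius a / 64) ->
  (forall a (k : 'rV['I_m.+2]_n), pt (center a) (radius a) k 0 i0 != 0) ->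
  (forall b, smooth_fun (u b)) ->
  (forall a b, CBe 1 (piece_cube (c a)) (piece_rep (c a) (u b))) ->
  (forall a, CB B 3 (piece_cube (c a)) (combination co u (c a))) ->
  \sum_a \sum_(k : 'rV['I_m.+2]_n) energy lam (combination co u (c a)) (pt (center a) (radius a) k) <=
  C * (\sum_a \sum_(k : 'rV['I_m.+2]_n | `|pt (center a) (radius a) k - center a| <= radius a / 4)
     energy lam (combination co u (c a)) (pt (center a) (radius a) k)) +
  K * (#|{: 'rV['I_m.+2]_n}|%:R / m.+2%:R).
Proof.
have [Q [V [b [L [L0 covV VW HL]]]]] := fine_cover.
pose T := \sum_a \sum_a' transfer_bound (c a) (c a').
have t0 a a' : 0 <= transfer_bound (c a) (c a') by exact: transfer_bound_ge0.
have T0 : 0 <= T by apply: sumr_ge0 => a _; apply: sumr_ge0.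
have tT a a' : transfer_bound (c a) (c a') <= T.
  rewrite /T (bigD1 a) //= (bigD1 a') //= -addrA lerDl addr_ge0 ?sumr_ge0 // => *.
  exact: sumr_ge0.
pose Cq := 1 + n%:R ^+ 2 * T ^+ 2.
have Cq0 : 0 <= Cq by rewrite addr_ge0 // mulr_ge0 ?sqr_ge0.
pose S := \sum_a piece_L (c a) * L / radius a.
have s0 a : 0 <= piece_L (c a) * L / radius a.
  by apply: divr_ge0; [apply: mulr_ge0 => //; exact: gp_L0 (gc a)|exact: ltW (gp_r0 (gc a))].
have S0 : 0 <= S by exact: sumr_ge0.
pose q := (Num.truncn S).+1.
have Sq a : piece_L (c a) * L / radius a <= q%:R.
  have /andP[_ /ltW] := truncn_itv S0; apply: le_trans.
  by rewrite /S (bigD1 a) //= lerDl sumr_ge0.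
pose N := (q.*2.+1 ^ n)%N.
pose D := P%:R * N%:R * (2 * Q%:R) * Cq.
have D0 : 0 <= D by rewrite !mulr_ge0.
exists (D * 2); first by rewrite mulr_ge0.
move=> B lam B0; pose err := 2 * (lam ^+ 2 + n%:R) * (n%:R * B) ^+ 2.
exists (D * err) => m d co u om hr ptn su Cu Hv.
set G := 'rV['I_m.+2]_n; set W := #|{: G}|%:R.
pose pk a (k : G) := pt (center a) (radius a) k.
pose v a := combination co u (c a).
pose en a (k : G) := energy lam (v a) (pk a k).
pose inn a (k : G) := `|pk a k - center a| <= radius a / 4.
set e2 := err / m.+2%:R.
have err0 : 0 <= err.
  by apply: mulr_ge0; [apply: mulr_ge0 => //; apply: addr_ge0 => //|]; exact: sqr_ge0.
have e20 : 0 <= e2 by rewrite divr_ge0.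
have cube a k : piece_cube (c a) (pk a k).
  by split; [apply: pt_in_cube; exact: gp_r0 (gc a)|exact: ptn].
have match_ a (k : G) : exists t : 'I_Q * G, let: (s, l) := t in
  [/\ V s (piece_point (c a) (pk a k)),
   `|pk (b s) l - coord M (piece_chart (c (b s))) (piece_point (c a) (pk a k))| <= mesh m (radius (b s)),
   inn (b s) l & en a k <= Cq * (2 * en (b s) l + e2)].
  have [s Vs] := covV (piece_point (c a) (pk a k)); have [dp pr] := VW s _ Vs.
  have rb := gp_r0 (gc (b s)).
  have r8 : radius (b s) / 8 < radius (b s) by move: rb; move: (radius _) => *; lra.
  have [y0 Em] := combination_match co su Cu lam T0 (tT a (b s)) (cube a k) dp (lt_trans pr r8).
  have [l [ly l0 lin]] := cell_of_point (VW s) Vs om (hr (b s)) y0.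
  exists (s, l); split => //; apply: le_trans Em _; rewrite -/Cq ler_wpM2l //.
  have yb := @window_coord _ _ i0 _ (c (b s)) _ _ (ltW r8) (conj dp pr) y0.
  apply: le_trans (energy_near lam B0 (Hv (b s)) yb (cube (b s) l) _ _) _.
  - exact: mulr_gt0.
  - by rewrite distrC; exact: ly.
  have -> : e2 = 2 * (lam ^+ 2 + n%:R) * ((n%:R * B) ^+ 2 * m.+2%:R^-1) by rewrite /e2 /err !mulrA.
  rewrite lerD2l ler_wpM2l //; first by apply: mulr_ge0 => //; apply: addr_ge0 => //; exact: sqr_ge0.
  rewrite exprMn ler_wpM2l ?sqr_ge0 //.
  have h0 := mesh_gt0 m rb; have h1 := mesh_le1 m (gp_r1 (gc (b s))).
  apply: le_trans h1; rewrite expr2 ger_pMl //; apply: le_trans (mesh_le1 m (gp_r1 (gc (b s)))) _.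
  by rewrite invf_le1 ?ltr0n // ler1n.
have bound a : \sum_k en a k <= N%:R * (2 * Q%:R) * (Cq * (2 * (\sum_a' \sum_(k | inn a' k) en a' k) + W * e2)).
  have [phi phiP] := choice (match_ a).
  (* The side of the plane is recorded because a point and its mirror image have the same lift, so
     only points on one side can be told apart. *)
  pose psi k := (0 < pk a k 0 i0, phi k).
  pose Gt (t : bool * ('I_Q * G)) := (inn (b t.2.1) t.2.2)%:R * (Cq * (2 * en (b t.2.1) t.2.2 + e2)).
  have en0 a' k : 0 <= en a' k by exact: energy_ge0.
  have tm0 a' k : 0 <= Cq * (2 * en a' k + e2).
    by apply: mulr_ge0 => //; apply: addr_ge0 => //; exact: mulr_ge0.
  have St := @sum_fiber_le _ _ _ psi N (en a) Gt; apply: le_trans (St _ _ _) _.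
  - by move=> t; apply: mulr_ge0; [exact: ler0n|exact: tm0].
  - move=> k; have := phiP k; rewrite /Gt /psi /=; case: (phi k) => s l [_ _ -> ek].
    by rewrite mul1r.
  - move=> [s0' [s l]].
    apply: (fiber_bound (V := V s) (b := b s) (a := a) L0 (HL s) (Sq a) (ptn a)).
      by move=> k /eqP[_ pE]; have := phiP k; rewrite pE => -[].
    move=> k k' /eqP[sk pk1] /eqP[sk' pk2].
    have := phiP k; have := phiP k'; rewrite pk1 pk2 => -[_ d1 _ _] [_ d2 _ _].
    split.
      have := ptn a k; have := ptn a k'; rewrite -/(pk a k) -/(pk a k').
      move: sk sk'; case: ltgtP => //= h1 <-; case: ltgtP => //= h2 _ _ _; nra.
    set y1 := coord _ _ _ in d2 *; set y2 := coord _ _ _ in d1 *.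
    rewrite -(subrK (pk (b s) l) y1) -addrA; apply: le_trans (ler_normD _ _) _.
    rewrite mulr_natl mulr2n; apply: lerD => //; by rewrite distrC.
  rewrite -mulrA ler_wpM2l // -(pair_bigA _ (fun s t => Gt (s, t))) /=.
  have -> : \sum_(s : bool) \sum_t Gt (s, t) = 2 * \sum_(t : 'I_Q * G) Gt (true, t).
    by rewrite big_bool /= mulr_natl mulr2n.
  rewrite -mulrA ler_wpM2l // -(pair_bigA _ (fun s (l : G) => Gt (true, (s, l)))) /=.
  apply: (@le_trans _ _ (\sum_(s < Q) Cq * (2 * (\sum_a' \sum_(k | inn a' k) en a' k) + W * e2))); last first.
    by rewrite sum_card card_ord.
  apply: ler_sum => s _; rewrite /Gt /=.
  apply: (@le_trans _ _ (\sum_l ((inn (b s) l)%:R * (Cq * (2 * en (b s) l)) + Cq * e2))).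
    apply: ler_sum => l _; rewrite mulrDr mulrDr lerD2l.
    by case: (inn _ _); rewrite ?mul1r // mul0r mulr_ge0.
  rewrite big_split /= -sum_indicator sum_card -/W.
  have -> : \sum_(l | inn (b s) l) Cq * (2 * en (b s) l) = Cq * (2 * \sum_(l | inn (b s) l) en (b s) l).
    by rewrite !mulr_sumr.
  have -> : W * (Cq * e2) = Cq * (W * e2) by rewrite mulrCA.
  rewrite -mulrDr ler_wpM2l // lerD2r ler_wpM2l // (bigD1 (b s)) //= lerDl.
  by apply: sumr_ge0 => a' _; apply: sumr_ge0.
apply: le_trans (ler_sum _ (fun a _ => bound a)) _.
rewrite sum_card card_ord /D -/W /e2.
set X := \sum_a \sum_(k | _) _.
have alg (p N' q' c' x w e m' : R) : p * (N' * (2 * q') * (c' * (2 * x + w * (e * m')))) =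
  p * N' * (2 * q') * c' * 2 * x + p * N' * (2 * q') * c' * e * (w * m') by ring.
by rewrite alg.
Qed.

End Covering.

(** * Linear algebra and the final count *)

Section LinearAlgebra.
Variable R : realType.

(** Dividing a kernel vector by its largest entry gives the normalisation that is kept when the mesh
    changes. *)
Lemma kernel_vector (T : finType) (d : nat) (A : 'I_d -> T -> R) : (#|T| < d)%N ->
  exists co : 'I_d -> R, [/\ exists i, `|co i| = 1, forall i, `|co i| <= 1 &
    forall t, \sum_i co i * A i t = 0].
Proof.
move=> Td; pose U : 'M[R]_(d, #|T|) := \matrix_(i, j) A i (enum_val j).
have : kermx U != 0.
  by rewrite -mxrank_eq0 mxrank_ker subn_eq0 -ltnNge; apply: leq_ltn_trans (rank_leq_col _) Td.
move=> /rowV0Pn[w /sub_kermxP wU w0].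
have [i1 wi1] : exists i, w 0 i != 0.
  by apply/existsP; apply: contraNT w0; rewrite negb_exists => /forallP H; apply/eqP/rowP => i;
     apply/eqP; rewrite mxE; move: (H i); rewrite negbK.
have [i _ wi] := @arg_maxP _ R _ i1 predT (fun i => `|w 0 i|) isT.
have i0 : 0 < `|w 0 i| by apply: lt_le_trans (wi i1 isT); rewrite normr_gt0.
exists (fun j => w 0 j / `|w 0 i|); split.
- by exists i; rewrite normrM normfV normr_id divff // gt_eqF.
- by move=> j; rewrite normrM normfV normr_id ler_pdivrMr // mul1r; exact: wi.
move=> t; under eq_bigr do rewrite mulrAC; rewrite -mulr_suml.
have := congr1 (fun B : 'rV_#|T| => B 0 (enum_rank t)) wU; rewrite !mxE.
under eq_bigr do rewrite mxE enum_rankK.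
by move=> ->; rewrite mul0r.
Qed.

(** Greedy choice: while fewer than [d] points are chosen, some nontrivial combination vanishes at
    all of them, and any point of [Y] where it does not vanish raises the rank. *)
Lemma evaluation_points (X : Type) (Y : set X) d (u : 'I_d -> X -> R) :
  (forall co : 'I_d -> R, (forall p, Y p -> \sum_i co i * u i p = 0) -> forall i, co i = 0) ->
  exists q : 'I_d -> X, (forall j, Y (q j)) /\ \matrix_(i, j) u i (q j) \in unitmx.
Proof.
move=> indep; have H k : (k <= d)%N -> exists q : 'I_k -> X, (forall j, Y (q j)) /\
    (k <= \rank (\matrix_(i < d, j < k) u i (q j)))%N.
  elim: k => [_|k IH kd].
    by have q0 (j : 'I_0) : X by [case: j]; exists q0; split => // -[].
  have [q [Yq rk]] := IH (ltnW kd); set U := \matrix_(i, j) _ in rk.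
  have : kermx U != 0.
    by rewrite -mxrank_eq0 mxrank_ker subn_eq0 -ltnNge; apply: leq_ltn_trans (rank_leq_col _) kd.
  move=> /rowV0Pn[w /sub_kermxP wU w0].
  have [p Yp wp] : exists2 p, Y p & \sum_i w 0 i * u i p != 0.
    apply: contrapT => N; move/negP: w0; apply; apply/eqP/rowP => i; rewrite [RHS]mxE.
    apply: (indep (fun i => w 0 i)) => p Yp; apply: contrapT => /eqP wp; apply: N.
    by exists p.
  rewrite -[k.+1]addn1.
  exists (fun j => match fintype.split j with inl j' => q j' | inr _ => p end); split.
    by move=> j; case: fintype.split.
  pose v : 'cV[R]_d := \col_i u i p.
  have -> : \matrix_(i < d, j < k + 1) u i (match fintype.split j with inl j' => q j' | inr _ => p end) =
      row_mx U v.
    by apply/matrixP => i j; rewrite !mxE; case: fintype.split => j'; rewrite !mxE.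
  rewrite -mxrank_tr tr_row_mx -addsmxE addn1.
  apply: (@leq_ltn_trans (\rank U^T)); first by rewrite mxrank_tr.
  apply: rank_ltmx; rewrite /ltmx addsmxSl /=; apply: contra wp => /submxP[D DE].
  have : (v^T <= U^T)%MS.
    by apply: submx_trans (addsmxSr U^T v^T) _; apply/submxP; exists D.
  move=> /submxP[D' D'E]; have : w *m v = 0.
    by rewrite -[v]trmxK D'E trmx_mul trmxK mulmxA wU mul0mx.
  move=> /matrixP/(_ 0 0); rewrite !mxE => wv; apply/eqP; rewrite -[RHS]wv.
  by apply: eq_bigr => i _; rewrite mxE.
have [q [Yq rk]] := H d (leqnn d); exists q; split => //.
by rewrite -row_free_unit /row_free eqn_leq rank_leq_row.
Qed.

(** If all values were below 1/S, applying the inverse matrix, whose entries sum in absolute value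
    to less than S, would make every coefficient smaller than 1. *)
Lemma evaluation_bound d (U : 'M[R]_d) : U \in unitmx -> exists2 kap, 0 < kap &
  forall co : 'I_d -> R, (exists i, `|co i| = 1) -> exists j, kap <= `|\sum_i co i * U i j|.
Proof.
move=> Uu; pose S := 1 + \sum_i \sum_j `|invmx U i j|.
have S0 : 0 < S by rewrite ltr_pwDl // sumr_ge0 // => i _; exact: sumr_ge0.
exists S^-1 => [|co [i ci]]; first by rewrite invr_gt0.
pose w := \row_i co i; apply: contrapT => N.
have small j : `|(w *m U) 0 j| < S^-1.
  have -> : (w *m U) 0 j = \sum_i co i * U i j by rewrite mxE; apply: eq_bigr => l _; rewrite mxE.
  by rewrite ltNge; apply/negP => h; apply: N; exists j.
have : `|(w *m U *m invmx U) 0 i| < 1.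
  rewrite mxE; apply: le_lt_trans (ler_norm_sum _ _ _) _.
  apply: (@le_lt_trans _ _ (\sum_j S^-1 * `|invmx U j i|)).
    by apply: ler_sum => j _; rewrite normrM ler_wpM2r // ltW.
  rewrite -mulr_sumr mulrC -[X in _ < X](divff (lt0r_neq0 S0)) ltr_pM2r ?invr_gt0 //.
  apply: (@le_lt_trans _ _ (\sum_j \sum_l `|invmx U j l|)); last by rewrite /S ltrDr.
  by apply: ler_sum => j _; rewrite (bigD1 i) //= lerDl sumr_ge0.
by rewrite mulmxK // mxE ci ltxx.
Qed.

(** Finite dimension is a conclusion: a bound on independent families yields one of maximal size,
    and it spans because no element can be added to it. *)
Lemma bounded_dimension (X : Type) (V : set (X -> R)) (D : R) :
  (forall d (u : 'I_d -> X -> R), (forall i, V (u i)) ->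
     (forall co : 'I_d -> R, (forall p, \sum_i co i * u i p = 0) -> forall i, co i = 0) ->
     d%:R <= D) ->
  exists d, has_dimension V d /\ d%:R <= D.
Proof.
move=> HD; pose indep d := exists u : 'I_d -> X -> R, (forall i, V (u i)) /\
  (forall co : 'I_d -> R, (forall p, \sum_i co i * u i p = 0) -> forall i, co i = 0).
pose P d := `[< indep d >].
have P0 : P 0%N.
  apply/asboolP; have u0 (j : 'I_0) : X -> R by [case: j]; exists u0.
  by split => [[]|co _ []].
have PD d : P d -> (d <= Num.truncn D)%N.
  move=> /asboolP[u [Vu iu]]; have dD := HD d u Vu iu.
  by rewrite truncn_ge_nat // (le_trans _ dD).
have [d /asboolP[u [Vu iu]] dmax] := ex_maxnP (ex_intro _ 0%N P0) PD.
exists d; split; last exact: HD Vu iu.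
exists u; split => // v Vv; apply: contrapT => nv.
suff /asboolP/dmax : indep d.+1 by rewrite ltnn.
exists (fun i => if unlift ord0 i is Some j then u j else v); split.
  by move=> i; case: unliftP.
move=> co H.
have H' p : co ord0 * v p + \sum_j co (lift ord0 j) * u j p = 0.
  rewrite -[RHS](H p) big_ord_recl unlift_none; congr (_ + _).
  by apply: eq_bigr => j _; rewrite liftK.
have c0 : co ord0 = 0.
  apply: contrapT => /eqP c0; apply: nv; exists (fun j => - (co (lift ord0 j) / co ord0)) => p.
  apply: (mulfI c0); rewrite mulr_sumr; move/eqP: (H' p); rewrite addr_eq0 => /eqP ->.
  rewrite -sumrN; apply: eq_bigr => j _.
  by rewrite mulNr mulrN mulrA; congr (- (_ * _)); rewrite mulrCA divff // mulr1.
have cj : forall j, co (lift ord0 j) = 0.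
  by apply: iu => p; have := H' p; rewrite c0 mul0r add0r.
by move=> i; case: (unliftP ord0 i) => [j ->|->].
Qed.

End LinearAlgebra.

Section Counting.
Variables (R : realType) (n : nat) (i0 : 'I_n) (z : 'rV[R]_n) (r : R).
Hypothesis r0 : 0 < r.

(** A box of [w] consecutive cells per direction, w = (m + 2) / D, fits in the cube of radius [rho],
    and m + 2 <= 2 D w. So these points are a fixed fraction of the lattice. *)
Lemma card_near (y : 'rV[R]_n) (rho : R) (D m : nat) : 0 < rho -> rho <= r / 2 ->
  4 * r / rho <= D%:R -> (D <= m.+2)%N -> (0 < D)%N -> `|y - z| < r / 8 ->
  mesh m r <= rho / 2 ->
  (#|{: 'rV['I_m.+2]_n}| <= #|[pred k : 'rV['I_m.+2]_n | (`|pt z r k - y| <= rho)%R]| * D.*2 ^ n)%N.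
Proof.
move=> rho0 rhor Dr DM D0 yz hrho; set h := mesh m r in hrho *.
have h0 : 0 < h by exact: mesh_gt0.
(* The box grows in the positive directions from a cell near this shifted corner, so that it stays
   within [rho] of [y]. *)
pose y' : 'rV[R]_n := y - const_mx (rho / 2).
have y'z : `|y' - z| < r.
  rewrite /y' addrAC; apply: le_lt_trans (ler_normB _ _) _.
  have : `|const_mx (rho / 2) : 'rV[R]_n| <= rho / 2.
    by apply: norm_leP => [|j]; [apply: ltW; rewrite divr_gt0|rewrite mxE ger0_norm // ltW // divr_gt0].
  by move: yz rhor r0; move: `|_| `|_| => a b; lra.
have [k0 [k0y _]] := cell_exists i0 m r0 y'z.
pose w := (m.+2 %/ D)%N.
have w0 : (0 < w)%N by rewrite divn_gt0.
have wh : w%:R * h <= rho / 2.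
  rewrite /h /mesh; have : (w * D)%:R <= m.+2%:R :> R by rewrite ler_nat leq_trunc_div.
  rewrite natrM => wD; have D0' : 0 < D%:R :> R by rewrite ltr0n.
  have : w%:R * D%:R / m.+2%:R <= 1 :> R by rewrite ler_pdivrMr ?mul1r // ltr0n.
  move: Dr; rewrite ler_pdivrMr // => Dr.
  have -> : w%:R * (2 * r / m.+2%:R) = 2 * r * (w%:R / m.+2%:R) by rewrite mulrCA mulrA; ring.
  rewrite mulrAC; set q := w%:R / _ => qD.
  have q0 : 0 <= q by rewrite divr_ge0.
  have H1 : 4 * r * q <= D%:R * rho * q by rewrite ler_wpM2r.
  have H2 : D%:R * rho * q <= rho.
    have -> : D%:R * rho * q = rho * (q * D%:R) by ring.
    by rewrite ger_pMr.
  by move: H1 H2; rewrite -!mulrA; move: (r * q) => *; lra.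
have kM (i : 'I_n) (f : 'I_w) : (k0 0%R i + f < m.+2)%N.
  have Mh : m.+2%:R * h = 2 * r by rewrite /h /mesh mulrC divfK // pnatr_eq0.
  rewrite -(ltr_nat R) -(ltr_pM2r h0) Mh natrD mulrDl.
  have fw : f%:R * h <= w%:R * h by rewrite ler_pM2r // ler_nat ltnW.
  have := le_trans (coord_le_norm _ i) k0y; have := le_lt_trans (coord_le_norm _ i) yz.
  rewrite !mxE -/h.
  move: wh fw hrho rhor r0 h0; move: (f%:R * h) (w%:R * h) => a b.
  have -> : z 0 i - r + ((k0 0 i)%:R + 1 / 2) * h = z 0 i - r + (k0 0 i)%:R * h + h / 2 by ring.
  move: ((k0 0 i)%:R * h) => c *.
  have {}H1 : y 0 i - z 0 i < r / 8 by apply: le_lt_trans (ler_norm _) _; eassumption.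
  have {}H2 : z 0 i - r + c + h / 2 - (y 0 i - rho / 2) <= h by apply: le_trans (ler_norm _) _; eassumption.
  lra.
pose F (f : {ffun 'I_n -> 'I_w}) : 'rV['I_m.+2]_n := \row_i inord (k0 0 i + f i).
have FE f i : (F f 0 i : nat) = (k0 0%R i + f i)%N by rewrite mxE inordK // kM.
have Finj : injective F.
  move=> f f' /rowP E; apply/ffunP => i; apply: val_inj; apply: (@addnI (k0 0 i)).
  by rewrite -!FE E.
have sub : (w ^ n <= #|[pred k : 'rV['I_m.+2]_n | (`|pt z r k - y| <= rho)%R]|)%N.
  have -> : (w ^ n)%N = #|[set F f | f in {: {ffun 'I_n -> 'I_w}}]%SET|.
    by rewrite card_imset // card_ffun !card_ord.
  apply: subset_leq_card; apply/fintype.subsetP => k /imsetP[f _ ->]; rewrite inE.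
  apply: norm_leP => [|i]; first exact: ltW.
  have := le_trans (coord_le_norm _ i) k0y; rewrite !mxE -/h.
  have -> : (inord (k0 0 i + f i) : 'I_m.+2) = F f 0 i by rewrite mxE.
  rewrite FE natrD.
  have fw : (f i)%:R * h <= w%:R * h by rewrite ler_pM2r // ler_nat ltnW.
  have f0 : 0 <= (f i)%:R * h by rewrite mulr_ge0 // ltW.
  have -> : z 0 i - r + ((k0 0 i)%:R + (f i)%:R + 1 / 2) * h - y 0 i =
    (z 0 i - r + ((k0 0 i)%:R + 1 / 2) * h - (y 0 i - rho / 2)) + (f i)%:R * h - rho / 2 by field.
  move: fw f0 wh hrho; rewrite !ler_norml; move: (_ - (_ - _)) (_%:R * h) (_%:R * h) => a b c.
  by move=> *; apply/andP; split; move: rho0; lra.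
apply: leq_trans (leq_mul sub (leqnn _)); rewrite card_mx card_ord mul1n -expnMn leq_exp2r //.
  apply: leq_trans (ltnW (ltn_ceil m.+2 D0)) _; rewrite -/w -muln2 mulnCA mulnC leq_mul2l.
  by rewrite muln2 -addnn -addn1 leq_add2l w0 orbT.
exact: leq_ltn_trans (leq0n _) (ltn_ord i0).
Qed.

End Counting.

Lemma fcoefs_sum (R : realType) (m N n d : nat) (ks : seq 'I_n) md (co : 'I_d -> R)
    (f : 'I_d -> 'rV['I_m.+2]_n -> R) y :
  fcoefs (N := N) ks md (fun k => \sum_i co i * f i k) y = \sum_i co i * fcoefs (N := N) ks md (f i) y.
Proof.
elim: (index_enum _) => [|i s IH].
  rewrite big_nil; have := fcoefs_lin (N := N) ks md (-1 : R) (fun=> 0) (fun=> 0) y.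
  under eq_fun do rewrite mulr0 addr0.
  move=> Z0; have {}Z0 : fcoefs (N := N) ks md (fun=> 0 : R) y = 0 by rewrite Z0 mulN1r addNr.
  by rewrite -[RHS]Z0; congr (fcoefs _ _ _ _); apply/funext => k; rewrite big_nil.
rewrite big_cons -IH -fcoefs_lin; congr fcoefs.
by apply/funext => k; rewrite big_cons.
Qed.

Section RegularCombination.
Variables (R : realType) (n : nat) (i0 : 'I_n) (z : 'rV[R]_n) (r B : R) (d : nat).
Variables (co : 'I_d -> R) (f : 'I_d -> 'rV[R]_n -> R).
Hypothesis B0 : 0 <= B.
Hypothesis co1 : forall b, `|co b| <= 1.
Hypothesis rf : forall b, regular i0 z r B (f b).

Lemma regular_lin : regular i0 z r (d%:R * (2 ^+ 3 * B)) (fun x => \sum_b co b * f b x).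
Proof.
have oO : open (split_cube i0 z r) by exact: open_split_cube.
have B8 : B <= 2 ^+ 3 * B.
  by rewrite ler_peMl // exprn_ege1 // ler1n.
have HLL (h : 'I_d -> 'rV[R]_n -> R) : (forall b, LL i0 z r B (h b)) ->
    LL i0 z r (d%:R * (2 ^+ 3 * B)) (fun x => \sum_b co b * h b x).
  move=> Hh x i s Ox Oy; rewrite -sumrB; apply: le_trans (ler_norm_sum _ _ _) _.
  have -> : d%:R * (2 ^+ 3 * B) * `|s| = \sum_(b < d) 2 ^+ 3 * B * `|s|.
    by rewrite sum_card card_ord !mulrA.
  apply: ler_sum => b _; rewrite -mulrBr normrM.
  apply: (@le_trans _ _ (1 * (B * `|s|))); first by apply: ler_pM => //; exact: (Hh b).
  by rewrite mul1r ler_wpM2r.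
have Cf b : CBe 1 (split_cube i0 z r) (f b).
  by exists B => //; apply: (@CB_leq _ _ _ 3) => //; have [] := rf b.
split.
- have := @CB_sum R n _ (fun b x => co b * f b x) (2 ^+ 3 * B) 3 _ oO.
  rewrite card_ord; apply => b; apply: (CB_le (B := 2 ^+ 3 * (`|co b| * B))).
    by rewrite ler_wpM2l ?exprn_ge0 // ler_piMl.
  by apply: CB_mul => //; [exact: CB_cst|have [] := rf b].
- by apply: HLL => b; have [] := rf b.
move=> j x i s Ox Oy; rewrite !(pd_lin _ _ Cf) //.
apply: (HLL (fun b => pd j (f b))) => // b.
by have [_ _ h] := rf b; exact: h.
Qed.

End RegularCombination.

Section Multiplicity.
Variables (R : realType) (n : nat) (i0 : 'I_n).
Hypothesis i00 : i0 = 0%N :> nat.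
Variables (M : compact_manifold R n) (g : riemannian_metric M) (bc : boundary_condition).
Local Notation E := 'rV[R]_n.
Local Notation e := (basis_vec R).
Local Notation H := (@half_space R n).
Local Notation piece := (piece M).
Local Notation good_piece := (good_piece i0 g bc).
Local Notation piece_cube := (piece_cube i0).
Local Notation piece_lift := (piece_lift i0).
Local Notation piece_rep := (piece_rep i0 bc).
Local Notation piece_point := (piece_point i0).
Local Notation window c := (piece_window c (piece_radius c / 8)).
Local Notation combination := (combination i0 bc).
Implicit Types (x y : E) (p : M) (i j l : 'I_n) (c : piece).

Definition interior_point p := 0 < coord M (chart_at M p) p 0 i0.

(** Moving a point slightly in direction [i0] makes it interior, and the combination has a
    continuous local extension. Hence evaluation points can be taken off the boundary, where a cube
    contains them strictly above the plane. *)
Lemma interior_dense d (co : 'I_d -> R) (u : 'I_d -> M -> R) : (forall b, smooth_fun (u b)) ->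
  (forall p, interior_point p -> \sum_b co b * u b p = 0) -> forall p, \sum_b co b * u b p = 0.
Proof.
move=> su int p; set a := chart_at M p; pose x := coord M a p.
have ap : dom M a p by exact: chart_at_dom.
have ax : img M a x by exact: coord_img.
have HU b : exists UF : set E * (E -> R), [/\ open UF.1, UF.1 x, CBe 0 UF.1 UF.2 &
    forall y, UF.1 y -> H y -> img M a y /\ UF.2 y = local_fun a (u b) y].
  by have [U [F HF]] := local_fun_ext 0 (su b) ax; exists (U, F).
have [UF UFP] := choice HU.
have [U [oU Ux UP]] : exists U, [/\ open U, U x & forall b y, U y -> (UF b).1 y].
  apply: finite_nbhs_open => b; have [oV Ub _ _] := UFP b.
  exact: open_nbhs_nbhs.
have val q : U q -> H q -> (0 < d)%N -> img M a q.
  by move=> Uq Hq d0; have [_ _ _ h] := UFP (Ordinal d0); have [] := h q (UP _ q Uq) Hq.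
case: (posnP d) => [d0|d0].
  by rewrite big1 // => b; have := ltn_ord b; rewrite {2}d0.
pose Phi y := \sum_b co b * (UF b).2 y.
have PhiE y : U y -> H y -> Phi y = \sum_b co b * u b (param M a y).
  by move=> Uy Hy; apply: eq_bigr => b _; have [_ _ _ h] := UFP b; have [_ ->] := h y (UP b y Uy) Hy.
have Hx : H x by exact: img_half ax.
have -> : \sum_b co b * u b p = Phi x by rewrite PhiE // /x coordK.
have cPhi : {for x, continuous Phi}.
  apply: (@CBe_continuous _ _ 0%N U _ _ _ Ux); apply: CBe_sum => // b.
  apply: CBe_mul => //; first exact: CBe_cst.
  by have [_ _ h _] := UFP b; apply: CBe_sub h => y; exact: UP.
apply: contrapT => /eqP Px.
have nP : nbhs x [set y | Phi y != 0].
  by apply: (cPhi [set t | t != 0]); apply: open_nbhs_nbhs; split => //; exact: open_neq.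
have [r r0 Hr] := nbhs_cube (filterI (open_nbhs_nbhs (conj oU Ux)) nP).
pose y := x + (r / 2) *: e i0.
have yx : `|y - x| < r.
  rewrite /y addrC addKr; apply: (@le_lt_trans _ _ (r / 2)); last by rewrite ltr_pdivrMr // ltr_pMr // ltr1n.
  apply: norm_leP => [|j]; first by rewrite divr_ge0 ?ltW.
  rewrite mxE basisE normrM normr_nat ger0_norm ?divr_ge0 ?(ltW r0) //.
  by case: (j == i0); rewrite ?mulr1 // mulr0 divr_ge0 ?ltW.
have [Uy /negP] := Hr y yx; apply; apply/eqP.
have y0 : 0 < y 0 i0.
  by rewrite shift_coord eqxx ltr_wpDl ?divr_gt0 //; apply/(half_spaceP i00).
have Hy : H y by apply/(half_spaceP i00); exact: ltW.
have ay := val y Uy Hy d0; rewrite PhiE //; apply: int.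
by apply: (interior_chart i00 g (param_dom ay) (chart_at_dom _)); rewrite paramK.
Qed.

Variables (P : nat) (c : 'I_P -> piece).
Hypothesis gc : forall a, good_piece (c a).
Hypothesis cov : forall p, exists a, window (c a) p.
Local Notation center a := (piece_center (c a)).
Local Notation radius a := (piece_radius (c a)).

Definition total_energy lam d (co : 'I_d -> R) (u : 'I_d -> M -> R) m : R :=
  \sum_a \sum_(k : 'rV['I_m.+2]_n) energy lam (combination co u (c a)) (pt (center a) (radius a) k).

Definition normalized d (co : 'I_d -> R) := (exists b, `|co b| = 1) /\ forall b, `|co b| <= 1.

Lemma energy_lower_point lam d (u : 'I_d -> M -> R) (B kap : R) p : 0 < kap -> 0 <= B -> 1 <= lam ->
  (forall a co, normalized co -> CB B 3 (piece_cube (c a)) (combination co u (c a))) ->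
  interior_point p -> exists D : nat, forall m co, (D <= m)%N -> normalized co ->
  (forall a (k : 'rV['I_m.+2]_n), pt (center a) (radius a) k 0 i0 != 0) ->
  kap <= `|\sum_b co b * u b p| ->
  kap ^+ 2 / 4 * #|{: 'rV['I_m.+2]_n}|%:R <= total_energy lam co u m * (D.*2 ^ n)%:R.
Proof.
move=> kap0 B0 lam1 HB ip; have [a [ap pr]] := cov p.
set z := center a in pr; set y := coord M (piece_chart (c a)) p in pr.
have r0 : 0 < radius a := gp_r0 (gc a); set r := radius a in pr r0.
have y0 : 0 < y 0 i0 by exact: (interior_chart i00 g (chart_at_dom p) ap ip).
have nB0 : 0 < n%:R * B + 1 by rewrite ltr_wpDl // mulr_ge0.
(* Within this distance of [y] points stay above the plane, and the combination, with Lipschitz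
   constant n B, keeps at least half of its value. *)
pose rho := Num.min (r / 2) (Num.min (y 0 i0 / 2) (kap / (2 * (n%:R * B + 1)))).
have rho0 : 0 < rho.
  rewrite !lt_min !divr_gt0 //=; exact: mulr_gt0.
have rho1 : rho <= r / 2 by rewrite ge_min lexx.
have rho2 : rho <= y 0 i0 / 2 by rewrite !ge_min lexx orbT.
have rho3 : n%:R * B * rho <= kap / 2.
  have : rho <= kap / (2 * (n%:R * B + 1)) by rewrite !ge_min lexx !orbT.
  rewrite ler_pdivlMr ?mulr_gt0 // => h.
  have alg (s t w : R) : 0 < s -> s * (2 * (t + 1)) <= w -> t * s <= w / 2 by move=> *; nra.
  exact: alg rho0 h.
have t0 : 0 <= 4 * r / rho by rewrite divr_ge0 ?mulr_ge0 // ltW.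
pose D := (Num.truncn (4 * r / rho)).+1.
have DD : 4 * r / rho <= D%:R by have /andP[_ /ltW] := truncn_itv t0.
exists D => m co Dm nco ptn kp; set v := combination co u (c a).
have DM : (D <= m.+2)%N by apply: leq_trans Dm _; rewrite !leqW.
have hr : mesh m r <= rho / 2.
  rewrite /mesh ler_pdivrMr ?ltr0n //.
  have : D%:R <= m.+2%:R :> R by rewrite ler_nat.
  move: DD; rewrite ler_pdivrMr // => h1 h2.
  have alg (s t w q : R) : 0 < t -> 4 * s <= w * t -> w <= q -> 2 * s <= t / 2 * q by move=> *; nra.
  exact: alg rho0 h1 h2.
have := card_near i0 r0 rho0 rho1 DD DM (ltn0Sn _) pr hr.
rewrite -(ler_nat R) natrM => cn.
have k40 : 0 <= kap ^+ 2 / 4 by rewrite divr_ge0 ?sqr_ge0.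
apply: le_trans (ler_wpM2l k40 cn) _; rewrite mulrA ler_wpM2r //.
have v_y : v y = \sum_b co b * u b p.
  by apply: eq_bigr => b _; rewrite piece_rep_upper // /local_fun coordK.
have Oy : piece_cube (c a) y.
  by split; [apply: lt_trans pr _; rewrite ltr_pdivrMr // ltr_pMr // ltr1n|rewrite gt_eqF].
have en0 a' (k : 'rV['I_m.+2]_n) : 0 <= energy lam (combination co u (c a')) (pt (center a') (radius a') k).
  exact: energy_ge0.
rewrite /total_energy (bigD1 a) //=; apply: ler_wpDr; first by apply: sumr_ge0 => a' _; exact: sumr_ge0.
rewrite (bigID (fun k => `|pt z r k - y| <= rho)) /=; apply: ler_wpDr; first exact: sumr_ge0.
rewrite mulrC -sum1_card natr_sum mulr_suml; apply: ler_sum => k ky; rewrite mul1r.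
have k0 : 0 < pt z r k 0 i0.
  have := le_trans (coord_le_norm _ i0) ky; rewrite [X in `|X|]mxE [X in `|_ + X|]mxE.
  rewrite ler_norml => /andP[h _].
  have alg (s t w : R) : - w <= s - t -> w <= t / 2 -> 0 < t -> 0 < s by move=> *; lra.
  exact: alg h rho2 y0.
have Ok : piece_cube (c a) (pt z r k) by split; [exact: pt_in_cube|rewrite gt_eqF].
have lip : `|v (pt z r k) - v y| <= kap / 2.
  have Hv : CB B 1 (piece_cube (c a)) v by apply: (@CB_leq _ _ _ 3) => //; exact: HB.
  apply: le_trans (lip_side B0 Hv Oy Ok (mulr_gt0 y0 k0)) _; apply: le_trans _ rho3.
  by rewrite ler_wpM2l // mulr_ge0.
have vk : kap / 2 <= `|v (pt z r k)|.
  have := ler_normB (v (pt z r k)) (v (pt z r k) - v y).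
  rewrite subKr v_y => h.
  have alg (s t w q : R) : q <= w -> t <= q / 2 -> w <= s + t -> q / 2 <= s by move=> *; lra.
  by apply: alg kp _ h; rewrite -v_y.
rewrite /energy; apply: ler_wpDr; first by apply: sumr_ge0 => j _; exact: sqr_ge0.
have sq : kap ^+ 2 / 4 <= v (pt z r k) ^+ 2.
  rewrite -[X in _ <= X]real_normK ?num_real //.
  have alg (s t : R) : 0 < s -> s / 2 <= t -> s ^+ 2 / 4 <= t ^+ 2 by move=> *; nra.
  exact: alg kap0 vk.
apply: le_trans sq _; rewrite ler_peMl ?sqr_ge0 //; exact: exprn_ege1.
Qed.

(** Some evaluation point carries a value of at least [kap] for every normalised combination; which
    one depends on the combination, so the constants of all [d] points are merged. *)
Lemma energy_lower lam d (u : 'I_d -> M -> R) (B : R) : 0 <= B -> 1 <= lam ->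
  (forall b, smooth_fun (u b)) ->
  (forall co : 'I_d -> R, (forall p, \sum_b co b * u b p = 0) -> forall b, co b = 0) ->
  (forall a co, normalized co -> CB B 3 (piece_cube (c a)) (combination co u (c a))) ->
  exists2 kap, 0 < kap & exists m0, forall m co, (m0 <= m)%N -> normalized co ->
  (forall a (k : 'rV['I_m.+2]_n), pt (center a) (radius a) k 0 i0 != 0) ->
  kap * #|{: 'rV['I_m.+2]_n}|%:R <= total_energy lam co u m.
Proof.
move=> B0 lam1 su indep HB.
have [q [Yq Uq]] := @evaluation_points R M interior_point d u
  (fun co h => indep co (interior_dense su h)).
have [kap kap0 Hkap] := evaluation_bound Uq.
have HD (b : 'I_d) := energy_lower_point kap0 B0 lam1 HB (Yq b).
have [D DP] := choice HD.
pose S := \sum_b D b; have DS (b : 'I_d) : (D b <= S)%N by rewrite /S (bigD1 b) //= leq_addr.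
pose w : R := (S.*2.+1 ^ n)%:R; have w0 : 0 < w by rewrite ltr0n expn_gt0.
exists (kap ^+ 2 / 4 / w); first by rewrite !divr_gt0 // exprn_gt0.
exists S => m co Sm nco ptn; have [b] := Hkap co (proj1 nco).
under eq_bigr do rewrite mxE.
move=> /(DP b m co (leq_trans (DS b) Sm) nco ptn) h.
rewrite mulrAC ler_pdivrMr //; apply: le_trans h _; apply: ler_wpM2l.
  by apply: sumr_ge0 => a _; apply: sumr_ge0 => k _; exact: energy_ge0.
rewrite ler_nat leq_exp2r; first by rewrite leqW // leq_double.
exact: leq_ltn_trans (leq0n _) (ltn_ord i0).
Qed.

End Multiplicity.

Section Multiplicity.
Variables (R : realType) (n : nat) (i0 : 'I_n).
Hypothesis i00 : i0 = 0%N :> nat.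
Variables (M : compact_manifold R n) (g : riemannian_metric M) (bc : boundary_condition).
Local Notation E := 'rV[R]_n.
Local Notation e := (basis_vec R).
Local Notation H := (@half_space R n).
Local Notation piece := (piece M).
Local Notation good_piece := (good_piece i0 g bc).
Local Notation piece_cube := (piece_cube i0).
Local Notation piece_lift := (piece_lift i0).
Local Notation piece_rep := (piece_rep i0 bc).
Local Notation piece_point := (piece_point i0).
Local Notation window c := (piece_window c (piece_radius c / 8)).
Local Notation combination := (combination i0 bc).
Implicit Types (x y : E) (p : M) (i j l : 'I_n) (c : piece).


Variables (P : nat) (c : 'I_P -> piece).
Hypothesis gc : forall a, good_piece (c a).
Hypothesis cov : forall p, exists a, window (c a) p.
Local Notation center a := (piece_center (c a)).
Local Notation radius a := (piece_radius (c a)).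
Local Notation total_energy := (total_energy i0 bc c).

Lemma combination_pde lam d (co : 'I_d -> R) (u : 'I_d -> M -> R) a x :
  (forall b, laplace_eigenspace g bc (lam ^+ 2) (u b)) -> piece_cube (c a) x ->
  `|cont_operator (piece_coef (c a)) (combination co u (c a)) lam x| <=
  piece_C1 (c a) * \sum_l `|pd l (combination co u (c a)) x|.
Proof.
move=> eu ax; have oO : open (piece_cube (c a)) by exact: open_split_cube.
have Cf k b : (k <= 3)%N -> CBe k (piece_cube (c a)) (piece_rep (c a) (u b)).
  by move=> k3; have [_ [B B0 [HB _ _]]] := gp_eigen (gc a) (eu b); exists B => //; exact: CB_leq k3 HB.
have Ca i j : CBe 1 (piece_cube (c a)) (piece_coef (c a) i j).
  by exists (piece_A (c a)); [exact: gp_A0 (gc a)|apply: CB_leq (gp_CB (gc a) i j)].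
rewrite /combination (cont_operator_lin co oO lam Ca (fun b => Cf 2%N b isT) ax).
have -> : \sum_b co b * cont_operator (piece_coef (c a)) (piece_rep (c a) (u b)) lam x =
    \sum_l piece_drift (c a) l x * pd l (fun y => \sum_b co b * piece_rep (c a) (u b) y) x.
  under eq_bigr => b _ do rewrite (proj1 (gp_eigen (gc a) (eu b)) x ax).
  under [RHS]eq_bigr => l _ do rewrite (pd_lin _ l (fun b => Cf 1%N b isT) ax) mulr_sumr.
  rewrite [RHS]exchange_big; apply: eq_bigr => b _; rewrite mulr_sumr.
  by apply: eq_bigr => l _; exact: mulrCA.
rewrite mulr_sumr; apply: le_trans (ler_norm_sum _ _ _) _; apply: ler_sum => l _.
by rewrite normrM ler_wpM2r //; exact: gp_drift (gc a) l x ax.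
Qed.

Lemma combination_regular lam d (u : 'I_d -> M -> R) :
  (forall b, laplace_eigenspace g bc (lam ^+ 2) (u b)) -> exists2 B, 0 <= B &
  forall a co, normalized co -> regular i0 (center a) (radius a) B (combination co u (c a)).
Proof.
move=> eu; have HB (ab : 'I_P * 'I_d) : exists B, 0 <= B /\
    regular i0 (center ab.1) (radius ab.1) B (piece_rep (c ab.1) (u ab.2)).
  by have [_ [B B0 rB]] := gp_eigen (gc ab.1) (eu ab.2); exists B.
have [Bf BP] := choice HB; pose B := \sum_ab Bf ab.
have B0 : 0 <= B by apply: sumr_ge0 => ab _; have [] := BP ab.
exists (d%:R * (2 ^+ 3 * B)); first by rewrite !mulr_ge0 // exprn_ge0.
move=> a co [_ co1]; apply: regular_lin => // b.
have Bab : Bf (a, b) <= B.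
  by rewrite /B (bigD1 (a, b)) //= lerDl sumr_ge0 // => ab _; have [] := BP ab.
have [_ [h1 h2 h3]] := BP (a, b); split.
- exact: CB_le h1.
- exact: LL_le h2.
by move=> j; exact: LL_le (h3 j).
Qed.

(* The slices are those of index l * (m.+2 / Q) and its successor, [s] telling which. *)
Definition mode_condition N m (Q : nat) (T := ('I_P * 'I_n * ('I_Q * bool) * (n.-1).-tuple ('I_N.*2.+1 * bool))%type)
    (u : M -> R) (t : T) : R :=
  let: (a, i, (l, s), md) := t in
  fcoefs (others i) md (fun k => plateau (center a) (radius a) (pt (center a) (radius a) k) *
      piece_rep (c a) u (pt (center a) (radius a) k))
    (axis i (inord (l * (m.+2 %/ Q) + s) : 'I_m.+2)).

Lemma conditions_vanish N m Q s d (co : 'I_d -> R) (u : 'I_d -> M -> R) : (0 < s)%N -> (0 < Q)%N ->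
  m.+2 = (2 * Q * s)%N ->
  (forall t, \sum_b co b * mode_condition (N := N) (Q := Q) m (u b) t = 0) ->
  forall a (i : 'I_n) (t : 'I_m.+2) md, (t %% (2 * s) <= 1)%N -> size md = n.-1 ->
  fcoefs (N := N) (others i) md (fun k => plateau (center a) (radius a) (pt (center a) (radius a) k) *
    combination co u (c a) (pt (center a) (radius a) k)) (axis i t) = 0.
Proof.
move=> s0 Q0 mE Z a i t md t1 smd.
have m'E : (m.+2 %/ Q = 2 * s)%N by rewrite mE mulnAC mulnK.
have jQ : (t %/ (2 * s) < Q)%N.
  by rewrite ltn_divLR ?muln_gt0 //; have := ltn_ord t; rewrite {2}mE; lia.
have := Z (a, i, (Ordinal jQ, (t %% (2 * s) == 1)%N), tcast smd (in_tuple md)).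
rewrite /mode_condition val_tcast /=.
have -> : inord (t %/ (2 * s) * (m.+2 %/ Q) + (t %% (2 * s) == 1)%N) = t.
  apply: val_inj; rewrite /= m'E -[(_ == 1)%N : nat]/(nat_of_bool _).
  have -> : nat_of_bool (t %% (2 * s) == 1)%N = (t %% (2 * s))%N by case: (t %% _)%N t1 => [|[|]].
  by rewrite -divn_eq inordK.
rewrite -fcoefs_sum => <-; congr (fcoefs _ _ _ _); apply/funext => k.
by rewrite /combination mulr_sumr; apply: eq_bigr => b _; exact: mulrCA.
Qed.

(** With more functions than conditions a normalised combination satisfies all of them.
    [local_estimate] on each cube followed by [cover_comparison] bounds the total energy by half of
    itself plus an error of the order of the number of points divided by m + 2. *)
Lemma energy_upper : (2 <= n)%N -> exists D lam0 : R, [/\ 0 <= D, 1 <= lam0 &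
  forall lam d (u : 'I_d -> M -> R), lam0 <= lam ->
  (forall b, laplace_eigenspace g bc (lam ^+ 2) (u b)) -> D * lam ^+ (n - 1) < d%:R ->
  exists K, forall m0, exists m co, [/\ (m0 <= m)%N, normalized co,
    forall a (k : 'rV['I_m.+2]_n), pt (center a) (radius a) k 0 i0 != 0 &
    total_energy lam co u m <= K * (#|{: 'rV['I_m.+2]_n}|%:R / m.+2%:R)]].
Proof.
have alg1 (s t w : R) : 1 <= t -> w <= s * t + 1 -> (w * 2 + 1) * 2 <= 2 * (2 * s + 3) * t.
    by move=> *; lra.
have alg2 (r' w : R) : 0 < r' -> 128%:R <= w -> 2 * r' <= r' / 64 * w by move=> *; nra.
have alg3 (x y w : R) : 4 * x <= w * y -> x <= y / 4 * w by move=> *; lra.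
have alg4 (x y w t : R) : 0 < t -> x <= t / 4 -> y <= t / 4 -> w <= t / 4 -> 0 <= x -> 0 <= y -> 0 <= w ->
    0 <= x + t / 4 + y + w <= t by move=> *; apply/andP; split; lra.
have alg5 (x y w t : R) : x * 24 * y <= w * t -> x * 6 * y <= t / 4 * w by move=> *; lra.
have alg6 (q t x w y k : R) : t <= q * (x * t + k * w) + y * w -> q * x * t <= 2^-1 * t ->
  t <= 2 * (q * k + y) * w by move=> *; lra.
have alg7 (x y w : R) : w * (2 * (x + 1) * (y + 1)) = 1 -> 0 <= x -> 0 <= y -> 0 <= w ->
    x * w <= 1 /\ y * (x * w) <= 2^-1.
  move=> H x0 y0 w0; have ? := mulr_ge0 x0 w0; have ? := mulr_ge0 y0 w0; have ? := mulr_ge0 y0 (mulr_ge0 x0 w0).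
  have {}H : 2 * (y * (x * w)) + 2 * (x * w) + 2 * (y * w) + 2 * w = 1 by apply: etrans H; ring.
  by split; lra.
have scale (N t b : nat) : exists s, [/\ (128 <= s)%N, (N.*2.+2 < s)%N, (t <= s)%N & (b.+2 <= s)%N].
  by exists (128 + N.*2.+3 + t + b.+2)%N; split; lia.
have lattice (Q s : nat) : (0 < Q)%N -> (1 < s)%N ->
    exists m, [/\ m.+2 = (2 * Q * s)%N, (s <= m.+2)%N & ~~ odd m].
  move=> Q0 s1; have mE : (2 * Q * s - 2).+2 = (2 * Q * s)%N by nia.
  exists (2 * Q * s - 2)%N; split => //; first by rewrite mE; nia.
  by have := congr1 odd mE; rewrite /= negbK -mulnA oddM /= => ->.
move=> n2; have HL a := local_estimate (gp_r0 (gc a)) (gp_r1 (gc a)) (gp_A0 (gc a)) (gp_sym (gc a))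
  (gp_CB (gc a)) (gp_LL (gc a)) (gp_nu0 (gc a)) (gp_elliptic (gc a)) (gp_C1 (gc a)).
have ex2_ex (X : Type) (A A' : X -> Prop) : (exists2 t, A t & A' t) -> exists t, A t /\ A' t.
  by case=> t; exists t.
have [Cl ClP] := choice (fun a => ex2_ex _ _ _ (HL a)); have Cl0 a : 0 <= Cl a by have [] := ClP a.
pose CL := \sum_a Cl a; have CL0 : 0 <= CL by exact: sumr_ge0.
have ClC a : Cl a <= CL by rewrite /CL (bigD1 a) //= lerDl sumr_ge0.
have [C C0 HC] := cover_comparison i00 gc cov.
(* The admissible size of [ee]: it makes C CL eta at most 1/2 and CL eta at most 1. Each of the four
   summands of [ee] gets a quarter of it. *)
pose eta := (2 * (CL + 1) * (C + 1))^-1.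
have eta0 : 0 < eta by rewrite invr_gt0 !mulr_gt0 // ltr_wpDl.
have etaE : eta * (2 * (CL + 1) * (C + 1)) = 1 by rewrite mulVf // gt_eqF // -invr_gt0.
have slope0 a := slope_bound_ge0 (gp_r0 (gc a)) (gp_A0 (gc a)).
pose S := \sum_a slope_bound (radius a) (piece_A (c a)).
have S0 : 0 <= S by exact: sumr_ge0.
have slopeS a : slope_bound (radius a) (piece_A (c a)) <= S.
  by rewrite /S (bigD1 a) //= lerDl sumr_ge0.
(* N >= K' lam makes (n S + 1) (6/N) lam at most eta / 4. *)
pose K' := (n%:R * S + 1) * 24 / eta.
have K'0 : 0 <= K' by rewrite divr_ge0 ?(ltW eta0) // mulr_ge0 // addr_ge0 // mulr_ge0.
pose Q := (Num.truncn (4 / eta)).+1.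
have Q4 : 4 / eta <= Q%:R by have /andP[_ /ltW] := truncn_itv (divr_ge0 (ler0n R 4) (ltW eta0)).
(* The number of conditions divided by lam^(n-1): cubes, directions, two slices per tooth, and 2 (2N
   + 1) <= 2 (2 K' + 3) lam modes in each of the n - 1 other directions. *)
pose D := (P * n * (Q * 2))%:R * (2 * (2 * K' + 3)) ^+ (n - 1).
have D0 : 0 <= D by rewrite mulr_ge0 // exprn_ge0 // mulr_ge0 // addr_ge0 // mulr_ge0.
exists D, (1 + 4 / eta); split => //; first by rewrite lerDl divr_ge0 // ltW.
move=> lam d u lam0 eu Dd.
have eta4 : 0 <= 4 / eta by rewrite divr_ge0 // ltW.
have lam1 : 1 <= lam by apply: le_trans lam0; rewrite lerDl.
have lamp : 0 < lam by exact: lt_le_trans ltr01 lam1.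
have [B B0 rB] := combination_regular eu.
pose N := (Num.truncn (K' * lam)).+1.
have Kl0 : 0 <= K' * lam by rewrite mulr_ge0 // ltW.
have [/ltW N2 N1] : K' * lam < N%:R /\ N%:R <= K' * lam + 1.
  by have /andP[h1 h2] := truncn_itv Kl0; split => //; rewrite -natr1 lerD2r.
pose T := ('I_P * 'I_n * ('I_Q * bool) * (n.-1).-tuple ('I_N.*2.+1 * bool))%type.
have Td : (#|{: T}| < d)%N.
  rewrite -(ltr_nat R); apply: le_lt_trans Dd.
  rewrite !card_prod card_tuple !card_prod !card_ord card_bool natrM /D -mulrA.
  rewrite ler_wpM2l // -exprMn natrX subn1; apply: lerXn2r; rewrite ?nnegrE //.
    by rewrite mulr_ge0 ?(ltW lamp) // mulr_ge0 // addr_ge0 // mulr_ge0.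
  rewrite natrM -natr1 -muln2 natrM.
  exact: alg1 lam1 N1.
have [KC HKC] := HC B lam B0.
have HKl a := (proj2 (ClP a)) B lam B0 lam1.
have [Kl KlP] := choice HKl.
pose K0 := \sum_a `|Kl a|.
exists (2 * (C * K0 + `|KC|)) => m0.
(* The lattice has 2 Q s points per side: [Q] teeth of length 2 s, an even number, so that cell
   centres avoid the plane. The bounds on [s] ensure a mesh of at most r/64, no aliasing, h lam^2 <=
   eta / 4 and m >= m0. *)
have [s [s128 sN st sm0]] := scale N (Num.truncn (4 * lam ^+ 2 / eta)).+1 m0.
have [m [mE ms om]] := lattice (Num.truncn (4 / eta)).+1 s isT (leq_trans (isT : (1 < 128)%N) s128).
have [co [co1 co2 coZ]] := kernel_vector (fun b (t : T) => mode_condition (N := N) (Q := Q) m (u b) t) Td.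
have nco : normalized co by split.
have ptn a (k : 'rV['I_m.+2]_n) : pt (center a) (radius a) k 0 i0 != 0.
  case: (gp_plane (gc a)) => [z0|H0]; first by apply: pt_off_plane => //; exact: gp_r0 (gc a).
  by rewrite gt_eqF //; apply: H0; apply: pt_in_cube; exact: gp_r0 (gc a).
exists m, co; split => //; first by rewrite -ltnS -ltnS; exact: leq_trans sm0 ms.
have M0 : 0 < m.+2%:R :> R by rewrite ltr0n.
have Mge (x : nat) : (x <= s)%N -> x%:R <= m.+2%:R :> R by move=> xs; rewrite ler_nat (leq_trans xs).
have hr a : mesh m (radius a) <= radius a / 64.
  have r0 := gp_r0 (gc a); rewrite /mesh ler_pdivrMr //.
  have M128 : 128%:R <= m.+2%:R :> R by exact: Mge.
  exact: alg2 r0 M128.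
have hM a : mesh m (radius a) <= m.+2%:R^-1 by apply: mesh_le1 (gp_r1 (gc a)).
have h0 a : 0 < mesh m (radius a) by apply: mesh_gt0; exact: gp_r0 (gc a).
pose kap := eta / 4.
have eeP a : 0 <= mesh m (radius a) * (2 * s)%:R + kap + lam^-1 + mesh m (radius a) * lam ^+ 2 <= eta.
  have i1 : mesh m (radius a) * (2 * s)%:R <= eta / 4.
    apply: le_trans (ler_wpM2r (ler0n _ _) (hM a)) _.
    have -> : m.+2%:R^-1 * (2 * s)%:R = Q%:R^-1 :> R.
      rewrite mE mulnAC natrM invfM mulrC mulrA divff ?mul1r //.
      by rewrite pnatr_eq0 muln_eq0 /= -lt0n (leq_trans _ s128).
    by rewrite -[eta / 4]invrK invf_div lef_pV2 // posrE ?divr_gt0 // ltr0n.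
  have i2 : lam^-1 <= eta / 4.
    rewrite -[eta / 4]invrK invf_div lef_pV2 ?posrE ?divr_gt0 //.
    by apply: le_trans lam0; rewrite lerDr.
  have i3 : mesh m (radius a) * lam ^+ 2 <= eta / 4.
    apply: le_trans (ler_wpM2r (sqr_ge0 _) (hM a)) _; rewrite mulrC ler_pdivrMr //.
    have l4 : 0 <= 4 * lam ^+ 2 / eta by rewrite divr_ge0 ?(ltW eta0) // mulr_ge0 // sqr_ge0.
    have /andP[_ /ltW h] := truncn_itv l4.
    have {}h : 4 * lam ^+ 2 / eta <= m.+2%:R by apply: le_trans h _; exact: Mge.
    move: h; rewrite ler_pdivrMr // => h.
    exact: alg3 h.
  have p1 : 0 <= mesh m (radius a) * (2 * s)%:R by rewrite mulr_ge0 // ltW.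
  have p2 : 0 <= lam^-1 by rewrite invr_ge0 ltW.
  have p3 : 0 <= mesh m (radius a) * lam ^+ 2 by rewrite mulr_ge0 ?sqr_ge0 // ltW.
  exact: alg4 eta0 i1 i2 i3 p1 p2 p3.
have Neta a : (n%:R * slope_bound (radius a) (piece_A (c a)) + 1) * (6 / N%:R) * lam <= kap.
  have N0 : 0 < N%:R :> R by rewrite ltr0n.
  have l1 : n%:R * slope_bound (radius a) (piece_A (c a)) + 1 <= n%:R * S + 1.
    by rewrite lerD2r ler_wpM2l.
  apply: (@le_trans _ _ ((n%:R * S + 1) * (6 / N%:R) * lam)).
    by rewrite ler_wpM2r ?(ltW lamp) // ler_wpM2r // divr_ge0.
  rewrite mulrA mulrAC ler_pdivrMr //; move: N2; rewrite /K' mulrAC ler_pdivrMr //.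
  exact: alg5.
set tot := total_energy lam co u m.
set W := #|_|%:R / _; have W0 : 0 <= W by rewrite divr_ge0.
pose v a := combination co u (c a).
pose en a (k : 'rV['I_m.+2]_n) := energy lam (v a) (pt (center a) (radius a) k).
have en0 a k : 0 <= en a k by exact: energy_ge0.
have Cu a b : CBe 1 (piece_cube (c a)) (piece_rep (c a) (u b)).
  have [_ [Bb Bb0 [HB _ _]]] := gp_eigen (gc a) (eu b).
  by exists Bb => //; apply: (@CB_leq _ _ _ 3).
have su b : smooth_fun (u b) by have [] := eu b.
have inner a : \sum_(k | `|pt (center a) (radius a) k - center a| <= radius a / 4) en a k <=
    CL * eta * \sum_k en a k + `|Kl a| * W.
  have /andP[ee0 ee1] := eeP a.
  have Cee : Cl a * (mesh m (radius a) * (2 * s)%:R + kap + lam^-1 + mesh m (radius a) * lam ^+ 2) <= CL * eta.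
    by apply: ler_pM.
  have [CLe _] := alg7 _ _ _ etaE CL0 C0 (ltW eta0).
  apply: le_trans (KlP a m N (2 * s)%N kap (v a) (ptn a) (hr a) _ _ _ _ (Neta a) (rB a co nco) _ _ _) _.
  - by [].
  - exact: leq_trans sN ms.
  - by apply: leq_trans (leq_pmulr 2 _) => //; exact: leq_trans s128.
  - by rewrite mE mulnAC dvdn_mulr.
  - by move=> x ax; exact: combination_pde eu ax.
  - move=> i t md; exact: (conditions_vanish (leq_trans (isT : (0 < 128)%N) s128) (isT : (0 < Q)%N) mE coZ).
  - exact: le_trans Cee CLe.
  apply: lerD; last by rewrite ler_wpM2r // ler_norm.
  apply: ler_pM => //; first by rewrite mulr_ge0.
    by apply: sumr_ge0 => k _; exact: en0.
  by rewrite [X in _ <= X](bigID (fun k => `|pt (center a) (radius a) k - center a| <= radius a / 2)) /= lerDl; apply: sumr_ge0 => k _; exact: en0.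
have Hv a : CB B 3 (piece_cube (c a)) (v a) by have [] := rB a co nco.
have := HKC m d co u om hr ptn su Cu Hv; rewrite -/(total_energy lam co u m) -/tot -/W => Htot.
have Hin : \sum_a \sum_(k | `|pt (center a) (radius a) k - center a| <= radius a / 4) en a k <=
    CL * eta * tot + K0 * W.
  apply: le_trans (ler_sum _ (fun a _ => inner a)) _.
  by rewrite big_split /= -mulr_sumr -mulr_suml.
have tot0 : 0 <= tot by apply: sumr_ge0 => a _; apply: sumr_ge0 => k _; exact: en0.
have H1 := le_trans Htot (lerD (ler_wpM2l C0 Hin) (ler_wpM2r W0 (ler_norm KC))).
have [_ half] := alg7 _ _ _ etaE CL0 C0 (ltW eta0).
have H2 : C * (CL * eta) * tot <= 2^-1 * tot by rewrite ler_wpM2r.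
exact: alg6 H1 H2.
Qed.

End Multiplicity.

Lemma multiplicity_bound (R : realType) (n : nat) (M : compact_manifold R n)
    (g : riemannian_metric M) (bc : boundary_condition) : (2 <= n)%N -> exists D lam0 : R, [/\ 0 <= D, 1 <= lam0 &
  forall lam d (u : 'I_d -> M -> R), lam0 <= lam ->
  (forall b, laplace_eigenspace g bc (lam ^+ 2) (u b)) ->
  (forall co : 'I_d -> R, (forall p, \sum_b co b * u b p = 0) -> forall b, co b = 0) ->
  d%:R <= D * lam ^+ (n - 1)].
Proof.
move=> n2; pose i0 : 'I_n := Ordinal (ltnW n2); have i00 : i0 = 0%N :> nat by [].
have [P [c [gc cov]]] := cover_pieces i00 g bc.
have [D [lam0 [D0 lam01 HD]]] := energy_upper i00 gc cov n2.
exists D, lam0; split => // lam d u lam0l eu indep; rewrite leNgt; apply/negP => Dd.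
have [K HK] := HD lam d u lam0l eu Dd.
have lam1 : 1 <= lam by exact: le_trans lam0l.
have [B B0 rB] := combination_regular gc eu.
have su b : smooth_fun (u b) by have [] := eu b.
have HB a co : normalized co -> CB B 3 (piece_cube i0 (c a)) (combination i0 bc co u (c a)).
  by move=> nco; have [] := rB a co nco.
have [kap kap0 [m1 Hm]] := energy_lower i00 gc cov B0 lam1 su indep HB.
(* Beyond this mesh kap (m + 2) > |K|, which contradicts the two energy bounds divided by the number
   of points. *)
pose m0 := (m1 + Num.truncn (`|K| / kap))%N.
have [m [co [mm nco ptn tot]]] := HK m0.
have := le_trans (Hm m co (leq_trans (leq_addr _ _) mm) nco ptn) tot.
have W0 : 0 < #|{: 'rV['I_m.+2]_n}|%:R :> R by rewrite ltr0n; apply/card_gt0P; exists 0.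
have alg (x y w t : R) : 0 < w -> x * w <= y * (w / t) -> x <= y / t.
  by move=> w0; rewrite mulrA mulrAC ler_pM2r.
move=> /(alg _ _ _ _ W0) h.
have M0 : 0 < m.+2%:R :> R by rewrite ltr0n.
move: h; rewrite ler_pdivlMr // => h.
have /andP[_ Kt] := truncn_itv (divr_ge0 (normr_ge0 K) (ltW kap0)).
have : kap * m.+2%:R <= `|K| by apply: le_trans h (ler_norm K).
rewrite leNgt => /negP; apply; rewrite mulrC -ltr_pdivrMr //.
apply: lt_le_trans Kt _; rewrite ler_nat ltnS; apply: leq_trans (leqnSn _).
by apply: leq_trans mm; rewrite leq_addl.
Qed.

Theorem corollary2 (R : realType) (n : nat) (hn : (2 <= n)%N)
    (M : compact_manifold R n) (g : riemannian_metric M) :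
  exists C lambda0 : R, 0 < lambda0 /\
    forall (bc : boundary_condition) (lambda : R),
      lambda0 <= lambda ->
      is_laplace_eigenvalue g bc (lambda ^+ 2) ->
      exists d : nat,
        has_dimension (laplace_eigenspace g bc (lambda ^+ 2)) d /\
        d%:R <= C * lambda ^+ (n - 1).
Proof.
have [D1 [l1 [D10 l11 H1]]] := multiplicity_bound g Dirichlet hn.
have [D2 [l2 [D20 l21 H2]]] := multiplicity_bound g Neumann hn.
(* The constants are chosen before the boundary condition, so both cases have to be covered at
   once. *)
exists (D1 + D2), (l1 + l2); split; first by rewrite addr_gt0 // (lt_le_trans ltr01).
move=> bc lam lam0 _; apply: bounded_dimension => d u eu indep.
have l1l : l1 <= lam by apply: le_trans lam0; rewrite lerDl (le_trans ler01).
have l2l : l2 <= lam by apply: le_trans lam0; rewrite lerDr (le_trans ler01).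
have lam1 : 0 <= lam ^+ (n - 1) by rewrite exprn_ge0 // (le_trans ler01) // (le_trans l11).
rewrite mulrDl; case: bc eu => eu.
  by apply: le_trans (H1 lam d u l1l eu indep) _; rewrite lerDl mulr_ge0.
by apply: le_trans (H2 lam d u l2l eu indep) _; rewrite lerDr mulr_ge0.
Qed.
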